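(* Fix $s\ge 0$. For any $\vec u_0=(\eta_0,v_0)\in X^s$ there exist $T=T(\vec u_0)>0$ and a unique solution $\vec u=(\eta,v)\in X^s_T$ of the integral equation $$\vec u(t)=S(t)\vec u_0+N_2(\vec u,\vec u)(t),\qquad t\in[0,T],$$ and hence of the Boussinesq system $$\eta_t-\eta_{txx}+v_x+(\eta v)_x=0,\qquad v_t-v_{txx}+\eta_x+vv_x=0,\qquad x\in\mathbb R,\ t\ge 0,$$ with initial value $\vec u_0$. The maximal existence time $T_s$ of the solution satisfies $$T_s\ge \frac{1}{4C_s\|\vec u_0\|_s}$$ where $C_s>0$ is a constant depending only on $s$, and $$T_s<\infty\ \Longrightarrow\ \limsup_{t\to T_s^-}\|\vec u(t)\|_s=\infty .$$ Moreover, $T_s$ is independent of $s$ if $s>1/2$ (that is, if $s,s'>1/2$ and $\vec u_0\in X^s\cap X^{s'}$, then $T_s=T_{s'}$). More specifically, one can construct maps $A_n:X^s\to X^s_T$, $n=1,2,\dots$, by the recursive formulae $$A_1(\vec u_0)=S(t)\vec u_0,\qquad A_n(\vec u_0)=\sum_{n_1,n_2\ge 1,\ n_1+n_2=n}N_2\big(A_{n_1}(\vec u_0),A_{n_2}(\vec u_0)\big)\quad\text{for } n>1,$$ with the property that $\|A_n(f)\|_{X^s_T}\le K^n\|f\|_{s}^n$ for some $K>0$, and one has the absolutely convergent (in $X^s_T$) power series expansion $$\vec u=\sum_{n=1}^\infty A_n(\vec u_0).$$ Consequently the solution map $\vec u_0\mapsto\vec u$ is analytic from bounded sets of $X^s$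 to $X^s_T$.
   Context: $X^s=H^s(\mathbb R)\times H^s(\mathbb R)$ with norm $\|(\eta,v)\|_s=\|\eta\|_{H^s}+\|v\|_{H^s}$. $X^s_T=C([0,T],X^s)$ with norm $\|\vec u\|_{X^s_T}=\sup_{t\in[0,T]}\|\vec u(t)\|_s$. $S(t)=e^{tA}$ is the linear group generated by $A=-(1-\partial_x^2)^{-1}\partial_x\begin{pmatrix}0&1\\ 1&0\end{pmatrix}$, i.e. the solution operator of the linearized system $\eta_t-\eta_{txx}+v_x=0$, $v_t-v_{txx}+\eta_x=0$. For $\vec u=(u_1,u_2)$ and $\vec v=(v_1,v_2)$, the bilinear operator $N_2$ is $$N_2(\vec u,\vec v)(t)=-\frac12\int_0^tS(t-t')(1-\partial_x^2)^{-1}\partial_x\begin{pmatrix}u_1v_2+u_2v_1\\ u_2v_2\end{pmatrix}(t')\,dt'.$$ The maximal existence time $T_s$ is the supremum of the times $T$ such that the integral equation has a solution in $X^s_T$ with data $\vec u_0\in X^s$. In the last assertion (analyticity on a bounded set), $T$ is a time common to all data in the bounded set. *)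

(* Defs.v *)
From HB Require Import structures.
From mathcomp Require Import all_boot all_order all_algebra.
From mathcomp Require Import all_classical all_reals all_analysis.

Set Implicit Arguments.
Unset Strict Implicit.
Unset Printing Implicit Defensive.
Import Order.TTheory GRing.Theory Num.Theory.
Import numFieldNormedType.Exports.
Local Open Scope classical_set_scope.
Local Open Scope ring_scope.

(* Elements of L^2, H^s and X^s are represented by functions; equality in these
   spaces is almost everywhere equality, see [Xeq]. *)

(** * Sobolev spaces on the line *)

(* For real-valued f, the Fourier transform is
   fhat(xi) = \int e^{-i x xi} f(x) dx = g.1 xi - i * g.2 xi
   where g.1 and g.2 are the cosine and sine transforms of f. *)
Definition cos_transform_on (R : realType) (n : nat) (f : R -> R) (xi : R) : R :=
  \int[lebesgue_measure]_(x in `[- n%:R, n%:R]) (f x * cos (x * xi)).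

Definition sin_transform_on (R : realType) (n : nat) (f : R -> R) (xi : R) : R :=
  \int[lebesgue_measure]_(x in `[- n%:R, n%:R]) (f x * sin (x * xi)).

(* The Fourier transform of f in L^2, as a limit in mean of the transforms of
   the truncations of f; by Plancherel's theorem it exists and is unique up to
   almost everywhere equality. *)
Definition is_fourier (R : realType) (f : R -> R) (g : (R -> R) * (R -> R)) : Prop :=
  let mu := @lebesgue_measure R in
  [/\ f \in Lfun mu 2%:E, g.1 \in Lfun mu 2%:E, g.2 \in Lfun mu 2%:E,
      'N[mu]_2%:E[EFin \o (fun xi => cos_transform_on n f xi - g.1 xi)%R]%E
        @[n --> \oo] --> 0%E
    & 'N[mu]_2%:E[EFin \o (fun xi => sin_transform_on n f xi - g.2 xi)%R]%E
        @[n --> \oo] --> 0%E].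

(* All g such that [is_fourier f g] give the same value of the integral. The
   infimum is +oo when there is none, i.e. when f is not in L^2. *)
Definition Hs_norm (R : realType) (s : R) (f : R -> R) : \bar R :=
  ereal_inf [set ((\int[lebesgue_measure]_xi
      ((1 + xi ^+ 2) `^ s * (g.1 xi ^+ 2 + g.2 xi ^+ 2))%R%:E) `^ (2^-1))%E
    | g in is_fourier f].

(** * The spaces X^s and X^s_T *)

Notation Xfun R := ((R -> R) * (R -> R))%type.

Definition Xnorm (R : realType) (s : R) (f : Xfun R) : \bar R :=
  (Hs_norm s f.1 + Hs_norm s f.2)%E.
Arguments Xnorm {R} s%_R f%_R.

Definition Xs (R : realType) (s : R) : set (Xfun R) :=
  [set f | (Xnorm s f < +oo)%E].

Definition Xeq (R : realType) (f g : Xfun R) : Prop :=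
  f.1 = g.1 %[ae lebesgue_measure] /\ f.2 = g.2 %[ae lebesgue_measure].

Definition XsT (R : realType) (s T : R) : set (R -> Xfun R) :=
  [set u | forall t : R, t \in `[0, T] -> Xs s (u t) /\
     Xnorm s (u t' - u t) @[t' --> within `[0, T] (nbhs t)] --> 0%E].

Definition XsT_norm (R : realType) (s T : R) (u : R -> Xfun R) : \bar R :=
  ereal_sup [set Xnorm s (u t) | t in `[0, T]].
Arguments XsT_norm {R} (s T)%_R u%_R.

(* The limit of a sequence in X^s (any representative of it). *)
Definition Xlim (R : realType) (s : R) (w : nat -> Xfun R) : Xfun R :=
  xget 0 [set l | Xs s l /\ Xnorm s (w n - l) @[n --> \oo] --> 0%E].

(* w is the Riemann integral of F over [a, b], in the norm of X^s. *)
Definition is_Xintegral (R : realType) (s a b : R) (F : R -> Xfun R)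
    (w : Xfun R) : Prop :=
  Xs s w /\
  forall eps : R, 0 < eps -> exists2 delta : R, 0 < delta &
  forall (n : nat) (p c : nat -> R), p 0%N = a -> p n = b ->
    (forall i, (i < n)%N -> p i <= c i <= p i.+1 /\ p i.+1 - p i < delta) ->
    (Xnorm s (\sum_(i < n) (p i.+1 - p i) *: F (c i) - w) < eps%:E)%E.

Definition Xintegral (R : realType) (s a b : R) (F : R -> Xfun R) : Xfun R :=
  xget 0 (is_Xintegral s a b F).

(** * The operators *)

Definition test_function (R : realType) (phi : R -> R) : Prop :=
  (forall n x, derivable (derive1n n phi) x 1) /\
  exists M : R, forall x, M < `|x| -> phi x = 0.

(* w = (1 - d_x^2)^{-1} d_x f, i.e. w is the element of L^2 for which
   w - w'' = f' in the sense of distributions on R. *)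
Definition is_inv_dx (R : realType) (f w : R -> R) : Prop :=
  w \in Lfun (@lebesgue_measure R) 2%:E /\
  forall phi, test_function phi ->
    \int[lebesgue_measure]_x (w x * (phi x - derive1n 2 phi x)) =
    - \int[lebesgue_measure]_x (f x * derive1 phi x).

Definition inv_dx (R : realType) (f : R -> R) : R -> R :=
  xget (cst 0) (is_inv_dx f).

Definition opA (R : realType) (f : Xfun R) : Xfun R :=
  (- inv_dx f.2, - inv_dx f.1).

(* A is bounded on X^s, so that e^{tA} is the sum of the exponential series. *)
Definition opS (R : realType) (s t : R) (f : Xfun R) : Xfun R :=
  Xlim s (fun n => \sum_(k < n) (t ^+ k / k`!%:R) *: iter k (@opA R) f).

Definition opN2 (R : realType) (s : R) (u v : R -> Xfun R) (t : R) : Xfun R :=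
  - 2^-1 *: Xintegral s 0 t (fun t' => opS s (t - t')
     (inv_dx ((u t').1 * (v t').2 + (u t').2 * (v t').1),
      inv_dx ((u t').2 * (v t').2))).

(** * Solutions *)

Definition mild_solution (R : realType) (s T : R) (u0 : Xfun R)
    (u : R -> Xfun R) : Prop :=
  XsT s T u /\
  forall t : R, t \in `[0, T] -> Xeq (u t) (opS s t u0 + opN2 s u u t).

(* Here ut is the time derivative of u in X^s, and for each t the equations hold
   in the sense of distributions on R; v v_x is read as (v^2 / 2)_x. *)
Definition boussinesq_solution (R : realType) (s T : R) (u0 : Xfun R)
    (u : R -> Xfun R) : Prop :=
  let mu := @lebesgue_measure R in
  [/\ XsT s T u, Xeq (u 0) u0 &
  exists ut : R -> Xfun R, [/\ XsT s T ut,
    (forall t : R, t \in `[0, T] ->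
       Xnorm s ((t' - t)^-1 *: (u t' - u t) - ut t)
         @[t' --> within (`[0, T] `\ t) (nbhs t)] --> 0%E) &
    forall (t : R) phi, t \in `[0, T] -> test_function phi ->
      let eta := (u t).1 in let v := (u t).2 in
      let eta_t := (ut t).1 in let v_t := (ut t).2 in
      \int[mu]_x (eta_t x * phi x) - \int[mu]_x (eta_t x * derive1n 2 phi x)
        - \int[mu]_x (v x * derive1 phi x)
        - \int[mu]_x (eta x * v x * derive1 phi x) = 0 /\
      \int[mu]_x (v_t x * phi x) - \int[mu]_x (v_t x * derive1n 2 phi x)
        - \int[mu]_x (eta x * derive1 phi x)
        - 2^-1 * \int[mu]_x (v x ^+ 2 * derive1 phi x) = 0]].

Definition unique_on (R : realType) (T : R) (P : set (R -> Xfun R))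
    (u : R -> Xfun R) : Prop :=
  P u /\ forall w, P w -> forall t : R, t \in `[0, T] -> Xeq (w t) (u t).

Definition max_time (R : realType) (s : R) (u0 : Xfun R) : \bar R :=
  ereal_sup [set T%:E | T in
    [set T : R | 0 < T /\ exists u, mild_solution s T u0 u]].

Definition maximal_solution (R : realType) (s : R) (u0 : Xfun R)
    (u : R -> Xfun R) : Prop :=
  forall T : R, 0 < T -> (T%:E < max_time s u0)%E -> mild_solution s T u0 u.

(** * The power series and analyticity *)

Definition series_terms (R : realType) (s : R)
    (A : nat -> Xfun R -> R -> Xfun R) : Prop :=
  (forall f t, A 1%N f t = opS s t f) /\
  (forall n f t, (1 < n)%N ->
     A n f t = \sum_(1 <= k < n) opN2 s (A k f) (A (n - k)%N f) t).

Definition Xs_bounded (R : realType) (s : R) (B : set (Xfun R)) : Prop :=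
  exists r : R, forall f, B f -> (Xnorm s f <= r%:E)%E.

Definition Xs_open (R : realType) (s : R) (U : set (Xfun R)) : Prop :=
  U `<=` Xs s /\
  forall a, U a -> exists2 rho : R, 0 < rho &
    forall h, (Xnorm s h < rho%:E)%E -> U (a + h).

(* L is a k-linear map from X^s to X^s_T, with norm at most M. *)
Definition bounded_multilinear (R : realType) (s T : R) (k : nat) (M : R)
    (L : ('I_k -> Xfun R) -> R -> Xfun R) : Prop :=
  (forall h : 'I_k -> Xfun R, (forall i, Xs s (h i)) -> XsT s T (L h) /\
     (XsT_norm s T (L h) <= (M * \prod_(i < k) fine (Xnorm s (h i)))%R%:E)%E) /\
  (forall (h : 'I_k -> Xfun R) (i : 'I_k) (a : R) (f g : Xfun R),
     (forall j, Xs s (h j)) -> Xs s f -> Xs s g ->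
     let put x := fun j => if j == i then x else h j in
     forall t : R, t \in `[0, T] ->
       Xeq (L (put (a *: f + g)) t) (a *: L (put f) t + L (put g) t)).

(* Around a, Phi is the sum of a power series of bounded k-homogeneous
   polynomials h |-> L k (h, ..., h) with a positive radius of convergence. *)
Definition analytic_at (R : realType) (s T : R)
    (Phi : Xfun R -> R -> Xfun R) (a : Xfun R) : Prop :=
  exists (rho : R) (M : nat -> R)
         (L : forall k, ('I_k -> Xfun R) -> R -> Xfun R),
  [/\ 0 < rho,
      forall k, 0 <= M k /\ bounded_multilinear s T (M k) (L k),
      cvgn (series (fun k => M k * rho ^+ k)) &
      forall h, (Xnorm s h < rho%:E)%E ->
        XsT_norm s T (fun t => \sum_(k < n) L k (fun=> h) t - Phi (a + h) t)
          @[n --> \oo] --> 0%E].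

(* Main.v *)
Require Import Defs.
From HB Require Import structures.
From mathcomp Require Import all_boot all_order all_algebra.
From mathcomp Require Import all_classical all_reals all_analysis.
From mathcomp Require Import measurable_realfun.
From mathcomp Require Import ring lra.
Set Implicit Arguments.
Unset Strict Implicit.
Unset Printing Implicit Defensive.
Import Order.TTheory GRing.Theory Num.Theory.
Import numFieldNormedType.Exports.
Local Open Scope classical_set_scope.
Local Open Scope ring_scope.

(** The operator [A] is bounded on [X^s], because [(1 - d_x^2)^{-1} d_x] has the
    bounded symbol [i xi / (1 + xi^2)], and so is the bilinear form
    [B(u, v) = - (1 - d_x^2)^{-1} d_x (u_1 v_2 + u_2 v_1, u_2 v_2) / 2]. For the
    latter let [j = (1 + xi^2)^{1/2}]. Peetre's inequality moves the weight [j^s] onto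
    the two factors of a convolution, Cauchy-Schwarz bounds the convolution of two L2
    functions uniformly, and the symbol supplies [j^{-1}], which is square integrable
    ([inv_dx_product]). A quarter of a derivative is left over, since even
    [j^{1/4 - 1}] is square integrable, so that [B] maps [X^s] to [X^{s + 1/4}].
    The system is therefore the ordinary differential equation [u' = A u + B(u, u)]
    in a Banach space.

    Real functions call for the Hartley transform, with kernel [cas = cos + sin]: it is
    one real function, whose even and odd parts are the cosine and sine transforms
    ([hart_fourier], [fourier_hartley]). Plancherel's theorem is proved by inserting
    the factor [exp (- e |xi|)], whose transform is a Poisson kernel, and letting [e]
    tend to 0. The operator [inv_dx] is defined by testing against smooth functions;
    convolution with the derivative of the Green function [exp (- |z|) / 2] solves
    the problem on a dense class, Plancherel's theorem extends the solution to L2, and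
    a solution of [w = w''] in L2 vanishes because the transform of its cut-offs does.

    Classes of functions at distance zero form a complete normed space ([quo_complete]).
    There the exponential series defines the group [S], the variation of constants
    formula turns the integral equation into the differential equation ([mild_ode]), and
    Gronwall's lemma gives uniqueness. Since [A] is skew for the quadratic form of
    [X^s], the group is bounded for all times by an absolute constant ([S_le2]); hence
    the bilinear term has norm at most a constant times [T] on [0, T], and the series of
    the [A_n] is dominated by the one of the Catalan numbers, which solve
    [x = z + x^2] ([power_series]). This gives existence on [0, T] whenever
    [T |u_0|] is below a constant, whence the lower bound for the maximal time. Were the
    norm bounded near a finite maximal time, a solution restarted close to that time
    would outlive it ([mild_glue], [blow_up]).

    The gain of a quarter of a derivative propagates regularity: a solution in [X^r] whose
    data lie in [X^{r'}], with [r <= r' <= r + 1/4], has its bilinear term in [X^{r'}],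
    and solves there a linear equation with bounded coefficients ([mild_up]). Hence the
    maximal times for [r] and [r'] agree, and finitely many such steps join any two
    exponents.

    On data of norm below [rho] the time can be chosen as a constant over [rho].
    Around such data [g] the difference of two solutions solves a quadratic equation
    whose linear part is inverted by a Neumann series; its solution is again a series,
    whose terms are multilinear in the increment of the data ([expansion_sum]). *)

(** * Squared L2 norms *)

Section ereal_limits.
Context {R : realType}.

Lemma ecvg0P {T : Type} {F : set_system T} {FF : Filter F} (u : T -> \bar R) :
  (forall n, (0 <= u n)%E) ->
  (u @ F --> 0%E <-> forall e : R, 0 < e -> \forall n \near F, (u n <= e%:E)%E).
Proof.
move=> u0; split=> [cu e e0|H].
  move/fine_cvgP: cu => [fu cu].
  have /cvgr0_norm_le/(_ e e0) := cu.
  apply: filterS2 fu => n fn; rewrite /= => H.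
  rewrite -(fineK fn) lee_fin; exact: le_trans (ler_norm _) H.
apply/fine_cvgP; split.
  have := H 1 ltr01; apply: filterS => n un.
  by rewrite ge0_fin_numE // (le_lt_trans un) // ltry.
apply/cvgr0Pnorm_le => e e0; have := H e e0; apply: filterS => n un /=.
have fn : u n \is a fin_num by rewrite ge0_fin_numE // (le_lt_trans un) // ltry.
by rewrite ger0_norm ?fine_ge0 // -lee_fin fineK.
Qed.

End ereal_limits.

Global Instance lebesgue_ae_filter {R : realType} :
  Filter (almost_everywhere (@lebesgue_measure R)).
Proof. exact: (@ae_filter_ringOfSetsType _ (measurableTypeR R) R (@lebesgue_measure R)). Qed.

Global Instance lebesgue_ae_filter_nbhs {R : realType} :
  Filter (nbhs (almost_everywhere (@lebesgue_measure R))).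
Proof. exact: lebesgue_ae_filter. Qed.

Section L2.
Context {R : realType}.
Notation mu := (@lebesgue_measure R).
Implicit Types (f g h : R -> R).

Definition sq f : \bar R := (\int[mu]_x ((f x) ^+ 2)%:E)%E.

Definition L2 f : Prop := measurable_fun setT f /\ (sq f < +oo)%E.

Lemma sq_ge0 f : (0 <= sq f)%E.
Proof. by apply: integral_ge0 => x _; rewrite lee_fin sqr_ge0. Qed.
Hint Resolve sq_ge0 : core.

Lemma measurable_sq f : measurable_fun setT f ->
  measurable_fun setT (EFin \o (fun x => f x ^+ 2)).
Proof. by move=> mf; apply/measurable_EFinP; exact: measurable_funX. Qed.

Lemma sq_fin f : L2 f -> sq f \is a fin_num.
Proof. by case=> _ h; rewrite ge0_fin_numE. Qed.

Lemma ae_le_sq f g : measurable_fun setT f -> measurable_fun setT g ->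
  {ae mu, forall x, `|f x| <= `|g x|} -> (sq f <= sq g)%E.
Proof.
move=> mf mg fg; apply: ae_ge0_le_integral => //.
- by move=> x _; rewrite lee_fin sqr_ge0.
- exact: measurable_sq.
- by move=> x _; rewrite lee_fin sqr_ge0.
- exact: measurable_sq.
apply: filterS fg => x fg _; rewrite lee_fin.
by rewrite -(real_normK (num_real (f x))) -(real_normK (num_real (g x))) ler_sqr ?nnegrE.
Qed.

Lemma le_sq f g : measurable_fun setT f -> measurable_fun setT g ->
  (forall x, `|f x| <= `|g x|) -> (sq f <= sq g)%E.
Proof. by move=> mf mg fg; apply: ae_le_sq => //; apply: aeW. Qed.

Lemma ae_eq_sq f g : measurable_fun setT f -> measurable_fun setT g ->
  {ae mu, forall x, f x = g x} -> sq f = sq g.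
Proof.
move=> mf mg fg; apply/eqP; rewrite eq_le; apply/andP; split; apply: ae_le_sq => //;
by apply: filterS fg => x ->.
Qed.

Lemma eq_sq f g : f =1 g -> sq f = sq g.
Proof. by move=> /funext ->. Qed.

Lemma sqN f : sq (fun x => - f x) = sq f.
Proof. by apply: eq_integral => x _; rewrite sqrrN. Qed.

Lemma sqBC f g : sq (fun x => f x - g x) = sq (fun x => g x - f x).
Proof. by rewrite -sqN; apply: eq_sq => x; rewrite opprB. Qed.

Lemma sq_cst0 : sq (fun=> 0) = 0%E.
Proof. by rewrite /sq; under eq_integral do rewrite expr0n/=; rewrite integral0. Qed.

Lemma sqZ a f : measurable_fun setT f -> sq (fun x => a * f x) = ((a ^+ 2)%:E * sq f)%E.
Proof.
move=> mf; rewrite /sq -ge0_integralZl_EFin ?sqr_ge0 //.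
- by apply: eq_integral => x _; rewrite -EFinM exprMn.
- by move=> x _; rewrite lee_fin sqr_ge0.
- exact: measurable_sq.
Qed.

(** The weights [1 + d] and [1 + d^-1] come from [2ab <= d a^2 + b^2/d]; small
    [d] recovers the sharp triangle inequality. *)
Lemma sq_add f g (d : R) : 0 < d -> measurable_fun setT f -> measurable_fun setT g ->
  (sq (fun x => f x + g x)%R <= (1 + d)%:E * sq f + (1 + d^-1)%:E * sq g)%E.
Proof.
move=> d0 mf mg.
have d1 : 0 <= 1 + d by lra.
have d2 : 0 <= 1 + d^-1 by have := invr_gt0 d; lra.
rewrite /sq -!ge0_integralZl_EFin //; [|by move=> x _; rewrite lee_fin sqr_ge0
  |exact: measurable_sq|by move=> x _; rewrite lee_fin sqr_ge0|exact: measurable_sq].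
rewrite -ge0_integralD //; last first.
- by apply: measurable_funeM; exact: measurable_sq.
- by move=> x _; rewrite -EFinM lee_fin mulr_ge0 // sqr_ge0.
- by apply: measurable_funeM; exact: measurable_sq.
- by move=> x _; rewrite -EFinM lee_fin mulr_ge0 // sqr_ge0.
apply: ge0_le_integral => //.
- by move=> x _; rewrite lee_fin sqr_ge0.
- by apply: measurable_sq; exact: measurable_funD.
- by apply: emeasurable_funD; apply: measurable_funeM; exact: measurable_sq.
move=> x _; rewrite -!EFinM -EFinD lee_fin.
have : 0 <= d^-1 * (d * f x - g x) ^+ 2 by rewrite mulr_ge0 ?invr_ge0 ?sqr_ge0 ?ltW.
have -> : d^-1 * (d * f x - g x) ^+ 2 = d * f x ^+ 2 + d^-1 * g x ^+ 2 - 2 * f x * g x.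
  by field; exact: lt0r_neq0.
nra.
Qed.

Lemma sq_add2 f g : measurable_fun setT f -> measurable_fun setT g ->
  (sq (fun x => f x + g x)%R <= 2%:E * sq f + 2%:E * sq g)%E.
Proof.
move=> mf mg; have := sq_add ltr01 mf mg.
by rewrite invr1 (_ : 1 + 1 = 2).
Qed.

Lemma sq_sub2 f g : measurable_fun setT f -> measurable_fun setT g ->
  (sq (fun x => f x - g x)%R <= 2%:E * sq f + 2%:E * sq g)%E.
Proof.
move=> mf mg; rewrite -(sqN g); apply: sq_add2 => //; exact: measurableT_comp.
Qed.

Lemma L2D f g : L2 f -> L2 g -> L2 (fun x => f x + g x).
Proof.
move=> [mf lf] [mg lg]; split; first exact: measurable_funD.
apply: le_lt_trans (sq_add2 mf mg) _.
by rewrite lte_add_pinfty // lte_mul_pinfty.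
Qed.

Lemma L2Z a f : L2 f -> L2 (fun x => a * f x).
Proof.
move=> [mf lf]; split; first exact: measurable_funM.
by rewrite sqZ // lte_mul_pinfty // lee_fin sqr_ge0.
Qed.

Lemma L2N f : L2 f -> L2 (fun x => - f x).
Proof. by move=> [mf lf]; split; [exact: measurableT_comp|rewrite sqN]. Qed.

Lemma L2B f g : L2 f -> L2 g -> L2 (fun x => f x - g x).
Proof. by move=> lf lg; apply: L2D => //; exact: L2N. Qed.

Lemma L2_cst0 : L2 (fun=> 0).
Proof. by split; [exact: measurable_cst|rewrite sq_cst0]. Qed.

Lemma sq_eq0 f : measurable_fun setT f -> sq f = 0%E -> {ae mu, forall x, f x = 0}.
Proof.
move=> mf f0.
have /(_ measurableT _ (measurable_sq mf)) [+ _] := @ae_eq_integral_abs _ _ _ mu setT.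
have -> : (\int[mu]_x `|((f x) ^+ 2)%:E| = 0)%E.
  rewrite -[RHS]f0; apply: eq_integral => x _.
  by rewrite gee0_abs // lee_fin sqr_ge0.
move=> /(_ erefl); apply: filterS => x /(_ I) [] /eqP.
by rewrite sqrf_eq0 => /eqP.
Qed.

Lemma L2_ae f g : L2 f -> measurable_fun setT g -> {ae mu, forall x, f x = g x} -> L2 g.
Proof. by move=> [mf lf] mg fg; split => //; rewrite -(ae_eq_sq mf mg fg). Qed.

Lemma sq_fatou (h_ : nat -> R -> R) h (M : \bar R) :
  (forall n, measurable_fun setT (h_ n)) -> measurable_fun setT h ->
  {ae mu, forall x, h_ n x @[n --> \oo] --> h x} ->
  (\forall n \near \oo, (sq (h_ n) <= M)%E) -> (sq h <= M)%E.
Proof.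
move=> mh_ mh hh [N _ hM].
have -> : sq h = (\int[mu]_x limn_einf (fun n => ((h_ (n + N)%N x) ^+ 2)%:E))%E.
  apply: ge0_ae_eq_integral => //.
  - exact: measurable_sq.
  - apply: (@measurableT_comp _ _ _ _ _ _ -%E) => //.
    apply: measurable_fun_limn_esup => n; apply: measurableT_comp => //.
    exact: measurable_sq.
  - by move=> x _; rewrite lee_fin sqr_ge0.
  - move=> x _; rewrite limn_einf_lim; apply: lime_ge.
      exact: is_cvg_einfs.
    apply: nearW => n; apply: le_ereal_inf_tmp => _ [m _ <-].
    by rewrite lee_fin sqr_ge0.
  apply: filterS hh => x hx _; apply/esym.
  have cx : ((h_ (n + N)%N x) ^+ 2)%:E @[n --> \oo] --> ((h x) ^+ 2)%:E.
    apply: cvg_EFin; first exact: nearW.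
    have hx' : h_ (n + N)%N x @[n --> \oo] --> h x.
      by rewrite (cvg_shiftn N (h_ ^~ x)).
    rewrite expr2; under eq_fun do rewrite /= expr2; exact: cvgM.
  by rewrite is_cvg_limn_einfE; [apply/cvg_lim|apply/cvg_ex; eexists; exact: cx].
apply: le_trans.
  apply: fatou => //; first by move=> n; exact: measurable_sq.
  by move=> n x _; rewrite lee_fin sqr_ge0.
rewrite limn_einf_lim; apply: lime_le; first exact: is_cvg_einfs.
apply: nearW => n; apply: le_trans (hM (n + N)%N _); last exact: leq_addl.
by apply: ereal_inf_lbound; exists n => //=.
Qed.

Lemma sq_cvg (f_ : nat -> R -> R) f : (forall n, L2 (f_ n)) -> L2 f ->
  sq (fun x => f_ n x - f x) @[n --> \oo] --> 0%E -> sq (f_ n) @[n --> \oo] --> sq f.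
Proof.
move=> lf_ lf; have [mf _] := lf.
have mf_ n : measurable_fun setT (f_ n) by case: (lf_ n).
have md n : measurable_fun setT (fun x => f_ n x - f x) by exact: measurable_funB.
move=> /(@ecvg0P _ _ _ _ (fun n => sq (fun x => f_ n x - f x))) => /(_ (fun=> sq_ge0 _)) H.
rewrite -(fineK (sq_fin lf)); apply/fine_cvgP; split.
  by apply: nearW => n; exact: sq_fin.
have sf0 : 0 <= fine (sq f) by apply: fine_ge0.
apply/cvgrPdist_le => e e0.
pose S := fine (sq f).
pose d := Num.min 1 (e / (4 * (S + 1))).
have d0 : 0 < d by rewrite lt_min ltr01 divr_gt0 // mulr_gt0 // ltr_wpDl.
have d1 : d <= 1 by rewrite ge_min lexx.
have dS : d * S <= e / 4.
  have : d <= e / (4 * (S + 1)) by rewrite ge_min lexx orbT.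
  rewrite ler_pdivlMr ?mulr_gt0 ?ltr_wpDl // => ?; have : 0 <= S by []; nra.
pose r := e * d / 8.
have r0 : 0 < r by rewrite divr_gt0 // mulr_gt0.
have := H r r0; apply: filterS => n /= hn.
set D := (sq (fun x => f_ n x - f x)) in hn *.
have D0e : (0 <= D)%E by exact: sq_ge0.
have Df : D \is a fin_num by rewrite ge0_fin_numE // (le_lt_trans hn) // ltry.
have hn' : fine D <= r by rewrite -lee_fin fineK.
have rd : (1 + d^-1) * r <= e / 4.
  rewrite /r mulrDl mul1r (_ : d^-1 * (e * d / 8) = e / 8); last by field; exact: lt0r_neq0.
  nra.
have D0 : 0 <= fine D by apply: fine_ge0; exact: sq_ge0.
have di : 0 < d^-1 by rewrite invr_gt0.
have eS : S%:E = sq f by rewrite /S fineK // sq_fin.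
have eD : (fine D)%:E = D by rewrite fineK.
have eF : (fine (sq (f_ n)))%:E = sq (f_ n) by rewrite fineK // sq_fin.
have A1 : fine (sq (f_ n)) <= (1 + d) * S + (1 + d^-1) * fine D.
  rewrite -lee_fin EFinD !EFinM eS eD eF.
  have -> : sq (f_ n) = sq (fun x => f x + (f_ n x - f x)).
    by apply: eq_sq => x; rewrite addrC subrK.
  exact: sq_add.
have A2 : S <= (1 + d) * fine (sq (f_ n)) + (1 + d^-1) * fine D.
  rewrite -lee_fin EFinD !EFinM eS eD eF.
  have -> : sq f = sq (fun x => f_ n x + (f x - f_ n x)).
    by apply: eq_sq => x; rewrite addrC subrK.
  by rewrite /D sqBC; apply: sq_add => //; exact: measurable_funB.
have B : (1 + d^-1) * fine D <= e / 4.
  by apply: le_trans rd; apply: ler_wpM2l; [rewrite addr_ge0 // ltW|].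
have C : d * fine (sq (f_ n)) <= d * ((1 + d) * S + e / 4).
  apply: ler_wpM2l; first exact: ltW.
  by apply: le_trans A1 _; rewrite lerD2l.
have dS0 : 0 <= d * S by rewrite mulr_ge0 // ltW.
have ddS : d * (d * S) <= d * S by rewrite ler_piMl.
rewrite -/S ler_distl; apply/andP; split; nra.
Qed.

End L2.
#[export] Hint Extern 0 (is_true (@Order.le _ _ _ (sq _))) => exact: sq_ge0 : core.

(** * Changes of variables and completeness of L2 *)

Section change_of_variables.
Context {R : realType}.
Notation mu := (@lebesgue_measure R).

Let aff (a b : R) (x : measurableTypeR R) : measurableTypeR R := a * x + b.

Let measurable_aff a b : measurable_fun setT (aff a b).
Proof. by apply: measurable_funD => //; exact: measurable_funM. Qed.

Lemma lebesgue_measure_affine (a b : R) (a0 : 0 < a) (A : set R) : measurable A ->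
  (a%:E * mu ((fun x : R => a * x + b)%R @^-1` A) = mu A)%E.
Proof.
move=> mA.
have := @lebesgue_measure_unique R
  (mscale (NngNum (ltW a0)) (pushforward mu (aff a b))).
move=> /(_ (measurable_aff a b)) H; rewrite (H _ A mA) //.
move=> _ [[c d] _ <-].
rewrite /= /mscale /=.
have -> : pushforward mu (aff a b) [set` `]c, d]] = mu [set` `](c - b) / a, (d - b) / a]].
  rewrite /pushforward; congr (mu _); apply/seteqP; split => x /=;
  by rewrite !in_itv /= /aff ltr_pdivrMr // ler_pdivlMr // ltrBlDr lerBrDr (mulrC a).
rewrite /= !lebesgue_measure_itv /= !lte_fin ltr_pM2r ?invr_gt0 // ltrD2r.
case: ifP => _; last by rewrite mule0.
by rewrite -EFinD -EFinM; congr EFin; field; exact: lt0r_neq0.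
Qed.

Lemma ge0_integral_affine (a b : R) (f : R -> \bar R) : 0 < a -> measurable_fun setT f ->
  (forall x, 0 <= f x)%E ->
  (a%:E * (\int[mu]_x f (a * x + b)%R) = \int[mu]_x f x)%E.
Proof.
move=> a0 mf f0.
have := @eq_measure_integral _ (measurableTypeR R) R setT
  (mscale (NngNum (ltW a0)) (pushforward mu (aff a b))) mu f.
move=> /(_ (measurable_aff a b)) ->; last first.
  by move=> A mA _; rewrite /= /mscale /= -[LHS](lebesgue_measure_affine b a0).
rewrite ge0_integral_mscale //=; congr (_ * _)%E.
by rewrite ge0_integral_pushforward.
Qed.

Lemma integral_shift (b : R) (f : R -> \bar R) : measurable_fun setT f ->
  (\int[mu]_x f (x + b)%R = \int[mu]_x f x)%E.
Proof.
move=> mf; rewrite integralE [RHS]integralE; congr (_ - _)%E.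
  have := @ge0_integral_affine 1 b _ ltr01 (measurable_funepos mf).
  rewrite mul1e => <- //; apply: eq_integral => x _.
  by rewrite !funeposE mul1r.
have := @ge0_integral_affine 1 b _ ltr01 (measurable_funeneg mf).
rewrite mul1e => <- //; apply: eq_integral => x _.
by rewrite !funenegE mul1r.
Qed.

Lemma integral_reflect (f : R -> \bar R) : measurable_fun setT f ->
  (\int[mu]_x f (- x)%R = \int[mu]_x f x)%E.
Proof.
have H (g : R -> \bar R) : measurable_fun setT g -> (forall x, 0 <= g x)%E ->
    (\int[mu]_x g (- x)%R = \int[mu]_x g x)%E.
  move=> mg g0.
  have := @eq_measure_integral _ (measurableTypeR R) R setT
    (pushforward mu (-%R : R -> measurableTypeR R)) mu g.
  have mo : measurable_fun setT (-%R : measurableTypeR R -> measurableTypeR R).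
    exact: oppr_measurable.
  move=> /(_ mo) ->; last by move=> A mA _; rewrite -[LHS]lebesgue_measureN.
  by rewrite ge0_integral_pushforward.
move=> mf; rewrite integralE [RHS]integralE; congr (_ - _)%E.
  rewrite -(H _ (measurable_funepos mf)) //.
  by apply: eq_integral => x _; rewrite !funeposE.
rewrite -(H _ (measurable_funeneg mf)) //.
by apply: eq_integral => x _; rewrite !funenegE.
Qed.

Lemma measurable_shift (b : R) (f : R -> R) : measurable_fun setT f ->
  measurable_fun setT (fun x : R => f (x + b)).
Proof. by move=> mf; apply: measurableT_comp => //; exact: measurable_funD. Qed.

Lemma measurable_reflect (f : R -> R) : measurable_fun setT f ->
  measurable_fun setT (fun x : R => f (- x)).
Proof. by move=> mf; apply: measurableT_comp. Qed.

Lemma sq_shift b (f : R -> R) : measurable_fun setT f -> sq (fun x => f (x + b)) = sq f.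
Proof.
by move=> mf; rewrite /sq -[RHS](integral_shift b) //; exact: measurable_sq.
Qed.

Lemma sq_reflect (f : R -> R) : measurable_fun setT f -> sq (fun x => f (- x)) = sq f.
Proof.
by move=> mf; rewrite /sq -[RHS]integral_reflect //; exact: measurable_sq.
Qed.

Lemma L2_shift b f : L2 f -> L2 (fun x : R => f (x + b)).
Proof. by move=> [mf lf]; split; [exact: measurable_shift|rewrite sq_shift]. Qed.

Lemma L2_reflect f : L2 f -> L2 (fun x : R => f (- x)).
Proof. by move=> [mf lf]; split; [exact: measurable_reflect|rewrite sq_reflect]. Qed.

End change_of_variables.

Section L2_product.
Context {R : realType}.
Notation mu := (@lebesgue_measure R).
Implicit Types (f g h : R -> R).

Lemma Lnorm2E f : ('N[mu]_2%:E[EFin \o f] = (sq f) `^ 2^-1)%E.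
Proof.
rewrite unlock; congr poweR; apply: eq_integral => x _ /=.
by rewrite -(real_normK (num_real (f x))) powR_mulrn.
Qed.

Lemma L2P f : f \in Lfun mu 2%:E <-> L2 f.
Proof.
split=> [/[dup] lf|[mf lf]].
  rewrite inE => /andP[]; rewrite inE /= => mf _; split => //.
  have /integrableP[_] := Lfun2_integrable_sqr lf.
  congr (_ < _)%E; apply: eq_integral => x _ /=.
  by rewrite ger0_norm ?sqr_ge0.
rewrite inE; apply/andP; split; rewrite inE //=.
by rewrite /finite_norm Lnorm2E poweR_lty.
Qed.

Definition nrm f : R := Num.sqrt (fine (sq f)).

Lemma nrm_ge0 f : 0 <= nrm f. Proof. exact: sqrtr_ge0. Qed.
Hint Resolve nrm_ge0 : core.

Lemma sq_nrm f : L2 f -> sq f = ((nrm f) ^+ 2)%:E.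
Proof.
move=> lf; have s0 : 0 <= fine (sq f) by apply: fine_ge0.
by rewrite /nrm (sqr_sqrtr s0) fineK // sq_fin.
Qed.

Lemma L2_sqrt f : L2 f -> ((sq f) `^ 2^-1 = (nrm f)%:E)%E.
Proof.
move=> lf; have s0 : 0 <= fine (sq f) by apply: fine_ge0.
by rewrite -[X in (X `^ _)%E](fineK (sq_fin lf)) poweR_EFin /nrm (powR12_sqrt s0).
Qed.

Lemma cauchy_schwarz f g : L2 f -> L2 g ->
  (\int[mu]_x `|(f x * g x)%:E| <= (nrm f * nrm g)%:E)%E.
Proof.
move=> lf lg; have [mf _] := lf; have [mg _] := lg.
have p2 : 0 < 2 :> R by [].
have h2 : 2^-1 + 2^-1 = 1 :> R by field.
have := @hoelder _ _ _ mu f g 2 2 mf mg p2 p2 h2; rewrite Lnorm1 !Lnorm2E !L2_sqrt //.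
Qed.

Lemma L2_mul_integrable f g : L2 f -> L2 g -> mu.-integrable setT (EFin \o (fun x => f x * g x)).
Proof.
move=> lf lg; apply/integrableP; split.
  by apply/measurable_EFinP; apply: measurable_funM; [case: lf|case: lg].
by rewrite (le_lt_trans (cauchy_schwarz lf lg)) // ltry.
Qed.

Lemma sq_integrable f : L2 f -> mu.-integrable setT (EFin \o (fun x => f x ^+ 2)).
Proof. by move=> lf; exact: L2_mul_integrable. Qed.

Lemma L2_integral_bound f g : L2 f -> L2 g -> `|\int[mu]_x (f x * g x)| <= nrm f * nrm g.
Proof.
move=> lf lg; have i := L2_mul_integrable lf lg.
rewrite -lee_fin; apply: le_trans (cauchy_schwarz lf lg).
rewrite EFin_normr_Rintegral //.
by apply: le_abse_integral => //; exact: measurable_int i.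
Qed.

End L2_product.
#[export] Hint Extern 0 (is_true (@Order.le _ _ _ (nrm _))) => exact: nrm_ge0 : core.

Section riesz_fischer.
Context {R : realType}.
Notation mu := (@lebesgue_measure R).

Theorem riesz_fischer (f_ : nat -> R -> R) : (forall n, L2 (f_ n)) ->
  (forall e : R, 0 < e -> exists N, forall m n, (N <= m)%N -> (N <= n)%N ->
     (sq (fun x => f_ m x - f_ n x)%R <= e%:E)%E) ->
  exists (f : R -> R) (phi : nat -> nat), [/\ L2 f,
    sq (fun x => f_ n x - f x) @[n --> \oo] --> 0%E,
    (forall k, (k <= phi k)%N) &
    {ae mu, forall x, f_ (phi k) x @[k --> \oo] --> f x}].
Proof.
move=> lf cf.
have mf n : measurable_fun setT (f_ n) by case: (lf n).
have e4 k : 0 < (4^-1 : R) ^+ k by rewrite exprn_gt0.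
have [N HN] := @choice _ _ (fun k N => forall m n, (N <= m)%N -> (N <= n)%N ->
     (sq (fun x => f_ m x - f_ n x)%R <= ((4^-1) ^+ k)%:E)%E) (fun k => cf _ (e4 k)).
pose phi k := (\sum_(i < k.+1) N i + k)%N.
have phik k : (k <= phi k)%N by exact: leq_addl.
have Nphi k : (N k <= phi k)%N by rewrite /phi big_ord_recr /= addnAC leq_addl.
have Nphi1 k : (N k <= phi k.+1)%N by rewrite /phi !big_ord_recr /= -!addnA addnCA leq_addr.
pose d k x := f_ (phi k.+1) x - f_ (phi k) x.
have md k : measurable_fun setT (d k) by exact: measurable_funB.
have dk k : (sq (d k) <= ((4^-1) ^+ k)%:E)%E by exact: HN.
pose u k (x : R) : \bar R := (2 ^+ k * d k x ^+ 2)%:E.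
have u0 k x : (0 <= u k x)%E by rewrite lee_fin mulr_ge0 ?sqr_ge0 // exprn_ge0.
have mu_ k : measurable_fun setT (u k).
  by apply/measurable_EFinP; apply: measurable_funM => //; exact: measurable_funX.
have G_ae : {ae mu, forall x, (\sum_(k <oo) u k x < +oo)%E}.
  have : mu.-integrable setT (fun x => \sum_(k <oo) u k x)%E.
    apply/integrableP; split.
      exact: (@ge0_emeasurable_sum _ _ _ setT u xpredT (fun k x _ _ => u0 k x) (fun k _ => mu_ k)).
    under eq_integral do rewrite gee0_abs ?nneseries_ge0 //.
    rewrite integral_nneseries //.
    apply: (@le_lt_trans _ _ (\sum_(k <oo) ((2^-1) ^+ k)%:E)%E).
      apply: lee_nneseries => [k *|k *]; first by apply: integral_ge0 => x _; exact: u0.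
      rewrite /u; under eq_integral do rewrite EFinM.
      rewrite ge0_integralZl_EFin ?exprn_ge0 //; last 2 first.
        by move=> x _; rewrite lee_fin sqr_ge0.
        exact: measurable_sq.
      apply: (@le_trans _ _ ((2 ^+ k)%:E * ((4^-1) ^+ k)%:E)%E).
        by apply: lee_wpmul2l; [rewrite lee_fin exprn_ge0|exact: dk].
      rewrite -EFinM lee_fin -exprMn (_ : 2 * 4^-1 = 2^-1) //; by field.
    apply: (@le_lt_trans _ _ 2%:E); last exact: ltry.
    apply: lime_le; first by apply: is_cvg_nneseries => n _ _; rewrite lee_fin exprn_ge0.
    apply: nearW => n; rewrite sumEFin lee_fin.
    have -> : \sum_(0 <= k < n) (2^-1 : R) ^+ k = 2 - 2 * (2^-1) ^+ n.
      elim: n => [|n IH]; first by rewrite big_geq // expr0 mulr1 subrr.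
      by rewrite big_nat_recr //= IH exprS; field.
    by rewrite lerBlDr lerDl mulr_ge0 // exprn_ge0.
  by move=> /integrable_ae => /(_ measurableT); apply: filterS => x /(_ I); rewrite ge0_fin_numE ?nneseries_ge0.
have cvgx x : (\sum_(k <oo) u k x < +oo)%E -> cvgn (fun k => f_ (phi k) x).
  move=> Gx.
  have cu : cvgn (series (fun k => 2 ^+ k * d k x ^+ 2)).
    apply: nondecreasing_is_cvgn.
      by apply: nondecreasing_series => // n _; rewrite mulr_ge0 ?sqr_ge0 // exprn_ge0.
    exists (fine (\sum_(k <oo) u k x)%E) => _ [n _ <-].
    have G0 : (0 <= \sum_(k <oo) u k x)%E by apply: nneseries_ge0 => k _ _; exact: u0.
    have Gf : (\sum_(k <oo) u k x)%E \is a fin_num by rewrite (ge0_fin_numE G0).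
    rewrite -lee_fin (fineK Gf).
    rewrite /series /= -sumEFin; apply: nneseries_lim_ge => k *; exact: u0.
  have cg : cvgn (series (fun k => (2^-1 : R) ^+ k)).
    have -> : (fun k => (2^-1 : R) ^+ k) = geometric 1 2^-1.
      by apply/funext => k; rewrite /geometric /= mul1r.
    by apply: is_cvg_geometric_series; rewrite ger0_norm // invf_lt1 // ltr1n.
  have cd : cvgn (series (fun k => `|d k x|)).
    apply: (@series_le_cvg _ _ (fun k => (2^-1) ^+ k + 2 ^+ k * d k x ^+ 2)) => [k|k|k|].
    - exact: normr_ge0.
    - by rewrite addr_ge0 ?exprn_ge0 // mulr_ge0 ?sqr_ge0 // exprn_ge0.
    - rewrite -(real_normK (num_real (d k x))) exprVn.
      have t0 : 0 < (2 ^+ k : R) by rewrite exprn_gt0.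
      set t := 2 ^+ k in t0 *; set a := `|_|.
      have : 0 <= t^-1 * (1 - t * a) ^+ 2 by rewrite mulr_ge0 ?sqr_ge0 // invr_ge0 ltW.
      have -> : t^-1 * (1 - t * a) ^+ 2 = t^-1 + t * a ^+ 2 - 2 * a by field; exact: lt0r_neq0.
      have : 0 <= a by exact: normr_ge0.
      lra.
    - have -> : (series (fun k => (2^-1) ^+ k + 2 ^+ k * d k x ^+ 2)) =
          (series (fun k => (2^-1 : R) ^+ k)) \+ (series (fun k => 2 ^+ k * d k x ^+ 2)).
        by apply/funext => n; rewrite /series /= big_split.
      exact: is_cvgD.
  have := normed_cvg cd; rewrite /series /=.
  have -> : (fun n => \sum_(0 <= k < n) d k x) = (fun n => f_ (phi n) x - f_ (phi 0%N) x).
    by apply/funext => n; rewrite telescope_sumr.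
  move=> /cvg_ex [l hl]; apply/cvg_ex; exists (l + f_ (phi 0%N) x).
  have : (fun n => f_ (phi n) x - f_ (phi 0%N) x + f_ (phi 0%N) x) @ \oo --> l + f_ (phi 0%N) x.
    by apply: cvgD => //; exact: cvg_cst.
  by under eq_fun do rewrite subrK.
pose f x := fine (limn_esup (fun k => (f_ (phi k) x)%:E)).
have mf' : measurable_fun setT f.
  apply: (@measurableT_comp _ _ _ _ _ _ (fine : \bar R -> R)) => //.
  by apply: measurable_fun_limn_esup => n; apply/measurable_EFinP.
have fae : {ae mu, forall x, f_ (phi k) x @[k --> \oo] --> f x}.
  apply: filterS G_ae => x /cvgx /cvg_ex [l hl].
  rewrite /f; have /cvg_limn_einf_sup[_ ->] // : (fun k => (f_ (phi k) x)%:E) @ \oo --> l%:E.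
  by apply: cvg_EFin => //; exact: nearW.
have key e : 0 < e -> exists M, forall n, (M <= n)%N -> (sq (fun x => f_ n x - f x)%R <= e%:E)%E.
  move=> e0; have [M HM] := cf e e0; exists M => n Mn.
  apply: (@sq_fatou R (fun k x => f_ n x - f_ (phi k) x)).
  - by move=> k; exact: measurable_funB.
  - exact: measurable_funB.
  - by apply: filterS fae => x hx; apply: cvgB => //; exact: cvg_cst.
  - by exists M => // k /= Mk; apply: HM => //; exact: leq_trans (phik k).
have lf' : L2 f.
  have [M HM] := key 1 ltr01.
  have l1 : L2 (fun x => f_ M x - f x).
    by split; [exact: measurable_funB|exact: le_lt_trans (HM M (leqnn _)) (ltry _)].
  rewrite (_ : f = fun x => f_ M x - (f_ M x - f x)); first exact: L2B.
  by apply/funext => x; rewrite opprB addrC subrK.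
exists f, phi; split => //.
apply/(@ecvg0P _ _ _ _ (fun n => sq (fun x => f_ n x - f x))) => [n|e e0]; first exact: sq_ge0.
by have [M HM] := key e e0; exists M.
Qed.

End riesz_fischer.

(** * Pointwise derivatives and integrable functions *)

Section pointwise_derivatives.
Context {R : realType}.
Implicit Types (f g : R -> R) (x a b : R).

Lemma dv_eq f x a b : is_derive x (1:R) f a -> a = b -> is_derive x (1:R) f b.
Proof. by move=> h <-. Qed.

Lemma dvD f g x a b : is_derive x (1:R) f a -> is_derive x (1:R) g b ->
  is_derive x (1:R) (fun y => f y + g y) (a + b).
Proof. by move=> hf hg; exact: is_deriveD. Qed.

Lemma dvN f x a : is_derive x (1:R) f a -> is_derive x (1:R) (fun y => - f y) (- a).
Proof. by move=> hf; exact: is_deriveN. Qed.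

Lemma dvM f g x a b : is_derive x (1:R) f a -> is_derive x (1:R) g b ->
  is_derive x (1:R) (fun y => f y * g y) (a * g x + f x * b).
Proof.
move=> hf hg; apply: dv_eq (is_deriveM hf hg) _.
by rewrite /GRing.scale /= addrC (mulrC a).
Qed.

Lemma dvcst x c : is_derive x (1:R) (fun=> c : R) 0.
Proof. exact: is_derive_cst. Qed.

Lemma dvid x : is_derive x (1:R) (fun y => y) 1.
Proof. exact: is_derive_id. Qed.

Lemma dvZ c f x a : is_derive x (1:R) f a -> is_derive x (1:R) (fun y => c * f y) (c * a).
Proof. by move=> hf; have := dvM (dvcst x c) hf; rewrite mul0r add0r. Qed.

Lemma dvcomp f g x a b : is_derive (g x) (1:R) f a -> is_derive x (1:R) g b ->
  is_derive x (1:R) (fun y => f (g y)) (a * b).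
Proof. by move=> hf hg; exact: is_derive1_comp. Qed.

Lemma dv_continuous f x a : is_derive x (1:R) f a -> {for x, continuous f}.
Proof. by move=> h; apply/differentiable_continuous/derivable1_diffP; case: h. Qed.

Lemma dv_derive1 f x a : is_derive x (1:R) f a -> derive1 f x = a.
Proof. by move=> h; rewrite derive1E; case: h. Qed.

End pointwise_derivatives.

Section L1.
Context {R : realType}.
Notation mu := (@lebesgue_measure R).
Implicit Types (f g h K : R -> R).

Definition L1 f : Prop := mu.-integrable setT (EFin \o f).

Lemma L1_meas f : L1 f -> measurable_fun setT f.
Proof. by move=> /measurable_int /measurable_EFinP. Qed.

Lemma L1_le f g : measurable_fun setT f -> (forall x, `|f x| <= `|g x|) -> L1 g -> L1 f.
Proof.
move=> mf fg; apply: le_integrable => //; first exact/measurable_EFinP.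
by move=> x _ /=; rewrite lee_fin.
Qed.

Lemma L1D f g : L1 f -> L1 g -> L1 (fun x => f x + g x).
Proof. by move=> lf lg; exact: (integrableD measurableT lf lg). Qed.

Lemma L1Z a f : L1 f -> L1 (fun x => a * f x).
Proof. by move=> lf; exact: (integrableZl measurableT a lf). Qed.

Lemma L1N f : L1 f -> L1 (fun x => - f x).
Proof. by move=> lf; exact: (integrableN lf). Qed.

Lemma L1B f g : L1 f -> L1 g -> L1 (fun x => f x - g x).
Proof. by move=> lf lg; apply: L1D => //; exact: L1N. Qed.

Lemma L1_abs f : L1 f -> L1 (fun x => `|f x|).
Proof.
move=> lf; apply: (L1_le _ _ lf) => [|x]; last by rewrite normr_id.
by apply: measurableT_comp => //; exact: L1_meas.
Qed.

Lemma L1_bdd f K (C : R) : L1 f -> measurable_fun setT K -> (forall x, `|K x| <= C) ->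
  L1 (fun x => f x * K x).
Proof.
move=> lf mK KC; apply: (L1_le _ _ (L1Z C (L1_abs lf))).
  by apply: measurable_funM => //; exact: L1_meas.
move=> x; rewrite !normrM normr_id mulrC ler_wpM2r //.
exact: le_trans (KC x) (ler_norm _).
Qed.

Lemma Rint_le_abs f : L1 f -> `|\int[mu]_x f x| <= \int[mu]_x `|f x|.
Proof. by move=> lf; apply: le_normr_Rintegral. Qed.

Lemma Rint_bdd f K C : L1 f -> measurable_fun setT K -> (forall x, `|K x| <= C) ->
  `|\int[mu]_x (f x * K x)| <= C * \int[mu]_x `|f x|.
Proof.
move=> lf mK KC; have l := L1_bdd lf mK KC.
apply: le_trans (Rint_le_abs l) _.
rewrite -RintegralZl //; last exact: L1_abs.
apply: le_Rintegral => //; first exact: L1_abs.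
  by apply: L1Z; exact: L1_abs.
by move=> x _; rewrite normrM mulrC ler_wpM2r.
Qed.

Lemma EFin_Rint f : L1 f -> (\int[mu]_x f x)%:E = (\int[mu]_x (f x)%:E)%E.
Proof. by move=> lf; rewrite /Rintegral fineK //; exact: integrable_fin_num. Qed.

Lemma Rint_ae_eq f g : measurable_fun setT f -> measurable_fun setT g ->
  {ae mu, forall x, f x = g x} -> \int[mu]_x f x = \int[mu]_x g x.
Proof.
move=> mf mg fg; congr fine; apply: ae_eq_integral => //; try exact/measurable_EFinP.
by apply: filterS fg => x /= ->.
Qed.

Lemma Rint_shift b f : measurable_fun setT f -> \int[mu]_x f (x + b) = \int[mu]_x f x.
Proof.
by move=> mf; congr fine; apply: (@integral_shift _ b (EFin \o f)); exact/measurable_EFinP.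
Qed.

Lemma Rint_reflect f : measurable_fun setT f -> \int[mu]_x f (- x) = \int[mu]_x f x.
Proof.
by move=> mf; congr fine; apply: (@integral_reflect _ (EFin \o f)); exact/measurable_EFinP.
Qed.

Lemma measurable_affine a b f : measurable_fun setT f ->
  measurable_fun setT (fun x : R => f (a * x + b)).
Proof.
move=> mf; apply: measurableT_comp => //; exact: measurable_funD.
Qed.

Lemma L1_affine a b f : 0 < a -> L1 f -> L1 (fun x => f (a * x + b)).
Proof.
move=> a0 lf; have mf := L1_meas lf; apply/integrableP; split.
  by apply/measurable_EFinP; exact: measurable_affine.
have /integrableP[_] := lf.
rewrite -(@ge0_integral_affine _ a b (fun x => `|(f x)%:E|%E)) //; last first.
  by apply: measurableT_comp => //; exact/measurable_EFinP.
set I := (X in (_ * X)%E) => H.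
suff : (a^-1%:E * (a%:E * I) < +oo)%E.
  by rewrite muleA -EFinM mulVf ?lt0r_neq0 // mul1e.
by apply: lte_mul_pinfty => //; rewrite lee_fin invr_ge0 ltW.
Qed.

Lemma Rint_affine a b f : 0 < a -> L1 f ->
  \int[mu]_x f x = a * \int[mu]_x f (a * x + b).
Proof.
move=> a0 lf.
have H g : measurable_fun setT g -> (forall x, 0 <= g x) -> L1 g ->
    \int[mu]_x g x = a * \int[mu]_x g (a * x + b).
  move=> mg g0 lg; apply: EFin_inj; rewrite EFinM EFin_Rint // EFin_Rint; last exact: L1_affine.
  rewrite -(@ge0_integral_affine _ a b (EFin \o g)) //; exact/measurable_EFinP.
have lp : L1 (fun x => (`|f x| + f x)) by apply: L1D => //; exact: L1_abs.
have la := L1_abs lf.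
have -> : \int[mu]_x f x = \int[mu]_x (`|f x| + f x) - \int[mu]_x `|f x|.
  by rewrite -RintegralB //; apply: eq_Rintegral => x _; rewrite addrAC subrr add0r.
have -> : \int[mu]_x f (a * x + b) =
    \int[mu]_x (`|f (a * x + b)| + f (a * x + b)) - \int[mu]_x `|f (a * x + b)|.
  rewrite -RintegralB //; [|exact: (@L1_affine a b _ a0 lp)|exact: (@L1_affine a b _ a0 la)].
  by apply: eq_Rintegral => x _; rewrite addrAC subrr add0r.
rewrite mulrBr; congr (_ - _); apply: H => //; try exact: L1_meas.
by move=> x; rewrite -lerBlDr sub0r; have := ler_norm (- f x); rewrite normrN.
Qed.

End L1.

Section fubini_bounded_kernel.
Context {R : realType}.
Notation mu := (@lebesgue_measure R).

Let FK_integrable (a b : R -> R) (K : R * R -> R) (C : R) : L1 a -> L1 b ->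
  measurable_fun setT K -> (forall z, `|K z| <= C) ->
  (mu \x mu)%E.-integrable setT (EFin \o (fun z : R * R => a z.1 * (b z.2 * K z))).
Proof.
move=> la lb mK KC.
have C0 : 0 <= C by apply: le_trans (KC (0, 0)).
have mf : measurable_fun setT (fun z : R * R => a z.1 * (b z.2 * K z)).
  apply: measurable_funM.
    by apply: (measurableT_comp (L1_meas la)); exact: measurable_fst.
  apply: measurable_funM => //.
  by apply: (measurableT_comp (L1_meas lb)); exact: measurable_snd.
apply/(integrable12ltyP mu mu); first exact/measurable_EFinP.
apply: (@le_lt_trans _ _ (\int[mu]_x (`|a x|%:E * (C * \int[mu]_y `|b y|)%:E)))%E.
  apply: ge0_le_integral => //.
  - by move=> x _; exact: integral_ge0.
  - apply: (@measurable_fun_fubini_tonelli_F _ _ _ _ _ mu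
      (fun z : R * R => `|(a z.1 * (b z.2 * K z))%:E|)%E) => //.
    by apply: measurableT_comp => //; exact/measurable_EFinP.
  - apply: emeasurable_funM => //; apply/measurable_EFinP.
    by apply: measurableT_comp => //; exact: L1_meas.
  move=> x _; rewrite -EFinM.
  have lbx : L1 (fun y => `|a x| * (C * `|b y|)) by do 2 apply: L1Z; exact: L1_abs.
  apply: (@le_trans _ _ (\int[mu]_y (`|a x| * (C * `|b y|))%:E)%E).
    apply: ge0_le_integral => //.
    - apply: measurableT_comp => //; apply/measurable_EFinP.
      have mbK : measurable_fun setT (fun y : R => b y * K (x, y)).
        apply: measurable_funM; first exact: L1_meas.
        exact: (measurableT_comp mK (measurable_pair1 x)).
      exact: (measurable_funM (measurable_cst (a x)) mbK).
    - by apply/measurable_EFinP; exact: L1_meas lbx.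
    move=> y _; rewrite lee_fin /= !normrM ler_wpM2l // mulrC ler_wpM2r //.
  rewrite -EFin_Rint // RintegralZl //; last by apply: L1Z; exact: L1_abs.
  by rewrite RintegralZl //; exact: L1_abs.
have Rab := L1Z (C * \int[mu]_y `|b y|) (L1_abs la).
under eq_integral do rewrite -EFinM mulrC.
by rewrite -EFin_Rint // ltry.
Qed.

Lemma fubini_bdd (a b : R -> R) (K : R * R -> R) (C : R) : L1 a -> L1 b ->
  measurable_fun setT K -> (forall z, `|K z| <= C) ->
  \int[mu]_x (a x * \int[mu]_y (b y * K (x, y))) =
  \int[mu]_y (b y * \int[mu]_x (a x * K (x, y))).
Proof.
move=> la lb mK KC.
have lbK x : L1 (fun y => b y * K (x, y)).
  apply: (L1_bdd lb) => //; exact: (measurableT_comp mK (measurable_pair1 x)).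
have laK y : L1 (fun x => a x * K (x, y)).
  apply: (L1_bdd la) => //; exact: (measurableT_comp mK (measurable_pair2 y)).
have ea x : (a x * \int[mu]_y (b y * K (x, y)))%:E =
    (\int[mu]_y (a x * (b y * K (x, y)))%:E)%E.
  by rewrite -RintegralZl //; [rewrite EFin_Rint //; exact: L1Z|exact: lbK].
have eb y : (b y * \int[mu]_x (a x * K (x, y)))%:E =
    (\int[mu]_x (b y * (a x * K (x, y)))%:E)%E.
  by rewrite -RintegralZl //; [rewrite EFin_Rint //; exact: L1Z|exact: laK].
congr fine.
transitivity (\int[mu]_x \int[mu]_y (a x * (b y * K (x, y)))%:E)%E.
  by apply: eq_integral => x _; exact: ea.
transitivity (\int[mu]_y \int[mu]_x (a x * (b y * K (x, y)))%:E)%E.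
  exact: (Fubini (FK_integrable la lb mK KC)).
apply: eq_integral => y _; rewrite eb.
by apply: eq_integral => x _; congr EFin; ring.
Qed.

Lemma L1_fubini (a b : R -> R) (K : R * R -> R) (C : R) : L1 a -> L1 b ->
  measurable_fun setT K -> (forall z, `|K z| <= C) ->
  L1 (fun x => a x * \int[mu]_y (b y * K (x, y))).
Proof.
move=> la lb mK KC.
have lbK x : L1 (fun y => b y * K (x, y)).
  apply: (L1_bdd lb) => //; exact: (measurableT_comp mK (measurable_pair1 x)).
have := integrable_fubini_F (FK_integrable la lb mK KC).
rewrite /L1; congr (mu.-integrable _ _); apply/funext => x.
by rewrite /fubini_F /= -RintegralZl //; [rewrite EFin_Rint //; exact: L1Z|exact: lbK].
Qed.

End fubini_bounded_kernel.

(** * Exponential, Poisson and Bessel weights *)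

Section pointwise_continuity.
Context {R : realType}.
Implicit Types f g : R -> R.

Lemma ctcst (c : R) : continuous (fun _ : R => c).
Proof. exact: cst_continuous. Qed.

Lemma ctid : continuous (fun x : R => x).
Proof. by move=> x; exact: cvg_id. Qed.

Lemma ctD f g : continuous f -> continuous g -> continuous (fun x => f x + g x).
Proof. by move=> cf cg x; apply: cvgD; [exact: cf|exact: cg]. Qed.

Lemma ctN f : continuous f -> continuous (fun x => - f x).
Proof. by move=> cf x; apply: cvgN; exact: cf. Qed.

Lemma ctM f g : continuous f -> continuous g -> continuous (fun x => f x * g x).
Proof. by move=> cf cg x; apply: cvgM; [exact: cf|exact: cg]. Qed.

Lemma ctcomp f g : continuous f -> continuous g -> continuous (fun x => f (g x)).
Proof. by move=> cf cg x; apply: (@continuous_comp _ _ _ g f); [exact: cg|exact: cf]. Qed.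

Lemma ctabs : continuous (fun x : R => `|x|).
Proof. exact: norm_continuous. Qed.

Lemma ctZ (c : R) : continuous (fun x : R => c * x).
Proof. by apply: ctM; [exact: ctcst|exact: ctid]. Qed.

End pointwise_continuity.

Section even_integrals.
Context {R : realType}.
Notation mu := (@lebesgue_measure R).

Lemma even_integral (f F : R -> R) (l : R) : (forall x, 0 <= f x) -> continuous f ->
  (forall x, f (- x) = f x) -> (forall x : R, 0 <= x -> is_derive x (1:R) F (f x)) ->
  F x @[x --> +oo] --> l ->
  (\int[mu]_x (f x)%:E = (2 * (l - F 0))%:E)%E.
Proof.
move=> f0 cf ef dF Fl.
rewrite ge0_symfun_integralT //; last by move=> x /=; rewrite ef.
rewrite -set_itvcy (@ge0_continuous_FTC2y _ f F 0 l) //.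
- exact: continuous_subspaceT.
- by move=> x x0; have := dF x (ltW x0); case.
- by apply: cvg_at_right_filter; exact: (dv_continuous (dF 0 (lexx 0))).
- by move=> x; rewrite in_itv /= andbT => x0; apply: dv_derive1; exact: dF (ltW x0).
Qed.

Lemma cvgy0_inv (F : R -> R) (C e : R) : 0 < e -> 0 < C ->
  (forall x, 0 <= x -> `|F x| <= C / (1 + e * x)) -> F x @[x --> +oo] --> 0.
Proof.
move=> e0 C0 H; apply/cvgr0Pnorm_le => d d0.
exists (C / (d * e)); split; first exact: num_real.
move=> x /= hx; have x0 : 0 < x by apply: le_lt_trans hx; rewrite divr_ge0 ?mulr_ge0 // ltW.
apply: le_trans (H _ (ltW x0)) _.
rewrite ler_pdivrMr; last by rewrite addr_gt0 // mulr_gt0.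
by move: hx; rewrite ltr_pdivrMr ?mulr_gt0 // => hx; nra.
Qed.

Lemma expRN_le (x : R) : 0 <= x -> expR (- x) <= (1 + x)^-1.
Proof.
move=> x0; rewrite expRN lef_pV2 ?posrE ?expR_gt0 ?expR_ge1Dx //.
by rewrite ltr_wpDr.
Qed.

Definition poisson (e t : R) : R := 2 * e / (e ^+ 2 + t ^+ 2).

Let expcos (e t x : R) := expR (- (e * `|x|)) * (1 + cos (t * x)).

Let expcos_ge0 e t x : 0 <= expcos e t x.
Proof. by rewrite mulr_ge0 ?expR_ge0 //; have := cos_geN1 (t * x); lra. Qed.

Lemma continuous_expw_aux (e : R) : continuous (fun x : R => expR (- (e * `|x|))).
Proof.
apply: (ctcomp (f := expR)); first exact: continuous_expR.
by apply: ctN; apply: ctM; [exact: ctcst|exact: ctabs].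
Qed.

Let expcos_cont e t : continuous (expcos e t).
Proof.
apply: ctM; first exact: continuous_expw_aux.
apply: ctD; first exact: ctcst.
by apply: ctcomp; [exact: continuous_cos|exact: ctZ].
Qed.

Let int_expcos e t : 0 < e ->
  (\int[mu]_x (expcos e t x)%:E = (2 / e + poisson e t)%:E)%E.
Proof.
move=> e0; have D0 : 0 < e ^+ 2 + t ^+ 2 by rewrite ltr_wpDr ?sqr_ge0 // exprn_gt0.
pose F x := expR (- (e * x)) *
  (- e^-1 + (t * sin (t * x) - e * cos (t * x)) / (e ^+ 2 + t ^+ 2)).
have ev x : expcos e t (- x) = expcos e t x by rewrite /expcos normrN mulrN cosN.
have dF (x : R) : 0 <= x -> is_derive x (1:R) F (expcos e t x).
  move=> x0; rewrite /expcos ger0_norm //.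
  have d1 : is_derive x (1:R) (fun x => expR (- (e * x))) (expR (- (e * x)) * - (e * 1)).
    by apply: dvcomp; apply: dvN; apply: dvZ; exact: dvid.
  have dt : is_derive x (1:R) (fun x => t * x) (t * 1) by apply: dvZ; exact: dvid.
  have d2 := dvcomp (is_derive_sin (t * x)) dt.
  have d3 := dvcomp (is_derive_cos (t * x)) dt.
  have d4 := dvD (dvcst x (- e^-1)) (dvM (dvD (dvZ t d2) (dvN (dvZ e d3)))
     (dvcst x (e ^+ 2 + t ^+ 2)^-1)).
  apply: dv_eq (dvM d1 d4) _.
  by field; rewrite !lt0r_neq0.
have lF : F x @[x --> +oo] --> 0.
  have C0 : 0 < e^-1 + (`|t| + e) / (e ^+ 2 + t ^+ 2).
    apply: ltr_wpDr; last by rewrite invr_gt0.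
    by apply: divr_ge0; [rewrite addr_ge0 // ltW|exact: ltW].
  apply: (cvgy0_inv e0 C0) => x x0; rewrite /F normrM mulrC.
  rewrite (ger0_norm (expR_ge0 _)).
  have A : expR (- (e * x)) <= (1 + e * x)^-1 by apply: expRN_le; rewrite mulr_ge0 // ltW.
  apply: (ler_pM _ _ _ A); [exact: normr_ge0|exact: expR_ge0|].
  apply: le_trans (ler_normD _ _) _.
  rewrite normrN ger0_norm ?invr_ge0 ?(ltW e0) // lerD2l normrM.
  rewrite (@ger0_norm _ (_^-1)) ?invr_ge0 ?(ltW D0) // ler_wpM2r ?invr_ge0 ?(ltW D0) //.
  apply: le_trans (ler_normB _ _) _; rewrite !normrM (ger0_norm (ltW e0)) lerD //.
    by rewrite ler_piMr // sin_max.
  by rewrite ler_piMr ?(ltW e0) // cos_max.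
have -> := even_integral (expcos_ge0 e t) (@expcos_cont e t) ev dF lF.
congr EFin; rewrite /F /poisson !mulr0 oppr0 expR0 sin0 cos0.
by field; rewrite !lt0r_neq0.
Qed.

Definition expw (e x : R) : R := expR (- (e * `|x|)).

Lemma continuous_expw e : continuous (expw e).
Proof. exact: continuous_expw_aux. Qed.

Lemma expw_ge0 e x : 0 <= expw e x. Proof. exact: expR_ge0. Qed.

Lemma measurable_expw e : measurable_fun setT (expw e).
Proof. apply: continuous_measurable_fun; exact: continuous_expw. Qed.

Let L1_expcos e t : 0 < e -> L1 (expcos e t).
Proof.
move=> e0; apply/integrableP; split.
  by apply/measurable_EFinP; apply: continuous_measurable_fun; exact: expcos_cont.
under eq_integral do rewrite /= ger0_norm //.
by rewrite int_expcos // ltry.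
Qed.

Lemma L1_expw e : 0 < e -> L1 (expw e).
Proof.
move=> e0; apply: (L1_le _ _ (L1_expcos 0 e0)); first exact: measurable_expw.
move=> x; rewrite (ger0_norm (expcos_ge0 e 0 x)) (ger0_norm (expw_ge0 e x)).
by rewrite /expcos mul0r cos0 ler_peMr ?expR_ge0 // lerDl.
Qed.

Let Rint_expcos e t : 0 < e -> \int[mu]_x expcos e t x = 2 / e + poisson e t.
Proof. by move=> e0; rewrite /Rintegral int_expcos. Qed.

Lemma measurable_cosM t : measurable_fun setT (fun x : R => cos (t * x)).
Proof.
by apply: continuous_measurable_fun; apply: ctcomp; [exact: continuous_cos|exact: ctZ].
Qed.

Lemma measurable_sinM t : measurable_fun setT (fun x : R => sin (t * x)).
Proof.
by apply: continuous_measurable_fun; apply: ctcomp; [exact: continuous_sin|exact: ctZ].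
Qed.

Lemma int_expw_cos e t : 0 < e -> \int[mu]_x (expw e x * cos (t * x)) = poisson e t.
Proof.
move=> e0; have l1 := L1_expw e0.
have l2 : L1 (fun x => expw e x * cos (t * x)).
  by apply: (L1_bdd l1) (measurable_cosM t) (fun x => cos_max (t * x)).
have int1 : \int[mu]_x expw e x = 2 / e.
  have := Rint_expcos 0 e0; rewrite /poisson expr0n /= addr0.
  have -> : \int[mu]_x expcos e 0 x = \int[mu]_x (2 * expw e x).
    by apply: eq_Rintegral => x _; rewrite /expcos mul0r cos0 mulrC.
  rewrite RintegralZl // => H.
  apply: (@mulfI _ 2) => //; rewrite H; field; exact: lt0r_neq0.
have := Rint_expcos t e0.
have -> : \int[mu]_x expcos e t x = \int[mu]_x (expw e x + expw e x * cos (t * x)).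
  by apply: eq_Rintegral => x _; rewrite /expcos mulrDr mulr1.
by rewrite RintegralD // int1 => /addrI.
Qed.

Lemma int_expw_sin e t : 0 < e -> \int[mu]_x (expw e x * sin (t * x)) = 0.
Proof.
move=> e0; have l1 := L1_expw e0.
have l2 : L1 (fun x => expw e x * sin (t * x)).
  by apply: (L1_bdd l1) (measurable_sinM t) (fun x => sin_max (t * x)).
have := Rint_reflect (L1_meas l2).
have -> : \int[mu]_x (expw e (- x) * sin (t * - x)) =
    \int[mu]_x (-1 * (expw e x * sin (t * x))).
  by apply: eq_Rintegral => x _; rewrite /expw normrN mulrN sinN mulN1r mulrN.
by rewrite RintegralZl // mulN1r => h; lra.
Qed.

Let cont_p (a : R) : continuous (fun x : R => (1 + `|x|) `^ a).
Proof.
move=> x; have x0 : 0 < 1 + `|x| by rewrite ltr_wpDr.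
have A : continuous (fun x : R => 1 + `|x|) by apply: ctD; [exact: ctcst|exact: ctabs].
have B := dv_continuous (is_derive1_powR a x0).
exact: (continuous_comp (A x) B).
Qed.

Lemma L1_decay : L1 (fun x : R => (1 + `|x|) `^ (- (3 / 2))).
Proof.
pose F (x : R) := - 2 * (1 + x) `^ (- 2^-1).
have Fl : F x @[x --> +oo] --> 0.
  apply/cvgr0Pnorm_le => d d0; exists (4 / d ^+ 2); split; first exact: num_real.
  move=> x /= hx.
  have d2 : 0 < 4 / d ^+ 2 by rewrite divr_gt0 // exprn_gt0.
  have x0 : 0 < 1 + x by lra.
  rewrite /F normrM normrN (ger0_norm (powR_ge0 _ _)) ger0_norm //.
  rewrite -(@ler_pXn2r _ 2) ?nnegrE ?mulr_ge0 ?powR_ge0 ?(ltW d0) // exprMn.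
  rewrite -(powR_mulrn 2 (powR_ge0 _ _)) -powRrM.
  rewrite (_ : - 2^-1 * 2%:R = -1); last by field.
  rewrite powR_inv1 ?(ltW x0) // ler_pdivrMr //.
  by move: hx; rewrite ltr_pdivrMr ?exprn_gt0 // => hx; nra.
have ev (x : R) : (1 + `|- x|) `^ (- (3 / 2)) = (1 + `|x|) `^ (- (3 / 2)).
  by rewrite normrN.
have dF (x : R) : 0 <= x -> is_derive x (1:R) F ((1 + `|x|) `^ (- (3 / 2))).
  move=> x0; have x1 : 0 < 1 + x by lra.
  rewrite ger0_norm //.
  apply: dv_eq (dvZ (- 2) (dvcomp (is_derive1_powR (- 2^-1) x1) (dvD (dvcst x 1) (dvid x)))) _.
  rewrite (_ : - 2^-1 - 1 = - (3 / 2)); last by field.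
  by rewrite add0r mulr1; field.
have E := even_integral (fun x => powR_ge0 _ _) (@cont_p (- (3 / 2))) ev dF Fl.
apply/integrableP; split.
  by apply/measurable_EFinP; apply: continuous_measurable_fun; exact: cont_p.
under eq_integral do rewrite /= ger0_norm ?powR_ge0 //.
by rewrite E ltry.
Qed.

(** Bessel weights: [jb s] is the [s]-th power of [sqrt (1 + xi^2)]. *)
Definition jb (s xi : R) : R := (1 + xi ^+ 2) `^ (s / 2).

Lemma jb_base_gt0 (xi : R) : 0 < 1 + xi ^+ 2.
Proof. by rewrite ltr_wpDr ?sqr_ge0. Qed.
Hint Resolve jb_base_gt0 : core.

Lemma jb_gt0 s xi : 0 < jb s xi. Proof. exact: powR_gt0. Qed.
Lemma jb_ge0 s xi : 0 <= jb s xi. Proof. exact: powR_ge0. Qed.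

Lemma jb_sqr s xi : jb s xi ^+ 2 = (1 + xi ^+ 2) `^ s.
Proof.
rewrite -(powR_mulrn 2 (jb_ge0 s xi)) -powRrM.
by have -> : s / 2 * 2%:R = s by field.
Qed.

Lemma jbD s r xi : jb (s + r) xi = jb s xi * jb r xi.
Proof.
by rewrite /jb mulrDl powRD //; apply/implyP => _; apply: lt0r_neq0; exact: jb_base_gt0.
Qed.

Lemma jb0 xi : jb 0 xi = 1.
Proof. by rewrite /jb mul0r powRr0. Qed.

Lemma jbN s xi : jb s (- xi) = jb s xi.
Proof. by rewrite /jb sqrrN. Qed.

Lemma continuous_jb s : continuous (jb s).
Proof.
move=> x.
have A : continuous (fun x : R => 1 + x ^+ 2).
  by apply: ctD; [exact: ctcst|apply: (@ctM _ id id); exact: ctid].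
have B := dv_continuous (is_derive1_powR (s / 2) (jb_base_gt0 x)).
exact: (continuous_comp (A x) B).
Qed.

Lemma measurable_jb s : measurable_fun setT (jb s).
Proof. apply: continuous_measurable_fun; exact: continuous_jb. Qed.

Lemma jb_ge1 s xi : 0 <= s -> 1 <= jb s xi.
Proof.
move=> s0; have e1 : (1 : R) `^ (s / 2) = 1 by rewrite powR1.
rewrite -e1; apply: ge0_ler_powR;
  rewrite ?nnegrE ?divr_ge0 //; first exact: ltW.
by rewrite lerDl sqr_ge0.
Qed.

Lemma jb_mono s r xi : s <= r -> jb s xi <= jb r xi.
Proof.
move=> sr; have -> : r = (r - s) + s by rewrite subrK.
by rewrite jbD ler_peMl ?jb_ge0 //; apply: jb_ge1; rewrite subr_ge0.
Qed.

(** Peetre's inequality. *)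
Lemma jb_peetre s x y : 0 <= s -> jb s (x + y) <= 2 `^ (s / 2) * jb s x * jb s y.
Proof.
move=> s0; rewrite -mulrA /jb -!powRM //; try exact: ltW.
  apply: ge0_ler_powR; rewrite ?nnegrE ?divr_ge0 ?mulr_ge0 //; try exact: ltW.
  by have := sqr_ge0 (x - y); have := sqr_ge0 (x * y); nra.
by rewrite mulr_ge0 // ltW.
Qed.

Lemma jb_decay xi : jb (- (3 / 2)) xi <= 2 * (1 + `|xi|) `^ (- (3 / 2)).
Proof.
have a0 : 0 < 1 + `|xi| by rewrite ltr_wpDr.
have -> : (1 + `|xi|) `^ (- (3 / 2)) = ((1 + `|xi|) ^+ 2) `^ (- (3 / 2) / 2).
  rewrite -(powR_mulrn 2 (ltW a0)) -powRrM.
  by have -> : 2%:R * (- (3 / 2) / 2) = - (3 / 2) :> R by field.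
rewrite /jb !mulNr !powRN.
set A := ((1 + `|xi|) ^+ 2) `^ _.
have A0 : 0 < A by rewrite powR_gt0 // exprn_gt0.
have -> : 2 * A^-1 = (2^-1 * A)^-1 by rewrite invfM invrK.
rewrite lef_pV2 ?posrE ?powR_gt0 // ?mulr_gt0 // /A.
apply: (@le_trans _ _ ((2^-1 * (1 + `|xi|) ^+ 2) `^ (3 / 2 / 2))).
  have h2 : 0 <= 2^-1 :> R by [].
  have hs : 0 <= (1 + `|xi|) ^+ 2 by rewrite exprn_ge0 // ltW.
  rewrite (powRM _ h2 hs). rewrite ler_wpM2r ?powR_ge0 //.
  rewrite -[leLHS](powRr1 h2) //; apply: ger_powR; last by lra.
  by rewrite invr_gt0 invf_le1 // ltr0n ler1n.
apply: ge0_ler_powR; rewrite ?nnegrE ?mulr_ge0 ?exprn_ge0 ?(ltW a0) //; try exact: ltW.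
have e : `|xi| ^+ 2 = xi ^+ 2 by rewrite real_normK // num_real.
by have := sqr_ge0 (1 - `|xi|); rewrite -e; nra.
Qed.

Lemma L1_jb_decay : L1 (jb (- (3 / 2))).
Proof.
apply: (L1_le _ _ (L1Z 2 L1_decay)); first exact: measurable_jb.
by move=> x; rewrite (ger0_norm (jb_ge0 _ _)); exact: le_trans (jb_decay x) (ler_norm _).
Qed.

Lemma poisson_ge0 e t : 0 <= e -> 0 <= poisson e t.
Proof. by move=> e0; rewrite divr_ge0 ?mulr_ge0 ?addr_ge0 ?sqr_ge0. Qed.

Lemma L1_poisson : L1 (poisson 1).
Proof.
have E : poisson 1 = fun x => 2 * jb (- 2) x.
  apply/funext => x; rewrite /poisson /jb expr1n mulr1 mulNr divff //.
  by rewrite powR_inv1 // ltW.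
rewrite E; apply: L1Z; apply: (L1_le _ _ L1_jb_decay); first exact: measurable_jb.
by move=> x; rewrite !(ger0_norm (jb_ge0 _ _)); apply: jb_mono; lra.
Qed.

Lemma poisson_scale e z : 0 < e -> poisson e (e * z) = e^-1 * poisson 1 z.
Proof.
move=> e0; rewrite /poisson expr1n.
have -> : e ^+ 2 + (e * z) ^+ 2 = e ^+ 2 * (1 + z ^+ 2) by ring.
by field; rewrite (lt0r_neq0 e0) (lt0r_neq0 (jb_base_gt0 z)).
Qed.

End even_integrals.
#[export] Hint Extern 0 (is_true (@Order.lt _ _ _ (1 + _ ^+ 2))) => exact: jb_base_gt0 : core.
#[export] Hint Extern 0 (is_true (@Order.le _ _ _ (jb _ _))) => exact: jb_ge0 : core.

(** * The Hartley transform of integrable functions *)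

Section dominated_convergence_real.
Context {R : realType}.
Notation mu := (@lebesgue_measure R).

Lemma Rint_dct (f_ : nat -> R -> R) (f g : R -> R) :
  (forall n, measurable_fun setT (f_ n)) -> measurable_fun setT f ->
  {ae mu, forall x, f_ n x @[n --> \oo] --> f x} -> L1 g ->
  (forall n x, `|f_ n x| <= g x) ->
  \int[mu]_x f_ n x @[n --> \oo] --> \int[mu]_x f x.
Proof.
move=> mf_ mf ff lg fg.
have mf_' n : measurable_fun setT (EFin \o f_ n) by apply/measurable_EFinP.
have mf' : measurable_fun setT (EFin \o f) by apply/measurable_EFinP.
have ff' : {ae mu, forall x, setT x -> (EFin \o f_ n) x @[n --> \oo] --> (EFin \o f) x}.
  by apply: filterS ff => x fx _; apply: cvg_EFin => //; exact: nearW.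
have fg' : {ae mu, forall x n, setT x -> (`|(EFin \o f_ n) x| <= (EFin \o g) x)%E}.
  by apply: aeW => x n _; rewrite lee_fin.
have [lf _ H] := @dominated_convergence _ _ _ mu setT measurableT _ _ _ mf_' mf' ff' lg fg'.
apply: fine_cvg; move: H; rewrite /= -EFin_Rint //.
Qed.

Lemma sq_dct (f_ : nat -> R -> R) (f g : R -> R) :
  (forall n, measurable_fun setT (f_ n)) -> measurable_fun setT f ->
  {ae mu, forall x, f_ n x @[n --> \oo] --> f x} -> L2 g ->
  (forall n x, `|f_ n x - f x| <= g x) ->
  sq (fun x => f_ n x - f x) @[n --> \oo] --> 0%E.
Proof.
move=> mf_ mf ff lg fg.
have md n : measurable_fun setT (fun x => f_ n x - f x) by exact: measurable_funB.
have mf_' n := measurable_sq (md n).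
have ff' : {ae mu, forall x, setT x ->
    (EFin \o (fun x => (f_ n x - f x) ^+ 2)) x @[n --> \oo] --> (cst 0%E : R -> \bar R) x}.
  apply: filterS ff => x fx _; apply: cvg_EFin; first exact: nearW.
  have fx0 : (f_ n x - f x) @[n --> \oo] --> 0.
    by rewrite -(subrr (f x)); apply: cvgB => //; exact: cvg_cst.
  have := cvgM fx0 fx0; rewrite mulr0; exact.
have fg' : {ae mu, forall x n, setT x -> (`|(EFin \o (fun x => (f_ n x - f x) ^+ 2)%R) x|
    <= (EFin \o (fun x => g x ^+ 2)%R) x)%E}.
  apply: aeW => x n _; rewrite lee_fin /= normrX.
  by rewrite ler_sqr ?nnegrE //; apply: le_trans (fg n x).
have [_ _] := @dominated_convergence _ _ _ mu setT measurableT _ _ _ mf_'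
  (measurable_cst 0%E) ff' (sq_integrable lg) fg'.
by rewrite integral0.
Qed.

End dominated_convergence_real.

Section hartley_L1.
Context {R : realType}.
Notation mu := (@lebesgue_measure R).
Implicit Types (f g : R -> R).

(** The Hartley kernel. For real [f] the transform [f |-> \int f(x) cas(x xi) dx]
    packs the cosine (even) and sine (odd) transforms into one real function. *)
Definition cas (x : R) : R := cos x + sin x.

Lemma cas_le2 x : `|cas x| <= 2.
Proof.
apply: le_trans (ler_normD _ _) _; rewrite (_ : 2 = 1 + 1) //.
by rewrite lerD ?cos_max ?sin_max.
Qed.

Lemma casM a b : cas a * cas b = cos (a - b) + sin (a + b).
Proof. by rewrite /cas cosB sinD; ring. Qed.

Lemma continuous_cas : continuous cas.
Proof. by apply: ctD; [exact: continuous_cos|exact: continuous_sin]. Qed.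

Lemma measurable_casM xi : measurable_fun setT (fun x : R => cas (x * xi)).
Proof.
apply: continuous_measurable_fun; apply: ctcomp; first exact: continuous_cas.
by apply: ctM; [exact: ctid|exact: ctcst].
Qed.

Lemma measurable_cas2 : measurable_fun setT (fun z : R * R => cas (z.1 * z.2)).
Proof.
apply: (@measurableT_comp _ _ _ _ _ _ cas).
  by apply: continuous_measurable_fun; exact: continuous_cas.
by apply: measurable_funM; [exact: measurable_fst|exact: measurable_snd].
Qed.

Lemma measurable_swap2 (K : R * R -> R) : measurable_fun setT K ->
  measurable_fun setT (fun z : R * R => K (z.2, z.1)).
Proof.
move=> mK; apply: (measurableT_comp mK).
by apply: measurable_fun_pair; [exact: measurable_snd|exact: measurable_fst].
Qed.

Lemma measurable_fubini (b : R -> R) (K : R * R -> R) C : L1 b -> measurable_fun setT K ->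
  (forall z, `|K z| <= C) -> measurable_fun setT (fun x : R => \int[mu]_y (b y * K (x, y))).
Proof.
move=> lb mK KC; have := L1_meas (L1_fubini (L1_expw ltr01) lb mK KC).
move=> m; have me : measurable_fun setT (fun x : R => expR `|x|).
  apply: continuous_measurable_fun; apply: ctcomp; [exact: continuous_expR|exact: ctabs].
have := measurable_funM me m; congr (measurable_fun _ _).
apply/funext => x /=; rewrite mulrA /expw mul1r -expRD subrr expR0 mul1r //.
Qed.

Definition H1 f (xi : R) : R := \int[mu]_x (f x * cas (x * xi)).

Lemma L1_cas f xi : L1 f -> L1 (fun x => f x * cas (x * xi)).
Proof. by move=> lf; apply: (L1_bdd lf) (measurable_casM xi) (fun x => cas_le2 _). Qed.

Lemma H1_bound f xi : L1 f -> `|H1 f xi| <= 2 * \int[mu]_x `|f x|.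
Proof. by move=> lf; apply: (Rint_bdd lf) (measurable_casM xi) (fun x => cas_le2 _). Qed.

Lemma measurable_H1 f : L1 f -> measurable_fun setT (H1 f).
Proof.
move=> lf.
exact: (measurable_fubini lf (measurable_swap2 measurable_cas2) (fun z => cas_le2 _)).
Qed.

Lemma H1B f g xi : L1 f -> L1 g -> H1 (fun x => f x - g x) xi = H1 f xi - H1 g xi.
Proof.
move=> lf lg; rewrite /H1 -RintegralB //; try exact: L1_cas.
by apply: eq_Rintegral => x _; rewrite mulrBl.
Qed.

(** Regularizing by [exp (- e |xi|)] makes the double integral absolutely
    convergent, and the [xi]-integral of [cas * cas] is then a Poisson kernel. *)
Lemma weighted_plancherel f e : L1 f -> 0 < e ->
  \int[mu]_xi (H1 f xi ^+ 2 * expw e xi) =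
  \int[mu]_x (f x * \int[mu]_y (f y * poisson e (y - x))).
Proof.
move=> lf e0; have le := L1_expw e0.
have lHe : L1 (fun xi => H1 f xi * expw e xi).
  have := L1_bdd le (measurable_H1 lf) (fun xi => H1_bound xi lf).
  by congr L1; apply/funext => xi; rewrite mulrC.
transitivity (\int[mu]_xi ((H1 f xi * expw e xi) * \int[mu]_x (f x * cas (x * xi)))).
  by apply: eq_Rintegral => xi _; rewrite -/(H1 f xi); ring.
have := fubini_bdd lHe lf (measurable_swap2 measurable_cas2) (fun z => cas_le2 _).
rewrite /= => ->; apply: eq_Rintegral => x _; congr (_ * _).
have mK : measurable_fun setT (fun z : R * R => cas (z.2 * z.1) * cas (x * z.1)).
  apply: measurable_funM; first exact: (measurable_swap2 measurable_cas2).
  apply: (@measurableT_comp _ _ _ _ _ _ cas).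
    by apply: continuous_measurable_fun; exact: continuous_cas.
  by apply: measurable_funM => //; exact: measurable_fst.
have KC (z : R * R) : `|cas (z.2 * z.1) * cas (x * z.1)| <= 2 * 2.
  by rewrite normrM ler_pM // cas_le2.
transitivity (\int[mu]_xi (expw e xi * \int[mu]_y (f y * (cas (y * xi) * cas (x * xi))))).
  apply: eq_Rintegral => xi _.
  have -> : \int[mu]_y (f y * (cas (y * xi) * cas (x * xi))) = H1 f xi * cas (x * xi).
    rewrite /H1 -RintegralZr //; last exact: L1_cas.
    by apply: eq_Rintegral => y _; rewrite mulrA.
  ring.
rewrite (fubini_bdd le lf mK KC) /=; apply: eq_Rintegral => y _; congr (_ * _).
transitivity (\int[mu]_xi (expw e xi * cos ((y - x) * xi) + expw e xi * sin ((y + x) * xi))).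
  by apply: eq_Rintegral => xi _; rewrite casM -mulrBl -mulrDl mulrDr.
have l1 : L1 (fun xi => expw e xi * cos ((y - x) * xi)).
  by apply: (L1_bdd le) (measurable_cosM _) (fun x => cos_max _).
have l2 : L1 (fun xi => expw e xi * sin ((y + x) * xi)).
  by apply: (L1_bdd le) (measurable_sinM _) (fun x => sin_max _).
by rewrite RintegralD // int_expw_cos // int_expw_sin // addr0.
Qed.

Definition kappa : R := \int[mu]_z poisson 1 z.

Definition supp_in (n : R) f : Prop := forall x, n < `|x| -> f x = 0.

Definition nice f : Prop := [/\ measurable_fun setT f,
  exists M, forall x, `|f x| <= M, exists n, supp_in n f &
  {ae mu, forall x, {for x, continuous f}}].

Lemma nice_L1 f : nice f -> L1 f.
Proof.
move=> [mf [M fM] [n fn] _].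
apply: (L1_le mf _ (L1Z (M * expR n) (L1_expw ltr01))) => x.
have M0 : 0 <= M := le_trans (normr_ge0 _) (fM 0).
have [nx|xn] := ltP n `|x|; first by rewrite fn // normr0.
apply: le_trans (ler_norm _); apply: le_trans (fM x) _.
rewrite -mulrA ler_peMr // /expw mul1r -expRD.
by rewrite -expR0 ler_expR subr_ge0.
Qed.

Lemma niceB f g : nice f -> nice g -> nice (fun x => f x - g x).
Proof.
move=> [mf [M fM] [n fn] cf] [mg [N gN] [m gm] cg]; split.
- exact: measurable_funB.
- by exists (M + N) => x; apply: le_trans (ler_normB _ _) _; rewrite lerD.
- exists (Num.max n m) => x; rewrite gt_max => /andP[h1 h2].
  by rewrite fn // gm // subr0.
- by apply: filterS2 cf cg => x c1 c2; apply: cvgB.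
Qed.

Let eps (k : nat) : R := k.+1%:R^-1.
Let eps_gt0 k : 0 < eps k. Proof. by rewrite invr_gt0. Qed.
Let cvg_eps : eps k @[k --> \oo] --> 0. Proof. exact: cvg_harmonic. Qed.

Lemma measurable_poisson1 : measurable_fun setT (poisson (1 : R)).
Proof. exact: L1_meas (@L1_poisson R). Qed.

Lemma measurable_poisson e : 0 < e -> measurable_fun setT (poisson (e : R)).
Proof.
move=> e0; have m := measurable_affine e^-1 0 measurable_poisson1.
have := measurable_funM (measurable_cst e^-1) m; congr (measurable_fun _ _).
apply/funext => z /=; rewrite addr0 -poisson_scale // mulrA divff ?mul1r //.
exact: lt0r_neq0.
Qed.

Lemma poisson_le (e t : R) : 0 < e -> `|poisson e t| <= 2 / e.
Proof.
move=> e0; rewrite ger0_norm ?poisson_ge0 ?(ltW e0) //.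
rewrite ler_pdivrMr ?ltr_wpDr ?sqr_ge0 ?exprn_gt0 //.
rewrite (_ : 2 / e * _ = 2 * e + 2 / e * t ^+ 2); last by field; exact: lt0r_neq0.
by rewrite lerDl mulr_ge0 ?sqr_ge0 // divr_ge0 // ltW.
Qed.

Lemma poisson_approx f x : nice f -> {for x, continuous f} ->
  \int[mu]_y (f y * poisson (eps k) (y - x)) @[k --> \oo] --> f x * kappa.
Proof.
move=> nf cx; have lf := nice_L1 nf; have [mf [M fM] _ _] := nf.
have mp := measurable_poisson1.
have E k : \int[mu]_y (f y * poisson (eps k) (y - x)) =
    \int[mu]_z (f (eps k * z + x) * poisson 1 z).
  have e0 := eps_gt0 k.
  have lg : L1 (fun y => f y * poisson (eps k) (y - x)).
    apply: (L1_bdd lf) (fun y => poisson_le (y - x) e0).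
    by have := measurable_shift (- x) (measurable_poisson e0).
  rewrite (Rint_affine x e0 lg) -RintegralZl //; last exact: (L1_affine x e0 lg).
  apply: eq_Rintegral => z _; rewrite addrK poisson_scale //.
  by rewrite mulrCA; congr (_ * _); rewrite mulrA divff ?mul1r //; exact: lt0r_neq0.
under eq_fun do rewrite E.
rewrite /kappa -RintegralZl //; last exact: L1_poisson.
apply: (Rint_dct (g := fun z => M * poisson 1 z)).
- by move=> k; apply: measurable_funM => //; exact: measurable_affine.
- exact: measurable_funM.
- apply: aeW => z; apply: cvgM; last exact: cvg_cst.
  have H : eps k * z + x @[k --> \oo] --> 0 * z + x.
    by apply: cvgD; [apply: cvgM; [exact: cvg_eps|exact: cvg_cst]|exact: cvg_cst].
  by rewrite mul0r add0r in H; exact: (cvg_comp _ _ H cx).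
- by apply: L1Z; exact: L1_poisson.
- move=> k z; rewrite normrM (ger0_norm (poisson_ge0 z ler01)).
  by apply: ler_wpM2r => //; apply: poisson_ge0.
Qed.

Lemma sq_Rint f : L2 f -> sq f = (\int[mu]_x (f x ^+ 2))%:E.
Proof. by move=> lf; rewrite EFin_Rint //; exact: sq_integrable. Qed.

Lemma nice_L2 f : nice f -> L2 f.
Proof.
move=> nf; have lf := nice_L1 nf; have [mf [M fM] _ _] := nf; split => //.
have := L1_bdd lf mf fM => /integrableP[_]; apply: le_lt_trans.
apply: ge0_le_integral => //.
- by move=> x _; rewrite lee_fin sqr_ge0.
- exact: measurable_sq.
- by apply: measurableT_comp => //; apply/measurable_EFinP; exact: measurable_funM.
by move=> x _; rewrite lee_fin -expr2 ler_norm.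
Qed.

Lemma kappa_ge0 : 0 <= kappa.
Proof. by apply: Rintegral_ge0 => z _; exact: poisson_ge0. Qed.

Lemma plancherel_nice f : nice f -> sq (H1 f) = (kappa%:E * sq f)%E.
Proof.
move=> nf; have lf := nice_L1 nf; have l2 := nice_L2 nf; have [mf [M fM] _ cf] := nf.
have mH := measurable_H1 lf.
have mp := measurable_poisson1.
have MM : 0 <= M := le_trans (normr_ge0 _) (fM 0).
pose w k xi := H1 f xi ^+ 2 * expw (eps k) xi.
have lw k : L1 (w k).
  have b xi : `|H1 f xi ^+ 2| <= (2 * \int[mu]_x `|f x|) ^+ 2.
    by rewrite normrX lerXn2r ?nnegrE // ?H1_bound // (le_trans (normr_ge0 _) (H1_bound xi lf)).
  have := L1_bdd (L1_expw (eps_gt0 k)) (measurable_funX 2 mH) b.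
  by congr L1; apply/funext => xi; rewrite mulrC.
(* the left-hand side increases to [sq (H1 f)] *)
have c1 : (\int[mu]_xi w k xi)%:E @[k --> \oo] --> sq (H1 f).
  have E xi : limn (fun k => (w k xi)%:E) = (H1 f xi ^+ 2)%:E.
    apply/cvg_lim => //; apply: cvg_EFin; first exact: nearW.
    have H : - (eps k * `|xi|) @[k --> \oo] --> - (0 * `|xi|).
      by apply: cvgN; apply: cvgM; [exact: cvg_eps|exact: cvg_cst].
    have He := cvg_comp _ _ H (@continuous_expR R _).
    have := cvgM (@cvg_cst _ (H1 f xi ^+ 2) _ \oo _) He.
    by rewrite mul0r oppr0 expR0 mulr1; exact.
  under eq_fun do rewrite EFin_Rint //.
  have -> : sq (H1 f) = (\int[mu]_xi limn (fun k => (EFin \o w k) xi))%E.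
    by apply: eq_integral => xi _; rewrite E.
  apply: cvg_monotone_convergence => //.
  - by move=> k; apply/measurable_EFinP; exact: L1_meas.
  - by move=> k x _; rewrite lee_fin mulr_ge0 ?sqr_ge0 // expw_ge0.
  - move=> xi _ m n mn; rewrite lee_fin ler_wpM2l ?sqr_ge0 // ler_expR lerN2 ler_wpM2r //.
    by rewrite lef_pV2 ?posrE // ler_nat.
(* while the right-hand side tends to [kappa * sq f] *)
have c2 : (\int[mu]_xi w k xi)%:E @[k --> \oo] --> (kappa%:E * sq f)%E.
  rewrite sq_Rint // -EFinM; apply: cvg_EFin; first exact: nearW.
  rewrite /comp /=; under eq_fun do rewrite weighted_plancherel //.
  rewrite -RintegralZl //; last exact: sq_integrable.
  have mI k : measurable_fun setT (fun x : R => \int[mu]_y (f y * poisson (eps k) (y - x))).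
    have mK : measurable_fun setT (fun z : R * R => poisson (eps k) (z.2 - z.1)).
      apply: (measurableT_comp (measurable_poisson (eps_gt0 k))).
      by apply: measurable_funB; [exact: measurable_snd|exact: measurable_fst].
    exact: (measurable_fubini lf mK (fun z => poisson_le _ (eps_gt0 k))).
  apply: (Rint_dct (g := fun x => (M * kappa) * `|f x|)).
  - by move=> k; exact: measurable_funM.
  - by apply: measurable_funM => //; exact: measurable_funX.
  - apply: filterS cf => x cx.
    rewrite (_ : kappa * f x ^+ 2 = f x * (f x * kappa)); last by ring.
    by apply: cvgM; [exact: cvg_cst|exact: poisson_approx].
  - by apply: L1Z; exact: L1_abs.
  - move=> k x; rewrite normrM mulrC ler_wpM2r //.
    have e0 := eps_gt0 k.
    have lg : L1 (fun y => f y * poisson (eps k) (y - x)).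
      apply: (L1_bdd lf) (fun y => poisson_le (y - x) e0).
      by have := measurable_shift (- x) (measurable_poisson e0).
    rewrite (Rint_affine x e0 lg) -RintegralZl //; last exact: (L1_affine x e0 lg).
    have -> : \int[mu]_y (eps k * (f (eps k * y + x) * poisson (eps k) (eps k * y + x - x)))
       = \int[mu]_y (poisson 1 y * f (eps k * y + x)).
      apply: eq_Rintegral => z _; rewrite addrK poisson_scale // (mulrC (poisson 1 z)).
      by rewrite mulrCA; congr (_ * _); rewrite mulrA divff ?mul1r //; exact: lt0r_neq0.
    apply: le_trans (Rint_bdd (@L1_poisson R) _ (fun y => fM _)) _.
      exact: measurable_affine.
    rewrite ler_wpM2l // /kappa le_eqVlt; apply/orP; left; apply/eqP.
    by apply: eq_Rintegral => z _; rewrite ger0_norm // poisson_ge0.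
by have := cvg_unique _ c1 c2; apply.
Qed.

End hartley_L1.

(** * Density of bounded functions of bounded support *)

Section truncation.
Context {R : realType}.
Notation mu := (@lebesgue_measure R).
Implicit Types (f g : R -> R).

Definition clamp (k a : R) : R := Num.max (- k) (Num.min a k).

Lemma clamp_le k a : 0 <= k -> `|clamp k a| <= k.
Proof.
move=> k0; rewrite ler_norml le_max lexx /= ge_max ge_min lexx orbT andbT.
by lra.
Qed.

Lemma max_lip (c a b : R) : `|Num.max c a - Num.max c b| <= `|a - b|.
Proof.
have h1 := ler_norm (a - b); have h2 := ler_norm (b - a); rewrite distrC in h2.
rewrite !maxEle ler_norml; case: (leP c a) => ?; case: (leP c b) => ?;
  apply/andP; split; lra.
Qed.

Lemma clamp_lip k a b : `|clamp k a - clamp k b| <= `|a - b|.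
Proof.
apply: le_trans (max_lip _ _ _) _.
have h1 := ler_norm (a - b); have h2 := ler_norm (b - a); rewrite distrC in h2.
rewrite !minEle ler_norml; case: (leP a k) => ?; case: (leP b k) => ?;
  apply/andP; split; lra.
Qed.

Lemma clamp_id k a : `|a| <= k -> clamp k a = a.
Proof.
rewrite ler_norml => /andP[h1 h2]; rewrite /clamp.
by rewrite min_l // max_r.
Qed.

Lemma clamp_contr k a : 0 <= k -> `|clamp k a - a| <= `|a|.
Proof.
move=> k0; rewrite /clamp !maxEle !minEle.
by have [a0|a0] := leP 0 a; [rewrite (ger0_norm a0)|rewrite (ltr0_norm a0)];
  rewrite ler_norml; case: (leP a k) => ?; case: (leP (- k) a) => ?;
  case: (leP (- k) k) => ?; apply/andP; split; lra.
Qed.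

Lemma continuous_clamp k : continuous (clamp k).
Proof.
move=> x; apply/cvgrPdist_le => e e0.
have /cvgrPdist_le/(_ e e0) : (fun y : R => y) y @[y --> x] --> x by exact: cvg_id.
by apply: filterS => y; exact: le_trans (clamp_lip _ _ _).
Qed.

Lemma measurable_clamp k f : measurable_fun setT f -> measurable_fun setT (fun x => clamp k (f x)).
Proof.
move=> mf; apply: (measurableT_comp _ mf).
by apply: continuous_measurable_fun; exact: continuous_clamp.
Qed.

Definition box (n : nat) : set R := [set` `[- n%:R, n%:R]].
Definition tr (n : nat) f (x : R) : R := f x * \1_(box n) x.

Lemma measurable_box n : measurable (box n). Proof. exact: measurable_itv. Qed.

Lemma box_norm n x : (x \in box n) = (`|x| <= n%:R).
Proof. by rewrite ler_norml /box mem_setE in_itv. Qed.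

Lemma trE n f x : tr n f x = if `|x| <= n%:R then f x else 0.
Proof. by rewrite /tr indicE box_norm; case: ifP; rewrite ?mulr1 ?mulr0. Qed.

Lemma tr_le n f x : `|tr n f x| <= `|f x|.
Proof. by rewrite trE; case: ifP; rewrite ?normr0. Qed.

Lemma tr_contr n f x : `|tr n f x - f x| <= `|f x|.
Proof. by rewrite trE; case: ifP; rewrite ?subrr ?normr0 // sub0r normrN. Qed.

Lemma measurable_tr n f : measurable_fun setT f -> measurable_fun setT (tr n f).
Proof. move=> mf; apply: measurable_funM; first exact: mf. exact: measurable_indic (measurable_box n). Qed.

Lemma supp_tr n f : supp_in n%:R (tr n f).
Proof. by move=> x nx; rewrite trE leNgt nx. Qed.

Lemma L2_le f g : measurable_fun setT f -> (forall x, `|f x| <= `|g x|) -> L2 g -> L2 f.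
Proof. by move=> mf fg [mg lg]; split => //; apply: le_lt_trans lg; exact: le_sq. Qed.

Lemma L2_abs f : L2 f -> L2 (fun x => `|f x|).
Proof.
move=> lf; apply: (L2_le _ _ lf) => [|x]; last by rewrite normr_id.
by apply: measurableT_comp => //; case: lf.
Qed.

Lemma L2_tr n f : L2 f -> L2 (tr n f).
Proof. by move=> lf; apply: (L2_le _ (tr_le n f) lf); apply: measurable_tr; case: lf. Qed.

Lemma cvg_tr f x : tr n f x @[n --> \oo] --> f x.
Proof.
apply: cvg_near_cst.
exists (Num.bound `|x|) => // n /= hn; rewrite trE ifT //.
by apply: ltW; apply: lt_le_trans (archi_boundP (normr_ge0 x)) _; rewrite ler_nat.
Qed.

Lemma sq_cvg_tr f : L2 f -> sq (fun x => tr n f x - f x) @[n --> \oo] --> 0%E.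
Proof.
move=> lf; have [mf _] := lf; apply: (sq_dct (g := fun x => `|f x|)) => //.
- by move=> n; exact: measurable_tr.
- by apply: aeW => x; exact: cvg_tr.
- exact: L2_abs.
- by move=> n x; exact: tr_contr.
Qed.

Lemma sq_indic n : sq (\1_(box n) : R -> R) = (n%:R + n%:R)%:E.
Proof.
rewrite /sq; have -> : (\int[mu]_x (((\1_(box n) : R -> R) x) ^+ 2)%:E =
    \int[mu]_x (\1_(box n) x)%:E)%E.
  by apply: eq_integral => x _; rewrite indicE; case: (_ \in _); rewrite ?expr1n ?expr0n.
rewrite integral_indic ?setIT //; last exact: measurable_box.
rewrite [LHS]lebesgue_measure_itv /= lte_fin.
case: ltP => h; first by rewrite -EFinD opprK.
by congr EFin; have : 0 <= n%:R :> R by []; lra.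
Qed.

Lemma L2_indic n : L2 (\1_(box n) : R -> R).
Proof. by split; [exact: measurable_indic (measurable_box n)|rewrite sq_indic ltry]. Qed.

Lemma supp_L1 n f : L2 f -> supp_in n%:R f -> L1 f.
Proof.
move=> lf sf; have := L2_mul_integrable lf (L2_indic n).
congr (mu.-integrable _ _); apply/funext => x /=; congr EFin.
rewrite -/(tr n f x) trE; case: ifPn => //; rewrite -ltNge => nx.
by rewrite sf.
Qed.

Lemma nice_dense n f : L2 f -> supp_in n%:R f -> forall e : R, 0 < e ->
  exists g, [/\ nice g, supp_in n%:R g & (sq (fun x => f x - g x)%R <= e%:E)%E].
Proof.
move=> lf sf e e0; have [mf _] := lf.
(* first cut [f] off at a large height [k] *)
have ck : sq (fun x => clamp k%:R (f x) - f x) @[k --> \oo] --> 0%E.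
  apply: (sq_dct (g := fun x => `|f x|)) => //.
  - by move=> k; exact: measurable_clamp.
  - apply: aeW => x; apply: cvg_near_cst.
    exists (Num.bound `|f x|) => // k /= hk; apply: clamp_id.
    by apply: ltW; apply: lt_le_trans (archi_boundP (normr_ge0 _)) _; rewrite ler_nat.
  - exact: L2_abs.
  - by move=> k x; exact: clamp_contr.
have e4 : 0 < e / 4 by rewrite divr_gt0.
have /(ecvg0P (fun k => sq_ge0 _)) /(_ _ e4) [k0 _ /(_ k0 (leqnn _)) /= hk] := ck.
set k : R := k0%:R in hk; have k_ge0 : 0 <= k by exact: ler0n.
pose f' x := clamp k (f x).
have mf' : measurable_fun setT f' by exact: measurable_clamp.
have f'k x : `|f' x| <= k by exact: clamp_le.
have sf' : supp_in n%:R f'.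
  by move=> x nx; rewrite /f' sf // clamp_id // normr0.
(* then approximate in L1 by a continuous function and cut that off at height [k] too *)
have fin_box : (mu (box n) < +oo)%E by rewrite /box lebesgue_measure_itv /=; case: ifP => _; rewrite ?ltry // -EFinD ltry.
have lf' : mu.-integrable (box n) (EFin \o f').
  have mfb : measurable_fun (box n) f' by exact: measurable_funTS.
  apply: (@measurable_bounded_integrable _ _ _ mu _ _ (measurable_box n) fin_box mfb).
  exists k; split; first exact: num_real.
  by move=> M kM x _; apply: le_trans (f'k x) _; exact: ltW.
have [g_ [cg ig +]] := approximation_continuous_integrable (measurable_box n) fin_box lf'.
move=> cg0; have i0 j : (0 <= \int[mu]_(z in box n) `|(f' z - g_ j z)%:E|)%E.
  by apply: integral_ge0.
have d0 : 0 < e / (8 * (k + 1)).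
  by rewrite divr_gt0 // mulr_gt0 // ltr_wpDl.
have /(ecvg0P i0) /(_ _ d0) [j0 _ /(_ j0 (leqnn _)) /= hj] := cg0.
pose g := tr n (fun x => clamp k (g_ j0 x)).
have mg0 : measurable_fun setT (g_ j0) by apply: continuous_measurable_fun; exact: cg.
have mg : measurable_fun setT g by apply: measurable_tr; exact: measurable_clamp.
exists g; split.
- split => //.
  + by exists k => x; apply: le_trans (tr_le _ _ _) _; exact: clamp_le.
  + by exists n%:R; exact: supp_tr.
  + have cc : continuous (fun x => clamp k (g_ j0 x)).
      by apply: ctcomp; [exact: continuous_clamp|exact: cg].
    (* the only possible jumps of [g] are at the end points of the box *)
    have H : mu.-negligible ([set - n%:R; n%:R] : set R).
      exists [set - n%:R; n%:R]; split => //; first exact: measurableU.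
      apply: (@countable_lebesgue_measure0 R); apply: finite_set_countable.
      by rewrite finite_setU; split; exact: finite_set1.
    apply: negligibleS H => x /= ncx; apply: contrapT => /not_orP[/eqP xn1 /eqP xn2].
    apply: ncx; have [nx|xn] := ltP `|x| n%:R.
      have E : \forall y \near x, clamp k (g_ j0 y) = g y.
        have : \forall y \near x, `|y| < n%:R.
          by have /cvgr_lt := @ctabs R x; apply.
        by apply: filterS => y yn; rewrite /g trE ltW.
      have gx : g x = clamp k (g_ j0 x) by rewrite /g trE ltW.
      change (g @ x --> g x); rewrite gx.
      by apply: cvg_trans (cc x); apply: near_eq_cvg; exact: E.
    have {}xn : n%:R < `|x|.
      rewrite lt_neqAle xn andbT; apply/negP => /eqP h.
      by move: (esym h) => /eqP; rewrite eqr_norml (negbTE xn1) (negbTE xn2).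
    have E : \forall y \near x, 0 = g y.
      have : \forall y \near x, n%:R < `|y|.
        by have /cvgr_gt := @ctabs R x; apply.
      by apply: filterS => y yn; rewrite /g trE leNgt yn.
    have gx : g x = 0 by rewrite /g trE leNgt xn.
    change (g @ x --> g x); rewrite gx.
    have c0 : (fun _ : R => (0 : R)) @ x --> (0 : R) by exact: cvg_cst.
    by apply: cvg_trans c0; apply: near_eq_cvg; exact: E.
- exact: supp_tr.
have h2 : (sq (fun x => f' x - g x)%R <= (e / 4)%:E)%E.
  apply: (@le_trans _ _ (\int[mu]_(x in box n) ((2 * k)%:E * `|(f' x - g_ j0 x)%:E|))%E).
    rewrite integral_mkcond; apply: ge0_le_integral => //.
    - by move=> x _; rewrite lee_fin sqr_ge0.
    - by apply: measurable_sq; exact: measurable_funB.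
    - apply/(measurable_restrictT _ (measurable_box n)); apply: measurable_funTS.
      apply: measurable_funeM; apply: measurableT_comp => //.
      by apply/measurable_EFinP; exact: measurable_funB.
    move=> x _; rewrite patchE box_norm /g trE; case: ifPn => nx; last first.
      by rewrite sf' ?subrr ?expr0n // ltNge.
    rewrite -EFinM lee_fin -(real_normK (num_real _)) expr2.
    have L : `|f' x - clamp k (g_ j0 x)| <= `|f' x - g_ j0 x|.
      by rewrite -{1}(clamp_id (f'k x)); exact: clamp_lip.
    apply: ler_pM => //; apply: le_trans (ler_normB _ _) _.
    by rewrite mulr_natl mulr2n lerD // clamp_le.
  rewrite ge0_integralZl ?lee_fin ?mulr_ge0 //; last 2 first.
    exact: measurable_box.
    apply: measurable_funTS; apply: measurableT_comp => //.
    by apply/measurable_EFinP; exact: measurable_funB.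
  apply: (@le_trans _ _ ((2 * k)%:E * (e / (8 * (k + 1)))%:E)%E).
    by apply: lee_wpmul2l => //; rewrite lee_fin mulr_ge0.
  rewrite -EFinM lee_fin mulrA ler_pdivrMr ?mulr_gt0 ?ltr_wpDl //.
  have ek : 0 <= e * k by rewrite mulr_ge0 // ltW.
  nra.
have -> : sq (fun x => f x - g x) = sq (fun x => (f x - f' x) + (f' x - g x)).
  by apply: eq_sq => x; rewrite addrA subrK.
apply: le_trans (sq_add2 _ _) _; try exact: measurable_funB.
rewrite sqBC in hk.
apply: (@le_trans _ _ (2%:E * (e / 4)%:E + 2%:E * (e / 4)%:E)%E).
  by apply: leeD; apply: lee_wpmul2l.
by rewrite -!EFinM -EFinD lee_fin; lra.
Qed.

End truncation.

(** * The Hartley transform on L2 *)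

Section hartley_L2.
Context {R : realType}.
Notation mu := (@lebesgue_measure R).
Implicit Types (f g h k : R -> R).
Local Notation kappa := (@kappa R).

Lemma nrm_le f (e : R) : 0 <= e -> (sq f <= (e ^+ 2)%:E)%E -> nrm f <= e.
Proof.
move=> e0 h.
have sf : sq f \is a fin_num by rewrite (ge0_fin_numE (sq_ge0 f)) (le_lt_trans h) // ltry.
by rewrite /nrm -(ger0_norm e0) -sqrtr_sqr ler_wsqrtr // -lee_fin (fineK sf).
Qed.

Lemma sq_cvg0P (u : nat -> R -> R) : sq (u n) @[n --> \oo] --> 0%E <->
  forall e : R, 0 < e -> \forall n \near \oo, (sq (u n) <= e%:E)%E.
Proof. by apply: (@ecvg0P _ _ _ _ (fun n => sq (u n))) => n; exact: sq_ge0. Qed.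

Lemma nrm_cvg0 (u : nat -> R -> R) : sq (u n) @[n --> \oo] --> 0%E ->
  nrm (u n) @[n --> \oo] --> 0.
Proof.
move=> /sq_cvg0P H; apply/cvgr0Pnorm_le => e e0.
have e2 : 0 < e ^+ 2 by rewrite exprn_gt0.
have := H _ e2; apply: filterS => n un /=.
by rewrite (ger0_norm (nrm_ge0 _)); exact: nrm_le (ltW e0) un.
Qed.

Lemma sq_cvg_add (u v : nat -> R -> R) : (forall n, measurable_fun setT (u n)) ->
  (forall n, measurable_fun setT (v n)) -> sq (u n) @[n --> \oo] --> 0%E ->
  sq (v n) @[n --> \oo] --> 0%E -> sq (fun x => u n x + v n x) @[n --> \oo] --> 0%E.
Proof.
move=> mu_ mv /sq_cvg0P cu /sq_cvg0P cv.
apply/(@sq_cvg0P (fun n x => u n x + v n x)) => e e0.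
have e4 : 0 < e / 4 by rewrite divr_gt0.
apply: filterS2 (cu _ e4) (cv _ e4) => n un vn.
apply: le_trans (sq_add2 (mu_ n) (mv n)) _.
apply: (@le_trans _ _ (2%:E * (e / 4)%:E + 2%:E * (e / 4)%:E)%E).
  by apply: leeD; apply: lee_wpmul2l.
by rewrite -!EFinM -EFinD lee_fin; lra.
Qed.

Lemma sq_cvgN (u : nat -> R -> R) : sq (u n) @[n --> \oo] --> 0%E ->
  sq (fun x => - u n x) @[n --> \oo] --> 0%E.
Proof.
have -> : (fun n => sq (fun x => - u n x)) = fun n => sq (u n).
  by apply/funext => n; exact: sqN.
by [].
Qed.

Lemma sq_cvgZ a (u : nat -> R -> R) : (forall n, measurable_fun setT (u n)) ->
  sq (u n) @[n --> \oo] --> 0%E -> sq (fun x => a * u n x) @[n --> \oo] --> 0%E.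
Proof.
move=> mu_ /sq_cvg0P cu; apply/(@sq_cvg0P (fun n x => a * u n x)) => e e0.
have a1 : 0 < a ^+ 2 + 1 by rewrite ltr_wpDl ?sqr_ge0.
have e4 : 0 < e / (a ^+ 2 + 1) by rewrite divr_gt0.
apply: filterS (cu _ e4) => n un; rewrite sqZ //.
apply: (@le_trans _ _ ((a ^+ 2)%:E * (e / (a ^+ 2 + 1))%:E)%E).
  by apply: lee_wpmul2l => //; rewrite lee_fin sqr_ge0.
rewrite -EFinM lee_fin mulrA ler_pdivrMr // mulrC ler_wpM2l ?(ltW e0) //.
by rewrite lerDl.
Qed.

(** Limits in [L2] are unique almost everywhere. *)
Lemma sq_cvg_unique (u : nat -> R -> R) f g : (forall n, measurable_fun setT (u n)) ->
  measurable_fun setT f -> measurable_fun setT g ->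
  sq (fun x => u n x - f x) @[n --> \oo] --> 0%E ->
  sq (fun x => u n x - g x) @[n --> \oo] --> 0%E ->
  {ae mu, forall x, f x = g x}.
Proof.
move=> mu_ mf mg cf cg.
have mB h n : measurable_fun setT h -> measurable_fun setT (fun x => u n x - h x).
  by move=> mh; exact: measurable_funB.
have := sq_cvg_add (fun n => mB _ n mg) (fun n => measurableT_comp (@oppr_measurable R setT) (mB _ n mf)) cg (sq_cvgN cf).
have -> : (fun n => sq (fun x => u n x - g x + - (u n x - f x))) = fun=> sq (fun x => f x - g x).
  by apply/funext => n; apply: eq_sq => x; ring.
move=> /(cvg_unique _ (cvg_cst _)) => /(_ (@ereal_hausdorff R)) H.
have : sq (fun x => f x - g x) = 0%E by [].
move=> /sq_eq0 => /(_ (measurable_funB mf mg)); apply: filterS => x /eqP.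
by rewrite subr_eq0 => /eqP.
Qed.

Theorem plancherel_supp n f : L2 f -> supp_in n%:R f ->
  L2 (H1 f) /\ sq (H1 f) = (kappa%:E * sq f)%E.
Proof.
move=> lf sf; have l1 := supp_L1 lf sf; have [mf _] := lf.
have dense (i : nat) := nice_dense lf sf (@harmonic_gt0 R i).
have [g Hg] := @choice _ _ (fun (i : nat) g => [/\ nice g, supp_in n%:R g &
  (sq (fun x => f x - g x)%R <= (harmonic i)%:E)%E]) dense.
have ng i : nice (g i) by case: (Hg i).
have sg i : supp_in n%:R (g i) by case: (Hg i).
have lg i := nice_L2 (ng i).
have mg i : measurable_fun setT (g i) by case: (lg i).
have cg : sq (fun x => g i x - f x) @[i --> \oo] --> 0%E.
  apply/(@sq_cvg0P (fun i x => g i x - f x)) => e e0.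
  have /cvgr0_norm_le/(_ _ e0) := @cvg_harmonic R.
  apply: filterS => i /= hi; rewrite sqBC; have [_ _ h] := Hg i.
  by apply: le_trans h _; rewrite lee_fin; apply: le_trans (ler_norm _) hi.
have mH := measurable_H1 l1.
have mHg i : measurable_fun setT (H1 (g i)) by apply: measurable_H1; exact: nice_L1.
have HB i j : sq (fun x => H1 (g i) x - H1 (g j) x) = (kappa%:E * sq (fun x => g i x - g j x)%R)%E.
  rewrite -plancherel_nice; last exact: niceB.
  by apply: eq_sq => xi; rewrite H1B //; exact: nice_L1.
have lHg i : L2 (H1 (g i)).
  split => //; rewrite plancherel_nice //; have [_ h] := lg i.
  by apply: lte_mul_pinfty => //; rewrite lee_fin kappa_ge0.
(* on a fixed box, L2 convergence gives uniform convergence of the transforms *)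
have cH xi : H1 (g i) xi @[i --> \oo] --> H1 f xi.
  have lc : L2 (fun x => \1_(box n) x * cas (x * xi)).
    apply: (L2_le _ _ (L2Z 2 (@L2_indic R n))).
      apply: measurable_funM; first by case: (@L2_indic R n).
      exact: measurable_casM.
    by move=> x; rewrite !normrM (ger0_norm (_ : 0 <= 2)) // mulrC ler_wpM2r // cas_le2.
  set c := nrm (fun x => \1_(box n) x * cas (x * xi)).
  have b i : `|H1 (g i) xi - H1 f xi| <= nrm (fun x => g i x - f x) * c.
    rewrite -H1B //; last exact: nice_L1.
    have -> : H1 (fun x => g i x - f x) xi =
       \int[mu]_x ((g i x - f x) * (\1_(box n) x * cas (x * xi))).
      apply: eq_Rintegral => x _; rewrite mulrA; congr (_ * _).
      rewrite -/(tr n (fun x => g i x - f x) x) trE; case: ifPn => //.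
      by rewrite -ltNge => nx; rewrite (sg i) // sf // subrr.
    by apply: L2_integral_bound => //; exact: L2B.
  have c0 : nrm (fun x => g i x - f x) * c @[i --> \oo] --> 0.
    by rewrite -(mul0r c); apply: cvgM; [exact: nrm_cvg0|exact: cvg_cst].
  apply/cvgrPdist_le => e e0; have /cvgr0_norm_le/(_ _ e0) := c0.
  apply: filterS => i hi; rewrite distrC; apply: le_trans (b i) _.
  by apply: le_trans (ler_norm _) hi.
have cHg : sq (fun x => H1 (g i) x - H1 f x) @[i --> \oo] --> 0%E.
  apply/(@sq_cvg0P (fun i x => H1 (g i) x - H1 f x)) => e e0.
  have k1 : 0 < 4 * (kappa + 1) by rewrite mulr_gt0 // ltr_wpDl ?kappa_ge0.
  have d0 : 0 < e / (4 * (kappa + 1)) by rewrite divr_gt0.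
  have /(@sq_cvg0P (fun i x => g i x - f x))/(_ _ d0) [N _ HN] := cg.
  exists N => // i /= Ni.
  apply: (@sq_fatou R (fun j x => H1 (g i) x - H1 (g j) x)).
  - by move=> j; exact: measurable_funB.
  - exact: measurable_funB.
  - by apply: aeW => xi; apply: cvgB; [exact: cvg_cst|exact: cH].
  - exists N => // j /= Nj; rewrite HB.
    have -> : sq (fun x => g i x - g j x) = sq (fun x => (g i x - f x) + - (g j x - f x)).
      by apply: eq_sq => x; ring.
    apply: (@le_trans _ _ (kappa%:E * (2%:E * (e / (4 * (kappa + 1)))%:E + 2%:E * (e / (4 * (kappa + 1)))%:E))%E).
      apply: lee_wpmul2l; first by rewrite lee_fin kappa_ge0.
      apply: le_trans (sq_add2 _ _) _; try exact: measurable_funB.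
        by apply: measurableT_comp => //; exact: measurable_funB.
      rewrite sqN; apply: leeD; apply: lee_wpmul2l => //; exact: HN.
    have E0 (r : R) : (kappa%:E * (2%:E * r%:E + 2%:E * r%:E) = (kappa * (2 * r + 2 * r))%:E)%E by [].
    rewrite E0 lee_fin.
    rewrite (_ : kappa * _ = kappa * e / (kappa + 1)); last first.
      by field; rewrite lt0r_neq0 // ltr_wpDl ?kappa_ge0.
    rewrite ler_pdivrMr ?ltr_wpDl ?kappa_ge0 //.
    by rewrite mulrC ler_wpM2l ?(ltW e0) // lerDl.
have lH : L2 (H1 f).
  have /(@sq_cvg0P (fun i x => H1 (g i) x - H1 f x))/(_ _ ltr01) [N _ /(_ N (leqnn _)) /= hN] := cHg.
  have lN : L2 (fun x => H1 (g N) x - H1 f x).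
    by split; [exact: measurable_funB|exact: le_lt_trans hN (ltry _)].
  rewrite (_ : H1 f = fun x => H1 (g N) x - (H1 (g N) x - H1 f x)); first exact: L2B.
  by apply/funext => x; rewrite opprB addrC subrK.
split => //.
have c1 := sq_cvg lHg lH cHg.
have c2 : sq (H1 (g i)) @[i --> \oo] --> (kappa%:E * sq f)%E.
  under eq_fun do rewrite plancherel_nice //.
  by apply: cvgeZl => //; exact: sq_cvg.
by apply: (cvg_unique _ c1 c2).
Qed.

(** The Hartley transform on [L2], as a limit in mean. *)
Definition is_hart f h : Prop :=
  [/\ L2 f, L2 h & sq (fun xi => H1 (tr n f) xi - h xi) @[n --> \oo] --> 0%E].

Lemma tr_L1 n f : L2 f -> L1 (tr n f).
Proof. by move=> lf; apply: (supp_L1 (L2_tr n lf)); exact: supp_tr. Qed.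

Lemma L2_H1_tr n f : L2 f -> L2 (H1 (tr n f)).
Proof. by move=> lf; case: (plancherel_supp (L2_tr n lf) (@supp_tr _ n f)). Qed.

Lemma sq_H1_tr n f : L2 f -> sq (H1 (tr n f)) = (kappa%:E * sq (tr n f))%E.
Proof. by move=> lf; case: (plancherel_supp (L2_tr n lf) (@supp_tr _ n f)). Qed.

Lemma measurable_H1_tr n f : L2 f -> measurable_fun setT (H1 (tr n f)).
Proof. by move=> /(L2_H1_tr n) []. Qed.

Lemma hart_L2l f h : is_hart f h -> L2 f. Proof. by case. Qed.
Lemma hart_L2r f h : is_hart f h -> L2 h. Proof. by case. Qed.

Theorem plancherel f h : is_hart f h -> sq h = (kappa%:E * sq f)%E.
Proof.
move=> [lf lh ch].
have c1 := sq_cvg (fun n => L2_H1_tr n lf) lh ch.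
have c2 : sq (H1 (tr n f)) @[n --> \oo] --> (kappa%:E * sq f)%E.
  under eq_fun do rewrite sq_H1_tr //.
  by apply: cvgeZl => //; apply: sq_cvg => //; [move=> n; exact: L2_tr|exact: sq_cvg_tr].
by apply: (cvg_unique _ c1 c2).
Qed.

Lemma hart_exists f : L2 f -> exists h, is_hart f h.
Proof.
move=> lf; have [mf _] := lf.
have /(@sq_cvg0P (fun n x => tr n f x - f x)) c := sq_cvg_tr lf.
have [||h [phi [lh ch _ _]]] := @riesz_fischer R (fun n => H1 (tr n f)).
- by move=> n; exact: L2_H1_tr.
- move=> e e0.
  have k1 : 0 < 4 * (kappa + 1) by rewrite mulr_gt0 // ltr_wpDl ?kappa_ge0.
  have d0 : 0 < e / (4 * (kappa + 1)) by rewrite divr_gt0.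
  have [N _ HN] := c _ d0; exists N => m n Nm Nn.
  pose u x := tr m f x - tr n f x.
  have lu : L2 u by apply: L2B; exact: L2_tr.
  have su : supp_in (maxn m n)%:R u.
    move=> x; rewrite natr_max gt_max => /andP[h1 h2].
    by rewrite /u (@supp_tr _ m) // (@supp_tr _ n) // subrr.
  have -> : sq (fun xi => H1 (tr m f) xi - H1 (tr n f) xi) = sq (H1 u).
    by apply: eq_sq => xi; rewrite H1B //; exact: tr_L1.
  have [_ ->] := plancherel_supp lu su.
  have -> : sq u = sq (fun x => (tr m f x - f x) + - (tr n f x - f x)).
    by apply: eq_sq => x; rewrite /u; ring.
  have mt i : measurable_fun setT (fun x => tr i f x - f x).
    by apply: measurable_funB => //; exact: measurable_tr.
  apply: (@le_trans _ _ (kappa%:E * (2%:E * (e / (4 * (kappa + 1)))%:E + 2%:E * (e / (4 * (kappa + 1)))%:E))%E).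
    apply: lee_wpmul2l; first by rewrite lee_fin kappa_ge0.
    apply: le_trans (sq_add2 (mt m) (measurableT_comp (@oppr_measurable R setT) (mt n))) _.
    by rewrite sqN; apply: leeD; apply: lee_wpmul2l => //; exact: HN.
  have E0 (r : R) : (kappa%:E * (2%:E * r%:E + 2%:E * r%:E) = (kappa * (2 * r + 2 * r))%:E)%E by [].
    rewrite E0 lee_fin.
  rewrite (_ : kappa * _ = kappa * e / (kappa + 1)); last first.
    by field; rewrite lt0r_neq0 // ltr_wpDl ?kappa_ge0.
  rewrite ler_pdivrMr ?ltr_wpDl ?kappa_ge0 //.
  by rewrite mulrC ler_wpM2l ?(ltW e0) // lerDl.
by exists h.
Qed.

Lemma hart_ae f h k : is_hart f h -> measurable_fun setT k ->
  {ae mu, forall x, h x = k x} -> is_hart f k.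
Proof.
move=> [lf lh ch] mk hk; split => //; first exact: L2_ae hk.
suff E : (fun n => sq (fun xi => H1 (tr n f) xi - k xi)) = fun n => sq (fun xi => H1 (tr n f) xi - h xi).
  by rewrite E.
apply/funext => n; have [mh _] := lh; have m := measurable_H1_tr n lf.
by apply: ae_eq_sq; [exact: measurable_funB|exact: measurable_funB|apply: filterS hk => x ->].
Qed.

Lemma hart_ael f g h : is_hart f h -> measurable_fun setT g ->
  {ae mu, forall x, f x = g x} -> is_hart g h.
Proof.
move=> [lf lh ch] mg fg; split; [exact: L2_ae lf mg fg|exact: lh|].
suff E : (fun n => sq (fun xi => H1 (tr n g) xi - h xi)) = fun n => sq (fun xi => H1 (tr n f) xi - h xi).
  by rewrite E.
apply/funext => n; apply: eq_sq => xi; congr (_ - _); have [mf _] := lf.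
apply: Rint_ae_eq.
- by apply: measurable_funM; [exact: measurable_tr|exact: measurable_casM].
- by apply: measurable_funM; [exact: measurable_tr|exact: measurable_casM].
- by apply: filterS fg => x; rewrite /tr => ->.
Qed.

Lemma hartD f g h k : is_hart f h -> is_hart g k ->
  is_hart (fun x => f x + g x) (fun x => h x + k x).
Proof.
move=> [lf lh ch] [lg lk ck]; split; [exact: L2D|exact: L2D|].
have [mh _] := lh; have [mk _] := lk.
pose u n xi := H1 (tr n f) xi - h xi; pose v n xi := H1 (tr n g) xi - k xi.
have muu n : measurable_fun setT (u n) by apply: measurable_funB => //; exact: measurable_H1_tr.
have mv n : measurable_fun setT (v n) by apply: measurable_funB => //; exact: measurable_H1_tr.
suff E : (fun n => sq (fun xi => H1 (tr n (fun x => f x + g x)) xi - (h xi + k xi))) =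
    fun n => sq (fun xi => u n xi + v n xi) by rewrite E; exact: sq_cvg_add.
apply/funext => n; apply: eq_sq => xi; rewrite /u /v.
have -> : H1 (tr n (fun x => f x + g x)) xi = H1 (tr n f) xi + H1 (tr n g) xi.
  rewrite /H1 -RintegralD //; try by apply: L1_cas; exact: tr_L1.
  by apply: eq_Rintegral => x _; rewrite /tr; ring.
ring.
Qed.

Lemma hartZ a f h : is_hart f h -> is_hart (fun x => a * f x) (fun x => a * h x).
Proof.
move=> [lf lh ch]; split; [exact: L2Z|exact: L2Z|].
have [mh _] := lh.
pose u n xi := H1 (tr n f) xi - h xi.
have muu n : measurable_fun setT (u n) by apply: measurable_funB => //; exact: measurable_H1_tr.
suff E : (fun n => sq (fun xi => H1 (tr n (fun x => a * f x)) xi - a * h xi)) =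
    fun n => sq (fun xi => a * u n xi) by rewrite E; exact: sq_cvgZ.
apply/funext => n; apply: eq_sq => xi; rewrite /u.
have -> : H1 (tr n (fun x => a * f x)) xi = a * H1 (tr n f) xi.
  rewrite /H1 -RintegralZl //; last by apply: L1_cas; exact: tr_L1.
  by apply: eq_Rintegral => x _; rewrite /tr; ring.
ring.
Qed.

Lemma hartN f h : is_hart f h -> is_hart (fun x => - f x) (fun x => - h x).
Proof.
move=> /(hartZ (-1)).
by under eq_fun do rewrite mulN1r; under [X in is_hart _ X]eq_fun do rewrite mulN1r.
Qed.

Lemma hartB f g h k : is_hart f h -> is_hart g k ->
  is_hart (fun x => f x - g x) (fun x => h x - k x).
Proof. by move=> hf hg; apply: hartD => //; exact: hartN. Qed.

Lemma hart_closed (f_ h_ : nat -> R -> R) f h : (forall n, is_hart (f_ n) (h_ n)) ->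
  L2 f -> L2 h -> sq (fun x => f_ n x - f x) @[n --> \oo] --> 0%E ->
  sq (fun x => h_ n x - h x) @[n --> \oo] --> 0%E -> is_hart f h.
Proof.
move=> fh lf lh cf ch; have [k hk] := hart_exists lf.
have [mk _] := hart_L2r hk; have [mh _] := lh.
have ck : sq (fun x => h_ n x - k x) @[n --> \oo] --> 0%E.
  under eq_fun do rewrite (plancherel (hartB (fh _) hk)).
  rewrite -(mule0 kappa%:E); exact: cvgeZl.
apply: hart_ae hk mh _.
have mh_ n : measurable_fun setT (h_ n) by case: (hart_L2r (fh n)).
exact: (sq_cvg_unique mh_ mk (proj1 lh) ck ch).
Qed.

Lemma cvg_H1_tr f xi : L1 f -> H1 (tr n f) xi @[n --> \oo] --> H1 f xi.
Proof.
move=> lf; have mf := L1_meas lf.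
apply: (Rint_dct (g := fun x => 2 * `|f x|)).
- by move=> n; apply: measurable_funM; [exact: measurable_tr|exact: measurable_casM].
- by apply: measurable_funM => //; exact: measurable_casM.
- by apply: aeW => x; apply: cvgM; [exact: cvg_tr|exact: cvg_cst].
- by apply: L1Z; exact: L1_abs.
- by move=> n x; rewrite normrM mulrC ler_pM // ?cas_le2 // tr_le.
Qed.

Lemma hart_L1 f : L1 f -> L2 f -> is_hart f (H1 f).
Proof.
move=> l1 lf; have [h hh] := hart_exists lf; have [_ [mh _] ch] := hh.
have mH := measurable_H1 l1.
apply: (hart_ae hh mH).
have s0 : sq (fun x => H1 f x - h x) = 0%E.
  apply/eqP; rewrite eq_le sq_ge0 andbT; apply/lee_addgt0Pr => e e0; rewrite add0e.
  apply: (@sq_fatou R (fun n x => H1 (tr n f) x - h x)).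
  - by move=> n; apply: measurable_funB => //; exact: measurable_H1_tr.
  - exact: measurable_funB.
  - by apply: aeW => x; apply: cvgB; [exact: cvg_H1_tr|exact: cvg_cst].
  - by have /(@sq_cvg0P (fun n x => H1 (tr n f) x - h x)) := ch; apply.
have := sq_eq0 (measurable_funB mH mh) s0; apply: filterS => x /eqP.
by rewrite subr_eq0 => /eqP ->.
Qed.

Lemma parseval f g h k : is_hart f h -> is_hart g k ->
  \int[mu]_x (h x * k x) = kappa * \int[mu]_x (f x * g x).
Proof.
move=> hf hg; have P u v : is_hart u v -> \int[mu]_x (v x ^+ 2) = kappa * \int[mu]_x (u x ^+ 2).
  move=> uv; have := plancherel uv; rewrite !sq_Rint; [|exact: hart_L2l uv|exact: hart_L2r uv].
  by rewrite -EFinM => -[].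
have E u v : L2 u -> L2 v -> \int[mu]_x ((u x + v x) ^+ 2) =
    \int[mu]_x (u x ^+ 2) + 2 * \int[mu]_x (u x * v x) + \int[mu]_x (v x ^+ 2).
  move=> lu lv; have i1 := sq_integrable lu; have i2 := sq_integrable lv.
  have i3 := L2_mul_integrable lu lv.
  rewrite -RintegralZl // -RintegralD //; last exact: L1Z.
  rewrite -RintegralD //; last by apply: L1D => //; exact: L1Z.
  by apply: eq_Rintegral => x _; ring.
have := P _ _ (hartD hf hg).
rewrite !E; try by [exact: hart_L2l hf|exact: hart_L2l hg|exact: hart_L2r hf|exact: hart_L2r hg].
rewrite (P _ _ hf) (P _ _ hg); lra.
Qed.

End hartley_L2.

(** * From the Hartley to the Fourier transform *)

Section fourier_hartley.
Context {R : realType}.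
Notation mu := (@lebesgue_measure R).
Implicit Types (f g h k : R -> R).

Lemma sqrt_le_iff (x : \bar R) (e : R) : 0 <= e -> (0 <= x)%E ->
  (x `^ 2^-1 <= e%:E)%E = (x <= (e ^+ 2)%:E)%E.
Proof.
move=> e0; case: x => [r| |] // r0.
  rewrite poweR_EFin !lee_fin powR12_sqrt // -(ler_pXn2r (_ : 0 < 2)%N) ?nnegrE ?sqrtr_ge0 //.
  by rewrite sqr_sqrtr.
by rewrite poweRyr ?leye_eq // invr_eq0.
Qed.

Lemma Lnorm_cvg0 (u : nat -> R -> R) :
  'N[mu]_2%:E[EFin \o u n]%E @[n --> \oo] --> 0%E <-> sq (u n) @[n --> \oo] --> 0%E.
Proof.
under eq_fun do rewrite Lnorm2E.
split.
  move=> /(@ecvg0P _ _ _ _ (fun n => sq (u n) `^ 2^-1)%E (fun n => poweR_ge0 _ _)) H.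
  apply/(@sq_cvg0P R u) => e e0.
  have se : 0 < Num.sqrt e by rewrite sqrtr_gt0.
  have := H _ se; apply: filterS => n; rewrite sqrt_le_iff // ?sqr_sqrtr //; exact: ltW.
move=> /(@sq_cvg0P R u) H.
apply/(@ecvg0P _ _ _ _ (fun n => sq (u n) `^ 2^-1)%E (fun n => poweR_ge0 _ _)) => e e0.
have e2 : 0 < e ^+ 2 by rewrite exprn_gt0.
by have := H _ e2; apply: filterS => n; rewrite sqrt_le_iff // ltW.
Qed.

Lemma cos_transformE n f xi : L2 f ->
  cos_transform_on n f xi = (H1 (tr n f) xi + H1 (tr n f) (- xi)) / 2.
Proof.
move=> lf; have lt := tr_L1 n lf.
have E : H1 (tr n f) xi + H1 (tr n f) (- xi) = 2 * \int[mu]_x (tr n f x * cos (xi * x)).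
  have l : L1 (fun x => tr n f x * cos (xi * x)).
    by apply: (L1_bdd lt) (measurable_cosM xi) (fun x => cos_max _).
  rewrite /H1 -RintegralD //; try exact: L1_cas.
  rewrite -RintegralZl //; apply: eq_Rintegral => x _.
  by rewrite /cas mulrN cosN sinN (mulrC xi); ring.
rewrite E mulrAC divff // mul1r /cos_transform_on Rintegral_mkcond.
apply: eq_Rintegral => x _; rewrite patchE trE (mulrC xi).
by have := @box_norm R n x; rewrite /box => ->; case: ifP; rewrite ?mul0r.
Qed.

Lemma sin_transformE n f xi : L2 f ->
  sin_transform_on n f xi = (H1 (tr n f) xi - H1 (tr n f) (- xi)) / 2.
Proof.
move=> lf; have lt := tr_L1 n lf.
have E : H1 (tr n f) xi - H1 (tr n f) (- xi) = 2 * \int[mu]_x (tr n f x * sin (xi * x)).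
  have l : L1 (fun x => tr n f x * sin (xi * x)).
    by apply: (L1_bdd lt) (measurable_sinM xi) (fun x => sin_max _).
  rewrite /H1 -RintegralB //; try exact: L1_cas.
  rewrite -RintegralZl //; apply: eq_Rintegral => x _.
  by rewrite /cas mulrN cosN sinN (mulrC xi); ring.
rewrite E mulrAC divff // mul1r /sin_transform_on Rintegral_mkcond.
apply: eq_Rintegral => x _; rewrite patchE trE (mulrC xi).
by have := @box_norm R n x; rewrite /box => ->; case: ifP; rewrite ?mul0r.
Qed.

Let evn h x : R := (h x + h (- x)) / 2.
Let odd h x : R := (h x - h (- x)) / 2.

Let sq_evn h : measurable_fun setT h -> (sq (evn h) <= sq h)%E.
Proof.
move=> mh; have mr := measurable_reflect mh.
have -> : sq (evn h) = sq (fun x => 2^-1 * (h x + h (- x))).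
  by apply: eq_sq => x; rewrite /evn mulrC.
rewrite sqZ; last exact: measurable_funD.
apply: (@le_trans _ _ ((2^-1 ^+ 2)%:E * (2%:E * sq h + 2%:E * sq h))%E).
  apply: lee_wpmul2l; first by rewrite lee_fin sqr_ge0.
  by have := sq_add2 mh mr; rewrite (sq_reflect mh).
rewrite -ge0_muleDl // -EFinD muleA -EFinM (_ : 2^-1 ^+ 2 * (2 + 2) = 1) ?mul1e //.
by field.
Qed.

Let sq_odd h : measurable_fun setT h -> (sq (odd h) <= sq h)%E.
Proof.
move=> mh; have mr := measurable_reflect mh.
have -> : sq (odd h) = sq (fun x => 2^-1 * (h x - h (- x))).
  by apply: eq_sq => x; rewrite /odd mulrC.
rewrite sqZ; last exact: measurable_funB.
apply: (@le_trans _ _ ((2^-1 ^+ 2)%:E * (2%:E * sq h + 2%:E * sq h))%E).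
  apply: lee_wpmul2l; first by rewrite lee_fin sqr_ge0.
  by have := sq_sub2 mh mr; rewrite (sq_reflect mh).
rewrite -ge0_muleDl // -EFinD muleA -EFinM (_ : 2^-1 ^+ 2 * (2 + 2) = 1) ?mul1e //.
by field.
Qed.

Lemma hart_fourier f h : is_hart f h -> is_fourier f (evn h, odd h).
Proof.
move=> [lf lh ch]; have [mh hh] := lh; have mr := measurable_reflect mh.
have me : measurable_fun setT (evn h).
  by apply: measurable_funM => //; exact: measurable_funD.
have mo : measurable_fun setT (odd h).
  by apply: measurable_funM => //; exact: measurable_funB.
have md n : measurable_fun setT (fun xi => H1 (tr n f) xi - h xi).
  by apply: measurable_funB => //; exact: measurable_H1_tr.
split => /=.
- exact/L2P.
- by apply/L2P; split => //; apply: le_lt_trans (sq_evn mh) hh.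
- by apply/L2P; split => //; apply: le_lt_trans (sq_odd mh) hh.
- apply/(@Lnorm_cvg0 (fun n xi => cos_transform_on n f xi - evn h xi)).
  apply/(@sq_cvg0P R (fun n xi => cos_transform_on n f xi - evn h xi)) => e e0.
  have /(@sq_cvg0P R (fun n xi => H1 (tr n f) xi - h xi))/(_ _ e0) := ch.
  apply: filterS => n hn; apply: le_trans hn; apply: le_trans (sq_evn (md n)).
  rewrite le_eqVlt; apply/orP; left; apply/eqP; apply: eq_sq => xi.
  by rewrite cos_transformE // /evn; field.
- apply/(@Lnorm_cvg0 (fun n xi => sin_transform_on n f xi - odd h xi)).
  apply/(@sq_cvg0P R (fun n xi => sin_transform_on n f xi - odd h xi)) => e e0.
  have /(@sq_cvg0P R (fun n xi => H1 (tr n f) xi - h xi))/(_ _ e0) := ch.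
  apply: filterS => n hn; apply: le_trans hn; apply: le_trans (sq_odd (md n)).
  rewrite le_eqVlt; apply/orP; left; apply/eqP; apply: eq_sq => xi.
  by rewrite sin_transformE // /odd; field.
Qed.

(** Conversely, the two components of a Fourier transform are a.e. the even and
    the odd part of the Hartley transform. *)
Lemma fourier_hart f h (g : (R -> R) * (R -> R)) : is_hart f h -> is_fourier f g ->
  {ae mu, forall x, g.1 x = evn h x} /\ {ae mu, forall x, g.2 x = odd h x}.
Proof.
move=> hh [/L2P lf /L2P l1 /L2P l2 c1 c2]; have [_ _ _ e1 e2] := hart_fourier hh.
have [mh _] := hart_L2r hh; have mr := measurable_reflect mh.
have mH n := measurable_H1_tr n lf.
have mHr n := measurable_reflect (mH n).
have mc n : measurable_fun setT (cos_transform_on n f).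
  rewrite (_ : cos_transform_on n f = evn (H1 (tr n f))).
    by apply: measurable_funM => //; exact: measurable_funD.
  by apply/funext => xi; rewrite cos_transformE.
have ms n : measurable_fun setT (sin_transform_on n f).
  rewrite (_ : sin_transform_on n f = odd (H1 (tr n f))).
    by apply: measurable_funM => //; exact: measurable_funB.
  by apply/funext => xi; rewrite sin_transformE.
split.
  apply: (sq_cvg_unique mc (proj1 l1) _ _ _).
  - by apply: measurable_funM => //; exact: measurable_funD.
  - exact/(@Lnorm_cvg0 (fun n xi => cos_transform_on n f xi - g.1 xi)).
  - exact/(@Lnorm_cvg0 (fun n xi => cos_transform_on n f xi - evn h xi)).
apply: (sq_cvg_unique ms (proj1 l2) _ _ _).
- by apply: measurable_funM => //; exact: measurable_funB.
- exact/(@Lnorm_cvg0 (fun n xi => sin_transform_on n f xi - g.2 xi)).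
- exact/(@Lnorm_cvg0 (fun n xi => sin_transform_on n f xi - odd h xi)).
Qed.

Definition wgt (s : R) h (xi : R) : R := jb s xi * h xi.

Lemma measurable_wgt s h : measurable_fun setT h -> measurable_fun setT (wgt s h).
Proof. by move=> mh; apply: measurable_funM => //; exact: measurable_jb. Qed.

Lemma Hs_normE s f h : is_hart f h -> Hs_norm s f = (sq (wgt s h) `^ 2^-1)%E.
Proof.
move=> hh; have [mh _] := hart_L2r hh; have mr := measurable_reflect mh.
have mw := measurable_wgt s mh; have mwr := measurable_reflect mw.
rewrite /Hs_norm (_ : [set _ | _ in _] = [set (sq (wgt s h) `^ 2^-1)%E]) ?ereal_inf1 //.
have K (g : (R -> R) * (R -> R)) : is_fourier f g -> (\int[lebesgue_measure]_xi
      ((1 + xi ^+ 2) `^ s * (g.1 xi ^+ 2 + g.2 xi ^+ 2))%R%:E)%E = sq (wgt s h).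
  move=> fg; have [_ /L2P[m1 _] /L2P[m2 _] _ _] := fg; have [h1 h2] := fourier_hart hh fg.
  have mW : measurable_fun setT (fun xi : R => (1 + xi ^+ 2) `^ s).
    rewrite (_ : (fun xi : R => (1 + xi ^+ 2) `^ s) = fun xi => jb s xi ^+ 2).
      by apply: measurable_funX; exact: measurable_jb.
    by apply/funext => xi; rewrite jb_sqr.
  transitivity (\int[mu]_xi ((2^-1)%:E * ((wgt s h xi ^+ 2)%:E + (wgt s h (- xi) ^+ 2)%:E)))%E.
    apply: ge0_ae_eq_integral => //.
    - apply/measurable_EFinP; apply: measurable_funM => //.
      by apply: measurable_funD; exact: measurable_funX.
    - apply: measurable_funeM; apply: emeasurable_funD; exact: measurable_sq.
    - by move=> x _; rewrite lee_fin mulr_ge0 ?powR_ge0 ?addr_ge0 ?sqr_ge0.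
    - by move=> x _; rewrite -EFinD -EFinM lee_fin mulr_ge0 ?addr_ge0 ?sqr_ge0.
    apply: filterS2 h1 h2 => x -> -> _; rewrite -EFinD -EFinM; congr EFin.
    by rewrite /wgt jbN /evn /odd -jb_sqr; field.
  rewrite ge0_integralZl_EFin //; last 2 first.
  - by move=> x _; rewrite -EFinD lee_fin addr_ge0 ?sqr_ge0.
  - by apply: emeasurable_funD; exact: measurable_sq.
  rewrite ge0_integralD //; [|by move=> x _; rewrite lee_fin sqr_ge0
    |exact: measurable_sq|by move=> x _; rewrite lee_fin sqr_ge0|exact: measurable_sq].
  have -> : (\int[mu]_x (wgt s h (- x) ^+ 2)%:E = sq (wgt s h))%E by exact: sq_reflect.
  rewrite -/(sq (wgt s h)).
  have -> : (sq (wgt s h) + sq (wgt s h) = 2%:E * sq (wgt s h))%E.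
    by rewrite mule_natl mule2n.
  by rewrite muleA -EFinM mulVf // mul1e.
apply/seteqP; split => x /=.
  by move=> [g fg <-]; rewrite K.
by move=> ->; exists (evn h, odd h); [exact: hart_fourier|rewrite K //; exact: hart_fourier].
Qed.

Lemma Hs_norm_infty s f : ~ L2 f -> Hs_norm s f = +oo%E.
Proof.
move=> nf; rewrite /Hs_norm (_ : [set _ | _ in _] = set0) ?ereal_inf0 //.
by apply/seteqP; split => x //= [g [/L2P]].
Qed.

End fourier_hartley.

(** * The Green kernel of the inverse operator *)

Section green_kernel.
Context {R : realType}.
Notation mu := (@lebesgue_measure R).
Implicit Types (f g h a : R -> R).

(** The derivative of the Green function [exp (- |z|) / 2] of [1 - d_x^2]. *)
Definition green' (z : R) : R := - (Num.sg z * expw 1 z) / 2.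

Lemma green'_le z : `|green' z| <= expw 1 z.
Proof.
rewrite /green' normrM normrN normrM (ger0_norm (expw_ge0 _ _)) (@ger0_norm _ 2^-1) //.
apply: (@le_trans _ _ (1 * expw 1 z * 1)); last by rewrite mul1r mulr1.
apply: ler_pM => //; [by rewrite mulr_ge0 ?expw_ge0| | by rewrite invf_le1 // ler1n].
apply: ler_pM => //; first exact: expw_ge0.
by rewrite normr_sg; case: (_ == _).
Qed.

Lemma measurable_green' : measurable_fun setT green'.
Proof.
apply: measurable_funM => //; apply: measurableT_comp => //.
apply: measurable_funM; last exact: measurable_expw.
have -> : (Num.sg : R -> R) = fun x => \1_[set` `]0, +oo[] x - \1_[set` `]-oo, 0[] x.
  apply/funext => x; rewrite !indicE !mem_setE !in_itv /= andbT.
  by case: sgrP => x0; rewrite ?ltxx ?subrr // ?x0 ?(ltW x0) ?(lt_gtF x0) ?subr0 ?sub0r.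
by apply: measurable_funB; apply: measurable_indic; exact: measurable_itv.
Qed.

Lemma L1_green' : L1 green'.
Proof.
apply: (L1_le measurable_green' _ (@L1_expw R _ ltr01)) => z.
by rewrite (ger0_norm (expw_ge0 _ _)) green'_le.
Qed.

Lemma green'_le1 z : `|green' z| <= 1.
Proof.
apply: le_trans (green'_le z) _; rewrite /expw mul1r -expR0 ler_expR.
by rewrite oppr_le0.
Qed.

(** The symbol of [(1 - d_x^2)^{-1} d_x], up to the factor [i]. *)
Definition sym (xi : R) : R := xi / (1 + xi ^+ 2).

Lemma int_expw_sgsin xi : \int[mu]_z (expw 1 z * sin (xi * `|z|)) = 2 * sym xi.
Proof.
have D0 := jb_base_gt0 xi.
pose f z := expw 1 z * (1 + sin (xi * `|z|)).
pose F x := - (expR (- (1 * x)) * (1 + (sin (xi * x) + xi * cos (xi * x)) / (1 + xi ^+ 2))).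
have cs : continuous (fun z : R => sin (xi * `|z|)).
  apply: ctcomp; first exact: continuous_sin.
  by apply: ctM; [exact: ctcst|exact: ctabs].
have f0 z : 0 <= f z.
  by rewrite mulr_ge0 ?expw_ge0 //; have := sin_geN1 (xi * `|z|); lra.
have cf : continuous f.
  by apply: ctM; [exact: continuous_expw|apply: ctD => //; exact: ctcst].
have ev z : f (- z) = f z by rewrite /f /expw normrN.
have dF (x : R) : 0 <= x -> is_derive x (1:R) F (f x).
  move=> x0; rewrite /f /expw ger0_norm //.
  have d1 : is_derive x (1:R) (fun x => expR (- (1 * x))) (expR (- (1 * x)) * - (1 * 1)).
    by apply: dvcomp; apply: dvN; apply: dvZ; exact: dvid.
  have dt : is_derive x (1:R) (fun x => xi * x) (xi * 1) by apply: dvZ; exact: dvid.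
  have d2 := dvcomp (is_derive_sin (xi * x)) dt.
  have d3 := dvcomp (is_derive_cos (xi * x)) dt.
  have d4 := dvD (dvcst x 1) (dvM (dvD d2 (dvZ xi d3)) (dvcst x (1 + xi ^+ 2)^-1)).
  apply: dv_eq (dvN (dvM d1 d4)) _.
  by field; rewrite lt0r_neq0.
have lF : F x @[x --> +oo] --> 0.
  have C0 : 0 < 1 + (1 + `|xi|) / (1 + xi ^+ 2).
    apply: ltr_wpDr => //.
    by apply: divr_ge0; [rewrite addr_ge0|exact: ltW].
  apply: (cvgy0_inv ltr01 C0) => x x0; rewrite /F normrN normrM mulrC.
  rewrite (ger0_norm (expR_ge0 _)).
  have A : expR (- (1 * x)) <= (1 + 1 * x)^-1 by apply: expRN_le; rewrite mul1r.
  apply: (ler_pM _ _ _ A); [exact: normr_ge0|exact: expR_ge0|].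
  apply: le_trans (ler_normD _ _) _.
  rewrite normr1 lerD2l normrM.
  rewrite (@ger0_norm _ (_^-1)) ?invr_ge0 ?(ltW D0) // ler_wpM2r ?invr_ge0 ?(ltW D0) //.
  apply: le_trans (ler_normD _ _) _; rewrite lerD ?sin_max // normrM.
  by rewrite ler_piMr // cos_max.
have E := even_integral f0 cf ev dF lF.
have l1 := @L1_expw R _ ltr01.
have l2 : L1 (fun z => expw 1 z * sin (xi * `|z|)).
  apply: (L1_bdd l1) (fun z => sin_max _); exact: continuous_measurable_fun cs.
have e1 : \int[mu]_z expw 1 z = 2.
  have := int_expw_cos 0 (@ltr01 R).
  under eq_Rintegral do rewrite mul0r cos0 mulr1.
  by move=> ->; rewrite /poisson expr0n /= expr1n; field.
have : \int[mu]_z f z = 2 + 2 * sym xi.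
  rewrite /Rintegral E /= /F !mulr0 oppr0 expR0 sin0 cos0 /sym; field.
  by rewrite lt0r_neq0.
have -> : \int[mu]_z f z = \int[mu]_z (expw 1 z + expw 1 z * sin (xi * `|z|)).
  by apply: eq_Rintegral => z _; rewrite /f mulrDr mulr1.
by rewrite RintegralD // e1 => /addrI.
Qed.

Lemma int_green'_sin xi : \int[mu]_z (green' z * sin (z * xi)) = - sym xi.
Proof.
have cs : continuous (fun z : R => sin (xi * `|z|)).
  apply: ctcomp; first exact: continuous_sin.
  by apply: ctM; [exact: ctcst|exact: ctabs].
have l2 : L1 (fun z => expw 1 z * sin (xi * `|z|)).
  apply: (L1_bdd (@L1_expw R _ ltr01)) (fun z => sin_max _).
  exact: continuous_measurable_fun cs.
transitivity (\int[mu]_z (- 2^-1 * (expw 1 z * sin (xi * `|z|)))).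
  apply: eq_Rintegral => z _; rewrite /green' (mulrC z).
  have -> : sin (xi * `|z|) = Num.sg z * sin (xi * z).
    rewrite normrEsg mulrCA; case: sgrP => z0.
    - by rewrite z0 !mul0r sin0.
    - by rewrite !mul1r.
    - by rewrite !mulN1r sinN.
  by ring.
by rewrite RintegralZl // int_expw_sgsin; field; rewrite /sym; rewrite ?lt0r_neq0.
Qed.

Lemma int_green'_cos xi : \int[mu]_z (green' z * cos (z * xi)) = 0.
Proof.
have l : L1 (fun z => green' z * cos (z * xi)).
  apply: (L1_bdd L1_green' _ (fun z => cos_max _)).
  by have := @measurable_cosM R xi; under eq_fun do rewrite mulrC.
have := Rint_reflect (L1_meas l).
have -> : \int[mu]_z (green' (- z) * cos (- z * xi)) =
    \int[mu]_z (-1 * (green' z * cos (z * xi))).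
  by apply: eq_Rintegral => z _; rewrite /green' /expw normrN sgrN (mulNr z xi) cosN; ring.
by rewrite RintegralZl // mulN1r => h; lra.
Qed.

(** Convolution with [green'] of an integrable function. *)
Definition gconv f (x : R) : R := \int[mu]_y (f y * green' (x - y)).

Lemma measurable_greenB : measurable_fun setT (fun z : R * R => green' (z.1 - z.2)).
Proof.
apply: (measurableT_comp measurable_green').
by apply: measurable_funB; [exact: measurable_fst|exact: measurable_snd].
Qed.

Let conv_integrable f a (C : R) : L1 f -> measurable_fun setT a -> (forall x, `|a x| <= C) ->
  (mu \x mu)%E.-integrable setT (EFin \o (fun z : R * R => f z.2 * (a z.1 * green' (z.1 - z.2)))).
Proof.
move=> lf ma aC; have C0 : 0 <= C := le_trans (normr_ge0 _) (aC 0).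
have mf := L1_meas lf.
have m2 : measurable_fun setT (fun z : R * R => f z.2 * (a z.1 * green' (z.1 - z.2))).
  apply: measurable_funM; first by apply: (measurableT_comp mf); exact: measurable_snd.
  apply: measurable_funM; last exact: measurable_greenB.
  by apply: (measurableT_comp ma); exact: measurable_fst.
apply/(integrable21ltyP mu mu); first exact/measurable_EFinP.
have lg := L1_abs L1_green'.
set G := \int[mu]_z `|green' z|.
apply: (@le_lt_trans _ _ (\int[mu]_y (`|f y| * (C * G))%:E))%E.
  apply: ge0_le_integral => //.
  - by move=> x _; exact: integral_ge0.
  - apply: (@measurable_fun_fubini_tonelli_G _ _ _ _ _ mu
      (fun z : R * R => `|(f z.2 * (a z.1 * green' (z.1 - z.2)))%:E|)%E) => //.
    by apply: measurableT_comp => //; exact/measurable_EFinP.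
  - apply/measurable_EFinP; apply: measurable_funM => //.
    exact: measurableT_comp.
  move=> y _.
  have lgy : L1 (fun x => `|green' (x - y)|).
    by have := L1_affine (- y) ltr01 lg; under eq_fun do rewrite mul1r.
  have lb : L1 (fun x => `|f y| * (C * `|green' (x - y)|)) by do 2 apply: L1Z.
  apply: (@le_trans _ _ (\int[mu]_x (`|f y| * (C * `|green' (x - y)|))%:E)%E).
    apply: ge0_le_integral => //.
    - apply: measurableT_comp => //; apply/measurable_EFinP.
      exact: (measurableT_comp m2 (measurable_pair2 y)).
    - by apply/measurable_EFinP; exact: L1_meas lb.
    by move=> x _; rewrite lee_fin /= !normrM ler_wpM2l // ler_wpM2r.
  rewrite -EFin_Rint // RintegralZl //; last exact: L1Z.
  rewrite RintegralZl //.
  have -> : \int[mu]_x `|green' (x - y)| = G by exact: Rint_shift (L1_meas lg).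
  by [].
have l : L1 (fun y => `|f y| * (C * G)).
  by have := L1Z (C * G) (L1_abs lf); under eq_fun do rewrite mulrC.
by rewrite -EFin_Rint // ltry.
Qed.

Lemma L1_greenB f x : L1 f -> L1 (fun y => f y * green' (x - y)).
Proof.
move=> lf; apply: (L1_bdd lf _ (fun y => green'_le1 _)).
exact: (measurableT_comp measurable_greenB (measurable_pair1 x)).
Qed.

Lemma L1_conv f : L1 f -> L1 (gconv f).
Proof.
move=> lf; have m1 : measurable_fun setT (fun _ : R => 1 : R) by exact: measurable_cst.
have := integrable_fubini_F (conv_integrable lf m1 (fun x => lexx `|1|)).
congr (mu.-integrable _ _); apply/funext => x.
rewrite /fubini_F /= /gconv EFin_Rint; last exact: L1_greenB.
by apply: eq_integral => y _; rewrite mul1r.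
Qed.

Lemma conv_fubini f a (C : R) : L1 f -> measurable_fun setT a -> (forall x, `|a x| <= C) ->
  \int[mu]_x (gconv f x * a x) = \int[mu]_y (f y * \int[mu]_x (a x * green' (x - y))).
Proof.
move=> lf ma aC.
have la y : L1 (fun x => a x * green' (x - y)).
  have lgy : L1 (fun x => green' (x - y)).
    by have := L1_affine (- y) ltr01 L1_green'; under eq_fun do rewrite mul1r.
  by have := L1_bdd lgy ma aC; under eq_fun do rewrite mulrC.
congr fine.
transitivity (\int[mu]_x \int[mu]_y (f y * (a x * green' (x - y)))%:E)%E.
  apply: eq_integral => x _; rewrite /gconv mulrC -RintegralZl //; last exact: L1_greenB.
  rewrite EFin_Rint; last by apply: L1Z; exact: L1_greenB.
  by apply: eq_integral => y _; congr EFin; ring.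
transitivity (\int[mu]_y \int[mu]_x (f y * (a x * green' (x - y)))%:E)%E.
  exact: (Fubini (conv_integrable lf ma aC)).
apply: eq_integral => y _; rewrite -RintegralZl //; last exact: la.
by rewrite EFin_Rint //; exact: L1Z.
Qed.

Lemma L2_bounded f (M : R) : L1 f -> (forall x, `|f x| <= M) -> L2 f.
Proof.
move=> lf fM; have mf := L1_meas lf; split => //.
have := L1_bdd lf mf fM => /integrableP[_]; apply: le_lt_trans.
apply: ge0_le_integral => //.
- by move=> x _; rewrite lee_fin sqr_ge0.
- exact: measurable_sq.
- by apply: measurableT_comp => //; apply/measurable_EFinP; exact: measurable_funM.
by move=> x _; rewrite lee_fin -expr2 ler_norm.
Qed.

Lemma L2_conv f : L1 f -> L2 (gconv f).
Proof.
move=> lf; apply: (L2_bounded (L1_conv lf)) => x.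
apply: (Rint_bdd lf _ (fun y => green'_le1 _)).
exact: (measurableT_comp measurable_greenB (measurable_pair1 x)).
Qed.

Lemma H1_conv f xi : L1 f -> H1 (gconv f) xi = - sym xi * H1 f (- xi).
Proof.
move=> lf; rewrite /H1 (conv_fubini lf (measurable_casM xi) (fun x => cas_le2 _)).
rewrite -RintegralZl //; last exact: L1_cas.
apply: eq_Rintegral => y _; rewrite mulrCA; congr (_ * _).
have lg := L1_green'.
have ls : L1 (fun z => green' z * sin (z * xi)).
  apply: (L1_bdd lg _ (fun z => sin_max _)).
  by have := @measurable_sinM R xi; under eq_fun do rewrite mulrC.
have lc : L1 (fun z => green' z * cos (z * xi)).
  apply: (L1_bdd lg _ (fun z => cos_max _)).
  by have := @measurable_cosM R xi; under eq_fun do rewrite mulrC.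
have m : measurable_fun setT (fun x : R => cas (x * xi) * green' (x - y)).
  apply: measurable_funM; first exact: measurable_casM.
  exact: (measurableT_comp measurable_greenB (measurable_pair2 y)).
rewrite -(Rint_shift y m).
transitivity (\int[mu]_z (cas (y * xi) * (green' z * cos (z * xi)) +
    cas (y * - xi) * (green' z * sin (z * xi)))).
  apply: eq_Rintegral => z _; rewrite addrK (mulrDl z y xi) /cas cosD sinD mulrN cosN sinN; ring.
rewrite RintegralD //; try exact: L1Z.
by rewrite !RintegralZl // int_green'_cos int_green'_sin; ring.
Qed.

Lemma hart_conv f : L1 f -> is_hart (gconv f) (fun xi => - sym xi * H1 f (- xi)).
Proof.
move=> lf; have := hart_L1 (L1_conv lf) (L2_conv lf).
by congr is_hart; apply/funext => xi; exact: H1_conv.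
Qed.

End green_kernel.

(** * Smooth functions of bounded support *)

Section smooth_functions.
Context {R : realType}.
Implicit Types (f g : R -> R).

Fixpoint Ck (n : nat) f : Prop :=
  if n is n'.+1 then (forall x, derivable f x 1) /\ Ck n' (derive1 f) else True.

Definition smooth f := forall n, Ck n f.

Lemma smoothP f : smooth f <-> forall n x, derivable (derive1n n f) x 1.
Proof.
split.
  move=> sf n; have := sf n.+1; elim: n f {sf} => [|n IH] f [d s] x; first exact: d.
  by rewrite /derive1n iterSr; exact: IH.
move=> H n; elim: n f H => [//|n IH] f H; split; first exact: (H 0%N).
by apply: IH => m x; have := H m.+1 x; rewrite /derive1n iterSr.
Qed.

Lemma CkS n f : Ck n.+1 f -> Ck n f.
Proof. by elim: n f => [//|n IH] f [d s]; split => //; exact: IH. Qed.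

Lemma Ck_dv n f g : (forall x : R, is_derive x (1:R) f (g x)) -> Ck n g -> Ck n.+1 f.
Proof.
move=> fg cg; split; first by move=> x; case: (fg x).
by rewrite (_ : derive1 f = g) //; apply/funext => x; exact: dv_derive1.
Qed.

Lemma dv_derivable f x : derivable f x 1 -> is_derive x (1:R) f (derive1 f x).
Proof. by rewrite derive1E; exact: derivableP. Qed.

Lemma CkD n f g : Ck n f -> Ck n g -> Ck n (fun x => f x + g x).
Proof.
elim: n f g => [//|n IH] f g [df cf] [dg cg].
exact: (Ck_dv (fun x => dvD (dv_derivable (df x)) (dv_derivable (dg x))) (IH _ _ cf cg)).
Qed.

Lemma CkM n f g : Ck n f -> Ck n g -> Ck n (fun x => f x * g x).
Proof.
elim: n f g => [//|n IH] f g Cf Cg; have [df cf] := Cf; have [dg cg] := Cg.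
have D x := dvM (dv_derivable (df x)) (dv_derivable (dg x)).
exact: (Ck_dv D (CkD (IH _ _ cf (CkS Cg)) (IH _ _ (CkS Cf) cg))).
Qed.

Lemma Ck_cst n (c : R) : Ck n (fun=> c).
Proof.
elim: n c => [//|n IH] c; exact: (@Ck_dv _ _ (fun=> 0) (fun x => dvcst x c) (IH 0)).
Qed.

Lemma dv_affine (a b x : R) : is_derive x (1:R) (fun y => a * y + b) a.
Proof.
by apply: dv_eq (dvD (dvZ a (dvid x)) (dvcst x b)) _; rewrite mulr1 addr0.
Qed.

Lemma Ck_affine n a b f : Ck n f -> Ck n (fun x => f (a * x + b)).
Proof.
elim: n f => [//|n IH] f [df cf].
have D x := @dvcomp _ f (fun y => a * y + b) x _ _ (dv_derivable (df _)) (dv_affine a b x).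
exact: (Ck_dv D (CkM (IH _ cf) (Ck_cst n a))).
Qed.

Lemma Ck_sincos n : Ck n (@sin R) /\ Ck n (@cos R).
Proof.
elim: n => [//|n [IHs IHc]]; split.
  exact: (@Ck_dv _ _ cos (@is_derive_sin R) IHc).
have D (x : R) : is_derive x (1:R) cos (-1 * sin x).
  by apply: dv_eq (is_derive_cos x) _; rewrite mulN1r.
exact: (Ck_dv D (CkM (Ck_cst n (-1)) IHs)).
Qed.

Lemma Ck_cas n : Ck n (@cas R).
Proof. by have [hs hc] := Ck_sincos n; exact: (CkD hc hs). Qed.

(** Flat functions [P(1/x) exp(-1/x)] on [x > 0], extended by [0]: a family closed
    under differentiation. *)
Definition flat (P : {poly R}) (x : R) : R := if 0 < x then P.[x^-1] * expR (- x^-1) else 0.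

Lemma pow_expRN k (t : R) : 0 <= t -> t ^+ k * expR (- t) <= k%:R ^+ k.
Proof.
case: k => [|k] t0; first by rewrite !expr0 mul1r -expR0 ler_expR oppr_le0.
have k0 : 0 < k.+1%:R :> R by [].
rewrite expRN ler_pdivrMr ?expR_gt0 //.
pose u := t / k.+1%:R; have u0 : 0 <= u by rewrite divr_ge0.
have -> : t = k.+1%:R * u by rewrite /u mulrCA divff ?mulr1 // lt0r_neq0.
rewrite expRM_natl exprMn ler_wpM2l ?exprn_ge0 //.
rewrite lerXn2r ?nnegrE ?expR_ge0 //.
by apply: le_trans (expR_ge1Dx _); rewrite lerDr.
Qed.

Lemma poly_expRN (P : {poly R}) : exists C : R, forall t : R, 1 <= t ->
  `|P.[t] * expR (- t)| <= C / t.
Proof.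
exists (\sum_(i < size P) `|P`_i| * i.+1%:R ^+ i.+1) => t t1.
have t0 : 0 < t by lra.
rewrite horner_coef mulr_suml mulr_suml; apply: le_trans (ler_norm_sum _ _ _) _.
apply: ler_sum => i _; rewrite -mulrA normrM -mulrA ler_wpM2l //.
rewrite ger0_norm ?mulr_ge0 ?exprn_ge0 ?expR_ge0 ?(ltW t0) // ler_pdivlMr //.
by rewrite mulrAC -exprSr; apply: pow_expRN; exact: ltW.
Qed.

Lemma dv_flat (P : {poly R}) x :
  is_derive x (1:R) (flat P) (flat ('X^2 * (P - P^`())) x).
Proof.
have [x0|x0|x0] := ltgtP x 0.
- have -> : flat ('X^2 * (P - P^`())) x = 0 by rewrite /flat ltNge ltW.
  have N : \near x, (fun=> 0) x = flat P x.
    by near=> y; rewrite /flat ltNge ltW //; near: y; exact: lt_nbhsl.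
  exact: (near_eq_is_derive N (dvcst x 0)).
- have -> : flat ('X^2 * (P - P^`())) x = ('X^2 * (P - P^`())).[x^-1] * expR (- x^-1).
    by rewrite /flat x0.
  have N : \near x, P.[x^-1] * expR (- x^-1) = flat P x.
    by near=> y; rewrite /flat ifT //; near: y; exact: lt_nbhsr.
  have xn : x != 0 by exact: lt0r_neq0.
  have d1 : is_derive x (1:R) (fun y => y^-1) (- x^-2).
    apply: DeriveDef; first by apply: (@derivableV _ _ id).
    by rewrite (@deriveV _ _ id) // derive_id /GRing.scale /= mulr1.
  have d2 : is_derive x (1:R) (fun y => P.[y^-1]) (P^`().[x^-1] * - x^-2).
    by apply: (@dvcomp _ (horner P)) d1; exact: is_derive_poly.
  have d3 : is_derive x (1:R) (fun y => expR (- y^-1)) (expR (- x^-1) * - - x^-2).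
    by apply: (@dvcomp _ expR) (dvN d1); exact: is_derive_expR.
  apply: dv_eq (near_eq_is_derive N (dvM d2 d3)) _.
  by rewrite !hornerE /=; field.
- rewrite x0; have -> : flat ('X^2 * (P - P^`())) 0 = 0 by rewrite /flat ltxx.
  have [C HC] := poly_expRN ('X * P).
  have H : (h^-1 *: (flat P (h *: 1 + 0) - flat P 0)) @[h --> 0^'] --> 0.
    apply/cvgr0Pnorm_le => e e0.
    have C1 : 0 < `|C| + 1 by rewrite ltr_wpDl.
    near=> h.
    have hd : `|h| < Num.min 1 (e / (`|C| + 1)).
      near: h; apply: dnbhs0_lt; by rewrite lt_min ltr01 divr_gt0.
    move: hd; rewrite lt_min => /andP[h1 h2].
    rewrite addr0 /GRing.scale /= mulr1 /flat ltxx subr0; case: ifP => h0; last by rewrite mulr0 normr0 ltW.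
    have hn : h != 0 by exact: lt0r_neq0.
    rewrite (ger0_norm (ltW h0)) in h1 h2.
    have := HC h^-1; rewrite invf_ge1 // (ltW h1) => /(_ isT).
    rewrite hornerM hornerX invrK -mulrA => /le_trans; apply.
    apply: (@le_trans _ _ ((`|C| + 1) * h)).
      by rewrite ler_wpM2r ?(ltW h0) //; have := ler_norm C; lra.
    by move: h2; rewrite ltr_pdivlMr // mulrC => /ltW.
  by apply: DeriveDef; [apply/cvg_ex; exists 0|apply/cvg_lim].
Unshelve. all: by end_near. Qed.

Lemma Ck_flat n P : Ck n (flat P).
Proof.
by elim: n P => [//|n IH] P; exact: (Ck_dv (dv_flat P) (IH _)).
Qed.

Definition sbump (x : R) : R := flat 1 (1 - x) * flat 1 (1 + x).

Lemma smooth_bump : smooth sbump.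
Proof.
move=> n; apply: CkM.
  have := Ck_affine (-1) 1 (Ck_flat n 1).
  by congr Ck; apply/funext => x; rewrite mulN1r addrC.
have := Ck_affine 1 1 (Ck_flat n 1).
by congr Ck; apply/funext => x; rewrite mul1r addrC.
Qed.

Lemma bump0_gt0 : 0 < sbump 0.
Proof.
rewrite /sbump /flat subr0 addr0 ltr01 invr1 hornerC mul1r.
by rewrite mulr_gt0 // expR_gt0.
Qed.

Lemma supp_bump : supp_in 1 sbump.
Proof.
move=> x; rewrite /sbump /flat; have [x0|x0] := leP 0 x.
  by rewrite ger0_norm // => x1; rewrite ifF ?mul0r //; apply/negbTE; rewrite -leNgt; lra.
by rewrite ltr0_norm // => x1; rewrite mulrC ifF ?mul0r //; apply/negbTE; rewrite -leNgt; lra.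
Qed.

End smooth_functions.

Section test_functions.
Context {R : realType}.
Notation mu := (@lebesgue_measure R).
Implicit Types (f g phi : R -> R).

Lemma test_functionP phi : test_function phi <-> smooth phi /\ exists M, supp_in M phi.
Proof. by split => -[/smoothP]. Qed.

Lemma smooth_derive1 phi : smooth phi -> smooth (derive1 phi).
Proof. by move=> s n; have [] := s n.+1. Qed.

Lemma smooth_dv phi x : smooth phi -> is_derive x (1:R) phi (derive1 phi x).
Proof. by move=> s; apply: dv_derivable; have [] := s 1%N. Qed.

Lemma smooth_continuous phi : smooth phi -> continuous phi.
Proof. by move=> s x; exact: dv_continuous (smooth_dv x s). Qed.

Lemma supp_derive1 M phi : supp_in M phi -> supp_in M (derive1 phi).
Proof.
move=> sp x Mx; apply: dv_derive1.
have N : \near x, (fun=> 0) x = phi x.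
  have : \forall y \near x, M < `|y| by have /cvgr_gt := @ctabs R x; apply.
  by apply: filterS => y /sp.
exact: (near_eq_is_derive N (dvcst x 0)).
Qed.

Lemma continuous_supp_bounded M f : continuous f -> supp_in M f -> exists B : R, forall x, `|f x| <= B.
Proof.
move=> cf sf; pose N := `|M| + 1.
have N0 : - N <= N by rewrite /N; have := normr_ge0 M; lra.
have cn : {within `[- N, N], continuous (fun x => `|f x|)}.
  by apply: continuous_subspaceT; apply: ctcomp => //; exact: ctabs.
have [c _ Hc] := EVT_max N0 cn.
exists `|f c| => x; have [xN|Nx] := leP `|x| N.
  by apply: Hc; rewrite in_itv /= -ler_norml.
by rewrite sf ?normr0 //; apply: le_lt_trans Nx; rewrite /N; have := ler_norm M; lra.
Qed.

Lemma nice_continuous M f : continuous f -> supp_in M f -> nice f.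
Proof.
move=> cf sf; have mf := continuous_measurable_fun cf.
have bf := continuous_supp_bounded cf sf.
split; [exact: mf|exact: bf|by exists M|].
by apply: aeW => x; exact: cf.
Qed.

(** [(1 - d_x^2)^{-1} d_x] really inverts: both half-lines are integrated by parts,
    and the jump of [green'] at the origin produces the point value. *)
Lemma green'_parts phi y : test_function phi ->
  \int[mu]_x ((phi x - derive1n 2 phi x) * green' (x - y)) = - derive1 phi y.
Proof.
move=> /test_functionP[s [M sp]].
have s1 := smooth_derive1 s; have s2 := smooth_derive1 s1.
have sp1 := supp_derive1 sp; have sp2 := supp_derive1 sp1.
pose psi x := phi x - derive1 (derive1 phi) x.
have cpsi : continuous psi by apply: ctD; [exact: smooth_continuous|apply: ctN; exact: smooth_continuous].
pose b := Num.max y M + 1; pose a := Num.min y (- M) - 1.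
have yb : y < b by rewrite /b ltr_pwDr // le_max lexx.
have Mb : M < b by rewrite /b ltr_pwDr // le_max lexx orbT.
have ay : a < y by rewrite /a ltrBlDr ltr_pwDr // ge_min lexx.
have aM : a < - M by rewrite /a ltrBlDr ltr_pwDr // ge_min lexx orbT.
pose u x := - 2^-1 * (expR (y - x) * psi x).
pose v x := 2^-1 * (expR (x - y) * psi x).
have ce : continuous (fun x : R => expR (y - x)).
  apply: ctcomp; first exact: continuous_expR.
  by apply: ctD; [exact: ctcst|apply: ctN; exact: ctid].
have ce' : continuous (fun x : R => expR (x - y)).
  apply: ctcomp; first exact: continuous_expR.
  by apply: ctD; [exact: ctid|exact: ctcst].
have cu : continuous u by apply: ctM; [exact: ctcst|exact: ctM].
have cv : continuous v by apply: ctM; [exact: ctcst|exact: ctM].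
pose G x := 2^-1 * (expR (y - x) * (phi x + derive1 phi x)).
pose H x := 2^-1 * (expR (x - y) * (phi x - derive1 phi x)).
have dG (x : R) : is_derive x (1:R) G (u x).
  have d1 : is_derive x (1:R) (fun x => expR (y - x)) (expR (y - x) * (0 - 1)).
    exact: (@dvcomp _ expR _ x _ _ (is_derive_expR _) (dvD (dvcst x y) (dvN (dvid x)))).
  apply: dv_eq (dvZ 2^-1 (dvM d1 (dvD (smooth_dv x s) (smooth_dv x s1)))) _.
  by rewrite /u /psi; field.
have dH (x : R) : is_derive x (1:R) H (v x).
  have d1 : is_derive x (1:R) (fun x => expR (x - y)) (expR (x - y) * (1 - 0)).
    exact: (@dvcomp _ expR _ x _ _ (is_derive_expR _) (dvD (dvid x) (dvN (dvcst x y)))).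
  apply: dv_eq (dvZ 2^-1 (dvM d1 (dvD (smooth_dv x s) (dvN (smooth_dv x s1))))) _.
  by rewrite /v /psi; field.
have FTC (F w : R -> R) (p q : R) : p < q -> continuous w ->
    (forall x : R, is_derive x (1:R) F (w x)) -> \int[mu]_(x in `[p, q]) w x = F q - F p.
  move=> pq cw dF; rewrite /Rintegral (@continuous_FTC2 _ w F) //.
  - exact: continuous_subspaceT.
  - split.
    + by move=> x _; case: (dF x).
    + by apply: cvg_at_right_filter; exact: dv_continuous (dF p).
    + by apply: cvg_at_left_filter; exact: dv_continuous (dF q).
  - by move=> x _; exact: dv_derive1.
have iw (w : R -> R) (p q : R) : continuous w -> L1 (w \_ [set` `[p, q]]).
  move=> cw; rewrite /L1 -restrict_EFin; have mi : measurable [set` `[p, q]] by exact: measurable_itv.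
  have [H1 _] := @integrable_mkcond _ (measurableTypeR R) R mu [set` `[p, q]] (EFin \o w) mi.
  apply: H1.
  by apply: continuous_compact_integrable; [exact: segment_compact|exact: continuous_subspaceT].
have EG : \int[mu]_x (u \_ [set` `[y, b]]) x = G b - G y.
  by rewrite -Rintegral_mkcond; exact: FTC.
have EH : \int[mu]_x (v \_ [set` `[a, y]]) x = H y - H a.
  by rewrite -Rintegral_mkcond; exact: FTC.
have Gb : G b = 0.
  have mb : M < `|b| by apply: lt_le_trans Mb (ler_norm _).
  by rewrite /G sp // sp1 // addr0 !mulr0.
have Ha : H a = 0.
  have ma : M < `|a| by rewrite -normrN; apply: lt_le_trans (ler_norm _); rewrite ltrNr.
  by rewrite /H sp // sp1 // subr0 !mulr0.
have mpsi : measurable_fun setT psi by exact: continuous_measurable_fun.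
transitivity (\int[mu]_x ((u \_ [set` `[y, b]]) x + (v \_ [set` `[a, y]]) x)).
  apply: Rint_ae_eq.
  - apply: measurable_funM => //.
    exact: (measurableT_comp (@measurable_greenB R) (measurable_pair2 y)).
  - by apply: measurable_funD; apply: L1_meas; exact: iw.
  exists [set y]; split; [exact: measurable_set1|exact: lebesgue_measure_set1|].
  move=> x /= hx; apply: contrapT => xy; apply: hx.
  rewrite !patchE !mem_setE !in_itv /= -/(psi x).
  have xout : b < x \/ x < a -> psi x = 0.
    move=> xo; have mx : M < `|x|.
      case: xo => h; first exact: lt_le_trans (lt_trans Mb h) (ler_norm _).
      by rewrite -normrN; apply: lt_le_trans (ler_norm _); rewrite ltrNr (lt_trans h).
    by rewrite /psi sp // sp2 // subr0.
  have [xly|ylx|//] := ltgtP x y.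
    rewrite /= andbT add0r.
    rewrite /green' /expw ltr0_sg ?subr_lt0 // ltr0_norm ?subr_lt0 //.
    case: leP => ax; first by rewrite /v mul1r opprK mulN1r opprK; ring.
    by rewrite xout ?mul0r //; right.
  rewrite /= andbF addr0.
  rewrite /green' /expw gtr0_sg ?subr_gt0 // gtr0_norm ?subr_gt0 //.
  case: leP => bx; first by rewrite /u !mul1r opprB; field.
  by rewrite xout ?mul0r //; left.
rewrite (RintegralD measurableT (iw u y b cu) (iw v a y cv)) /=.
by rewrite EG EH Gb Ha /G /H subrr expR0; field.
Qed.

End test_functions.

(** * Uniqueness for the equation w = w'' *)

Section inverse_operator.
Context {R : realType}.
Notation mu := (@lebesgue_measure R).
Implicit Types (f g h w phi : R -> R).

Lemma test_psi_nice phi : test_function phi ->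
  nice (fun x => phi x - derive1n 2 phi x) /\ nice (derive1 phi).
Proof.
move=> /test_functionP[s [M sp]].
have s1 := smooth_derive1 s; have s2 := smooth_derive1 s1.
have sp1 := supp_derive1 sp; have sp2 := supp_derive1 sp1.
split; last exact: (nice_continuous (smooth_continuous s1) sp1).
apply: (@nice_continuous _ M); first by apply: ctD; [|apply: ctN]; exact: smooth_continuous.
by move=> x Mx; rewrite sp // /derive1n /= sp2 // subr0.
Qed.

Lemma conv_weak f phi : L1 f -> test_function phi ->
  \int[mu]_x (gconv f x * (phi x - derive1n 2 phi x)) = - \int[mu]_x (f x * derive1 phi x).
Proof.
move=> lf tphi; have [n1 n2] := test_psi_nice tphi.
have [m1 [B b1] _ _] := n1; have [m2 [C b2] _ _] := n2.
rewrite (conv_fubini lf m1 b1).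
have l2 := L1_bdd lf m2 b2.
rewrite -mulN1r -RintegralZl //; apply: eq_Rintegral => y _.
by rewrite green'_parts //; ring.
Qed.

Lemma kappa_gt0 : 0 < @kappa R.
Proof.
have : \int[mu]_x ((\1_(box 1) : R -> R) x) <= @kappa R.
  have l1 : L1 (\1_(box 1) : R -> R).
    have := L2_mul_integrable (@L2_indic R 1) (@L2_indic R 1).
    congr (mu.-integrable _ _); apply/funext => x /=; congr EFin.
    by rewrite indicE; case: (x \in box 1); rewrite ?mulr1 ?mulr0.
  apply: le_Rintegral => //; first exact: L1_poisson.
  move=> x _; rewrite indicE box_norm.
  have [x1|_] /= := boolP (`|x| <= 1); last exact: poisson_ge0.
  change (1 <= poisson 1 x); rewrite /poisson expr1n mulr1 (ler_pdivlMr _ _ (jb_base_gt0 x)) mul1r.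
  have : `|x| ^+ 2 <= 1 by rewrite expr_le1.
  by rewrite real_normK ?num_real // => h; lra.
apply: lt_le_trans; rewrite /Rintegral.
have -> : (\int[mu]_x ((\1_(box 1) : R -> R) x)%:E = sq (\1_(box 1) : R -> R))%E.
  apply: eq_integral => x _; rewrite indicE; case: (x \in box 1); by rewrite ?expr1n ?expr0n.
by rewrite sq_indic /=.
Qed.

Lemma smooth_scaled_bump (a : R) : smooth (fun x : R => sbump (a * x : R)).
Proof.
move=> n; have := Ck_affine a 0 (smooth_bump n).
by congr Ck; apply/funext => x; rewrite addr0.
Qed.

(** Testing with [sbump (x / N) * cas (x eta)] turns the equation [w = w''] into
    [(1 + eta^2) H (w chi) = O (1 / N)], where [H] is the Hartley transform: by
    Plancherel [w chi] is small in [L2], uniformly as the cut-off [chi] opens up. *)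
Lemma inv_dx_kernel w : L2 w ->
  (forall phi, test_function phi -> \int[mu]_x (w x * (phi x - derive1n 2 phi x)) = 0) ->
  {ae mu, forall x, w x = 0}.
Proof.
move=> lw Hw; have [mw _] := lw.
pose b1 : R -> R := derive1 (@sbump R); pose b2 : R -> R := derive1 b1.
have s0 := @smooth_bump R; have s1 := smooth_derive1 s0; have s2 := smooth_derive1 s1.
have p0 := @supp_bump R; have p1 := supp_derive1 p0; have p2 := supp_derive1 p1.
have [C0 hC0] := continuous_supp_bounded (smooth_continuous s0) p0.
have [C1 hC1] := continuous_supp_bounded (smooth_continuous s1) p1.
have [C2 hC2] := continuous_supp_bounded (smooth_continuous s2) p2.
pose e (N : nat) : R := N.+1%:R^-1.
have e0 N : 0 < e N by rewrite invr_gt0.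
have e1 N : e N <= 1 by rewrite invf_le1 // ler1n.
pose cut (b : R -> R) N x := w x * b (e N * x).
have supp_cut b N : supp_in 1 b -> supp_in N.+1%:R (cut b N).
  move=> sb x hx; rewrite /cut sb ?mulr0 // normrM (gtr0_norm (e0 N)) /e.
  by rewrite mulrC ltr_pdivlMr // mul1r.
have mcut (b : R -> R) N : continuous b -> measurable_fun setT (fun x : R => b (e N * x)).
  by move=> cb; apply: continuous_measurable_fun; apply: ctcomp => //; exact: ctZ.
have L2_cut (b : R -> R) (C : R) N : continuous b -> (forall x, `|b x| <= C) -> L2 (cut b N).
  move=> cb hb; apply: (L2_le _ _ (L2Z C lw)).
    by apply: measurable_funM => //; exact: mcut.
  move=> x; rewrite /cut !normrM mulrC ler_wpM2r //.
  exact: le_trans (hb _) (ler_norm _).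
have lc0 N := L2_cut _ _ N (smooth_continuous s0) hC0.
have lc1 N := L2_cut _ _ N (smooth_continuous s1) hC1.
have lc2 N := L2_cut _ _ N (smooth_continuous s2) hC2.
have i0 N := supp_L1 (lc0 N) (supp_cut _ N p0).
have i1 N := supp_L1 (lc1 N) (supp_cut _ N p1).
have i2 N := supp_L1 (lc2 N) (supp_cut _ N p2).
have key N eta : (1 + eta ^+ 2) * H1 (cut (@sbump R) N) eta =
    2 * e N * eta * H1 (cut b1 N) (- eta) + e N ^+ 2 * H1 (cut b2 N) eta.
  pose phi x := sbump (e N * x) * cas (x * eta).
  have dl (x : R) : is_derive x (1:R) (fun x => e N * x) (e N).
    by apply: dv_eq (dvZ (e N) (dvid x)) _; rewrite mulr1.
  have dcas (c x : R) : is_derive x (1:R) (fun x => cas (x * c)) (c * cas (x * - c)).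
    have dr : is_derive x (1:R) (fun x => x * c) c.
      by apply: dv_eq (dvM (dvid x) (dvcst x c)) _; rewrite mul1r mulr0 addr0.
    have := dvD (@dvcomp _ cos (fun x => x * c) x _ _ (is_derive_cos _) dr)
      (@dvcomp _ sin (fun x => x * c) x _ _ (is_derive_sin _) dr).
    by move=> h; apply: dv_eq h _; rewrite /cas mulrN cosN sinN; ring.
  have dcas' (x : R) : is_derive x (1:R) (fun x => cas (x * - eta)) (- eta * cas (x * eta)).
    by apply: dv_eq (dcas (- eta) x) _; rewrite opprK.
  have db (x : R) := @dvcomp _ (@sbump R) (fun x => e N * x) x _ _ (smooth_dv _ s0) (dl x).
  have db1 (x : R) := @dvcomp _ b1 (fun x => e N * x) x _ _ (smooth_dv _ s1) (dl x).
  have d1 (x : R) : is_derive x (1:R) phi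
      (e N * (b1 (e N * x) * cas (x * eta)) + eta * (sbump (e N * x) * cas (x * - eta))).
    by apply: dv_eq (dvM (db x) (dcas eta x)) _; rewrite -/b1; ring.
  have d2 (x : R) : is_derive x (1:R) (fun x => e N * (b1 (e N * x) * cas (x * eta)) +
      eta * (sbump (e N * x) * cas (x * - eta)))
      (e N ^+ 2 * (b2 (e N * x) * cas (x * eta)) + 2 * e N * eta * (b1 (e N * x) * cas (x * - eta))
       - eta ^+ 2 * (sbump (e N * x) * cas (x * eta))).
    apply: dv_eq (dvD (dvZ (e N) (dvM (db1 x) (dcas eta x))) (dvZ eta (dvM (db x) (dcas' x)))) _.
    by rewrite -/b1 -/b2; ring.
  have tphi : test_function phi.
    apply/test_functionP; split.
      move=> n; apply: CkM; first exact: smooth_scaled_bump.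
      have := Ck_affine eta 0 (Ck_cas (R := R) n).
      by congr Ck; apply/funext => x; rewrite addr0 mulrC.
    exists N.+1%:R => x hx; rewrite /phi p0 ?mul0r //.
    by rewrite normrM (gtr0_norm (e0 N)) /e mulrC ltr_pdivlMr // mul1r.
  have E : derive1n 2 phi = fun x => e N ^+ 2 * (b2 (e N * x) * cas (x * eta)) +
      2 * e N * eta * (b1 (e N * x) * cas (x * - eta)) - eta ^+ 2 * (sbump (e N * x) * cas (x * eta)).
    rewrite /derive1n /=.
    have -> : derive1 phi = fun x => e N * (b1 (e N * x) * cas (x * eta)) +
        eta * (sbump (e N * x) * cas (x * - eta)).
      by apply/funext => x; exact: dv_derive1.
    by apply/funext => x; exact: dv_derive1.
  have := Hw _ tphi; rewrite E.
  have l0 := L1_cas eta (i0 N); have l1 := L1_cas (- eta) (i1 N); have l2 := L1_cas eta (i2 N).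
  have -> : \int[mu]_x (w x * (phi x - (e N ^+ 2 * (b2 (e N * x) * cas (x * eta)) +
      2 * e N * eta * (b1 (e N * x) * cas (x * - eta)) - eta ^+ 2 * (sbump (e N * x) * cas (x * eta)))))
    = \int[mu]_x ((1 + eta ^+ 2) * (cut (@sbump R) N x * cas (x * eta)) -
       (2 * e N * eta * (cut b1 N x * cas (x * - eta)) + e N ^+ 2 * (cut b2 N x * cas (x * eta)))).
    by apply: eq_Rintegral => x _; rewrite /phi /cut; ring.
  rewrite RintegralB //; [|exact: L1Z|by apply: L1D; exact: L1Z].
  rewrite RintegralD //; try exact: L1Z.
  rewrite !RintegralZl //; move=> /eqP; rewrite subr_eq0 => /eqP.
  by rewrite /H1.
(* hence the cut-off functions tend to [0] in [L2] *)
pose C := `|C1| + `|C2|.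
have small N : (sq (cut (@sbump R) N) <= (4 * e N ^+ 2 * C ^+ 2)%:E * sq w)%E.
  have [lH0 E0] := plancherel_supp (lc0 N) (supp_cut _ N p0).
  have [lH1 E1] := plancherel_supp (lc1 N) (supp_cut _ N p1).
  have [lH2 E2] := plancherel_supp (lc2 N) (supp_cut _ N p2).
  have mH0 := proj1 lH0; have mH1 := measurable_reflect (proj1 lH1); have mH2 := proj1 lH2.
  pose G eta := `|H1 (cut b1 N) (- eta)| + `|H1 (cut b2 N) eta|.
  have mG : measurable_fun setT G by apply: measurable_funD; apply: measurableT_comp.
  have B eta : `|H1 (cut (@sbump R) N) eta| <= `|e N * G eta|.
    have D0 := jb_base_gt0 eta.
    have G0 : 0 <= G eta by rewrite addr_ge0.
    rewrite (ger0_norm (mulr_ge0 (ltW (e0 N)) G0)).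
    rewrite -(ler_pM2l D0) -{1}(gtr0_norm D0) -normrM key.
    apply: le_trans (ler_normD _ _) _; rewrite !normrM.
    rewrite (ger0_norm (_ : 0 <= 2)) // (gtr0_norm (e0 N)) /G.
    set X := `|H1 (cut b1 N) (- eta)|; set Y := `|H1 (cut b2 N) eta|.
    have X0 : 0 <= X by exact: normr_ge0.
    have Y0 : 0 <= Y by exact: normr_ge0.
    have t1 : 2 * e N * `|eta| * X <= (1 + eta ^+ 2) * (e N * X).
      have h : 2 * `|eta| <= 1 + eta ^+ 2.
        rewrite -(real_normK (num_real eta)); have := sqr_ge0 (1 - `|eta|); lra.
      rewrite (_ : 2 * e N * `|eta| * X = 2 * `|eta| * (e N * X)); last by ring.
      by rewrite ler_wpM2r // mulr_ge0 // ltW.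
    have t2 : e N ^+ 2 * Y <= (1 + eta ^+ 2) * (e N * Y).
      rewrite expr2 -mulrA; apply: (@le_trans _ _ (1 * (e N * Y))).
        by rewrite ler_wpM2r // mulr_ge0 // ltW.
      by rewrite ler_wpM2r ?mulr_ge0 ?(ltW (e0 N)) // lerDl sqr_ge0.
    by rewrite mulrDr mulrDr; exact: lerD.
  have b (bb : R -> R) D : continuous bb -> (forall x, `|bb x| <= D) -> D <= C -> 0 <= D ->
      (sq (cut bb N) <= (C ^+ 2)%:E * sq w)%E.
    move=> cb hb DC D0; rewrite -sqZ //; apply: le_sq.
    - by apply: measurable_funM => //; exact: mcut.
    - exact: measurable_funM.
    move=> x; rewrite /cut !normrM mulrC ler_wpM2r //.
    by apply: le_trans (hb _) _; apply: le_trans DC (ler_norm _).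
  have c1 := b b1 `|C1| (smooth_continuous s1) (fun x => le_trans (hC1 x) (ler_norm _)).
  have c2 := b b2 `|C2| (smooth_continuous s2) (fun x => le_trans (hC2 x) (ler_norm _)).
  have {}c1 := c1 (_ : `|C1| <= C) (normr_ge0 _).
  have {}c2 := c2 (_ : `|C2| <= C) (normr_ge0 _).
  have k0 := kappa_gt0.
  have sw : sq w = ((nrm w) ^+ 2)%:E by exact: sq_nrm.
  have {}c1 : (sq (cut b1 N) <= (C ^+ 2 * nrm w ^+ 2)%:E)%E.
    by rewrite EFinM -sw; apply: c1; rewrite lerDl.
  have {}c2 : (sq (cut b2 N) <= (C ^+ 2 * nrm w ^+ 2)%:E)%E.
    by rewrite EFinM -sw; apply: c2; rewrite lerDr.
  have : ((@kappa R)%:E * sq (cut (@sbump R) N) <=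
     (e N ^+ 2)%:E * (2%:E * ((@kappa R)%:E * (C ^+ 2 * nrm w ^+ 2)%:E) +
       2%:E * ((@kappa R)%:E * (C ^+ 2 * nrm w ^+ 2)%:E)))%E.
    rewrite -E0; apply: (le_trans (le_sq mH0 _ B)); first exact: measurable_funM.
    rewrite sqZ //; apply: lee_wpmul2l; first by rewrite lee_fin sqr_ge0.
    apply: le_trans (sq_add2 _ _) _; try exact: measurableT_comp.
    have A1 : sq (fun x => `|H1 (cut b1 N) (- x)|) = ((@kappa R)%:E * sq (cut b1 N))%E.
      rewrite -E1 -(sq_reflect (proj1 lH1)); apply: eq_integral => x _.
      by rewrite real_normK // num_real.
    have A2 : sq (fun x => `|H1 (cut b2 N) x|) = ((@kappa R)%:E * sq (cut b2 N))%E.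
      rewrite -E2; apply: eq_integral => x _.
      by rewrite real_normK // num_real.
    have K0 : (0 <= (@kappa R)%:E)%E by rewrite lee_fin ltW.
    have t0 : (0 <= 2%:E :> \bar R)%E by [].
    rewrite A1 A2; apply: leeD.
      exact: (lee_wpmul2l t0 (lee_wpmul2l K0 c1)).
    exact: (lee_wpmul2l t0 (lee_wpmul2l K0 c2)).
  have EE (a k r : R) : (a%:E * (2%:E * (k%:E * r%:E) + 2%:E * (k%:E * r%:E)) =
    (a * (2 * (k * r) + 2 * (k * r)))%:E)%E by [].
  rewrite EE sw (sq_nrm (lc0 N)) -!EFinM !lee_fin => h.
  rewrite -(ler_pM2l k0); apply: le_trans h _.
  by rewrite le_eqVlt; apply/orP; left; apply/eqP; ring.
have z : sq (fun x => sbump 0 * w x) = 0%E.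
  apply/eqP; rewrite eq_le sq_ge0 andbT; apply/lee_addgt0Pr => d d0; rewrite add0e.
  apply: (@sq_fatou R (cut (@sbump R))).
  - by move=> N; case: (lc0 N).
  - exact: measurable_funM.
  - apply: aeW => x.
    have H : e N * x @[N --> \oo] --> 0 * x by apply: cvgM; [exact: cvg_harmonic|exact: cvg_cst].
    rewrite mul0r in H.
    have H2 : sbump (e N * x) @[N --> \oo] --> @sbump R 0.
      by apply: (cvg_comp _ _ H); exact: (smooth_continuous s0).
    rewrite (mulrC (sbump 0)); exact: (cvgM (cvg_cst (w x)) H2).
  have c : 4 * e N ^+ 2 * C ^+ 2 * nrm w ^+ 2 @[N --> \oo] --> 4 * (0 * 0) * C ^+ 2 * nrm w ^+ 2.
    apply: cvgM; last exact: cvg_cst; apply: cvgM; last exact: cvg_cst.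
    apply: cvgM; first exact: cvg_cst.
    by apply: (cvgM (f := e) (g := e)); exact: cvg_harmonic.
  rewrite !mulr0 !mul0r in c; have /cvgr0_norm_le/(_ _ d0) := c.
  apply: filterS => N hN; apply: le_trans (small N) _.
  rewrite (sq_nrm lw) -EFinM lee_fin.
  by apply: le_trans (ler_norm _) hN.
have := sq_eq0 (measurable_funM (measurable_cst _) mw) z.
apply: filterS => x /eqP; rewrite mulf_eq0 => /orP[|/eqP //].
by rewrite (gt_eqF bump0_gt0).
Qed.

End inverse_operator.

(** * The inverse operator on L2 *)

Section inverse_operator_spec.
Context {R : realType}.
Notation mu := (@lebesgue_measure R).
Implicit Types (f g h k u v w phi : R -> R).
Local Notation kappa := (@kappa R).

Lemma L2_nice_int w phi : L2 w -> nice phi -> L1 (fun x => w x * phi x).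
Proof. by move=> lw np; exact: L2_mul_integrable lw (nice_L2 np). Qed.

Lemma inv_dx_unique f w w' : is_inv_dx f w -> is_inv_dx f w' ->
  {ae mu, forall x, w x = w' x}.
Proof.
move=> [/L2P lw Hw] [/L2P lw' Hw'].
have : {ae mu, forall x, (fun x => w x - w' x) x = 0}.
  apply: inv_dx_kernel; first exact: L2B.
  move=> phi tphi; have [n1 _] := test_psi_nice tphi.
  have -> : \int[mu]_x ((w x - w' x) * (phi x - derive1n 2 phi x)) =
      \int[mu]_x (w x * (phi x - derive1n 2 phi x)) - \int[mu]_x (w' x * (phi x - derive1n 2 phi x)).
    rewrite -RintegralB //; try exact: L2_nice_int.
    by apply: eq_Rintegral => x _; rewrite mulrBl.
  by rewrite Hw // Hw' // subrr.
by apply: filterS => x /eqP; rewrite subr_eq0 => /eqP.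
Qed.

Lemma inv_dx_spec f w : is_inv_dx f w ->
  is_inv_dx f (inv_dx f) /\ {ae mu, forall x, w x = inv_dx f x}.
Proof.
move=> H; have S : is_inv_dx f (inv_dx f) := xgetPex (cst 0) (ex_intro _ w H).
by split => //; exact: inv_dx_unique H S.
Qed.

Lemma inv_dx_L1 f : L1 f ->
  is_inv_dx f (inv_dx f) /\ is_hart (inv_dx f) (fun xi => - sym xi * H1 f (- xi)).
Proof.
move=> lf; have [S E] : is_inv_dx f (inv_dx f) /\ {ae mu, forall x, gconv f x = inv_dx f x}.
  apply: inv_dx_spec; split; first by apply/L2P; exact: L2_conv.
  by move=> phi; exact: conv_weak.
split; first exact: S.
apply: (hart_ael (hart_conv lf) _ E).
by case: S => /L2P[].
Qed.

Lemma sym_le1 (xi : R) : `|sym xi| <= 1.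
Proof.
have D0 := jb_base_gt0 xi.
rewrite /sym normrM normfV (gtr0_norm D0) ler_pdivrMr // mul1r.
by rewrite -(real_normK (num_real xi)); have := sqr_ge0 (2^-1 - `|xi|); nra.
Qed.

Lemma symN (xi : R) : sym (- xi) = - sym xi.
Proof. by rewrite /sym sqrrN mulNr. Qed.

Lemma measurable_sym : measurable_fun setT (@sym R).
Proof.
have -> : @sym R = fun xi => xi * jb (- 2) xi.
  apply/funext => xi; rewrite /sym /jb mulNr divff // powR_inv1 // ltW //.
by apply: measurable_funM => //; exact: measurable_jb.
Qed.

Lemma measurable_symM h : measurable_fun setT h ->
  measurable_fun setT (fun xi : R => - sym xi * h (- xi)).
Proof.
move=> mh; apply: measurable_funM; last exact: measurable_reflect.
by apply: measurableT_comp => //; exact: measurable_sym.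
Qed.

Lemma L2_symM h : L2 h -> L2 (fun xi => - sym xi * h (- xi)).
Proof.
move=> lh; apply: (L2_le _ _ (L2_reflect lh)); first by apply: measurable_symM; case: lh.
by move=> x; rewrite normrM normrN ler_piMl // sym_le1.
Qed.

Lemma cvg_pair_nice (u : nat -> R -> R) w phi : (forall n, L2 (u n)) -> L2 w -> nice phi ->
  sq (fun x => u n x - w x) @[n --> \oo] --> 0%E ->
  \int[mu]_x (u n x * phi x) @[n --> \oo] --> \int[mu]_x (w x * phi x).
Proof.
move=> lu lw np c; apply/cvgrPdist_le => e e0.
have lp := nice_L2 np.
have c0 : nrm (fun x => u n x - w x) * nrm phi @[n --> \oo] --> 0.
  by rewrite -(mul0r (nrm phi)); apply: cvgM; [exact: nrm_cvg0|exact: cvg_cst].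
have /cvgr0_norm_le/(_ _ e0) := c0; apply: filterS => n hn.
rewrite distrC -RintegralB //; try exact: L2_nice_int.
have -> : \int[mu]_x (u n x * phi x - w x * phi x) = \int[mu]_x ((u n x - w x) * phi x).
  by apply: eq_Rintegral => x _; rewrite mulrBl.
apply: le_trans (L2_integral_bound (L2B (lu n) lw) lp) _.
exact: le_trans (ler_norm _) hn.
Qed.

Lemma inv_dx_L2 f h : is_hart f h ->
  is_inv_dx f (inv_dx f) /\ is_hart (inv_dx f) (fun xi => - sym xi * h (- xi)).
Proof.
move=> hf; have lf := hart_L2l hf; have lh := hart_L2r hf; have [_ _ ch] := hf.
have [mh _] := lh.
have ln n := tr_L1 n lf.
pose w n := gconv (tr n f); pose k n xi := - sym xi * H1 (tr n f) (- xi).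
have hw n : is_hart (w n) (k n) by exact: hart_conv.
have lk := L2_symM lh; have [mk _] := lk.
have mkn n : measurable_fun setT (k n) by case: (hart_L2r (hw n)).
have ck : sq (fun xi => k n xi - - sym xi * h (- xi)) @[n --> \oo] --> 0%E.
  apply/(@sq_cvg0P R (fun n xi => k n xi - - sym xi * h (- xi))) => e e0.
  have /(@sq_cvg0P R (fun n xi => H1 (tr n f) xi - h xi))/(_ _ e0) := ch.
  apply: filterS => n; have md := measurable_funB (measurable_H1_tr n lf) mh.
  rewrite -(sq_reflect md); apply: le_trans; apply: le_sq.
  - exact: measurable_funB.
  - exact: measurable_reflect md.
  move=> xi; rewrite /k -mulrBr normrM normrN ler_piMl // sym_le1 //.
have k0 := @kappa_gt0 R.
have [||w0 [_ [lw cw _ _]]] := @riesz_fischer R w.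
- by move=> n; exact: hart_L2l (hw n).
- move=> e e0.
  have d0 : 0 < kappa * e / 4 by rewrite divr_gt0 // mulr_gt0.
  have /(@sq_cvg0P R (fun n xi => k n xi - - sym xi * h (- xi)))/(_ _ d0) [N _ HN] := ck.
  exists N => m n Nm Nn; have P := plancherel (hartB (hw m) (hw n)).
  have : (kappa%:E * sq (fun x => w m x - w n x)%R <= (kappa * e)%:E)%E.
    rewrite -P.
    have -> : sq (fun x => k m x - k n x) = sq (fun x => (k m x - - sym x * h (- x)) +
        - (k n x - - sym x * h (- x))) by apply: eq_sq => x; ring.
    have mm i : measurable_fun setT (fun x : R => k i x - - sym x * h (- x)).
      exact: measurable_funB.
    apply: le_trans (sq_add2 (mm m) (measurableT_comp (@oppr_measurable R setT) (mm n))) _.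
    rewrite sqN; apply: (@le_trans _ _ (2%:E * (kappa * e / 4)%:E + 2%:E * (kappa * e / 4)%:E)%E).
      by apply: leeD; apply: lee_wpmul2l => //; exact: HN.
    have EE (r : R) : (2%:E * r%:E + 2%:E * r%:E = (2 * r + 2 * r)%:E)%E by [].
    by rewrite EE lee_fin; lra.
  have lww := L2B (hart_L2l (hw m)) (hart_L2l (hw n)).
  by rewrite (sq_nrm lww) -EFinM !lee_fin ler_pM2l.
have hw0 : is_hart w0 (fun xi => - sym xi * h (- xi)) by exact: hart_closed hw lw lk cw ck.
have [S E] : is_inv_dx f (inv_dx f) /\ {ae mu, forall x, w0 x = inv_dx f x}.
  apply: inv_dx_spec; split; first exact/L2P.
  move=> phi tphi; have [n1 n2] := test_psi_nice tphi.
  have c1 := cvg_pair_nice (fun n => hart_L2l (hw n)) lw n1 cw.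
  have c2 := cvg_pair_nice (fun n => L2_tr n lf) lf n2 (sq_cvg_tr lf).
  have c3 : \int[mu]_x (w n x * (phi x - derive1n 2 phi x)) @[n --> \oo] -->
      - \int[mu]_x (f x * derive1 phi x).
    under eq_fun do rewrite conv_weak //.
    exact: cvgN.
  exact: cvg_unique c1 c3.
split; first exact: S.
apply: (hart_ael hw0 _ E).
by case: S => /L2P[].
Qed.

(** Multiplication by [cas (x xi)] acts on the Hartley side by translations and
    reflections. *)
Lemma hart_modulate v b xi : is_hart v b -> is_hart (fun x => v x * cas (x * xi))
  (fun eta => 2^-1 * (b (xi - eta) + b (eta - xi) + b (xi + eta) - b (- xi - eta))).
Proof.
move=> [lv lb cb]; have [mv _] := lv; have [mb _] := lb.
have lvc : L2 (fun x => v x * cas (x * xi)).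
  apply: (L2_le _ _ (L2Z 2 lv)); first by apply: measurable_funM => //; exact: measurable_casM.
  by move=> x; rewrite !normrM (ger0_norm (_ : 0 <= 2)) // mulrC ler_wpM2r // cas_le2.
pose T1 g (eta : R) : R := g (xi - eta).
pose T2 g (eta : R) : R := g (eta - xi).
pose T3 g (eta : R) : R := g (xi + eta).
pose T4 g (eta : R) : R := g (- xi - eta).
have m1 g : measurable_fun setT g -> measurable_fun setT (T1 g) /\ sq (T1 g) = sq g.
  move=> mg; have E : T1 g = fun eta => (fun y => g (y + xi)) (- eta).
    by apply/funext => y; rewrite /T1 addrC.
  have ms := measurable_shift xi mg.
  by rewrite E; split; [exact: (measurable_reflect ms)|rewrite (sq_reflect ms); exact: sq_shift].
have m2 g : measurable_fun setT g -> measurable_fun setT (T2 g) /\ sq (T2 g) = sq g.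
  by move=> mg; split; [exact: (measurable_shift (- xi) mg)|exact: (sq_shift (- xi) mg)].
have m3 g : measurable_fun setT g -> measurable_fun setT (T3 g) /\ sq (T3 g) = sq g.
  move=> mg; have E : T3 g = fun eta => g (eta + xi) by apply/funext => y; rewrite /T3 addrC.
  by rewrite E; split; [exact: (measurable_shift xi mg)|exact: (sq_shift xi mg)].
have m4 g : measurable_fun setT g -> measurable_fun setT (T4 g) /\ sq (T4 g) = sq g.
  move=> mg; have E : T4 g = fun eta => (fun y => g (y - xi)) (- eta).
    by apply/funext => y; rewrite /T4 addrC.
  have ms := measurable_shift (- xi) mg.
  by rewrite E; split; [exact: (measurable_reflect ms)|rewrite (sq_reflect ms); exact: sq_shift].
have l1 g : L2 g -> L2 (T1 g) by move=> [mg lg]; have [a e] := m1 _ mg; split => //; rewrite e.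
have l2 g : L2 g -> L2 (T2 g) by move=> [mg lg]; have [a e] := m2 _ mg; split => //; rewrite e.
have l3 g : L2 g -> L2 (T3 g) by move=> [mg lg]; have [a e] := m3 _ mg; split => //; rewrite e.
have l4 g : L2 g -> L2 (T4 g) by move=> [mg lg]; have [a e] := m4 _ mg; split => //; rewrite e.
split => //.
  by apply: L2Z; apply: L2B; [apply: L2D; [apply: L2D|]|]; [exact: l1|exact: l2|exact: l3|exact: l4].
pose d n eta := H1 (tr n v) eta - b eta.
have md n : measurable_fun setT (d n) by apply: measurable_funB => //; exact: measurable_H1_tr.
have E n eta : H1 (tr n (fun x => v x * cas (x * xi))) eta -
    2^-1 * (b (xi - eta) + b (eta - xi) + b (xi + eta) - b (- xi - eta)) =
    2^-1 * ((T1 (d n) eta + T2 (d n) eta) + (T3 (d n) eta + - T4 (d n) eta)).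
  have -> : H1 (tr n (fun x => v x * cas (x * xi))) eta = 2^-1 *
      ((H1 (tr n v) (xi - eta) + H1 (tr n v) (eta - xi)) +
       (H1 (tr n v) (xi + eta) - H1 (tr n v) (- xi - eta))).
    have lc z := L1_cas z (tr_L1 n lv).
    have i1 := L1D (lc (xi - eta)) (lc (eta - xi)); have i2 := L1B (lc (xi + eta)) (lc (- xi - eta)).
    have e1 : H1 (tr n v) (xi - eta) + H1 (tr n v) (eta - xi) = \int[mu]_x
        (tr n v x * cas (x * (xi - eta)) + tr n v x * cas (x * (eta - xi))).
      by rewrite (RintegralD measurableT (lc _) (lc _)).
    have e2 : H1 (tr n v) (xi + eta) - H1 (tr n v) (- xi - eta) = \int[mu]_x
        (tr n v x * cas (x * (xi + eta)) - tr n v x * cas (x * (- xi - eta))).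
      by rewrite (RintegralB measurableT (lc _) (lc _)).
    rewrite e1 e2 -(RintegralD measurableT i1 i2) -(RintegralZl _ measurableT (L1D i1 i2)) /H1.
    apply: eq_Rintegral => x _; rewrite /tr.
    have c0 := casM (x * xi) (x * eta).
    have c1 : cas (x * (xi - eta)) = cos (x * xi - x * eta) + sin (x * xi - x * eta).
      by rewrite mulrBr.
    have c2 : cas (x * (eta - xi)) = cos (x * xi - x * eta) - sin (x * xi - x * eta).
      by rewrite -opprB mulrN mulrBr /cas cosN sinN.
    have c3 : cas (x * (xi + eta)) = cos (x * xi + x * eta) + sin (x * xi + x * eta).
      by rewrite mulrDr.
    have c4 : cas (x * (- xi - eta)) = cos (x * xi + x * eta) - sin (x * xi + x * eta).
      by rewrite -opprD mulrN mulrDr /cas cosN sinN.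
    have -> : v x * cas (x * xi) * \1_(box n) x * cas (x * eta) =
       v x * \1_(box n) x * (cas (x * xi) * cas (x * eta)) by ring.
    by rewrite c0 c1 c2 c3 c4; field.
  by rewrite /d /T1 /T2 /T3 /T4; ring.
have cd : sq (d n) @[n --> \oo] --> 0%E by [].
have c1 : sq (T1 (d n)) @[n --> \oo] --> 0%E.
  by under eq_fun => n do rewrite (proj2 (m1 _ (md n))).
have c2 : sq (T2 (d n)) @[n --> \oo] --> 0%E.
  by under eq_fun => n do rewrite (proj2 (m2 _ (md n))).
have c3 : sq (T3 (d n)) @[n --> \oo] --> 0%E.
  by under eq_fun => n do rewrite (proj2 (m3 _ (md n))).
have c4 : sq (T4 (d n)) @[n --> \oo] --> 0%E.
  by under eq_fun => n do rewrite (proj2 (m4 _ (md n))).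
have t1 n := proj1 (m1 _ (md n)); have t2 n := proj1 (m2 _ (md n)).
have t3 n := proj1 (m3 _ (md n)); have t4 n := proj1 (m4 _ (md n)).
have t4' n : measurable_fun setT (fun x => - T4 (d n) x) by exact: measurableT_comp.
under eq_fun => n do under eq_sq => eta do rewrite E.
apply: sq_cvgZ.
  by move=> n; apply: measurable_funD; exact: measurable_funD.
apply: sq_cvg_add; [by move=> n; exact: measurable_funD|by move=> n; exact: measurable_funD| |].
  exact: sq_cvg_add.
by apply: sq_cvg_add => //; exact: sq_cvgN.
Qed.

End inverse_operator_spec.

(** * Products and norms in Sobolev spaces *)

Section sobolev.
Context {R : realType}.
Notation mu := (@lebesgue_measure R).
Implicit Types (f g h k u v w a b : R -> R) (s : R).
Local Notation kappa := (@kappa R).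

Lemma nrm_sqr f : nrm f ^+ 2 = \int[mu]_x (f x ^+ 2).
Proof. by rewrite /nrm sqr_sqrtr //; exact/fine_ge0/sq_ge0. Qed.

Lemma nrm_sqrD f g : L2 f -> L2 g ->
  nrm (fun x => f x + g x) ^+ 2 = nrm f ^+ 2 + nrm g ^+ 2 + 2 * \int[mu]_x (f x * g x).
Proof.
move=> lf lg; have i1 := sq_integrable lf; have i2 := sq_integrable lg.
have i3 := L2_mul_integrable lf lg.
have i4 : L1 (fun x => 2 * (f x * g x)) := L1Z 2 i3.
have i5 : L1 (fun x => f x ^+ 2 + g x ^+ 2) := L1D i1 i2.
rewrite !nrm_sqr -(RintegralZl _ measurableT i3) -(RintegralD measurableT i1 i2).
rewrite -(RintegralD measurableT i5 i4).
by apply: eq_Rintegral => x _; ring.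
Qed.

Lemma nrmD f g : L2 f -> L2 g -> nrm (fun x => f x + g x) <= nrm f + nrm g.
Proof.
move=> lf lg; rewrite -(ler_pXn2r (isT : (0 < 2)%N)) ?nnegrE ?addr_ge0 ?nrm_ge0 //.
rewrite nrm_sqrD //; have := L2_integral_bound lf lg.
have := ler_norm (\int[mu]_x (f x * g x)).
move: (\int[mu]_x _) (nrm f) (nrm g) => I a b h1 h2.
have h3 := le_trans h1 h2; rewrite [leRHS]sqrrD.
have h4 : 2 * I <= a * b *+ 2 by rewrite mulr2n; lra.
lra.
Qed.

Lemma nrmZ c f : L2 f -> nrm (fun x => c * f x) = `|c| * nrm f.
Proof.
move=> lf; have E : nrm (fun x => c * f x) ^+ 2 = (`|c| * nrm f) ^+ 2.
  rewrite exprMn !nrm_sqr real_normK ?num_real // -(RintegralZl _ measurableT (sq_integrable lf)).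
  by apply/eq_Rintegral => x _; rewrite exprMn.
by apply: (@pexpIrn R 2) E => //; rewrite nnegrE ?mulr_ge0 ?nrm_ge0.
Qed.

Lemma nrm_mono f g : L2 g -> measurable_fun setT f -> (forall x, `|f x| <= `|g x|) ->
  nrm f <= nrm g.
Proof.
move=> lg mf fg; apply: nrm_le => //; rewrite -sq_nrm //; apply: le_sq => //; by case: lg.
Qed.

Lemma wgt_abs s h xi : `|wgt s h xi| = jb s xi * `|h xi|.
Proof. by rewrite /wgt normrM ger0_norm // jb_ge0. Qed.

Lemma L2_wgt s h : 0 <= s -> measurable_fun setT h -> L2 (wgt s h) -> L2 h.
Proof.
move=> s0 mh; apply: L2_le => // x; rewrite wgt_abs ler_peMl //; exact: jb_ge1.
Qed.

(** Peetre's inequality distributes the weight at [xi] over the two factors. *)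
Lemma peetre_pairing s a b (rho : R -> R) xi : 0 <= s -> L2 (wgt s a) -> L2 a -> L2 b ->
  L2 (wgt s b) -> (forall k, L2 k -> L2 (k \o rho) /\ nrm (k \o rho) = nrm k) ->
  (forall eta, jb s xi <= 2 `^ (s / 2) * jb s eta * jb s (rho eta)) ->
  jb s xi * `|\int[mu]_eta (a eta * b (rho eta))| <=
    2 `^ (s / 2) * (nrm (wgt s a) * nrm (wgt s b)).
Proof.
move=> s0 lwa la lb lwb inv pe; have [lwr nr] := inv _ lwb; have [lbr _] := inv _ lb.
have c0 : 0 <= 2 `^ (s / 2) :> R by exact: powR_ge0.
have i1 : L1 (fun x => a x * b (rho x)) := L2_mul_integrable la lbr.
have laa := L2_abs lwa; have lra := L2_abs lwr.
have i2 : L1 (fun x => `|wgt s a x| * `|(wgt s b \o rho) x|) := L2_mul_integrable laa lra.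
apply: (@le_trans _ _ (\int[mu]_x (2 `^ (s / 2) * (`|wgt s a x| * `|(wgt s b \o rho) x|)))).
  rewrite -(ger0_norm (jb_ge0 s xi)) -normrM -(RintegralZl _ measurableT i1).
  apply: le_trans (Rint_le_abs (L1Z _ i1)) _.
  apply: (le_Rintegral measurableT (L1_abs (L1Z _ i1)) (L1Z _ i2)) => x _ /=.
  have -> : `|jb s xi * (a x * b (rho x))| = jb s xi * (`|a x| * `|b (rho x)|).
    by rewrite !normrM (ger0_norm (jb_ge0 _ _)).
  rewrite (wgt_abs s a) (wgt_abs s b).
  have -> : 2 `^ (s / 2) * (jb s x * `|a x| * (jb s (rho x) * `|b (rho x)|)) =
     2 `^ (s / 2) * jb s x * jb s (rho x) * (`|a x| * `|b (rho x)|) by ring.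
  by apply: ler_wpM2r (pe x); rewrite mulr_ge0.
rewrite (RintegralZl _ measurableT i2) ler_wpM2l // -nr.
apply: le_trans (ler_norm _) _; apply: le_trans (L2_integral_bound laa lra) _.
have e1 g : nrm (fun x => `|g x|) = nrm g.
  by rewrite /nrm /sq; congr (Num.sqrt (fine _)); apply: eq_integral => x _; rewrite real_normK ?num_real.
by rewrite !e1.
Qed.

Definition bilC s : R := kappa^-1 * (2 * 2 `^ (s / 2)).

Lemma bilC_ge0 s : 0 <= bilC s.
Proof. by rewrite mulr_ge0 ?invr_ge0 ?kappa_ge0 // mulr_ge0 ?powR_ge0. Qed.

(** The transform of a product is a convolution of transforms; the weight is
    submultiplicative, so Cauchy-Schwarz bounds it pointwise. *)
Lemma H1_product_bound s u v a b xi : 0 <= s -> is_hart u a -> is_hart v b ->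
  L2 (wgt s a) -> L2 (wgt s b) ->
  jb s xi * `|H1 (fun x => u x * v x) xi| <= bilC s * (nrm (wgt s a) * nrm (wgt s b)).
Proof.
move=> s0 hu hv wa wb; have la := hart_L2r hu; have lb := hart_L2r hv.
have hm := hart_modulate xi hv.
have P := parseval hu hm; have k0 := @kappa_gt0 R.
have E : H1 (fun x => u x * v x) xi = kappa^-1 * \int[mu]_x (a x *
    (2^-1 * (b (xi - x) + b (x - xi) + b (xi + x) - b (- xi - x)))).
  rewrite P mulKf ?lt0r_neq0 // /H1; apply: eq_Rintegral => x _; ring.
pose r1 (x : R) := xi - x; pose r2 (x : R) := x - xi.
pose r3 (x : R) := xi + x; pose r4 (x : R) := - xi - x.
have v1 k : L2 k -> L2 (k \o r1) /\ nrm (k \o r1) = nrm k.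
  move=> lk; have ls := L2_shift xi lk; have [mk _] := lk; have [ms _] := ls.
  have -> : k \o r1 = fun x => (fun y => k (y + xi)) (- x) by apply/funext => x /=; rewrite /r1 addrC.
  by split; [exact: (L2_reflect ls)|rewrite /nrm (sq_reflect ms) (sq_shift xi mk)].
have v2 k : L2 k -> L2 (k \o r2) /\ nrm (k \o r2) = nrm k.
  by move=> lk; have [mk _] := lk; split; [exact: (L2_shift (- xi) lk)|rewrite /nrm (sq_shift (- xi) mk)].
have v3 k : L2 k -> L2 (k \o r3) /\ nrm (k \o r3) = nrm k.
  move=> lk; have [mk _] := lk.
  have -> : k \o r3 = fun x => k (x + xi) by apply/funext => x /=; rewrite /r3 addrC.
  by split; [exact: (L2_shift xi lk)|rewrite /nrm (sq_shift xi mk)].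
have v4 k : L2 k -> L2 (k \o r4) /\ nrm (k \o r4) = nrm k.
  move=> lk; have ls := L2_shift (- xi) lk; have [mk _] := lk; have [ms _] := ls.
  have -> : k \o r4 = fun x => (fun y => k (y - xi)) (- x) by apply/funext => x /=; rewrite /r4 addrC.
  by split; [exact: (L2_reflect ls)|rewrite /nrm (sq_reflect ms) (sq_shift (- xi) mk)].
have p1 x : jb s xi <= 2 `^ (s / 2) * jb s x * jb s (r1 x).
  have := jb_peetre x (r1 x) s0; rewrite /r1 (_ : x + (xi - x) = xi) //; ring.
have p2 x : jb s xi <= 2 `^ (s / 2) * jb s x * jb s (r2 x).
  by have := p1 x; rewrite /r1 -opprB jbN.
have p3 x : jb s xi <= 2 `^ (s / 2) * jb s x * jb s (r3 x).
  have := jb_peetre (- x) (r3 x) s0; rewrite jbN /r3 (_ : - x + (xi + x) = xi) //; ring.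
have p4 x : jb s xi <= 2 `^ (s / 2) * jb s x * jb s (r4 x).
  by have := p3 x; rewrite /r3 /r4 -opprD jbN.
have q1 := peetre_pairing s0 wa la lb wb v1 p1.
have q2 := peetre_pairing s0 wa la lb wb v2 p2.
have q3 := peetre_pairing s0 wa la lb wb v3 p3.
have q4 := peetre_pairing s0 wa la lb wb v4 p4.
have j1 : L1 (fun x => a x * b (r1 x)) := L2_mul_integrable la (proj1 (v1 _ lb)).
have j2 : L1 (fun x => a x * b (r2 x)) := L2_mul_integrable la (proj1 (v2 _ lb)).
have j3 : L1 (fun x => a x * b (r3 x)) := L2_mul_integrable la (proj1 (v3 _ lb)).
have j4 : L1 (fun x => a x * b (r4 x)) := L2_mul_integrable la (proj1 (v4 _ lb)).
have E2 : \int[mu]_x (a x * (2^-1 * (b (xi - x) + b (x - xi) + b (xi + x) - b (- xi - x)))) =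
   2^-1 * (\int[mu]_x (a x * b (r1 x)) + \int[mu]_x (a x * b (r2 x)) +
           (\int[mu]_x (a x * b (r3 x)) - \int[mu]_x (a x * b (r4 x)))).
  rewrite -(RintegralD measurableT j1 j2) -(RintegralB measurableT j3 j4).
  rewrite -(RintegralD measurableT (L1D j1 j2) (L1B j3 j4)).
  rewrite -(RintegralZl _ measurableT (L1D (L1D j1 j2) (L1B j3 j4))).
  by apply: eq_Rintegral => x _; rewrite /r1 /r2 /r3 /r4; ring.
rewrite E E2 normrM (ger0_norm (_ : 0 <= kappa^-1)) ?invr_ge0 ?kappa_ge0 //.
rewrite mulrCA /bilC -mulrA ler_wpM2l ?invr_ge0 ?kappa_ge0 //.
rewrite normrM (ger0_norm (_ : 0 <= 2^-1)) //.
move: q1 q2 q3 q4.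
set I1 := \int[mu]_x _; set I2 := \int[mu]_x _; set I3 := \int[mu]_x _; set I4 := \int[mu]_x _.
set c := 2 `^ _; set M := _ * nrm _ => q1 q2 q3 q4.
have T : `|I1 + I2 + (I3 - I4)| <= `|I1| + `|I2| + (`|I3| + `|I4|).
  by apply: le_trans (ler_normD _ _) _; apply: lerD; [exact: ler_normD|exact: ler_normB].
have := ler_wpM2l (jb_ge0 s xi) T; rewrite !mulrDr mulrCA -[2 * c * M]mulrA.
move: (jb s xi * _) q1 q2 q3 q4 => Y.
move: (jb s xi * _) (jb s xi * _) (jb s xi * _) (jb s xi * _) (c * M).
move=> *; lra.
Qed.

Lemma sym_weight xi : jb 4^-1 xi * `|@sym R xi| <= jb (- (3 / 4)) xi.
Proof.
have D0 := jb_base_gt0 xi.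
have E : `|sym xi| <= jb (- 1) xi.
  have e2 : jb (- 2) xi = (1 + xi ^+ 2)^-1.
    by rewrite /jb mulNr divff // powR_inv1 // ltW.
  have x1 : `|xi| <= jb 1 xi.
    rewrite -(ler_pXn2r (isT : (0 < 2)%N)) ?nnegrE ?jb_ge0 // jb_sqr powRr1 ?(ltW D0) //.
    by rewrite real_normK ?num_real // lerDr.
  rewrite /sym normrM normfV (gtr0_norm D0) -e2.
  have -> : (-1 : R) = 1 + - 2 by lra.
  by rewrite jbD ler_wpM2r // jb_ge0.
have -> : - (3 / 4) = 4^-1 + - 1 :> R by lra.
by rewrite jbD ler_wpM2l // jb_ge0.
Qed.

Lemma L2_jb : L2 (@jb R (- (3 / 4))).
Proof.
split; first exact: measurable_jb.
have /integrableP[_ L] := @L1_jb_decay R.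
suff -> : sq (@jb R (- (3 / 4))) = (\int[mu]_x `|(EFin \o jb (- (3 / 2))) x|)%E by exact: L.
rewrite /sq; apply: eq_integral => x _ /=.
rewrite ger0_norm ?jb_ge0 // expr2 -jbD; congr (jb _ _)%:E; lra.
Qed.

Definition smoothC s : R := bilC s * nrm (@jb R (- (3 / 4))).

Lemma smoothC_ge0 s : 0 <= smoothC s.
Proof. by apply: mulr_ge0; [exact: bilC_ge0|exact: nrm_ge0]. Qed.

(** The operator gains one derivative, and the convolution bound loses a bit
    more than half of one; a quarter of a derivative is left over. *)
Lemma inv_dx_product s u v a b : 0 <= s -> is_hart u a -> is_hart v b ->
  L2 (wgt s a) -> L2 (wgt s b) ->
  exists k, [/\ is_inv_dx (fun x => u x * v x) (inv_dx (fun x => u x * v x)),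
    is_hart (inv_dx (fun x => u x * v x)) k, L2 (wgt (s + 4^-1) k) &
    nrm (wgt (s + 4^-1) k) <= smoothC s * nrm (wgt s a) * nrm (wgt s b)].
Proof.
move=> s0 hu hv wa wb; pose p x := u x * v x.
have lp : L1 p := L2_mul_integrable (hart_L2l hu) (hart_L2l hv).
have [S hp] := inv_dx_L1 lp.
pose k xi := - sym xi * H1 p (- xi); exists k.
have mk : measurable_fun setT k by apply: measurable_symM; exact: measurable_H1.
pose M := bilC s * (nrm (wgt s a) * nrm (wgt s b)).
have M0 : 0 <= M by apply: mulr_ge0; [exact: bilC_ge0|exact: mulr_ge0 (nrm_ge0 _) (nrm_ge0 _)].
have B xi : `|wgt (s + 4^-1) k xi| <= `|M * jb (- (3 / 4)) xi|.
  have -> : `|M * jb (- (3 / 4)) xi| = M * jb (- (3 / 4)) xi.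
    by rewrite ger0_norm // mulr_ge0 // jb_ge0.
  have kE : `|k xi| = `|sym xi| * `|H1 p (- xi)| by rewrite /k normrM normrN.
  rewrite wgt_abs jbD kE.
  have h1 := H1_product_bound (- xi) s0 hu hv wa wb; have h2 := sym_weight xi.
  rewrite jbN in h1.
  have -> : jb s xi * jb 4^-1 xi * (`|sym xi| * `|H1 p (- xi)|) =
    (jb s xi * `|H1 p (- xi)|) * (jb 4^-1 xi * `|sym xi|) by ring.
  by apply: ler_pM h1 h2; apply: mulr_ge0; rewrite ?jb_ge0 ?normr_ge0.
have lj := L2Z M L2_jb; have mw := measurable_wgt (s + 4^-1) mk.
have lk := L2_le mw B lj.
split; [exact: S|exact: hp|exact: lk|].
apply: le_trans (nrm_mono lj mw B) _.
rewrite (nrmZ _ L2_jb) (ger0_norm M0).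
by rewrite /smoothC /M le_eqVlt; apply/orP; left; apply/eqP; ring.
Qed.

(** ** The norm of H^s *)

Lemma HsP s f : (Hs_norm s f < +oo)%E <-> exists2 h, is_hart f h & L2 (wgt s h).
Proof.
split=> [fs|[h hf lw]].
  have lf : L2 f by apply: contrapT => /Hs_norm_infty E; rewrite E ltxx in fs.
  have [h hf] := hart_exists lf; exists h => //.
  split; first by apply: measurable_wgt; case: (hart_L2r hf).
  by move: fs; rewrite (Hs_normE s hf); apply: lty_poweRy; rewrite invr_neq0 ?pnatr_eq0.
by rewrite (Hs_normE s hf) L2_sqrt // ltry.
Qed.

Lemma HsE s f h : is_hart f h -> L2 (wgt s h) -> Hs_norm s f = (nrm (wgt s h))%:E.
Proof. by move=> hf lw; rewrite (Hs_normE s hf) L2_sqrt. Qed.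

Lemma Hs_ge0 s f : (0 <= Hs_norm s f)%E.
Proof.
apply/ereal_infP => _ [g _ <-]; exact: poweR_ge0.
Qed.

Lemma wgtD s h k : wgt s (fun x => h x + k x) = fun x => wgt s h x + wgt s k x.
Proof. by apply/funext => x; rewrite /wgt mulrDr. Qed.

Lemma wgtZ s c h : wgt s (fun x => c * h x) = fun x => c * wgt s h x.
Proof. by apply/funext => x; rewrite /wgt mulrCA. Qed.

Lemma HsD s f g : (Hs_norm s (fun x => f x + g x)%R <= Hs_norm s f + Hs_norm s g)%E.
Proof.
have [fs|] := ltP (Hs_norm s f) +oo%E; last first.
  by rewrite leye_eq => /eqP ->; rewrite addye ?leey // gt_eqF // (lt_le_trans _ (Hs_ge0 _ _)).
have [gs|] := ltP (Hs_norm s g) +oo%E; last first.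
  by rewrite leye_eq => /eqP ->; rewrite addey ?leey // gt_eqF // (lt_le_trans _ (Hs_ge0 _ _)).
have [h hf lh] := (HsP s f).1 fs; have [k hg lk] := (HsP s g).1 gs.
rewrite (HsE (hartD hf hg)) wgtD; last exact: L2D.
by rewrite (HsE hf lh) (HsE hg lk) -EFinD lee_fin nrmD.
Qed.

Lemma HsZ s c f : (Hs_norm s f < +oo)%E ->
  Hs_norm s (fun x => c * f x)%R = (`|c|%:E * Hs_norm s f)%E.
Proof.
move=> /HsP[h hf lh]; rewrite (HsE (hartZ c hf)) wgtZ; last exact: L2Z.
by rewrite (HsE hf lh) -EFinM nrmZ.
Qed.

Lemma Hs_L2 s f : (Hs_norm s f < +oo)%E -> L2 f.
Proof. by move=> /HsP[h hf _]; exact: hart_L2l hf. Qed.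

Lemma Hs_ae s f g : L2 f -> L2 g -> {ae mu, forall x, f x = g x} -> Hs_norm s f = Hs_norm s g.
Proof.
move=> lf [mg _] fg; have [h hf] := hart_exists lf.
by rewrite (Hs_normE s hf) (Hs_normE s (hart_ael hf mg fg)).
Qed.

Lemma hart0 : is_hart (fun=> 0) (fun=> 0 : R).
Proof.
have [h hh] := hart_exists (@L2_cst0 R); have := hartZ 0 hh.
by under eq_fun do rewrite mul0r; under [X in is_hart _ X]eq_fun do rewrite mul0r.
Qed.

Lemma Hs0 s : Hs_norm s (fun=> 0 : R) = 0%E.
Proof.
by rewrite (Hs_normE s hart0) /wgt; under eq_sq do rewrite mulr0; rewrite sq_cst0 poweR0r ?invr_neq0 ?pnatr_eq0.
Qed.

Lemma Hs_eq0 s f : Hs_norm s f = 0%E -> {ae mu, forall x, f x = 0}.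
Proof.
move=> f0; have /HsP[h hf lw] : (Hs_norm s f < +oo)%E by rewrite f0 ltry.
have lh := hart_L2r hf; have [mh _] := lh; have [mw _] := lw.
have n0 : nrm (wgt s h) = 0 by have := HsE hf lw; rewrite f0 => -[].
have w0 : sq (wgt s h) = 0%E by rewrite sq_nrm // n0 expr0n.
have h0 : {ae mu, forall x, h x = 0}.
  apply: filterS (sq_eq0 mw w0) => x /eqP; rewrite /wgt mulf_eq0 => /orP[|/eqP//].
  by rewrite gt_eqF // jb_gt0.
have := plancherel hf; rewrite (@ae_eq_sq _ h (fun=> 0)) // sq_cst0 => /esym/eqP.
have k0 := @kappa_gt0 R.
rewrite mule_eq0 gt_eqF ?lte_fin //= => /eqP sf.
by apply: sq_eq0 sf; case: (hart_L2l hf).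
Qed.

Lemma Hs_mono s r f : s <= r -> (Hs_norm s f <= Hs_norm r f)%E.
Proof.
move=> sr; have [|] := ltP (Hs_norm r f) +oo%E; last by rewrite leye_eq => /eqP ->; rewrite leey.
move=> /HsP[h hf lr]; have [mh _] := hart_L2r hf; have ms := measurable_wgt s mh.
have B x : `|wgt s h x| <= `|wgt r h x| by rewrite !wgt_abs ler_wpM2r // jb_mono.
by rewrite (HsE hf lr) (HsE hf (L2_le ms B lr)) lee_fin nrm_mono.
Qed.

(** The weighted transforms converge in L^2; as the weight is at least 1, so do
    the transforms and, by Plancherel, the functions. *)
Lemma Hs_complete s (f_ : nat -> R -> R) : 0 <= s -> (forall n, (Hs_norm s (f_ n) < +oo)%E) ->
  (forall e : R, 0 < e -> exists N, forall m n, (N <= m)%N -> (N <= n)%N ->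
     (Hs_norm s (fun x => f_ m x - f_ n x)%R <= e%:E)%E) ->
  exists f, (Hs_norm s f < +oo)%E /\
    Hs_norm s (fun x => f_ n x - f x)%R @[n --> \oo] --> 0%E.
Proof.
move=> s0 fs fc.
have /choice[h hh] n : exists h, is_hart (f_ n) h /\ L2 (wgt s h).
  by have [h ? ?] := (HsP s (f_ n)).1 (fs n); exists h.
have hf n := proj1 (hh n); have lw n := proj2 (hh n).
have wB m n : wgt s (fun x => h m x - h n x) = fun x => wgt s (h m) x - wgt s (h n) x.
  by apply/funext => x; rewrite /wgt mulrBr.
have mlw m n : L2 (fun x => wgt s (h m) x - wgt s (h n) x) by exact: L2B.
have [||k [_ [lk ck _ _]]] := @riesz_fischer R (fun n => wgt s (h n)).
- exact: lw.
- move=> e e0; have [|N HN] := fc (Num.sqrt e); first by rewrite sqrtr_gt0.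
  exists N => m n Nm Nn; have := HN m n Nm Nn.
  rewrite (HsE (hartB (hf m) (hf n))) wB; last exact: mlw.
  rewrite lee_fin sq_nrm ?lee_fin; last exact: mlw.
  by move=> H; rewrite -(sqr_sqrtr (ltW e0)) ler_pXn2r ?nnegrE ?sqrtr_ge0.
have [mk _] := lk.
pose h0 x := jb (- s) x * k x.
have jj x : jb s x * jb (- s) x = 1 by rewrite -jbD subrr jb0.
have wh0 : wgt s h0 = k by apply/funext => x; rewrite /wgt /h0 mulrA jj mul1r.
have mh0 : measurable_fun setT h0 by exact: measurable_wgt.
have lh0 : L2 h0 by apply: (L2_wgt s0 mh0); rewrite wh0.
have [mhn] : (forall n, measurable_fun setT (h n)) /\ True.
  by split => // n; case: (hart_L2r (hf n)).
move=> _.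
have ch : sq (fun x => h n x - h0 x) @[n --> \oo] --> 0%E.
  apply/(@sq_cvg0P R (fun n x => h n x - h0 x)) => e e0.
  have /(@sq_cvg0P R (fun n x => wgt s (h n) x - k x))/(_ _ e0) := ck.
  apply: filterS => n; apply: le_trans; apply: le_sq.
  - exact: measurable_funB.
  - by apply: measurable_funB => //; exact: measurable_wgt.
  move=> x; rewrite -wh0 /wgt -mulrBr normrM ler_peMl //.
  by rewrite ger0_norm ?jb_ge0 // jb_ge1.
have k0 := @kappa_gt0 R.
have [||f [_ [lf cf _ _]]] := @riesz_fischer R f_.
- by move=> n; exact: hart_L2l (hf n).
- move=> e e0; have [|N HN] := fc (Num.sqrt (kappa * e)); first by rewrite sqrtr_gt0 mulr_gt0.
  exists N => m n Nm Nn; have hb := hartB (hf m) (hf n).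
  have := HN m n Nm Nn; rewrite (HsE hb) wB; last exact: mlw.
  rewrite lee_fin -wB => H; have P := plancherel hb.
  have lb := hart_L2r hb; have lfb := hart_L2l hb.
  have : nrm (fun x => h m x - h n x) <= Num.sqrt (kappa * e).
    apply: le_trans H; apply: nrm_mono; [by rewrite wB|by case: lb|].
    by move=> x; rewrite wgt_abs ler_peMl // jb_ge1.
  move=> nb; have nb2 : nrm (fun x => h m x - h n x) ^+ 2 <= kappa * e.
    rewrite -[leRHS]sqr_sqrtr; last by rewrite mulr_ge0 // ltW.
    by rewrite ler_pXn2r ?nnegrE ?sqrtr_ge0 ?nrm_ge0.
  have e1 : sq (fun x => h m x - h n x) = (nrm (fun x => h m x - h n x) ^+ 2)%:E := sq_nrm lb.
  have e2 : sq (fun x => f_ m x - f_ n x) = (nrm (fun x => f_ m x - f_ n x) ^+ 2)%:E := sq_nrm lfb.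
  move: P; rewrite e1 e2 -EFinM => -[P].
  by rewrite lee_fin -(ler_pM2l k0) -P.
have hff : is_hart f h0 by exact: hart_closed hf lf lh0 cf ch.
have lw0 : L2 (wgt s h0) by rewrite wh0.
exists f; split; first by apply/HsP; exists h0.
have E n : Hs_norm s (fun x => f_ n x - f x) = (nrm (fun x => wgt s (h n) x - k x))%:E.
  have W : wgt s (fun x => h n x - h0 x) = fun x => wgt s (h n) x - k x.
    by apply/funext => x; rewrite -wh0 /wgt mulrBr.
  by rewrite (HsE (hartB (hf n) hff)) W //; exact: L2B.
under eq_fun do rewrite E.
by apply: cvg_EFin; [exact: nearW|exact: nrm_cvg0 ck].
Qed.

End sobolev.
#[export] Hint Extern 0 (is_true (@Order.le _ _ _ (Hs_norm _ _))) => exact: Hs_ge0 : core.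

(** * The spaces of pairs and the operators of the system *)

Opaque Hs_norm sq inv_dx.

Section bona_space.
Context {R : realType}.
Notation mu := (@lebesgue_measure R).
Notation V := (Xfun R).
Implicit Types (p q w : R -> R) (s : R) (f g u v : V).

(** ** Linearity of the inverse operator *)

Definition pairable p := forall k : R -> R, nice k -> L1 (fun x => p x * k x).

Lemma pairable_L2 p : L2 p -> pairable p.
Proof. by move=> lp k nk; exact: L2_nice_int. Qed.

Lemma pairable_L1 p : L1 p -> pairable p.
Proof. by move=> lp k [mk [M kM] _ _]; exact: L1_bdd lp mk kM. Qed.

Lemma is_inv_dx_lin c p q w w' : pairable p -> pairable q -> is_inv_dx p w ->
  is_inv_dx q w' -> is_inv_dx (fun x => c * p x + q x) (fun x => c * w x + w' x).
Proof.
move=> gp gq [/L2P lw Hw] [/L2P lw' Hw']; split; first exact/L2P/L2D/lw'/L2Z.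
move=> phi tphi; have [n1 n2] := test_psi_nice tphi.
pose psi x := phi x - derive1n 2 phi x.
have a1 := L2_nice_int lw n1; have a2 := L2_nice_int lw' n1.
have b1 := gp _ n2; have b2 := gq _ n2.
have -> : \int[mu]_x ((c * w x + w' x) * (phi x - derive1n 2 phi x)) =
    c * \int[mu]_x (w x * psi x) + \int[mu]_x (w' x * psi x).
  rewrite -(RintegralZl _ measurableT a1) -(RintegralD measurableT (L1Z c a1) a2).
  by apply: eq_Rintegral => x _; rewrite /psi; ring.
have -> : \int[mu]_x ((c * p x + q x) * derive1 phi x) =
    c * \int[mu]_x (p x * derive1 phi x) + \int[mu]_x (q x * derive1 phi x).
  rewrite -(RintegralZl _ measurableT b1) -(RintegralD measurableT (L1Z c b1) b2).
  by apply: eq_Rintegral => x _; ring.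
by rewrite (Hw _ tphi) (Hw' _ tphi); ring.
Qed.

Lemma inv_dx_lin c p q w w' : pairable p -> pairable q -> is_inv_dx p w ->
  is_inv_dx q w' -> {ae mu, forall x, inv_dx (fun x => c * p x + q x) x = c * w x + w' x}.
Proof.
move=> gp gq hw hw'; have [_] := inv_dx_spec (is_inv_dx_lin c gp gq hw hw').
by apply: filterS => x ->.
Qed.

(** ** The norm of X^s *)

Definition hn s p : R := fine (Hs_norm s p).

Lemma hn_ge0 s p : 0 <= hn s p. Proof. exact/fine_ge0/Hs_ge0. Qed.

Lemma hnE s p : (Hs_norm s p < +oo)%E -> Hs_norm s p = (hn s p)%:E.
Proof.
by move=> fp; rewrite /hn fineK // ge0_fin_numE //; exact: Hs_ge0.
Qed.

Lemma hn_hart s p h : is_hart p h -> L2 (wgt s h) -> hn s p = nrm (wgt s h).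
Proof. by move=> hp lw; rewrite /hn (HsE hp lw). Qed.

Lemma XsP s f : Xs s f <-> (Hs_norm s f.1 < +oo)%E /\ (Hs_norm s f.2 < +oo)%E.
Proof.
split=> [H|[H1 H2]]; last exact: (lte_add_pinfty H1 H2).
by split; apply: le_lt_trans H; [exact: (leeDl _ (Hs_ge0 s f.2))|exact: (leeDr _ (Hs_ge0 s f.1))].
Qed.

Lemma Xnorm_ge0 s f : (0 <= Xnorm s f)%E.
Proof. by rewrite /Xnorm adde_ge0. Qed.

Lemma XnormE s f : Xs s f -> Xnorm s f = (hn s f.1 + hn s f.2)%:E.
Proof. by move=> /XsP[H1 H2]; rewrite /Xnorm (hnE H1) (hnE H2). Qed.

Lemma Xnorm0 s : Xnorm s (0 : V) = 0%E.
Proof. by rewrite /Xnorm /= (Hs0 s : Hs_norm s (0 : R -> R) = 0%E) adde0. Qed.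

Lemma XnormD s f g : (Xnorm s (f + g) <= Xnorm s f + Xnorm s g)%E.
Proof.
rewrite /Xnorm addeACA; exact: leeD (HsD s f.1 g.1) (HsD s f.2 g.2).
Qed.

Lemma XnormZ s (c : R) f : Xs s f -> Xnorm s (c *: f) = (`|c|%:E * Xnorm s f)%E.
Proof.
move=> /XsP[H1 H2]; rewrite /Xnorm ge0_muleDr //.
by congr (_ + _)%E; [exact: (HsZ c H1)|exact: (HsZ c H2)].
Qed.

Lemma Xs_mono s r f : s <= r -> (Xnorm s f <= Xnorm r f)%E.
Proof. by move=> sr; rewrite /Xnorm; apply: leeD; exact: Hs_mono. Qed.

Lemma Xs_L2 s f : Xs s f -> L2 f.1 /\ L2 f.2.
Proof. by move=> /XsP[H1 H2]; split; [exact: Hs_L2 H1|exact: Hs_L2 H2]. Qed.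

Lemma Xeq_Xnorm s f g : L2 f.1 -> L2 f.2 -> L2 g.1 -> L2 g.2 ->
  Xeq f g <-> Xnorm s (f - g) = 0%E.
Proof.
move=> f1 f2 g1 g2; split=> [[H1 H2]|].
  have E p q : L2 p -> L2 q -> p = q %[ae mu] -> Hs_norm s (p - q) = 0%E.
    move=> lp lq pq; rewrite -(Hs0 s); apply: Hs_ae; [exact: L2B|exact: L2_cst0|].
    by apply: filterS pq => x /(_ I) H; rewrite fctE H subrr.
  by rewrite /Xnorm (E _ _ f1 g1 H1 : Hs_norm s (f - g).1 = 0%E) (E _ _ f2 g2 H2 : Hs_norm s (f - g).2 = 0%E) adde0.
move=> /eqP; rewrite /Xnorm padde_eq0 // => /andP[/eqP H1 /eqP H2].
split; [apply: filterS (Hs_eq0 H1)|apply: filterS (Hs_eq0 H2)] => x /eqP H _; apply/eqP.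
  by move: H; rewrite [X in X == _](_ : _ = f.1 x - g.1 x) // subr_eq0.
by move: H; rewrite [X in X == _](_ : _ = f.2 x - g.2 x) // subr_eq0.
Qed.

Lemma Xs_complete s (f_ : nat -> V) : 0 <= s -> (forall n, Xs s (f_ n)) ->
  (forall e : R, 0 < e -> exists N, forall m n, (N <= m)%N -> (N <= n)%N ->
     (Xnorm s (f_ m - f_ n) <= e%:E)%E) ->
  exists2 f, Xs s f & Xnorm s (f_ n - f) @[n --> \oo] --> 0%E.
Proof.
move=> s0 fs fc.
have [||a [fa ca]] := @Hs_complete R s (fun n => (f_ n).1) s0.
- by move=> n; case: ((XsP s (f_ n)).1 (fs n)).
- move=> e e0; have [N HN] := fc e e0; exists N => m n Nm Nn.
  by apply: le_trans (HN m n Nm Nn); rewrite /Xnorm leeDl.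
have [||b [fb cb]] := @Hs_complete R s (fun n => (f_ n).2) s0.
- by move=> n; case: ((XsP s (f_ n)).1 (fs n)).
- move=> e e0; have [N HN] := fc e e0; exists N => m n Nm Nn.
  by apply: le_trans (HN m n Nm Nn); rewrite /Xnorm leeDr.
exists (a, b); first by apply/XsP; split; [exact: fa|exact: fb].
have E : (fun n => Xnorm s (f_ n - (a, b))) = fun n =>
    (Hs_norm s (fun x => (f_ n).1 x - a x)%R + Hs_norm s (fun x => (f_ n).2 x - b x)%R)%E by [].
have D : ((0 : \bar R) +? (0 : \bar R))%E by [].
rewrite E -[X in _ --> X](adde0 (0 : \bar R)%E).
exact: (cvgeD D ca cb).
Qed.

(** ** The operator A *)

Definition hpair s f (h : (R -> R) * (R -> R)) : Prop :=
  [/\ is_hart f.1 h.1, is_hart f.2 h.2, L2 (wgt s h.1) & L2 (wgt s h.2)].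

Lemma XsH s f : Xs s f <-> exists h, hpair s f h.
Proof.
rewrite XsP; split=> [[/HsP[h ? ?] /HsP[k ? ?]]|[[h k] [? ? ? ?]]]; first by exists (h, k).
by split; apply/HsP; [exists h|exists k].
Qed.

Definition rsym (h : R -> R) xi : R := sym xi * h (- xi).

Lemma rsym_weight s h xi : `|wgt s (rsym h) xi| <= `|wgt s h (- xi)|.
Proof.
rewrite !wgt_abs jbN ler_wpM2l ?jb_ge0 // /rsym normrM ler_piMl //; exact: sym_le1.
Qed.

Lemma L2_rsym s h : measurable_fun setT h -> L2 (wgt s h) ->
  L2 (wgt s (rsym h)) /\ nrm (wgt s (rsym h)) <= nrm (wgt s h).
Proof.
move=> mh lw; have lr := L2_reflect lw; have [mw _] := lw.
have mr : measurable_fun setT (wgt s (rsym h)).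
  apply: measurable_wgt; apply: measurable_funM; first exact: measurable_sym.
  exact: measurable_reflect.
split; first exact: L2_le mr (rsym_weight s h) lr.
have -> : nrm (wgt s h) = nrm (fun x => wgt s h (- x)) by rewrite /nrm (sq_reflect mw).
exact: nrm_mono lr mr (rsym_weight s h).
Qed.

Lemma hart_opA f h1 h2 : is_hart f.1 h1 -> is_hart f.2 h2 ->
  is_hart (opA f).1 (rsym h2) /\ is_hart (opA f).2 (rsym h1).
Proof.
move=> H1 H2; have E h : (fun xi => - (- sym xi * h (- xi))) = rsym h.
  by apply/funext => xi; rewrite /rsym mulNr opprK.
have [_ a1] := inv_dx_L2 H2; have [_ a2] := inv_dx_L2 H1.
by split; rewrite -E; [exact: (hartN a1)|exact: (hartN a2)].
Qed.

Lemma hpair_meas s f h : hpair s f h -> measurable_fun setT h.1 /\ measurable_fun setT h.2.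
Proof. by move=> [/hart_L2r[? _] /hart_L2r[? _] _ _]. Qed.

Lemma hpair_opA s f h : hpair s f h -> hpair s (opA f) (rsym h.2, rsym h.1).
Proof.
move=> hp; have [m1 m2] := hpair_meas hp; case: hp => H1 H2 l1 l2.
have [a1 a2] := hart_opA H1 H2.
by split; [exact: a1|exact: a2|exact: (L2_rsym m2 l2).1|exact: (L2_rsym m1 l1).1].
Qed.

Lemma Xnorm_hpair s f h : hpair s f h -> Xnorm s f = (nrm (wgt s h.1) + nrm (wgt s h.2))%:E.
Proof. by move=> [H1 H2 l1 l2]; rewrite /Xnorm (HsE H1 l1) (HsE H2 l2). Qed.

Lemma opA_bound s f : Xs s f -> (Xnorm s (opA f) <= Xnorm s f)%E.
Proof.
move=> /XsH[h hp]; rewrite (Xnorm_hpair hp) (Xnorm_hpair (hpair_opA hp)) lee_fin /= addrC.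
by have [m1 m2] := hpair_meas hp; case: hp => _ _ l1 l2; apply: lerD; exact: (L2_rsym _ _).2.
Qed.

Lemma opA_lin s (c : R) f g : Xs s f -> Xs s g ->
  Xnorm s (opA (c *: f + g) - (c *: opA f + opA g)) = 0%E.
Proof.
move=> fs gs.
have L p q : L2 p -> L2 q -> [/\ L2 (inv_dx p), L2 (inv_dx (c *: p + q)) &
    {ae mu, forall x, inv_dx (c *: p + q) x = c * inv_dx p x + inv_dx q x}].
  move=> lp lq; have [h hh] := hart_exists lp; have [k hk] := hart_exists lq.
  have [i1 j1] := inv_dx_L2 hh; have [i2 _] := inv_dx_L2 hk.
  have [_ j3] := inv_dx_L2 (hartD (hartZ c hh) hk).
  split; [exact: hart_L2l j1|exact: hart_L2l j3|].
  exact: inv_dx_lin (pairable_L2 lp) (pairable_L2 lq) i1 i2.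
have [f1 f2] := Xs_L2 fs; have [g1 g2] := Xs_L2 gs.
have [a1 b1 c1] := L _ _ f1 g1; have [a2 b2 c2] := L _ _ f2 g2.
have [d1 _ _] := L _ _ g1 g1; have [d2 _ _] := L _ _ g2 g2.
have z1 : L2 (c *: opA f + opA g).1 := L2D (L2Z c (L2N a2)) (L2N d2).
have z2 : L2 (c *: opA f + opA g).2 := L2D (L2Z c (L2N a1)) (L2N d1).
apply/(Xeq_Xnorm s (L2N b2 : L2 (opA (c *: f + g)).1) (L2N b1 : L2 (opA (c *: f + g)).2) z1 z2).
split; [apply: filterS c2|apply: filterS c1] => x H _.
  by rewrite [LHS](_ : _ = - inv_dx (c *: f.2 + g.2) x) // H opprD -mulrN.
by rewrite [LHS](_ : _ = - inv_dx (c *: f.1 + g.1) x) // H opprD -mulrN.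
Qed.

(** ** The conserved quadratic form *)

Opaque hn.

Definition energy s f : R := Num.sqrt (hn s f.1 ^+ 2 + hn s f.2 ^+ 2).

Lemma energy_ge0 s f : 0 <= energy s f. Proof. exact: sqrtr_ge0. Qed.

Lemma energy_sqr s f : energy s f ^+ 2 = hn s f.1 ^+ 2 + hn s f.2 ^+ 2.
Proof. by rewrite /energy sqr_sqrtr // addr_ge0 // sqr_ge0. Qed.

Lemma energy_le s f : Xs s f -> energy s f <= fine (Xnorm s f).
Proof.
move=> fs; rewrite (XnormE fs) /= /energy.
move: (hn_ge0 s f.1) (hn_ge0 s f.2); move: (hn s f.1) (hn s f.2) => x y x0 y0.
rewrite -[leRHS]ger0_norm ?addr_ge0 // -sqrtr_sqr ler_wsqrtr // sqrrD.
by have := mulr_ge0 x0 y0; lra.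
Qed.

Lemma energy_ge s f : Xs s f -> fine (Xnorm s f) <= 2 * energy s f.
Proof.
move=> fs; rewrite (XnormE fs) /= /energy.
move: (hn_ge0 s f.1) (hn_ge0 s f.2); move: (hn s f.1) (hn s f.2) => a b a0 b0.
have L (x y : R) : 0 <= x -> 0 <= y -> x <= Num.sqrt (x ^+ 2 + y ^+ 2).
  move=> x0 y0; rewrite -{1}(ger0_norm x0) -sqrtr_sqr ler_wsqrtr //.
  by rewrite lerDl sqr_ge0.
have := L _ _ a0 b0; have := L _ _ b0 a0; rewrite (addrC (b ^+ 2)).
by move: (Num.sqrt _) => z; lra.
Qed.

Lemma energyD s f g : Xs s f -> Xs s g -> energy s (f + g) <= energy s f + energy s g.
Proof.
move=> /XsP[f1 f2] /XsP[g1 g2].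
have T p q : (Hs_norm s p < +oo)%E -> (Hs_norm s q < +oo)%E -> hn s (p + q) <= hn s p + hn s q.
  move=> fp fq; have := HsD s p q; rewrite (hnE fp) (hnE fq) -EFinD => H.
  have fpq : (Hs_norm s (p + q)%R < +oo)%E by apply: le_lt_trans H _; rewrite ltry.
  by rewrite -lee_fin -(hnE fpq).
have t1 := T _ _ f1 g1; have t2 := T _ _ f2 g2.
have E1 : energy s (f + g) ^+ 2 = hn s (f.1 + g.1) ^+ 2 + hn s (f.2 + g.2) ^+ 2 := energy_sqr s (f + g).
move: t1 t2 E1 (energy_sqr s f) (energy_sqr s g) (energy_ge0 s (f + g)) (energy_ge0 s f) (energy_ge0 s g)
  (hn_ge0 s (f.1 + g.1)) (hn_ge0 s (f.2 + g.2)) (hn_ge0 s f.1) (hn_ge0 s f.2) (hn_ge0 s g.1) (hn_ge0 s g.2).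
move: (energy s (f + g)) (energy s f) (energy s g) (hn s (f.1 + g.1)) (hn s (f.2 + g.2)) (hn s f.1) (hn s f.2)
  (hn s g.1) (hn s g.2) => Z X Y a b c d e h t1 t2 E1 e1 e2 Z0 X0 Y0 a0 b0 c0 d0 c1 d1.
rewrite -(ler_pXn2r (isT : (0 < 2)%N)) ?nnegrE ?addr_ge0 // sqrrD E1 e1 e2.
have k1 : a ^+ 2 <= (c + e) ^+ 2 by rewrite ler_pXn2r ?nnegrE // addr_ge0.
have k2 : b ^+ 2 <= (d + h) ^+ 2 by rewrite ler_pXn2r ?nnegrE // addr_ge0.
have k3 : c * e + d * h <= X * Y.
  rewrite -(ler_pXn2r (isT : (0 < 2)%N)) ?nnegrE ?addr_ge0 ?mulr_ge0 // exprMn e1 e2.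
  by have := sqr_ge0 (c * h - d * e); lra.
rewrite mulr2n; lra.
Qed.

(** [A] is skew-symmetric, since its symbol is odd, so the cross terms cancel. *)
Lemma energy_step s (c : R) f : Xs s f ->
  energy s (f + c *: opA f) ^+ 2 <= (1 + c ^+ 2) * energy s f ^+ 2.
Proof.
move=> /XsH[[h1 h2] hp]; have hA := hpair_opA hp; have [m1 m2] := hpair_meas hp.
case: hp hA => H1 H2 l1 l2 [A1 A2 b1 b2] /=; simpl in *.
have [_ n1] := L2_rsym m1 l1; have [_ n2] := L2_rsym m2 l2.
have W h k : wgt s (fun x => h x + c * k x) = fun x => wgt s h x + c * wgt s k x.
  by apply/funext => x; rewrite /wgt; ring.
have S p q h k : is_hart p h -> is_hart q k -> L2 (wgt s h) -> L2 (wgt s k) ->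
    hn s (p + c *: q) ^+ 2 = nrm (wgt s h) ^+ 2 + c ^+ 2 * nrm (wgt s k) ^+ 2 +
      2 * c * \int[mu]_x (wgt s h x * wgt s k x).
  move=> hp hq lh lk; have lck := L2Z c lk.
  have -> : hn s (p + c *: q) = nrm (fun x => wgt s h x + c * wgt s k x).
    rewrite -W; apply: (hn_hart (hartD hp (hartZ c hq))); rewrite W; exact: L2D.
  rewrite (nrm_sqrD lh lck) (nrmZ c lk) exprMn real_normK ?num_real //.
  congr (_ + _); rewrite -mulrA -(RintegralZl _ measurableT (L2_mul_integrable lh lk)).
  by congr (_ * _); apply: eq_Rintegral => x _; rewrite mulrCA.
have E1 := energy_sqr s (f + c *: opA f); have E2 := energy_sqr s f.
have e1 : hn s (f + c *: opA f).1 ^+ 2 = _ := S _ _ _ _ H1 A1 l1 b1.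
have e2 : hn s (f + c *: opA f).2 ^+ 2 = _ := S _ _ _ _ H2 A2 l2 b2.
have e3 := hn_hart H1 l1; have e4 := hn_hart H2 l2.
have K (x y z t : R) : x = y -> z = t -> y <= (1 + c ^+ 2) * t -> x <= (1 + c ^+ 2) * z by move=> -> ->.
have E3 : energy s f ^+ 2 = nrm (wgt s h1) ^+ 2 + nrm (wgt s h2) ^+ 2.
  exact: etrans E2 (congr2 (fun a b => a ^+ 2 + b ^+ 2) e3 e4).
apply: (K _ _ _ _ (etrans E1 (congr2 +%R e1 e2)) E3); clear E1 E2 E3 e1 e2 e3 e4 K S.
have -> : \int[mu]_x (wgt s h2 x * wgt s (rsym h1) x) = - \int[mu]_x (wgt s h1 x * wgt s (rsym h2) x).
  have ip := L2_mul_integrable l1 b1.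
  have ml : measurable_fun setT (fun x : R => wgt s h2 x * wgt s (rsym h1) x).
    by apply: measurable_funM; [case: l2|case: b2].
  rewrite -(Rint_reflect ml) -mulN1r -(RintegralZl _ measurableT ip).
  by apply: eq_Rintegral => x _; rewrite /wgt /rsym !jbN symN opprK; ring.
have q1 : nrm (wgt s (rsym h1)) ^+ 2 <= nrm (wgt s h1) ^+ 2 by rewrite ler_pXn2r ?nnegrE ?nrm_ge0.
have q2 : nrm (wgt s (rsym h2)) ^+ 2 <= nrm (wgt s h2) ^+ 2 by rewrite ler_pXn2r ?nnegrE ?nrm_ge0.
move: q1 q2; move: (nrm (wgt s h1)) (nrm (wgt s h2)) (nrm (wgt s (rsym h1)))
  (nrm (wgt s (rsym h2))) (\int[mu]_x (wgt s h1 x * wgt s (rsym h2) x)) => a b a' b' J q1 q2.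
have r1 := ler_wpM2l (sqr_ge0 c) q1; have r2 := ler_wpM2l (sqr_ge0 c) q2.
rewrite mulrDl mul1r mulrDr mulrN; move: (2 * c * J) => Y; lra.
Qed.

(** ** The bilinear form *)

Definition Bq u v : V :=
  (inv_dx (u.1 * v.2 + u.2 * v.1), inv_dx (u.2 * v.2)).

Lemma Bq_sym u v : Bq u v = Bq v u.
Proof. by rewrite /Bq mulrC (mulrC u.2 v.1) addrC (mulrC u.2). Qed.

Lemma inv_dx_mul s p q : 0 <= s -> (Hs_norm s p < +oo)%E -> (Hs_norm s q < +oo)%E ->
  [/\ L1 (p * q), is_inv_dx (p * q) (inv_dx (p * q)) & (Hs_norm (s + 4^-1) (inv_dx (p * q))%R <=
     (smoothC s * hn s p * hn s q)%:E)%E].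
Proof.
move=> s0 /HsP[h hp lh] /HsP[k hq lk].
have [m [i1 i2 i3 i4]] := inv_dx_product s0 hp hq lh lk.
split; [exact: (L2_mul_integrable (hart_L2l hp) (hart_L2l hq))|exact: i1|].
by rewrite (HsE i2 i3) lee_fin (hn_hart hp lh) (hn_hart hq lk).
Qed.

Lemma inv_dx_add c p q : L1 p -> L1 q ->
  [/\ is_inv_dx (fun x => c * p x + q x) (inv_dx (fun x => c * p x + q x)),
   L2 (inv_dx (fun x => c * p x + q x)) &
   {ae mu, forall x, inv_dx (fun x => c * p x + q x) x = c * inv_dx p x + inv_dx q x}].
Proof.
move=> lp lq; have [i1 _] := inv_dx_L1 lp; have [i2 _] := inv_dx_L1 lq.
have [i3 h3] := inv_dx_L1 (L1D (L1Z c lp) lq).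
split; [exact: i3|exact: hart_L2l h3|].
exact: inv_dx_lin (pairable_L1 lp) (pairable_L1 lq) i1 i2.
Qed.

Lemma inv_dx_add1 p q : L1 p -> L1 q -> L2 (inv_dx (p + q)) /\
   {ae mu, forall x, inv_dx (p + q) x = inv_dx p x + inv_dx q x}.
Proof.
move=> lp lq; have [_] := inv_dx_add 1 lp lq.
have -> : (fun x => 1 * p x + q x) = p + q by apply/funext => x; rewrite mul1r.
move=> l2 H; split; first exact: l2.
by apply: filterS H => x ->; rewrite mul1r.
Qed.

Lemma Bq_bound s u v : 0 <= s -> Xs s u -> Xs s v ->
  (Xnorm (s + 4^-1) (Bq u v) <=
    (smoothC s * fine (Xnorm s u) * fine (Xnorm s v))%:E)%E.
Proof.
move=> s0 us vs; rewrite (XnormE us) (XnormE vs) /=.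
have [u1 u2] := (XsP s u).1 us; have [v1 v2] := (XsP s v).1 vs.
have [a1 b1 c1] := inv_dx_mul s0 u1 v2; have [a2 b2 c2] := inv_dx_mul s0 u2 v1.
have [a3 b3 c3] := inv_dx_mul s0 u2 v2.
have [l e] := inv_dx_add1 a1 a2.
have d1 : L2 (inv_dx (u.1 * v.2)) by case: b1 => /L2P.
have d2 : L2 (inv_dx (u.2 * v.1)) by case: b2 => /L2P.
have H1 : (Hs_norm (s + 4^-1) (inv_dx (u.1 * v.2 + u.2 * v.1))%R <=
   (smoothC s * hn s u.1 * hn s v.2)%:E + (smoothC s * hn s u.2 * hn s v.1)%:E)%E.
  have E := Hs_ae (s + 4^-1) l (L2D d1 d2) e; rewrite [leLHS]E.
  exact: le_trans (HsD (s + 4^-1) _ _) (leeD c1 c2).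
apply: (le_trans (leeD H1 c3)); rewrite -!EFinD lee_fin.
have := mulr_ge0 (smoothC_ge0 s) (mulr_ge0 (hn_ge0 s u.1) (hn_ge0 s v.1)).
by move: (hn s u.1) (hn s u.2) (hn s v.1) (hn s v.2) (smoothC s) => x y z w c; lra.
Qed.

Lemma Bq_lin s r (c : R) u u' v : 0 <= s -> Xs s u -> Xs s u' -> Xs s v ->
  Xnorm r (Bq (c *: u + u') v - (c *: Bq u v + Bq u' v)) = 0%E.
Proof.
move=> s0 us us' vs.
have [u1 u2] := Xs_L2 us; have [w1 w2] := Xs_L2 us'; have [v1 v2] := Xs_L2 vs.
have m p q : L2 p -> L2 q -> L1 (p * q) by exact: L2_mul_integrable.
have a1 : L1 (u.1 * v.2 + u.2 * v.1) := L1D (m _ _ u1 v2) (m _ _ u2 v1).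
have a2 : L1 (u'.1 * v.2 + u'.2 * v.1) := L1D (m _ _ w1 v2) (m _ _ w2 v1).
have a3 := m _ _ u2 v2; have a4 := m _ _ w2 v2.
have [_ l1 e1] := inv_dx_add c a1 a2; have [_ l2 e2] := inv_dx_add c a3 a4.
have E1 : (c *: u + u').1 * v.2 + (c *: u + u').2 * v.1 =
    fun x => c * (u.1 * v.2 + u.2 * v.1) x + (u'.1 * v.2 + u'.2 * v.1) x.
  apply/funext => x; rewrite [LHS](_ : _ = (c * u.1 x + u'.1 x) * v.2 x + (c * u.2 x + u'.2 x) * v.1 x) //.
  rewrite [RHS](_ : _ = c * (u.1 x * v.2 x + u.2 x * v.1 x) + (u'.1 x * v.2 x + u'.2 x * v.1 x)) //.
  ring.
have E2 : (c *: u + u').2 * v.2 = fun x => c * (u.2 * v.2) x + (u'.2 * v.2) x.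
  apply/funext => x; rewrite [LHS](_ : _ = (c * u.2 x + u'.2 x) * v.2 x) //.
  rewrite [RHS](_ : _ = c * (u.2 x * v.2 x) + (u'.2 x * v.2 x)) //.
  ring.
have k p : L1 p -> L2 (inv_dx p) by move=> /inv_dx_L1[_ /hart_L2l].
have L1' : L2 (Bq (c *: u + u') v).1 by rewrite /Bq [X in L2 (inv_dx X)]E1; exact: l1.
have L2' : L2 (Bq (c *: u + u') v).2 by rewrite /Bq [X in L2 (inv_dx X)]E2; exact: l2.
have r1 : L2 (c *: Bq u v + Bq u' v).1 := L2D (L2Z c (k _ a1)) (k _ a2).
have r2 : L2 (c *: Bq u v + Bq u' v).2 := L2D (L2Z c (k _ a3)) (k _ a4).
apply/(Xeq_Xnorm r L1' L2' r1 r2); split.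
  have F : (Bq (c *: u + u') v).1 = _ := congr1 (@inv_dx R) E1.
  by apply: filterS e1 => x H _; rewrite F; exact: H.
have F : (Bq (c *: u + u') v).2 = _ := congr1 (@inv_dx R) E2.
by apply: filterS e2 => x H _; rewrite F; exact: H.
Qed.

(** ** The differential equations *)

(** The two equations say that [- eta_t] and [- v_t] are the values of the inverse
    operator at [v + eta v] and at [eta + v^2 / 2]. *)
Lemma equations_inv_dx s u ut : 0 <= s -> Xs s u -> Xs s ut ->
  (forall phi, test_function phi ->
      let eta := u.1 in let v := u.2 in let eta_t := ut.1 in let v_t := ut.2 in
      \int[mu]_x (eta_t x * phi x) - \int[mu]_x (eta_t x * derive1n 2 phi x)
        - \int[mu]_x (v x * derive1 phi x)
        - \int[mu]_x (eta x * v x * derive1 phi x) = 0 /\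
      \int[mu]_x (v_t x * phi x) - \int[mu]_x (v_t x * derive1n 2 phi x)
        - \int[mu]_x (eta x * derive1 phi x)
        - 2^-1 * \int[mu]_x (v x ^+ 2 * derive1 phi x) = 0) <->
  Xnorm s (ut - (opA u + - 2^-1 *: Bq u u)) = 0%E.
Proof.
move=> s0 us ts.
have [u1 u2] := Xs_L2 us; have [t1 t2] := Xs_L2 ts.
have m p q : L2 p -> L2 q -> L1 (p * q) by exact: L2_mul_integrable.
have m12 := m _ _ u1 u2; have m22 := m _ _ u2 u2; have m21 := m _ _ u2 u1.
have [k1 h1] := hart_exists u1; have [k2 h2] := hart_exists u2.
have [i1 j1] := inv_dx_L2 h1; have [i2 j2] := inv_dx_L2 h2.
have lop1 := hart_L2l j1; have lop2 := hart_L2l j2.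
have [b1 _] := inv_dx_L1 (L1D m12 m21); have [b2 _] := inv_dx_L1 m22.
have lb1 : L2 (inv_dx (u.1 * u.2 + u.2 * u.1)) by case: b1 => /L2P.
have lb2 : L2 (inv_dx (u.2 * u.2)) by case: b2 => /L2P.
have c1 : is_inv_dx (fun x => 2^-1 * (u.1 * u.2 + u.2 * u.1) x + u.2 x)
    (fun x => 2^-1 * inv_dx (u.1 * u.2 + u.2 * u.1) x + inv_dx u.2 x).
  apply: is_inv_dx_lin; [exact: pairable_L1 (L1D m12 m21)|exact: pairable_L2|exact: b1|exact: i2].
have c2 : is_inv_dx (fun x => 2^-1 * (u.2 * u.2) x + u.1 x)
    (fun x => 2^-1 * inv_dx (u.2 * u.2) x + inv_dx u.1 x).
  apply: is_inv_dx_lin; [exact: pairable_L1|exact: pairable_L2|exact: b2|exact: i1].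
have K (p q r : R -> R) a phi : L2 p -> L2 q -> L1 r -> test_function phi ->
   (\int[mu]_x (p x * phi x) - \int[mu]_x (p x * derive1n 2 phi x)
        - \int[mu]_x (q x * derive1 phi x) - a * \int[mu]_x (r x * derive1 phi x) = 0) <->
   \int[mu]_x (- p x * (phi x - derive1n 2 phi x)) =
     - \int[mu]_x ((a * r x + q x) * derive1 phi x).
  move=> lp lq lr tphi; have [n1 n2] := test_psi_nice tphi.
  have n0 : nice phi.
    move: tphi => /test_functionP[sm [M sp]]; exact: nice_continuous (smooth_continuous sm) sp.
  have n3 : nice (derive1n 2 phi).
    move: tphi => /test_functionP[sm [M sp]]; have s2 := smooth_derive1 (smooth_derive1 sm).
    exact: nice_continuous (smooth_continuous s2) (supp_derive1 (supp_derive1 sp)).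
  have g1 := L2_nice_int lp n0; have g2 := L2_nice_int lp n3; have g3 := L2_nice_int lq n2.
  have g4 := pairable_L1 lr n2.
  have -> : \int[mu]_x (- p x * (phi x - derive1n 2 phi x)) =
     - (\int[mu]_x (p x * phi x) - \int[mu]_x (p x * derive1n 2 phi x)).
    rewrite -(RintegralB measurableT g1 g2) -mulN1r -(RintegralZl _ measurableT (L1B g1 g2)).
    by apply: eq_Rintegral => x _; ring.
  have -> : \int[mu]_x ((a * r x + q x) * derive1 phi x) =
     a * \int[mu]_x (r x * derive1 phi x) + \int[mu]_x (q x * derive1 phi x).
    rewrite -(RintegralZl _ measurableT g4) -(RintegralD measurableT (L1Z a g4) g3).
    by apply: eq_Rintegral => x _; ring.
  move: (\int[mu]_x (p x * phi x)) (\int[mu]_x (p x * derive1n 2 phi x))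
    (\int[mu]_x (q x * derive1 phi x)) (\int[mu]_x (r x * derive1 phi x)) => a1 a2 a3 a4.
  clear; split=> H; lra.
have q1 : (fun x => 2^-1 * (u.1 * u.2 + u.2 * u.1) x + u.2 x) = fun x => 1 * (u.1 * u.2) x + u.2 x.
  apply/funext => x; rewrite [LHS](_ : _ = 2^-1 * (u.1 x * u.2 x + u.2 x * u.1 x) + u.2 x) //.
  by rewrite [RHS](_ : _ = 1 * (u.1 x * u.2 x) + u.2 x) //; field.
have P1 : (forall phi, test_function phi -> \int[mu]_x (ut.1 x * phi x) - \int[mu]_x (ut.1 x * derive1n 2 phi x)
        - \int[mu]_x (u.2 x * derive1 phi x) - \int[mu]_x (u.1 x * u.2 x * derive1 phi x) = 0) <->
   is_inv_dx (fun x => 2^-1 * (u.1 * u.2 + u.2 * u.1) x + u.2 x) (fun x => - ut.1 x).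
  rewrite q1; split=> [H|[_ H] phi tphi].
    split; first exact/L2P/(L2N t1).
    by move=> phi tphi; apply/(K _ _ (u.1 * u.2) 1 _ t1 u2 m12 tphi); rewrite mul1r; exact: H.
  by rewrite -[X in _ - X = 0]mul1r; apply/(K _ _ (u.1 * u.2) 1 _ t1 u2 m12 tphi); exact: H.
have P2 : (forall phi, test_function phi -> \int[mu]_x (ut.2 x * phi x) - \int[mu]_x (ut.2 x * derive1n 2 phi x)
        - \int[mu]_x (u.1 x * derive1 phi x) - 2^-1 * \int[mu]_x (u.2 x ^+ 2 * derive1 phi x) = 0) <->
   is_inv_dx (fun x => 2^-1 * (u.2 * u.2) x + u.1 x) (fun x => - ut.2 x).
  split=> [H|[_ H] phi tphi].
    split; first exact/L2P/(L2N t2).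
    by move=> phi tphi; apply/(K _ _ (u.2 * u.2) 2^-1 _ t2 u1 m22 tphi); exact: H.
  by apply/(K _ _ (u.2 * u.2) 2^-1 _ t2 u1 m22 tphi); exact: H.
have z1 : L2 (fun x => - 2^-1 * inv_dx (u.1 * u.2 + u.2 * u.1) x) := L2Z _ lb1.
have z2 : L2 (fun x => - 2^-1 * inv_dx (u.2 * u.2) x) := L2Z _ lb2.
have y1 : L2 (opA u + - 2^-1 *: Bq u u).1 := L2D (L2N lop2) z1.
have y2 : L2 (opA u + - 2^-1 *: Bq u u).2 := L2D (L2N lop1) z2.
have o1 x : (opA u + - 2^-1 *: Bq u u).1 x =
  - (2^-1 * inv_dx (u.1 * u.2 + u.2 * u.1) x + inv_dx u.2 x).
  rewrite [LHS](_ : _ = - inv_dx u.2 x + - 2^-1 * inv_dx (u.1 * u.2 + u.2 * u.1) x) //.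
  by rewrite mulNr opprD addrC.
have o2 x : (opA u + - 2^-1 *: Bq u u).2 x =
  - (2^-1 * inv_dx (u.2 * u.2) x + inv_dx u.1 x).
  rewrite [LHS](_ : _ = - inv_dx u.1 x + - 2^-1 * inv_dx (u.2 * u.2) x) //.
  by rewrite mulNr opprD addrC.
have I p w q : is_inv_dx p w -> L2 q -> is_inv_dx p (fun x => - q x) <-> {ae mu, forall x, q x = - w x}.
  move=> hw lq; split=> [H|H].
    by apply: filterS (inv_dx_unique H hw) => x <-; rewrite opprK.
  case: (hw) => /L2P lw Hw; split; first exact/L2P/L2N.
  move=> phi tphi; rewrite -Hw //; have [[mn _ _ _] _] := test_psi_nice tphi.
  case: (lw) (lq) => mw _ [mq _].
  apply: Rint_ae_eq; [by apply: measurable_funM => //; exact: measurableT_comp|exact: measurable_funM|].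
  by apply: filterS H => x ->; rewrite opprK.
split=> [H|/(Xeq_Xnorm _ t1 t2 y1 y2)[H1 H2] phi tphi].
  apply/(Xeq_Xnorm s t1 t2 y1 y2); split.
    have /P1/(I _ _ _ c1 t1) : forall phi, test_function phi -> _ := fun phi tp => (H phi tp).1.
    by apply: filterS => x -> _; rewrite o1.
  have /P2/(I _ _ _ c2 t2) : forall phi, test_function phi -> _ := fun phi tp => (H phi tp).2.
  by apply: filterS => x -> _; rewrite o2.
split; [apply: P1.2 tphi; apply/(I _ _ _ c1 t1)|apply: P2.2 tphi; apply/(I _ _ _ c2 t2)].
  by apply: filterS H1 => x /(_ Logic.I) ->; rewrite o1.
by apply: filterS H2 => x /(_ Logic.I) ->; rewrite o2.
Qed.

End bona_space.
#[export] Hint Extern 0 (is_true (@Order.le _ _ _ (Xnorm _ _))) => exact: Xnorm_ge0 : core.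
#[export] Hint Extern 0 (is_true (@Order.le _ _ _ (energy _ _))) => exact: energy_ge0 : core.

(** * Quotients of extended seminormed spaces *)

(** Extended seminorms; the vectors of finite seminorm form a subspace. *)
Record esn (R : realType) (V : lmodType R) := ESN {
  esn_fun :> V -> \bar R;
  esn_ge0 : forall v, (0 <= esn_fun v)%E;
  esn0 : esn_fun 0 = 0%E;
  esnD : forall v w, (esn_fun (v + w)%R <= esn_fun v + esn_fun w)%E;
  esnZ : forall (c : R) v, (esn_fun v < +oo)%E ->
    esn_fun (c *: v) = (`|c|%:E * esn_fun v)%E }.

Section quotient.
Context {R : realType} {V : lmodType R} (N : esn V).
Implicit Types (v w : V) (c : R).

Definition fin v := (N v < +oo)%E.

Lemma fin0 : fin 0. Proof. by rewrite /fin esn0 ltry. Qed.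

Lemma finD v w : fin v -> fin w -> fin (v + w).
Proof. by move=> fv fw; apply: le_lt_trans (esnD N v w) _; exact: lte_add_pinfty. Qed.

Lemma finZ c v : fin v -> fin (c *: v).
Proof.
by move=> fv; rewrite /fin (esnZ c fv); apply: lte_mul_pinfty => //; rewrite lee_fin.
Qed.

Lemma finN v : fin v -> fin (- v).
Proof. by rewrite -scaleN1r; exact: finZ. Qed.

Lemma finB v w : fin v -> fin w -> fin (v - w).
Proof. by move=> fv fw; apply: finD => //; exact: finN. Qed.

Lemma esnN v : fin v -> N (- v) = N v.
Proof. by move=> fv; rewrite -scaleN1r (esnZ _ fv) normrN1 mul1e. Qed.

Lemma esnBC v w : fin v -> fin w -> N (v - w) = N (w - v).
Proof. by move=> fv fw; rewrite -(esnN (finB fv fw)) opprB. Qed.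

Lemma esn0_trans u v w : N (u - v) = 0%E -> N (v - w) = 0%E -> N (u - w) = 0%E.
Proof.
move=> uv vw; apply/eqP; rewrite eq_le esn_ge0 andbT.
have := esnD N (u - v) (v - w); rewrite uv vw adde0.
by have -> : u - v + (v - w) = u - w by rewrite addrA subrK.
Qed.

(* A canonical element of the class of v. *)
Definition canon v : V := xget 0 [set w | fin w /\ N (w - v) = 0%E].

Lemma canonP v : fin v -> fin (canon v) /\ N (canon v - v) = 0%E.
Proof.
move=> fv; have := @xgetPex _ 0 [set w | fin w /\ N (w - v) = 0%E].
by apply; exists v; rewrite /= subrr esn0.
Qed.

Lemma canon_eq v w : fin v -> fin w -> N (v - w) = 0%E -> canon v = canon w.
Proof.
move=> fv fw vw; rewrite /canon; congr xget; apply/seteqP; split=> u /= [fu H]; split=> //.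
  exact: esn0_trans H vw.
by apply: esn0_trans H _; rewrite (esnBC fw fv).
Qed.

Lemma canonK v : fin v -> canon (canon v) = canon v.
Proof. by move=> fv; have [f1 f2] := canonP fv; exact: canon_eq. Qed.

Definition quo := {v : V | `[< fin v /\ canon v = v >]}.

HB.instance Definition _ := Choice.on quo.

Lemma cls_subproof v : `[< fin (canon (if `[< fin v >] then v else 0)) /\
  canon (canon (if `[< fin v >] then v else 0)) = canon (if `[< fin v >] then v else 0) >].
Proof.
apply/asboolP; case: asboolP => fv; first by split; [case: (canonP fv)|exact: canonK].
by split; [case: (canonP fin0)|apply: canonK; exact: fin0].
Qed.

Definition cls v : quo :=
  exist (fun w : V => is_true `[< fin w /\ canon w = w >]) _ (cls_subproof v).
Definition rep (x : quo) : V := sval x.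

Lemma fin_rep x : fin (rep x).
Proof. by case: x => v /= p; case: (asboolP _ p). Qed.

Lemma repK x : cls (rep x) = x.
Proof.
apply: val_inj => /=; have fx := fin_rep x; rewrite asboolT //.
by case: x fx => v /= p _; case: (asboolP _ p).
Qed.

Lemma rep_cls v : fin v -> N (rep (cls v) - v) = 0%E.
Proof. by move=> fv; rewrite /rep /= asboolT //; case: (canonP fv). Qed.

Lemma cls_eq v w : fin v -> fin w -> cls v = cls w <-> N (v - w) = 0%E.
Proof.
move=> fv fw; split=> [E|E].
  have h1 := rep_cls fv; have h2 := rep_cls fw; rewrite E in h1.
  apply: (esn0_trans _ h2); rewrite esnBC //; exact: fin_rep.
by apply: val_inj => /=; rewrite !asboolT //; exact: canon_eq.
Qed.

Lemma N_le0 v : (N v <= 0)%E -> N v = 0%E.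
Proof. by move=> H; apply/eqP; rewrite eq_le H esn_ge0. Qed.

Lemma cls_congD v v' w w' : fin v -> fin v' -> fin w -> fin w' -> cls v = cls v' ->
  cls w = cls w' -> cls (v + w) = cls (v' + w').
Proof.
move=> f1 f2 f3 f4 /(cls_eq f1 f2) h1 /(cls_eq f3 f4) h2; apply/cls_eq; try exact: finD.
apply: N_le0; have := esnD N (v - v') (w - w'); rewrite h1 h2 adde0.
by have -> : v - v' + (w - w') = v + w - (v' + w') by rewrite opprD addrACA.
Qed.

Lemma cls_congZ c v v' : fin v -> fin v' -> cls v = cls v' -> cls (c *: v) = cls (c *: v').
Proof.
move=> f1 f2 /(cls_eq f1 f2) h; apply/cls_eq; try exact: finZ.
by rewrite -scalerBr esnZ ?h ?mule0 //; exact: finB.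
Qed.

Definition qadd (x y : quo) := cls (rep x + rep y).
Definition qscale c (x : quo) := cls (c *: rep x).
Definition qopp (x : quo) := qscale (-1) x.

Lemma qaddE v w : fin v -> fin w -> qadd (cls v) (cls w) = cls (v + w).
Proof.
by move=> fv fw; apply: cls_congD => //; try exact: fin_rep; exact: repK.
Qed.

Lemma qscaleE c v : fin v -> qscale c (cls v) = cls (c *: v).
Proof. by move=> fv; apply: cls_congZ => //; try exact: fin_rep; exact: repK. Qed.

Lemma quoP (P : quo -> Prop) : (forall v, fin v -> P (cls v)) -> forall x, P x.
Proof. by move=> H x; rewrite -(repK x); apply: H; exact: fin_rep. Qed.

Fact qaddA : associative qadd.
Proof.
elim/quoP => u fu; elim/quoP => v fv; elim/quoP => w fw.
by rewrite (qaddE fv fw) (qaddE fu fv) (qaddE fu (finD fv fw)) (qaddE (finD fu fv) fw) addrA.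
Qed.

Fact qaddC : commutative qadd.
Proof. by move=> x y; rewrite /qadd addrC. Qed.

Fact qadd0 : left_id (cls 0) qadd.
Proof. by elim/quoP => v fv; rewrite (qaddE fin0 fv) add0r. Qed.

Fact qaddN : left_inverse (cls 0) qopp qadd.
Proof.
elim/quoP => v fv; rewrite /qopp qscaleE // scaleN1r (qaddE (finN fv) fv).
by rewrite addNr.
Qed.

HB.instance Definition _ := GRing.isZmodule.Build quo qaddA qaddC qadd0 qaddN.

Fact qscaleA a b x : qscale a (qscale b x) = qscale (a * b) x.
Proof.
by elim/quoP: x => v fv; rewrite !qscaleE ?scalerA //; exact: finZ.
Qed.

Fact qscale1 : left_id 1 qscale.
Proof. by elim/quoP => v fv; rewrite qscaleE // scale1r. Qed.

Fact qscaleDr : right_distributive qscale +%R.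
Proof.
move=> c; elim/quoP => v fv; elim/quoP => w fw.
have f1 := finZ c fv; have f2 := finZ c fw.
rewrite [LHS](_ : _ = qscale c (qadd (cls v) (cls w))) // (qaddE fv fw) (qscaleE c (finD fv fw)).
by rewrite scalerDr -(qaddE f1 f2) -(qscaleE c fv) -(qscaleE c fw).
Qed.

Fact qscaleDl x : {morph qscale^~ x : a b / a + b}.
Proof.
elim/quoP: x => v fv a b; have f1 := finZ a fv; have f2 := finZ b fv.
by rewrite /= !qscaleE // scalerDl -(qaddE f1 f2).
Qed.

HB.instance Definition _ := GRing.Zmodule_isLmodule.Build R quo
  qscaleA qscale1 qscaleDr qscaleDl.

Lemma clsD v w : fin v -> fin w -> cls (v + w) = cls v + cls w.
Proof. by move=> fv fw; rewrite -qaddE. Qed.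

Lemma clsZ c v : fin v -> cls (c *: v) = c *: cls v.
Proof. by move=> fv; rewrite -qscaleE. Qed.

Definition qnorm (x : quo) : R := fine (N (rep x)).

Lemma qnormE v : fin v -> N v = (qnorm (cls v))%:E.
Proof.
move=> fv; have fr := fin_rep (cls v); have h := rep_cls fv.
rewrite /qnorm fineK ?ge0_fin_numE ?esn_ge0 //.
apply/eqP; rewrite eq_le; apply/andP; split.
  have := esnD N (v - rep (cls v)) (rep (cls v)); rewrite subrK esnBC //.
  by rewrite h add0e.
by have := esnD N (rep (cls v) - v) v; rewrite subrK h add0e.
Qed.

Fact qnormD x y : qnorm (x + y) <= qnorm x + qnorm y.
Proof.
elim/quoP: x => v fv; elim/quoP: y => w fw; rewrite -clsD // -lee_fin EFinD.
by rewrite -!qnormE //; [exact: esnD|exact: finD].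
Qed.

Fact qnormZ (c : R) x : qnorm (c *: x) = `|c| * qnorm x.
Proof.
elim/quoP: x => v fv; rewrite -clsZ //; apply: EFin_inj; rewrite EFinM.
by rewrite -!qnormE //; [exact: esnZ|exact: finZ].
Qed.

Fact qnorm_eq0 x : qnorm x = 0 -> x = 0.
Proof.
elim/quoP: x => v fv h; apply/(cls_eq fv fin0); rewrite subr0.
by rewrite (qnormE fv) h.
Qed.

HB.instance Definition _ := Lmodule_isNormed.Build R quo qnormD qnormZ qnorm_eq0.

Lemma norm_cls v : fin v -> N v = (`|cls v|)%:E.
Proof. exact: qnormE. Qed.

Lemma clsN v : fin v -> cls (- v) = - cls v.
Proof. by move=> fv; rewrite -scaleN1r clsZ // scaleN1r. Qed.

Lemma clsB v w : fin v -> fin w -> cls (v - w) = cls v - cls w.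
Proof. by move=> fv fw; rewrite clsD ?clsN //; exact: finN. Qed.

Lemma cls_sum (I : Type) (r : seq I) (P : pred I) (F : I -> V) : (forall i, fin (F i)) ->
  cls (\sum_(i <- r | P i) F i) = \sum_(i <- r | P i) cls (F i) /\ fin (\sum_(i <- r | P i) F i).
Proof.
move=> fF; elim: r => [|i r [IH1 IH2]]; first by rewrite !big_nil; split => //; exact: fin0.
rewrite !big_cons; case: (P i) => //; rewrite clsD // IH1; split => //; exact: finD.
Qed.

End quotient.

(** A decision procedure for identities between linear combinations: compare the
    coefficients of each atom. *)
Inductive lexp (R : Type) :=
  LV of nat | LZero | LAdd of lexp R & lexp R | LOpp of lexp R | LScale of R & lexp R.
Arguments LV {R}. Arguments LZero {R}.

Section linear_combinations.
Context {R : pzRingType} {V : lmodType R}.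

Fixpoint lev (xs : seq V) (e : lexp R) : V := match e with
  | LV n => nth 0 xs n | LZero => 0 | LAdd a b => lev xs a + lev xs b
  | LOpp a => - lev xs a | LScale c a => c *: lev xs a end.

Fixpoint lco (e : lexp R) (i : nat) : R := match e with
  | LV n => if Nat.eqb n i then 1 else 0 | LZero => 0 | LAdd a b => lco a i + lco b i
  | LOpp a => - lco a i | LScale c a => c * lco a i end.

Lemma levE xs e : lev xs e = \sum_(i < size xs) lco e i *: nth 0 xs i.
Proof.
elim: e => [n||a IHa b IHb|a IHa|c a IHa] /=.
- have [ns|ns] := ltnP n (size xs); last first.
    rewrite nth_default // big1 // => i _; case E : (Nat.eqb n i); last by rewrite scale0r.
    by move: ns; rewrite ((PeanoNat.Nat.eqb_eq n i).1 E) leqNgt ltn_ord.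
  rewrite (bigD1 (Ordinal ns)) //= PeanoNat.Nat.eqb_refl scale1r big1 ?addr0 // => i /eqP ni.
  case E : (Nat.eqb n i); last by rewrite scale0r.
  by case: ni; apply: val_inj; rewrite /= ((PeanoNat.Nat.eqb_eq n i).1 E).
- by rewrite big1 // => i _; rewrite scale0r.
- by rewrite IHa IHb -big_split; apply: eq_bigr => i _; rewrite scalerDl.
- by rewrite IHa -sumrN; apply: eq_bigr => i _; rewrite scaleNr.
- by rewrite IHa scaler_sumr; apply: eq_bigr => i _; rewrite scalerA.
Qed.

Fixpoint lchk (n : nat) (a b : lexp R) : Prop :=
  if n is m.+1 then lco a m = lco b m /\ lchk m a b else True.

Lemma lev_eq xs a b : lchk (size xs) a b -> lev xs a = lev xs b.
Proof.
move=> H; rewrite !levE; apply: eq_bigr => i _; congr (_ *: _).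
elim: (size xs) H (i : nat) (ltn_ord i) => [//|n IH] [E H] j; rewrite ltnS leq_eqVlt.
by move=> /orP[/eqP ->|] //; exact: IH.
Qed.

End linear_combinations.

Ltac lmem x l := match l with
  | nil => constr:(false) | cons x _ => constr:(true) | cons _ ?t => lmem x t end.
Ltac lfind x l := match l with
  | cons x _ => constr:(O) | cons _ ?t => let n := lfind x t in constr:(S n) end.
Ltac latoms e l := match e with
  | @GRing.add _ ?a ?b => let l1 := latoms a l in latoms b l1
  | @GRing.opp _ ?a => latoms a l
  | @GRing.scale _ _ _ ?a => latoms a l
  | @GRing.zero _ => l
  | _ => match lmem e l with true => l | false => constr:(cons e l) end end.
Ltac lquote R e l := match e with
  | @GRing.add _ ?a ?b => let x := lquote R a l in let y := lquote R b l in constr:(@LAdd R x y)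
  | @GRing.opp _ ?a => let x := lquote R a l in constr:(@LOpp R x)
  | @GRing.scale _ _ ?c ?a => let x := lquote R a l in constr:(@LScale R c x)
  | @GRing.zero _ => constr:(@LZero R)
  | _ => let n := lfind e l in constr:(@LV R n) end.
Ltac lmod_eq R := match goal with |- @eq ?T ?a ?b =>
  let l0 := latoms a (@nil T) in let l := latoms b l0 in
  let x := lquote (GRing.PzRing.sort R) a l in let y := lquote (GRing.PzRing.sort R) b l in
  apply: (@lev_eq R _ l x y); cbn [size lchk lco Nat.eqb];
  repeat (split; [first [ring | field]|]); try exact I end.

Definition seq_complete (R : realType) (Q : normedModType R) := forall u : nat -> Q,
  (forall e : R, 0 < e -> exists n0, forall m n, (n0 <= m)%N -> (n0 <= n)%N -> `|u m - u n| <= e) ->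
  exists l, forall e : R, 0 < e -> exists n0, forall n, (n0 <= n)%N -> `|u n - l| <= e.

(** * Antiderivatives of curves in a Banach space *)

Section real_lemmas.
Context {R : realType}.

(** A function whose increments are locally at most [M] times the increment of the
    variable has the same bound globally: subdivide and add. *)
Lemma increments_le (T M : R) (g : R -> R) :
  (forall e : R, 0 < e -> exists2 d : R, 0 < d & forall a b : R, 0 <= a -> a <= b -> b <= T ->
     b - a < d -> g b - g a <= (b - a) * (M + e)) ->
  forall a b : R, 0 <= a -> a <= b -> b <= T -> g b - g a <= (b - a) * M.
Proof.
move=> H a b a0 ab bT; apply/ler_addgt0Pr => e e0.
have ba : 0 <= b - a by rewrite subr_ge0.
have k0 : 0 < b - a + 1 by rewrite ltr_wpDl.
have [d d0 Hd] := H _ (divr_gt0 e0 k0).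
have [n nd] : exists n : nat, (b - a) / d < n.+1%:R.
  by exists (Num.truncn ((b - a) / d)); rewrite truncnS_gt.
pose h := (b - a) / n.+1%:R; have n0 : (0 : R) < n.+1%:R by rewrite ltr0n.
have h0 : 0 <= h by rewrite divr_ge0 // ltW.
have hd : h < d by rewrite /h ltr_pdivrMr // mulrC -ltr_pdivrMr.
have nh : n.+1%:R * h = b - a by rewrite /h mulrCA divff ?mulr1 // lt0r_neq0.
have K i : (i <= n.+1)%N -> g (a + i%:R * h) - g a <= i%:R * h * (M + e / (b - a + 1)).
  elim: i => [|i IH] i_n; first by rewrite mul0r addr0 subrr mul0r.
  have le1 : i.+1%:R * h <= n.+1%:R * h by rewrite ler_wpM2r // ler_nat.
  have E1 : a + i.+1%:R * h = a + i%:R * h + h by rewrite -addn1 natrD; ring.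
  have i0 : 0 <= i%:R * h by rewrite mulr_ge0.
  have := Hd (a + i%:R * h) (a + i.+1%:R * h).
  rewrite E1 (_ : a + i%:R * h + h - (a + i%:R * h) = h); last by ring.
  have p1 : 0 <= a + i%:R * h by rewrite addr_ge0.
  have p2 : a + i%:R * h <= a + i%:R * h + h by rewrite lerDl.
  have p3 : a + i%:R * h + h <= T by rewrite -E1; lra.
  move=> /(_ p1 p2 p3 hd) p4; have := IH (ltnW i_n) => p5.
  rewrite -addn1 natrD mulrDl mul1r mulrDl.
  by move: p4 p5; move: (g _) (g _) (g a) (_ * (M + _)) (_ * (M + _)) => *; lra.
have := K n.+1 (leqnn _); rewrite nh (_ : a + (b - a) = b); last by ring.
move/le_trans; apply; rewrite mulrDr lerD2l mulrCA ger_pMr // ler_pdivrMr // mul1r.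
by rewrite lerDl.
Qed.

Lemma increments_const (T : R) (g : R -> R) :
  (forall e : R, 0 < e -> exists2 d : R, 0 < d & forall a b : R, 0 <= a -> a <= b -> b <= T ->
     b - a < d -> g b - g a <= (b - a) * e) ->
  forall a b : R, 0 <= a -> a <= b -> b <= T -> g b <= g a.
Proof.
move=> H a b a0 ab bT; rewrite -subr_le0 -[leRHS](mulr0 (b - a)).
apply: increments_le a b a0 ab bT => e /H[d d0 Hd]; exists d => // a b a0 ab bT /Hd.
by rewrite add0r; apply.
Qed.

(** The part of the interval from [0] to [x] lying below [h]. *)
Definition clip (h x : R) : R := if x <= 0 then 0 else if x <= h then x else h.

Lemma clip_mono h x y : 0 <= h -> x <= y -> clip h x <= clip h y.
Proof.
move=> h0 xy; rewrite /clip.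
by case: (leP x 0) => ?; case: (leP y 0) => ?; case: (leP x h) => ?; case: (leP y h) => ?; lra.
Qed.

Lemma clip_sum h n t : 0 <= h -> 0 <= t -> \sum_(i < n) clip h (t - i%:R * h) = Num.min t (n%:R * h).
Proof.
move=> h0 t0; elim: n => [|n IH].
  by rewrite big_ord0 mul0r min_r.
rewrite big_ord_recr /= IH /clip -addn1 natrD mulrDl mul1r.
have := mulr_ge0 (ler0n R n) h0; move: (n%:R * h) => y y0.
by case: (leP t y) => ?; case: (leP t (y + h)) => ?; case: (leP (t - y) 0) => ?; case: (leP (t - y) h) => ?; lra.
Qed.

Lemma clip_local h x y : x <= y -> 0 <= h -> clip h y != clip h x -> x < h /\ 0 < y.
Proof.
move=> xy h0 /eqP ne; split; rewrite ltNge; apply/negP => H; apply: ne; rewrite /clip.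
  by case: (leP x 0) => ?; case: (leP y 0) => ?; case: (leP x h) => ?; case: (leP y h) => ?; lra.
by case: (leP x 0) => ?; case: (leP y 0) => ?; case: (leP x h) => ?; case: (leP y h) => ?; lra.
Qed.

End real_lemmas.

Section calculus.
Context {R : realType} (Q : normedModType R).
Hypothesis Qc : seq_complete Q.
Implicit Types (F G U W : R -> Q) (T : R).

Lemma absconv (a : nat -> R) (u : nat -> Q) : (forall n, `|u n.+1 - u n| <= a n) ->
  cvgn (series a) -> exists l, forall n, `|u n - l| <= limn (series a) - series a n.
Proof.
move=> ua ca.
have a0 n : 0 <= a n by apply: le_trans (ua n).
have nd : nondecreasing_seq (series a).
  apply/nondecreasing_seqP => n; rewrite /series /= big_nat_recr //= lerDl //.
have B n k : `|u (n + k)%N - u n| <= series a (n + k)%N - series a n.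
  elim: k => [|k IH]; first by rewrite addn0 !subrr normr0.
  have -> : u (n + k.+1)%N - u n = (u (n + k).+1 - u (n + k)%N) + (u (n + k)%N - u n).
    by rewrite addnS addrA subrK.
  apply: le_trans (ler_normD _ _) _; rewrite addnS /series /= big_nat_recr //=.
  by have := ua (n + k)%N; move: IH; rewrite /series /=; lra.
have lb n : series a n <= limn (series a) by exact: nondecreasing_cvgn_le.
have tail e : 0 < e -> exists n0, forall n, (n0 <= n)%N -> limn (series a) - series a n <= e.
  move=> e0; have /cvgrPdist_le/(_ _ e0)[n0 _ H] := ca; exists n0 => n /H.
  by rewrite ger0_norm // subr_ge0.
have C m n : (n <= m)%N -> `|u m - u n| <= limn (series a) - series a n.
  move=> nm; rewrite -(subnKC nm); apply: le_trans (B _ _) _.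
  by rewrite lerD2r.
have [l Hl] : exists l, forall e : R, 0 < e -> exists n0, forall n, (n0 <= n)%N -> `|u n - l| <= e.
  apply: Qc => e e0; have [n0 H0] := tail _ e0; exists n0 => m n mn nn.
  have [nm|/ltnW mn'] := leqP n m; first exact: le_trans (C _ _ nm) (H0 _ nn).
  by rewrite distrC; exact: le_trans (C _ _ mn') (H0 _ mn).
exists l => n; apply/ler_addgt0Pr => e e0; have [n0 H0] := Hl _ e0.
have -> : u n - l = (u n - u (maxn n n0)) + (u (maxn n n0) - l) by rewrite addrA subrK.
apply: le_trans (ler_normD _ _) _; apply: lerD; last exact/H0/leq_maxr.
by rewrite distrC; exact/C/leq_maxl.
Qed.

(** Uniform continuity on [[0, T]]. *)
Definition cont T F := forall e : R, 0 < e -> exists2 d : R, 0 < d &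
  forall a b : R, 0 <= a <= T -> 0 <= b <= T -> `|b - a| < d -> `|F b - F a| <= e.

(** [U] is an antiderivative of [F] on [[0, T]]. *)
Definition antider T F U := forall e : R, 0 < e -> exists2 d : R, 0 < d &
  forall a b : R, 0 <= a -> a <= b -> b <= T -> b - a < d ->
    `|U b - U a - (b - a) *: F a| <= (b - a) * e.

Definition bounded_on T F (M : R) := forall t, 0 <= t <= T -> `|F t| <= M.

Lemma norm_increments T F U M : bounded_on T F M -> antider T F U ->
  forall a b : R, 0 <= a -> a <= b -> b <= T -> `|U b - U a| <= (b - a) * M.
Proof.
move=> FM FU a b a0 ab bT.
have := @increments_le R T M (fun t => `|U t - U a|); rewrite /= => H.
have := H _ a b a0 ab bT; rewrite subrr normr0 subr0; apply => {H} e e0.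
have [d d0 Hd] := FU e e0; exists d => // x y x0 xy yT xyd.
have Fx : `|F x| <= M by apply: FM; rewrite x0 (le_trans xy yT).
have yx : 0 <= y - x by rewrite subr_ge0.
have := Hd x y x0 xy yT xyd.
have t1 : `|U y - U a| - `|U x - U a| <= `|U y - U x|.
  by rewrite lerBlDr; have := ler_normD (U y - U x) (U x - U a); rewrite addrA subrK.
have t2 : `|U y - U x| <= `|U y - U x - (y - x) *: F x| + (y - x) * `|F x|.
  by have := ler_normD (U y - U x - (y - x) *: F x) ((y - x) *: F x); rewrite subrK normrZ (ger0_norm yx).
by have := ler_wpM2l yx Fx; rewrite mulrDr; lra.
Qed.

Lemma antiderD T F G U W : antider T F U -> antider T G W ->
  antider T (fun t => F t + G t) (fun t => U t + W t).
Proof.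
move=> FU GW e e0; have e2 : 0 < e / 2 by rewrite divr_gt0.
have [d d0 Hd] := FU _ e2; have [d' d0' Hd'] := GW _ e2.
exists (Num.min d d'); first by rewrite lt_min d0.
move=> a b a0 ab bT; rewrite lt_min => /andP[h h'].
have := Hd a b a0 ab bT h; have := Hd' a b a0 ab bT h'.
have -> : U b + W b - (U a + W a) - (b - a) *: (F a + G a) =
  (U b - U a - (b - a) *: F a) + (W b - W a - (b - a) *: G a).
  by lmod_eq R.
have := ler_normD (U b - U a - (b - a) *: F a) (W b - W a - (b - a) *: G a).
move: (`|_|) (`|_|) (`|_|) => x y z; have : (b - a) * e = (b - a) * (e / 2) + (b - a) * (e / 2) by field.
by lra.
Qed.

Lemma eq_antider T F G U W : (forall t, 0 <= t <= T -> F t = G t) ->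
  (forall t, 0 <= t <= T -> U t = W t) -> antider T F U -> antider T G W.
Proof.
move=> FG UW H e /H[d d0 Hd]; exists d => // a b a0 ab bT; have bT' := le_trans a0 ab.
have aT := le_trans ab bT.
by rewrite -FG -?UW ?a0 ?bT' //; exact: Hd.
Qed.

(** Bounded linear maps preserve antiderivatives. *)
Lemma antider_linear (P : normedModType R) T F U (L : Q -> P) (M : R) :
  (forall c x y, L (c *: x + y) = c *: L x + L y) -> (forall x, `|L x| <= M * `|x|) -> 0 < M ->
  antider T F U -> forall e : R, 0 < e -> exists2 d : R, 0 < d &
  forall a b : R, 0 <= a -> a <= b -> b <= T -> b - a < d ->
    `|L (U b) - L (U a) - (b - a) *: L (F a)| <= (b - a) * e.
Proof.
move=> Llin LM M0 FU e e0; have [d d0 Hd] := FU _ (divr_gt0 e0 M0); exists d => // a b a0 ab bT abd.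
have L0 : L 0 = 0 by apply: (addIr (L 0)); have := Llin 1 0 0; rewrite !scale1r !add0r => <-.
have LN x : L (- x) = - L x by have := Llin (-1) x 0; rewrite L0 !addr0 !scaleN1r.
have LD x y : L (x + y) = L x + L y by have := Llin 1 x y; rewrite !scale1r.
have -> : L (U b) - L (U a) - (b - a) *: L (F a) = L (U b - U a - (b - a) *: F a).
  by rewrite !LD !LN; congr (_ - _); have := Llin (b - a) (F a) 0; rewrite L0 !addr0.
apply: le_trans (LM _) _; have := ler_wpM2l (ltW M0) (Hd a b a0 ab bT abd).
by have -> : M * ((b - a) * (e / M)) = (b - a) * e by field; exact: lt0r_neq0.
Qed.

Lemma antider_unique T F U W : antider T F U -> antider T F W -> U 0 = W 0 ->
  forall t, 0 <= t <= T -> U t = W t.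
Proof.
move=> FU FW UW t /andP[t0 tT].
have lin : forall c (x y : Q), -%R (c *: x + y) = c *: - x + - y by move=> c x y; rewrite opprD scalerN.
have bd : forall x : Q, `|- x| <= 1 * `|x| by move=> x; rewrite normrN mul1r.
have FN : antider T (fun t => - F t) (fun t => - W t) := antider_linear lin bd ltr01 FW.
have B0 : bounded_on T (fun t => F t - F t) 0 by move=> s _; rewrite subrr normr0.
have := norm_increments B0 (antiderD FU FN) (lexx 0) t0 tT.
by rewrite mulr0 normr_le0 UW !subrr subr0 subr_eq0 => /eqP.
Qed.

Lemma cont_bounded T F : cont T F -> 0 <= T -> exists2 M, 0 < M & bounded_on T F M.
Proof.
move=> cF T0; have [d d0 Hd] := cF 1 ltr01.
pose n := Num.truncn (T / d); have nd : T / d < n.+1%:R by rewrite truncnS_gt.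
have n0 : (0 : R) < n.+1%:R by rewrite ltr0n.
exists (`|F 0| + n.+1%:R); first by rewrite ltr_wpDl.
move=> t /andP[t0 tT].
pose h := t / n.+1%:R; have h0 : 0 <= h by rewrite divr_ge0 // ltW.
have hd : h < d.
  by rewrite /h ltr_pdivrMr // mulrC -ltr_pdivrMr // (le_lt_trans _ nd) // ler_pM2r ?invr_gt0.
have nh : n.+1%:R * h = t by rewrite /h mulrCA divff ?mulr1 // lt0r_neq0.
have K i : (i <= n.+1)%N -> `|F (i%:R * h)| <= `|F 0| + i%:R.
  elim: i => [|i IH] i_n; first by rewrite mul0r addr0.
  have le1 j : (j <= n.+1)%N -> 0 <= j%:R * h <= T.
    by move=> jn; rewrite mulr_ge0 //= (le_trans _ tT) // -nh ler_wpM2r // ler_nat.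
  have E1 : i.+1%:R * h - i%:R * h = h by rewrite -addn1 natrD; ring.
  have := Hd _ _ (le1 _ (ltnW i_n)) (le1 _ i_n); rewrite E1 (ger0_norm h0) => /(_ hd) p.
  have := ler_normD (F (i.+1%:R * h) - F (i%:R * h)) (F (i%:R * h)); rewrite subrK => q.
  have E2 : i.+1%:R = i%:R + 1 :> R by rewrite -addn1 natrD.
  by rewrite [X in _ <= _ + X]E2; have := IH (ltnW i_n); lra.
by have := K n.+1 (leqnn _); rewrite nh.
Qed.

Lemma contD T F G : cont T F -> cont T G -> cont T (fun t => F t + G t).
Proof.
move=> cF cG e e0; have e2 : 0 < e / 2 by rewrite divr_gt0.
have [d d0 Hd] := cF _ e2; have [d' d0' Hd'] := cG _ e2.
exists (Num.min d d'); first by rewrite lt_min d0.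
move=> a b aT bT; rewrite lt_min => /andP[h h'].
have -> : F b + G b - (F a + G a) = (F b - F a) + (G b - G a) by rewrite opprD addrACA.
apply: le_trans (ler_normD _ _) _; have := Hd _ _ aT bT h; have := Hd' _ _ aT bT h'; lra.
Qed.

Lemma contZ T (c : R) F : cont T F -> cont T (fun t => c *: F t).
Proof.
move=> cF e e0; have c0 : 0 < `|c| + 1 by rewrite ltr_wpDl.
have [d d0 Hd] := cF _ (divr_gt0 e0 c0); exists d => // a b aT bT h.
rewrite -scalerBr normrZ; have := Hd _ _ aT bT h; rewrite ler_pdivlMr // mulrC.
by apply: le_trans; rewrite ler_wpM2r // lerDl.
Qed.

Lemma eq_cont T F G : (forall t, 0 <= t <= T -> F t = G t) -> cont T F -> cont T G.
Proof. by move=> FG cF e /cF[d d0 H]; exists d => // a b aT bT; rewrite -!FG //; exact: H. Qed.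

Lemma cont_sub T T' F : T' <= T -> cont T F -> cont T' F.
Proof.
move=> TT cF e /cF[d d0 H]; exists d => // a b /andP[a0 aT] /andP[b0 bT]; apply: H.
  by rewrite a0 (le_trans aT TT).
by rewrite b0 (le_trans bT TT).
Qed.

Lemma antider_sub T T' F U : T' <= T -> antider T F U -> antider T' F U.
Proof.
move=> TT FU e /FU[d d0 H]; exists d => // a b a0 ab bT; apply: H => //; exact: le_trans bT TT.
Qed.

Lemma antider_cont T F U M : bounded_on T F M -> 0 < M -> antider T F U -> cont T U.
Proof.
move=> FM M0 FU e e0; exists (e / M); first by rewrite divr_gt0.
move=> a b /andP[a0 aT] /andP[b0 bT].
have K x y : 0 <= x -> x <= y -> y <= T -> y - x < e / M -> `|U y - U x| <= e.
  move=> x0 xy yT h; apply: le_trans (norm_increments FM FU x0 xy yT) _.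
  by rewrite -ler_pdivlMr // ltW.
case: (leP a b) => [ab|/ltW ba] h.
  by apply: K => //; exact: le_lt_trans (ler_norm _) h.
by rewrite distrC; apply: K => //; rewrite distrC in h; exact: le_lt_trans (ler_norm _) h.
Qed.

(** The value at an endpoint may be replaced by the value at any point between. *)
Lemma antider_any T F U : cont T F -> antider T F U -> forall e : R, 0 < e ->
  exists2 d : R, 0 < d & forall a c b : R, 0 <= a -> a <= c -> c <= b -> b <= T -> b - a < d ->
    `|U b - U a - (b - a) *: F c| <= (b - a) * e.
Proof.
move=> cF FU e e0; have e2 : 0 < e / 2 by rewrite divr_gt0.
have [d d0 Hd] := FU _ e2; have [d' d0' Hd'] := cF _ e2.
exists (Num.min d d'); first by rewrite lt_min d0.
move=> a c b a0 ac cb bT; rewrite lt_min => /andP[h h'].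
have ab := le_trans ac cb; have ba : 0 <= b - a by rewrite subr_ge0.
have -> : U b - U a - (b - a) *: F c = (U b - U a - (b - a) *: F a) + - ((b - a) *: (F c - F a)).
  by rewrite scalerBr opprB addrA subrK.
apply: le_trans (ler_normD _ _) _; rewrite normrN normrZ (ger0_norm ba).
have H1 := Hd a b a0 ab bT h.
have H2 : `|F c - F a| <= e / 2.
  apply: Hd'; rewrite ?a0 ?(le_trans ab bT) ?(le_trans a0 ac) ?(le_trans cb bT) //.
  by rewrite ger0_norm ?subr_ge0 //; lra.
have := ler_wpM2l ba H2; have : (b - a) * e = (b - a) * (e / 2) + (b - a) * (e / 2) by field.
by lra.
Qed.

Section polygon.
Variables (T : R) (F : R -> Q).
Hypotheses (T0 : 0 < T) (cF : cont T F).

Definition mesh n : R := T / n.+1%:R.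
Definition polygon n t : Q := \sum_(i < n.+1) clip (mesh n) (t - i%:R * mesh n) *: F (i%:R * mesh n).

Lemma mesh_gt0 n : 0 < mesh n. Proof. by rewrite divr_gt0. Qed.

Lemma mesh_total n : n.+1%:R * mesh n = T.
Proof. by rewrite /mesh mulrCA divff ?mulr1 // pnatr_eq0. Qed.

Lemma mesh_small (d : R) : 0 < d -> exists n0, forall n, (n0 <= n)%N -> mesh n < d.
Proof.
move=> d0; exists (Num.truncn (T / d)) => n nn; rewrite /mesh ltr_pdivrMr ?ltr0n // mulrC -ltr_pdivrMr //.
by apply: lt_le_trans (truncnS_gt _) _; rewrite ler_nat.
Qed.

Lemma polygon_antider (e : R) : 0 < e -> exists2 d : R, 0 < d & forall n (a b : R),
  mesh n < d -> 0 <= a -> a <= b -> b <= T -> b - a < d ->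
  `|polygon n b - polygon n a - (b - a) *: F a| <= (b - a) * e.
Proof.
move=> e0; have [d d0 Hd] := cF e0; exists (d / 2); first by rewrite divr_gt0.
move=> n a b hn a0 ab bT ba; set h := mesh n in hn *; have h0 : 0 < h := mesh_gt0 n.
pose w i := clip h (b - i%:R * h) - clip h (a - i%:R * h).
have w0 i : 0 <= w i by rewrite subr_ge0; apply: clip_mono; rewrite ?lerD2r // ltW.
have sw : \sum_(i < n.+1) w i = b - a.
  have aT := le_trans ab bT; have b0 := le_trans a0 ab.
  rewrite sumrB !clip_sum ?(ltW h0) // mesh_total.
  by rewrite !min_l.
have -> : polygon n b - polygon n a - (b - a) *: F a = \sum_(i < n.+1) w i *: (F (i%:R * h) - F a).
  rewrite -sw /polygon -sumrB scaler_suml -sumrB; apply: eq_bigr => i _.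
  by rewrite -scalerBl scalerBr.
apply: le_trans (ler_norm_sum _ _ _) _; rewrite -sw mulr_suml; apply: ler_sum => i _.
rewrite normrZ (ger0_norm (w0 i)).
have [/eqP wi|wi] := boolP (w i == 0); first by rewrite wi !mul0r.
apply: ler_wpM2l => //; have ih0 : 0 <= i%:R * h by rewrite mulr_ge0 // ltW.
have [l1 l2] : a - i%:R * h < h /\ 0 < b - i%:R * h.
  by apply: clip_local; rewrite ?lerD2r ?(ltW h0) // -subr_eq0.
apply: Hd.
- by rewrite a0 (le_trans ab bT).
- by rewrite ih0 -(mesh_total n) ler_wpM2r ?(ltW h0) // ler_nat ltnW.
by rewrite ltr_norml; apply/andP; split; lra.
Qed.

Lemma polygon0 n : polygon n 0 = 0.
Proof.
have h0 := mesh_gt0 n; apply: big1 => i _; have : 0 <= i%:R * mesh n by rewrite mulr_ge0 // ltW.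
move: (_ * mesh n) => x x0.
suff -> : clip (mesh n) (0 - x) = 0 by rewrite scale0r.
by rewrite /clip sub0r oppr_le0 x0.
Qed.

End polygon.

Lemma antider_exists T F : 0 <= T -> cont T F -> exists U, antider T F U /\ U 0 = 0.
Proof.
move=> T0 cF; have [T0'|Tn] := ltP 0 T; last first.
  exists (fun=> 0); split=> // e e0; exists 1 => // a b a0 ab bT _.
  have -> : b = a by lra.
  by rewrite !subrr scale0r mul0r oppr0 addr0 normr0.
have T1 : 0 < T + 1 by lra.
have /choice[U HU] (t : R) : exists l, 0 <= t <= T -> forall e : R, 0 < e -> exists n0, forall n,
    (n0 <= n)%N -> `|polygon T F n t - l| <= e.
  case: (boolP (0 <= t <= T)) => [/andP[t0 tT]|]; last by exists 0.
  have [|l Hl] := Qc (u := fun n => polygon T F n t); last by exists l.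
  move=> e e0; have e1 : 0 < e / 2 / (T + 1) by rewrite !divr_gt0.
  have [d d0 Hd] := polygon_antider T0' cF e1; have [n0 H0] := mesh_small T d0.
  exists n0 => m n mn nn.
  pose g s := `|polygon T F m s - polygon T F n s|.
  have : g t - g 0 <= (t - 0) * (2 * (e / 2 / (T + 1))).
    apply: (@increments_le R T) => // e' e0'; exists d => // a b a0 ab bT abd.
    have h1 := Hd m a b (H0 _ mn) a0 ab bT abd; have h2 := Hd n a b (H0 _ nn) a0 ab bT abd.
    rewrite /g lerBlDr.
    have -> : polygon T F m b - polygon T F n b =
      (polygon T F m b - polygon T F m a - (b - a) *: F a) -
      (polygon T F n b - polygon T F n a - (b - a) *: F a) + (polygon T F m a - polygon T F n a).
      by lmod_eq R.
    have := ler_normD (polygon T F m b - polygon T F m a - (b - a) *: F a -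
      (polygon T F n b - polygon T F n a - (b - a) *: F a)) (polygon T F m a - polygon T F n a).
    have := ler_normB (polygon T F m b - polygon T F m a - (b - a) *: F a)
      (polygon T F n b - polygon T F n a - (b - a) *: F a).
    have p0 : 0 <= (b - a) * e' by rewrite mulr_ge0 ?subr_ge0 // ltW.
    rewrite mulrDr mulrCA; move: h1 h2; move: (`|_|) (`|_|) (`|_|) (`|_|) (`|_|) (_ * e') p0 ((b - a) * _).
    by move=> *; lra.
  rewrite /g !polygon0 // subrr normr0 !subr0 => /le_trans; apply.
  have -> : t * (2 * (e / 2 / (T + 1))) = e * (t / (T + 1)) by field; lra.
  rewrite ger_pMr // ler_pdivrMr // mul1r; lra.
have z0 : 0 <= (0 : R) <= T by rewrite lexx.
have U0 : U 0 = 0.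
  apply/eqP; rewrite -normr_le0; apply/ler_addgt0Pr => e e0; rewrite add0r.
  have [n0 H] := HU 0 z0 e e0.
  by have := H n0 (leqnn _); rewrite polygon0 // sub0r normrN.
exists U; split => // e e0; have [d d0 Hd] := polygon_antider T0' cF e0.
exists d => // a b a0 ab bT abd; apply/ler_addgt0Pr => e' e0'.
have e2 : 0 < e' / 2 by rewrite divr_gt0.
have [n1 H1] := mesh_small T d0.
have aT : 0 <= a <= T by rewrite a0 (le_trans ab bT).
have bT' : 0 <= b <= T by rewrite bT (le_trans a0 ab).
have [n2 H2] := HU a aT _ e2; have [n3 H3] := HU b bT' _ e2.
pose n := maxn n1 (maxn n2 n3).
have h1 := H1 n (leq_maxl _ _).
have h2 := H2 n (leq_trans (leq_maxl _ _) (leq_maxr _ _)).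
have h3 := H3 n (leq_trans (leq_maxr _ _) (leq_maxr _ _)).
have := Hd n a b h1 a0 ab bT abd.
have -> : U b - U a - (b - a) *: F a = (polygon T F n b - polygon T F n a - (b - a) *: F a) +
   ((polygon T F n a - U a) - (polygon T F n b - U b)).
  by lmod_eq R.
have := ler_normD (polygon T F n b - polygon T F n a - (b - a) *: F a)
   ((polygon T F n a - U a) - (polygon T F n b - U b)).
have := ler_normB (polygon T F n a - U a) (polygon T F n b - U b).
move: h2 h3; move: (`|_|) (`|_|) (`|_|) (`|_|) (`|_|) (_ * e) => *; lra.
Qed.

End calculus.

(** * The exponential of a bounded skew operator *)

Section linear_maps.
Context {R : realType} (P Q : lmodType R) (L : P -> Q).

Definition lin := forall (c : R) x y, L (c *: x + y) = c *: L x + L y.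

Hypothesis Ll : lin.

Lemma lin0 : L 0 = 0.
Proof. by apply: (addIr (L 0)); have := Ll 1 0 0; rewrite !scale1r !add0r => <-. Qed.
Lemma linD x y : L (x + y) = L x + L y.
Proof. by have := Ll 1 x y; rewrite !scale1r. Qed.
Lemma linZ (c : R) x : L (c *: x) = c *: L x.
Proof. by have := Ll c x 0; rewrite lin0 !addr0. Qed.
Lemma linN x : L (- x) = - L x.
Proof. by rewrite -scaleN1r linZ scaleN1r. Qed.
Lemma linB x y : L (x - y) = L x - L y.
Proof. by rewrite linD linN. Qed.
Lemma linsum (I : Type) (r : seq I) (F : I -> P) : L (\sum_(i <- r) F i) = \sum_(i <- r) L (F i).
Proof.
elim: r => [|i r IH]; first by rewrite !big_nil lin0.
by rewrite !big_cons linD IH.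
Qed.

End linear_maps.

Section limits.
Context {R : realType} (Q : normedModType R).
Implicit Types (u v : nat -> Q).

Definition slim u l := forall e : R, 0 < e -> exists n0, forall n, (n0 <= n)%N -> `|u n - l| <= e.

Lemma slim_le u l (M : R) : slim u l -> (forall n, `|u n| <= M) -> `|l| <= M.
Proof.
move=> ul uM; apply/ler_addgt0Pr => e /ul[n0 /(_ n0 (leqnn _)) H].
have := ler_normB (u n0) (u n0 - l); rewrite opprB addrC subrK; have := uM n0; lra.
Qed.

Lemma slim_unique u l l' : slim u l -> slim u l' -> l = l'.
Proof.
move=> ul ul'; apply/eqP; rewrite -subr_eq0 -normr_le0; apply/ler_addgt0Pr => e e0; rewrite add0r.
have e2 : 0 < e / 2 by rewrite divr_gt0.
have [n H] := ul _ e2; have [m H'] := ul' _ e2.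
have h := H _ (leq_maxl n m); have h' := H' _ (leq_maxr n m).
have -> : l - l' = (u (maxn n m) - l') - (u (maxn n m) - l) by lmod_eq R.
by apply: le_trans (ler_normB _ _) _; lra.
Qed.

Lemma slim_shift u l : slim u l -> slim (fun n => u n.+1) l.
Proof. by move=> ul e /ul[n H]; exists n => m nm; apply: H; exact: leqW. Qed.

Lemma slim_lincomb (c : R) u v l l' : slim u l -> slim v l' ->
  slim (fun n => c *: u n + v n) (c *: l + l').
Proof.
move=> ul vl e e0; have c0 : 0 < 2 * (`|c| + 1) by rewrite mulr_gt0 // ltr_wpDl.
have e2 : 0 < e / 2 by rewrite divr_gt0.
have [n H] := ul _ (divr_gt0 e0 c0); have [m H'] := vl _ e2.
exists (maxn n m) => k; rewrite geq_max => /andP[/H h /H' h'].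
have -> : c *: u k + v k - (c *: l + l') = c *: (u k - l) + (v k - l') by lmod_eq R.
apply: le_trans (ler_normD _ _) _; rewrite normrZ.
have : `|c| * `|u k - l| <= (`|c| + 1) * (e / (2 * (`|c| + 1))) by apply: ler_pM => //; lra.
have -> : (`|c| + 1) * (e / (2 * (`|c| + 1))) = e / 2.
  by field; have := normr_ge0 c; lra.
by lra.
Qed.

Lemma slim_lin (P : normedModType R) (L : Q -> P) (M : R) u l : lin L -> 0 < M ->
  (forall x, `|L x| <= M * `|x|) -> slim u l ->
  forall e : R, 0 < e -> exists n0, forall n, (n0 <= n)%N -> `|L (u n) - L l| <= e.
Proof.
move=> Ll M0 LM ul e e0; have [n H] := ul _ (divr_gt0 e0 M0); exists n => m /H h.
by rewrite -linB //; apply: le_trans (LM _) _; rewrite mulrC -ler_pdivlMr.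
Qed.

End limits.

Section exponential.
Context {R : realType} (Q : normedModType R).
Hypothesis Qc : seq_complete Q.
Variable A : Q -> Q.
Hypotheses (Al : lin A) (Ale : forall x, `|A x| <= `|x|).

Definition Ek (r : R) : R := limn (series (exp_coeff r)).

Lemma Ek_ge r n : 0 <= r -> series (exp_coeff r) n <= Ek r.
Proof.
move=> r0; apply: nondecreasing_cvgn_le; last exact: is_cvg_series_exp_coeff.
apply/nondecreasing_seqP => k; rewrite /series /= big_nat_recr //= lerDl.
by rewrite /exp_coeff /= divr_ge0 // exprn_ge0.
Qed.

Lemma Ek_ge0 r : 0 <= r -> 0 <= Ek r.
Proof. by move=> r0; have := Ek_ge 0 r0; rewrite /series /= big_nil. Qed.

Lemma sum_Ek (r : R) n : 0 <= r -> \sum_(k < n) r ^+ k / k`!%:R <= Ek r.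
Proof. by move=> r0; have := Ek_ge n r0; rewrite /series /= big_mkord. Qed.

Definition expsum n (t : R) x : Q := \sum_(k < n) (t ^+ k / k`!%:R) *: iter k A x.
Definition S (t : R) x : Q := xget 0 [set l | slim (fun n => expsum n t x) l].

Lemma iterA_le k x : `|iter k A x| <= `|x|.
Proof. by elim: k => [//|k IH] /=; exact: le_trans (Ale _) IH. Qed.

Lemma iterA_lin k : lin (iter k A).
Proof. by elim: k => [//|k IH] c x y /=; rewrite IH Al. Qed.

Lemma expsum_lin n t : lin (expsum n t).
Proof.
move=> c x y; rewrite /expsum scaler_sumr -big_split; apply: eq_bigr => k _ /=.
by rewrite iterA_lin; lmod_eq R.
Qed.

Lemma S_slim t x : slim (fun n => expsum n t x) (S t x).
Proof.
suff [l H] : exists l, slim (fun n => expsum n t x) l.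
  by have := @xgetPex _ 0 [set l | slim (fun n => expsum n t x) l]; apply; exists l.
have cs : cvgn (series (`|x| *: exp_coeff `|t|)).
  by apply: is_cvg_seriesZ; exact: is_cvg_series_exp_coeff.
have [|l Hl] := absconv Qc (u := fun n => expsum n t x) _ cs.
  move=> n; rewrite /expsum big_ord_recr /= addrAC subrr add0r normrZ.
  rewrite normrM normfV normrX (ger0_norm (ler0n _ _)) [leRHS](_ : _ = `|x| * (`|t| ^+ n / n`!%:R)) //.
  rewrite mulrC ler_wpM2r ?iterA_le // divr_ge0 // exprn_ge0 //.
exists l => e e0; have /cvgrPdist_le/(_ _ e0)[n0 _ H] := cs; exists n0 => n /H h.
by apply: le_trans (Hl n) _; apply: le_trans (ler_norm _) h.
Qed.

Lemma S_unique t x l : slim (fun n => expsum n t x) l -> S t x = l.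
Proof. exact: slim_unique (S_slim t x). Qed.

Lemma S_lin t : lin (S t).
Proof.
move=> c x y; apply: S_unique.
have := slim_lincomb c (S_slim t x) (S_slim t y).
by under eq_fun do rewrite -expsum_lin.
Qed.

Lemma expsum_le n r t x : `|t| <= r -> `|expsum n t x| <= Ek r * `|x|.
Proof.
move=> tr; have r0 : 0 <= r by apply: le_trans tr.
apply: le_trans (ler_norm_sum _ _ _) _.
apply: (@le_trans _ _ ((\sum_(k < n) r ^+ k / k`!%:R) * `|x|)); last first.
  by rewrite ler_wpM2r // sum_Ek.
rewrite mulr_suml; apply: ler_sum => k _; rewrite normrZ.
apply: ler_pM => //; last exact: iterA_le.
rewrite normrM normfV normrX (ger0_norm (ler0n _ _)).
by rewrite ler_wpM2r ?invr_ge0 // lerXn2r.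
Qed.

Lemma S_le r t x : `|t| <= r -> `|S t x| <= Ek r * `|x|.
Proof. by move=> tr; apply: slim_le (S_slim t x) _ => n; exact: expsum_le. Qed.

Lemma S0 x : S 0 x = x.
Proof.
apply: S_unique => e e0; exists 1%N => -[//|n] _.
rewrite /expsum big_ord_recl /= expr0 fact0 divr1 scale1r big1 ?addr0 ?subrr ?normr0 ?ltW //.
by move=> i _; rewrite /bump /= add1n exprS mul0r mul0r scale0r.
Qed.

Lemma pow_taylor (r a b : R) k : 1 <= r -> `|a| <= r -> `|b| <= r ->
  `|b ^+ k.+1 - a ^+ k.+1 - k.+1%:R * a ^+ k * (b - a)| <= (k * k.+1)%:R * r ^+ k * (b - a) ^+ 2.
Proof.
move=> r1 ar br; have r0 : 0 <= r by lra.
elim: k => [|k IH]; first by rewrite !expr1 expr0 mul0n !mul0r mulr1 mul1r subrr normr0.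
have E : b ^+ k.+2 - a ^+ k.+2 - k.+2%:R * a ^+ k.+1 * (b - a) =
  b * (b ^+ k.+1 - a ^+ k.+1 - k.+1%:R * a ^+ k * (b - a)) + k.+1%:R * a ^+ k * (b - a) ^+ 2.
  have N : k.+2%:R = k.+1%:R + 1 :> R by rewrite -addn1 natrD.
  by rewrite N !exprS; move: (k.+1%:R) => c; ring.
have h2 := sqr_ge0 (b - a).
have n1 : `|k.+1%:R * a ^+ k * (b - a) ^+ 2| = k.+1%:R * `|a| ^+ k * (b - a) ^+ 2.
  by rewrite normrM (ger0_norm h2) normrM normrX (ger0_norm (ler0n _ _)).
rewrite E; apply: le_trans (ler_normD _ _) _; rewrite n1 normrM.
have p1 : `|b| * `|b ^+ k.+1 - a ^+ k.+1 - k.+1%:R * a ^+ k * (b - a)| <=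
   r * ((k * k.+1)%:R * r ^+ k * (b - a) ^+ 2) by apply: ler_pM.
have p2 : k.+1%:R * `|a| ^+ k * (b - a) ^+ 2 <= k.+1%:R * r ^+ k.+1 * (b - a) ^+ 2.
  rewrite ler_wpM2r // ler_wpM2l //; apply: (@le_trans _ _ (r ^+ k)); first by rewrite lerXn2r.
  by rewrite exprS ler_peMl // exprn_ge0.
apply: le_trans (lerD p1 p2) _.
rewrite mulrA (mulrCA r) -exprS -mulrDl -mulrDl ler_wpM2r // ler_wpM2r ?exprn_ge0 //.
have N1 : k.+1%:R = k%:R + 1 :> R by rewrite -addn1 natrD.
have N2 : k.+2%:R = k%:R + 2 :> R by rewrite -addn2 natrD.
by rewrite !natrM N2 N1; have := ler0n R k; lra.
Qed.

Lemma expsum_taylor n r a b x : 1 <= r -> `|a| <= r -> `|b| <= r ->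
  `|expsum n.+1 b x - expsum n.+1 a x - (b - a) *: A (expsum n a x)| <=
     (b - a) ^+ 2 * (Ek (2 * r) * `|x|).
Proof.
move=> r1 ar br; have r0 : 0 <= r by lra.
have E t : expsum n.+1 t x = x + \sum_(k < n) (t ^+ k.+1 / k.+1`!%:R) *: iter k.+1 A x.
  by rewrite /expsum big_ord_recl /= expr0 fact0 divr1 scale1r.
have -> : expsum n.+1 b x - expsum n.+1 a x - (b - a) *: A (expsum n a x) =
  \sum_(k < n) ((b ^+ k.+1 - a ^+ k.+1 - k.+1%:R * a ^+ k * (b - a)) / k.+1`!%:R) *: iter k.+1 A x.
  rewrite !E /expsum (linsum Al) scaler_sumr opprD addrACA subrr add0r -!sumrB.
  apply: eq_bigr => k _; rewrite (linZ Al) /=.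
  have f0 : (k`!%:R : R) != 0 by rewrite pnatr_eq0 -lt0n fact_gt0.
  have f1 : (k.+1%:R : R) != 0 by rewrite pnatr_eq0.
  have -> : (b ^+ k.+1 - a ^+ k.+1 - k.+1%:R * a ^+ k * (b - a)) / k.+1`!%:R =
    b ^+ k.+1 / k.+1`!%:R - a ^+ k.+1 / k.+1`!%:R - (b - a) * (a ^+ k / k`!%:R).
    rewrite factS natrM; move: (k.+1%:R) f1 (k`!%:R) f0 (b ^+ _) (a ^+ k.+1) => c c0 g g0 x' y'.
    by field; rewrite ?c0 ?g0.
  by lmod_eq R.
apply: le_trans (ler_norm_sum _ _ _) _.
rewrite mulrA; apply: (@le_trans _ _ ((b - a) ^+ 2 * (\sum_(k < n) (2 * r) ^+ k / k`!%:R) * `|x|)); last first.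
  by rewrite ler_wpM2r // ler_wpM2l ?sqr_ge0 // sum_Ek // mulr_ge0.
rewrite mulr_sumr mulr_suml; apply: ler_sum => k _; rewrite normrZ.
apply: ler_pM => //; last exact: iterA_le.
rewrite normrM normfV (ger0_norm (ler0n _ _)) ler_pdivrMr ?ltr0n ?fact_gt0 //.
apply: le_trans (pow_taylor k r1 ar br) _.
have -> : (b - a) ^+ 2 * ((2 * r) ^+ k / k`!%:R) * k.+1`!%:R = (k.+1 * 2 ^ k)%:R * r ^+ k * (b - a) ^+ 2.
  have f0 : (k`!%:R : R) != 0 by rewrite pnatr_eq0 -lt0n fact_gt0.
  rewrite factS !natrM natrX exprMn; move: (k.+1%:R) (k`!%:R) f0 (2 ^+ k) (r ^+ k) => c g g0 x' y'.
  by field.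
rewrite ler_wpM2r ?sqr_ge0 // ler_wpM2r ?exprn_ge0 // ler_nat mulnC leq_mul2l /=.
by apply: ltnW; exact: ltn_expl.
Qed.

Lemma S_taylor r a b x : 1 <= r -> `|a| <= r -> `|b| <= r ->
  `|S b x - S a x - (b - a) *: A (S a x)| <= (b - a) ^+ 2 * (Ek (2 * r) * `|x|).
Proof.
move=> r1 ar br; have Ale1 z : `|A z| <= 1 * `|z| by rewrite mul1r.
have l3 : slim (fun n => A (expsum n a x)) (A (S a x)) := slim_lin Al ltr01 Ale1 (S_slim a x).
have l1 := slim_shift (S_slim b x); have l2 := slim_shift (S_slim a x).
have l4 := slim_lincomb (-1) l2 l1; have l5 := slim_lincomb (- (b - a)) l3 l4.
have -> : S b x - S a x - (b - a) *: A (S a x) = - (b - a) *: A (S a x) + (-1 *: S a x + S b x).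
  by lmod_eq R.
apply: slim_le l5 _ => n; apply: le_trans (expsum_taylor n x r1 ar br).
by rewrite le_eqVlt; apply/orP; left; apply/eqP; congr (`|_|); lmod_eq R.
Qed.

Definition SLip r : R := Ek r + 2 * r * Ek (2 * r).

Lemma S_lip r a b x : 1 <= r -> `|a| <= r -> `|b| <= r -> `|S b x - S a x| <= `|b - a| * (SLip r * `|x|).
Proof.
move=> r1 ar br; have r0 : 0 <= r by lra.
have := ler_normD (S b x - S a x - (b - a) *: A (S a x)) ((b - a) *: A (S a x)); rewrite subrK => H.
apply: le_trans H _; rewrite normrZ.
have h1 := S_taylor x r1 ar br.
have h2 : `|A (S a x)| <= Ek r * `|x| := le_trans (Ale _) (S_le x ar).
have h3 : `|b - a| <= 2 * r by apply: le_trans (ler_normB _ _) _; lra.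
have r2 : 0 <= 2 * r by lra.
have k0 := mulr_ge0 (Ek_ge0 r2) (normr_ge0 x).
have h4 : (b - a) ^+ 2 * (Ek (2 * r) * `|x|) <= `|b - a| * (2 * r * (Ek (2 * r) * `|x|)).
  have E2 : (b - a) ^+ 2 = `|b - a| * `|b - a| by rewrite -expr2 real_normK // num_real.
  by rewrite E2 -(mulrA `|b - a| `|b - a|); apply: ler_wpM2l => //; apply: ler_wpM2r.
have h5 := ler_wpM2l (normr_ge0 (b - a)) h2.
have -> : `|b - a| * (SLip r * `|x|) = `|b - a| * (2 * r * (Ek (2 * r) * `|x|)) + `|b - a| * (Ek r * `|x|).
  by rewrite /SLip; ring.
by lra.
Qed.

Lemma SLip_ge0 r : 1 <= r -> 0 <= SLip r.
Proof.
by move=> r1; apply: addr_ge0; [apply: Ek_ge0|apply: mulr_ge0; [|apply: Ek_ge0]]; lra.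
Qed.

Lemma cont_S T (p : R -> R) (F : R -> Q) : 0 <= T -> (exists r, forall t, 0 <= t <= T -> `|p t| <= r) ->
  (forall a b, `|p b - p a| <= `|b - a|) -> cont T F -> cont T (fun t => S (p t) (F t)).
Proof.
move=> T0 [r0 pr] pl cF; pose r := Num.max 1 r0.
have r1 : 1 <= r by rewrite le_max lexx.
have pr' t : 0 <= t <= T -> `|p t| <= r by move=> /pr h; rewrite le_max h orbT.
have [M M0 FM] := cont_bounded cF T0 => e e0.
have rr : 0 <= r by lra.
have c1 : 0 < 2 * (Ek r + 1) by rewrite mulr_gt0 // ltr_wpDl // Ek_ge0.
have c2 : 0 < 2 * (SLip r * M + 1) by rewrite mulr_gt0 // ltr_wpDl // mulr_ge0 ?SLip_ge0 // ltW.
have [d d0 Hd] := cF _ (divr_gt0 e0 c1).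
exists (Num.min d (e / (2 * (SLip r * M + 1)))); first by rewrite lt_min d0 divr_gt0.
move=> a b aT bT; rewrite lt_min => /andP[h1 h2].
have -> : S (p b) (F b) - S (p a) (F a) = S (p b) (F b - F a) + (S (p b) (F a) - S (p a) (F a)).
  by rewrite (linB (@S_lin (p b))); lmod_eq R.
apply: le_trans (ler_normD _ _) _.
have g1 : `|S (p b) (F b - F a)| <= e / 2.
  apply: le_trans (S_le _ (pr' _ bT)) _.
  apply: (@le_trans _ _ ((Ek r + 1) * (e / (2 * (Ek r + 1))))).
    by apply: ler_pM; rewrite ?Ek_ge0 ?lerDl //; exact: Hd.
  by have -> : (Ek r + 1) * (e / (2 * (Ek r + 1))) = e / 2 by field; lra.
have g2 : `|S (p b) (F a) - S (p a) (F a)| <= e / 2.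
  apply: le_trans (S_lip _ r1 (pr' _ aT) (pr' _ bT)) _.
  apply: (@le_trans _ _ (e / (2 * (SLip r * M + 1)) * (SLip r * M + 1))).
    apply: ler_pM => //; first by rewrite mulr_ge0 ?SLip_ge0.
      exact: le_trans (pl _ _) (ltW h2).
    by apply: (@le_trans _ _ (SLip r * M)); rewrite ?lerDl // ler_wpM2l ?SLip_ge0 // FM.
  by have -> : e / (2 * (SLip r * M + 1)) * (SLip r * M + 1) = e / 2 by field; lra.
by lra.
Qed.

Lemma S_antider T s x : 0 <= T -> antider T (fun t => A (S (t + s) x)) (fun t => S (t + s) x).
Proof.
move=> T0 e e0; pose r := T + `|s| + 1.
have s0 := normr_ge0 s; have r1 : 1 <= r by rewrite /r; lra.
have r2 : 0 <= 2 * r by lra.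
have c0 : 0 < Ek (2 * r) * `|x| + 1 by rewrite ltr_wpDl // mulr_ge0 // Ek_ge0.
exists (e / (Ek (2 * r) * `|x| + 1)); first by rewrite divr_gt0.
move=> a b a0 ab bT h.
have K t : 0 <= t -> t <= T -> `|t + s| <= r.
  by move=> t0 tT; apply: le_trans (ler_normD _ _) _; rewrite (ger0_norm t0) /r; lra.
have := S_taylor x r1 (K a a0 (le_trans ab bT)) (K b (le_trans a0 ab) bT).
have -> : b + s - (a + s) = b - a by ring.
move=> /le_trans; apply; rewrite expr2 -mulrA ler_wpM2l ?subr_ge0 //.
apply: (@le_trans _ _ (e / (Ek (2 * r) * `|x| + 1) * (Ek (2 * r) * `|x| + 1))); last by rewrite divfK ?lt0r_neq0.
by apply: ler_pM; rewrite ?subr_ge0 ?mulr_ge0 ?Ek_ge0 ?lerDl // ltW.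
Qed.

Lemma antider_shift T a (F U : R -> Q) : 0 <= a -> antider T F U ->
  antider (T - a) (fun t => F (t + a)) (fun t => U (t + a)).
Proof.
move=> a0 H e /H[d d0 Hd]; exists d => // x y x0 xy yT h.
have E : y + a - (x + a) = y - x by ring.
by have := Hd (x + a) (y + a); rewrite E; apply; lra.
Qed.

(** Gronwall's lemma with zero data, by halving on steps of length [1 / (2 L)]. *)
Lemma ode_zero T (f w : R -> Q) (L M0 : R) : 0 < L -> antider T f w ->
  (forall t, 0 <= t <= T -> `|f t| <= L * `|w t|) -> bounded_on T w M0 -> w 0 = 0 ->
  forall t, 0 <= t <= T -> w t = 0.
Proof.
move=> L0 fw fL wM w0.
have inc a b m : 0 <= a -> a <= b -> b <= T -> (forall t, a <= t <= b -> `|w t| <= m) ->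
    `|w b - w a| <= (b - a) * (L * m).
  move=> a0 ab bT wm.
  have sh := antider_sub (lerB bT (lexx a)) (antider_shift a0 fw).
  have := @norm_increments _ _ (b - a) _ _ (L * m) _ sh 0 (b - a).
  rewrite add0r subrK subr0; apply=> //; last by rewrite subr_ge0.
  move=> t /andP[t0 tb]; apply: (le_trans (fL _ _)); first by apply/andP; split; lra.
  by rewrite ler_wpM2l ?(ltW L0) // wm //; apply/andP; split; lra.
pose tau := (2 * L)^-1; have tau0 : 0 < tau by rewrite invr_gt0 mulr_gt0.
have tauL : tau * L = 2^-1 by rewrite /tau; field; lra.
have K (n : nat) t : 0 <= t <= T -> t <= n%:R * tau -> w t = 0.
  elim: n t => [|n IH] t /andP[t0 tT] tn.
    by have -> : t = 0 by (move: tn; rewrite mul0r => tn; lra).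
  have [tn'|tn'] := leP t (n%:R * tau); first by apply: IH => //; rewrite t0 tT.
  set a := n%:R * tau in tn'; have a0 : 0 <= a by rewrite mulr_ge0 // ltW.
  have wa : w a = 0 by apply: IH; rewrite ?lexx // a0 (le_trans (ltW tn') tT).
  have ta : t <= a + tau by move: tn; rewrite -addn1 natrD mulrDl mul1r.
  have HK k s : a <= s <= t -> `|w s| <= M0 / 2 ^+ k.
    elim: k s => [|k IHk] s /andP[as_ st].
      by rewrite expr0 divr1; apply: wM; apply/andP; split; lra.
    have sT : s <= T by lra.
    have := inc a s (M0 / 2 ^+ k) a0 as_ sT; rewrite wa subr0 => Hinc.
    have {}Hinc : `|w s| <= (s - a) * (L * (M0 / 2 ^+ k)).
      by apply: Hinc => u /andP[au us]; apply: IHk; apply/andP; split; lra.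
    apply: le_trans Hinc _.
    have M1 : 0 <= M0 / 2 ^+ k by apply: le_trans (IHk a _) => //; rewrite lexx ltW.
    have : (s - a) * L <= 2^-1 by rewrite -tauL ler_wpM2r ?(ltW L0) //; lra.
    move/(ler_wpM2r M1); rewrite -mulrA => /le_trans; apply.
    by rewrite exprS invfM mulrCA.
  have tt : a <= t <= t by rewrite lexx ltW.
  apply/eqP; rewrite -normr_le0 leNgt; apply/negP => wt.
  have M1 : 0 < M0 by have := HK 0%N t tt; rewrite expr0 divr1; exact: lt_le_trans.
  pose k := Num.truncn (M0 / `|w t|).
  have h1 : M0 / `|w t| < k.+1%:R by rewrite truncnS_gt.
  have h2 : (k.+1%:R : R) <= 2 ^+ k.+1 by rewrite -natrX ler_nat ltnW // ltn_expl.
  have := HK k.+1 t tt; rewrite leNgt => /negP; apply.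
  by rewrite ltr_pdivrMr ?exprn_gt0 // mulrC -ltr_pdivrMr //; exact: lt_le_trans h1 h2.
move=> t tT; apply: (K (Num.truncn (t / tau)).+1) => //.
by rewrite -ler_pdivrMr // ltW // truncnS_gt.
Qed.

Lemma S_add t s x : 0 <= t -> S (t + s) x = S t (S s x).
Proof.
move=> t0; apply/eqP; rewrite -subr_eq0; apply/eqP.
have d1 := S_antider s x t0; have d2 := S_antider 0 (S s x) t0.
have lin : forall c (x y : Q), -%R (c *: x + y) = c *: - x + - y by move=> c z y; rewrite opprD scalerN.
have bd : forall x : Q, `|- x| <= 1 * `|x| by move=> z; rewrite normrN mul1r.
have d3 : antider t (fun u => - A (S (u + 0) (S s x))) (fun u => - S (u + 0) (S s x)) := antider_linear lin bd ltr01 d2.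
have := antiderD d1 d3; pose w u := S (u + s) x - S (u + 0) (S s x) => dw.
have -> : S (t + s) x - S t (S s x) = w t by rewrite /w addr0.
have r0 u : 0 <= u <= t -> `|u + s| <= t + `|s| by move=> /andP[u0 ut]; apply: le_trans (ler_normD _ _) _; rewrite ger0_norm // lerD2r.
have r1 u : 0 <= u <= t -> `|u + 0| <= t by move=> /andP[u0 ut]; rewrite addr0 ger0_norm.
apply: (ode_zero (T := t) (L := 1) (M0 := Ek (t + `|s|) * `|x| + Ek t * `|S s x|) ltr01 dw).
- by move=> u ut; rewrite mul1r -(linB Al); exact: Ale.
- move=> u ut; apply: le_trans (ler_normB _ _) _; apply: lerD; apply: S_le; [exact: r0|exact: r1].
- by rewrite /= !add0r S0 subrr.
- by rewrite t0 lexx.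
Qed.

Variable En : Q -> R.
Hypotheses (En_le : forall x, En x <= `|x|) (En_ge : forall x, `|x| <= 2 * En x)
  (EnD : forall x y, En (x + y) <= En x + En y)
  (EnA : forall (c : R) x, En (x + c *: A x) ^+ 2 <= (1 + c ^+ 2) * En x ^+ 2).

Lemma En_ge0 x : 0 <= En x.
Proof. by have := En_ge x; have := normr_ge0 x; lra. Qed.

(** The energy of [S t x] is constant up to second order in the time step, so it
    does not grow. *)
Lemma S_le2 t x : 0 <= t -> `|S t x| <= 2 * `|x|.
Proof.
move=> t0; apply: le_trans (En_ge _) _; rewrite ler_wpM2l //; apply: le_trans (En_le x).
suff : En (S t x) <= En (S 0 x) by rewrite S0.
pose r := t + 1; have r1 : 1 <= r by rewrite /r; lra.
have r2 : 0 <= 2 * r by lra.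
have rt : 0 <= t by [].
pose C := Ek t * `|x| + Ek (2 * r) * `|x|.
have C0 : 0 <= C by rewrite addr_ge0 // mulr_ge0 // Ek_ge0.
apply: (@increments_const R t (fun t => En (S t x))) => // e e0.
exists (e / (C + 1)); first by rewrite divr_gt0 // ltr_wpDl.
move=> a b a0 ab bt h; have ba : 0 <= b - a by rewrite subr_ge0.
have K u : 0 <= u -> u <= t -> `|u| <= r by move=> u0 ut; rewrite ger0_norm // /r; lra.
have at_ := le_trans ab bt; have b0 := le_trans a0 ab.
have h1 := S_taylor x r1 (K a a0 at_) (K b b0 bt).
set y := S a x in h1 *; set q := b - a in h h1 ba *.
have h2 : En (S b x) <= En (y + q *: A y) + q ^+ 2 * (Ek (2 * r) * `|x|).
  have -> : S b x = (y + q *: A y) + (S b x - y - q *: A y) by lmod_eq R.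
  by apply: le_trans (EnD _ _) _; rewrite lerD2l; exact: le_trans (En_le _) h1.
have q2 := sqr_ge0 q.
have h3 : En (y + q *: A y) <= (1 + q ^+ 2) * En y.
  have p0 : 0 <= (1 + q ^+ 2) * En y by rewrite mulr_ge0 ?En_ge0 // addr_ge0.
  rewrite -(ler_pXn2r (isT : (0 < 2)%N)) ?nnegrE ?En_ge0 //.
  apply: le_trans (EnA _ _) _; rewrite exprMn ler_wpM2r ?sqr_ge0 //.
  by rewrite expr2 ler_peMr ?addr_ge0 //; lra.
have h4 : En y <= Ek t * `|x| by apply: le_trans (En_le _) _; apply: S_le; rewrite ger0_norm.
have h5 := ler_wpM2l q2 h4.
have h6 : q * q * C <= q * e.
  rewrite -mulrA ler_wpM2l //; apply: (@le_trans _ _ (e / (C + 1) * (C + 1))); last by rewrite divfK // lt0r_neq0 // ltr_wpDl.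
  by apply: ler_pM => //; [exact: ltW|rewrite lerDl].
by move: h2 h3 h5 h6; rewrite /C expr2 !mulrDl !mulrDr !mul1r; lra.
Qed.

(** ** Duhamel's formula *)

Definition Int (F : R -> Q) t : Q :=
  xget 0 [set y | exists U, [/\ antider t F U, U 0 = 0 & U t = y]].

Lemma IntP T F : 0 <= T -> cont T F -> antider T F (Int F) /\ Int F 0 = 0.
Proof.
move=> T0 cF; have [U [FU U0]] := antider_exists Qc T0 cF.
have E t : 0 <= t <= T -> U t = Int F t.
  move=> /andP[t0 tT]; have Ut := antider_sub tT FU.
  have [W [FW W0 <-]] : [set y | exists U, [/\ antider t F U, U 0 = 0 & U t = y]] (Int F t).
    by apply: xgetPex; exists (U t); exists U.
  by apply: (antider_unique Ut FW); rewrite ?U0 ?W0 ?t0 ?lexx.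
split; first exact: eq_antider E FU.
by rewrite -E ?U0 ?lexx.
Qed.

Lemma Int_unique T F U t : antider T F U -> U 0 = 0 -> cont T F -> 0 <= t <= T -> Int F t = U t.
Proof.
move=> FU U0 cF tT; have T0 : 0 <= T by case/andP: tT; exact: le_trans.
by have [H H0] := IntP T0 cF; apply: (antider_unique H FU); rewrite ?U0.
Qed.

Definition duh (f : R -> Q) t : Q := S t (Int (fun u => S (- u) (f u)) t).

Lemma cont_Sneg T f : 0 <= T -> cont T f -> cont T (fun u => S (- u) (f u)).
Proof.
move=> T0 cf; apply: (cont_S (p := fun u => - u)) => //.
  by exists T => t /andP[t0 tT]; rewrite normrN ger0_norm.
by move=> a b; rewrite opprK addrC distrC.
Qed.

Lemma duh_lin T c f g t : cont T f -> cont T g -> 0 <= t <= T ->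
  duh (fun u => c *: f u + g u) t = c *: duh f t + duh g t.
Proof.
move=> cf cg tT; have T0 : 0 <= T by case/andP: tT; exact: le_trans.
have [h1 z1] := IntP T0 (cont_Sneg T0 cf); have [h2 z2] := IntP T0 (cont_Sneg T0 cg).
rewrite /duh -S_lin; congr (S t _).
have cfg := contD (contZ c cf) cg.
have lin : forall d (x y : Q), c *: (d *: x + y) = d *: (c *: x) + c *: y by move=> d x y; lmod_eq R.
have bd (x : Q) : `|c *: x| <= (`|c| + 1) * `|x| by rewrite normrZ ler_wpM2r // lerDl.
have cp : 0 < `|c| + 1 by rewrite ltr_wpDl.
have h3 : antider T (fun u => c *: S (- u) (f u)) (fun u => c *: Int (fun u => S (- u) (f u)) u) := antider_linear lin bd cp h1.
apply: (Int_unique (T := T) (U := fun u => c *: Int (fun u => S (- u) (f u)) u + Int (fun u => S (- u) (g u)) u)) => //.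
- by apply: eq_antider (antiderD h3 h2) => // u _; rewrite S_lin.
- by rewrite z1 z2 scaler0 addr0.
- exact: cont_Sneg.
Qed.

(** The integrand of the integral equation. *)
Lemma duh_int T f t : cont T f -> 0 <= t <= T ->
  exists W, [/\ antider t (fun u => S (t - u) (f u)) W, W 0 = 0 & W t = duh f t].
Proof.
move=> cf /andP[t0 tT]; have ct := cont_sub tT cf.
have [h z] := IntP t0 (cont_Sneg t0 ct).
have b2 x : `|S t x| <= 2 * `|x| by exact: S_le2.
have H : antider t (fun u => S t (S (- u) (f u))) (fun u => S t (Int (fun u => S (- u) (f u)) u)) :=
  antider_linear (@S_lin t) b2 (ltr0n _ 2) h.
exists (fun u => S t (Int (fun u => S (- u) (f u)) u)); split=> //.
  by apply: eq_antider H => // u _; rewrite -S_add.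
by rewrite z (lin0 (@S_lin t)).
Qed.

Lemma duh_le T f t (M : R) : cont T f -> bounded_on T f M -> 0 <= t <= T -> `|duh f t| <= 2 * T * M.
Proof.
move=> cf fM tT; have [W [h W0 <-]] := duh_int cf tT; have /andP[t0 tT'] := tT.
have B : bounded_on t (fun u => S (t - u) (f u)) (2 * M).
  move=> u /andP[u0 ut]; apply: le_trans (S_le2 _ _) _; first by rewrite subr_ge0.
  by rewrite ler_wpM2l // fM // u0 (le_trans ut).
have := norm_increments B h (lexx 0) t0 (lexx t); rewrite W0 !subr0 => /le_trans; apply.
have M0 : 0 <= M by apply: le_trans (normr_ge0 (f t)) (fM _ tT).
by rewrite mulrA (mulrC t) ler_wpM2r // ler_wpM2l.
Qed.

Lemma duh_ode T f x : 0 <= T -> cont T f ->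
  antider T (fun t => A (S t x + duh f t) + f t) (fun t => S t x + duh f t).
Proof.
move=> T0 cf; have cs := cont_Sneg T0 cf; have [hz z0] := IntP T0 cs.
set z := Int _ in hz z0.
have [Mf Mf0 fM] := cont_bounded cf T0; have [Ms Ms0 sM] := cont_bounded cs T0.
have cz := antider_cont sM Ms0 hz; have [Mz Mz0 zM] := cont_bounded cz T0.
pose r := T + 1; have r1 : 1 <= r by rewrite /r; lra.
have r2 : 0 <= 2 * r by lra.
pose C := Ek (2 * r) * (`|x| + Mz) + SLip r * Mf.
have C0 : 0 <= C.
  by rewrite addr_ge0 // mulr_ge0 ?Ek_ge0 ?SLip_ge0 ?addr_ge0 // ltW.
move=> e e0; have e4 : 0 < e / 4 by rewrite divr_gt0.
have [d d0 Hd] := hz _ e4; have c1 : 0 < C + 1 by rewrite ltr_wpDl.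
exists (Num.min d (e / 2 / (C + 1))); first by rewrite lt_min d0 !divr_gt0.
move=> a b a0 ab bT; rewrite lt_min => /andP[h1 h2].
have at_ := le_trans ab bT; have b0 := le_trans a0 ab; have ba : 0 <= b - a by rewrite subr_ge0.
have K u : 0 <= u -> u <= T -> `|u| <= r by move=> u0 ut; rewrite ger0_norm // /r; lra.
pose Z := x + z a.
have -> : S b x + duh f b - (S a x + duh f a) - (b - a) *: (A (S a x + duh f a) + f a) =
  (S b Z - S a Z - (b - a) *: A (S a Z)) + (S b (z b - z a - (b - a) *: S (- a) (f a)) +
   (b - a) *: (S (b - a) (f a) - S 0 (f a))).
  have e1 : S b (z b - z a - (b - a) *: S (- a) (f a)) =
      S b (z b) - S b (z a) - (b - a) *: S b (S (- a) (f a)).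
    by rewrite (linB (@S_lin b)) (linB (@S_lin b)) (linZ (@S_lin b)).
  have e2 u : S u Z = S u x + S u (z a) by rewrite /Z (linD (@S_lin u)).
  have e3 u : duh f u = S u (z u) by [].
  rewrite e1 !e2 !e3 S0 (S_add (- a) (f a) b0 : S (b - a) (f a) = _).
  by lmod_eq R.
have g1 := S_taylor Z r1 (K a a0 at_) (K b b0 bT).
have g2 : `|S b (z b - z a - (b - a) *: S (- a) (f a))| <= 2 * ((b - a) * (e / 4)).
  by apply: le_trans (S_le2 _ b0) _; rewrite ler_wpM2l //; exact: Hd.
have z0r : `|0 : R| <= r by rewrite normr0; lra.
have baT : b - a <= T by lra.
have g3 := S_lip (f a) r1 z0r (K _ ba baT); rewrite subr0 (ger0_norm ba) in g3.
have aT : 0 <= a <= T by rewrite a0.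
have ZM : `|Z| <= `|x| + Mz by apply: le_trans (ler_normD _ _) _; rewrite lerD2l; exact: zM.
have n1 : Ek (2 * r) * `|Z| <= Ek (2 * r) * (`|x| + Mz) by rewrite ler_wpM2l ?Ek_ge0.
have n2 : SLip r * `|f a| <= SLip r * Mf by rewrite ler_wpM2l ?SLip_ge0 // fM.
apply: le_trans (ler_normD _ _) _; apply: (le_trans (lerD g1 (ler_normD _ _))).
rewrite normrZ (ger0_norm ba).
have m1 := ler_wpM2l (sqr_ge0 (b - a)) n1.
have m2 := ler_wpM2l ba g3; have m3 := ler_wpM2l ba (ler_wpM2l ba n2).
have m4 : (b - a) * ((b - a) * C) <= (b - a) * (e / 2).
  rewrite ler_wpM2l //; apply: (@le_trans _ _ (e / 2 / (C + 1) * (C + 1))); last by rewrite divfK // lt0r_neq0.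
  by apply: ler_pM => //; [exact: ltW|rewrite lerDl].
move: m1 m2 m3 m4 g2; rewrite /C !mulrDr expr2 -!mulrA.
move: (`|S b _|) ((b - a) * `|_|) => *.
have : (b - a) * (e / 2) = 2 * ((b - a) * (e / 4)) by field.
lra.
Qed.

Lemma duh0 f : duh f 0 = 0.
Proof.
have c0 : cont 0 (fun u => S (- u) (f u)).
  move=> e e0; exists 1 => // a b aT bT _.
  have -> : b = a by (move: aT bT => /andP[? ?] /andP[? ?]; lra).
  by rewrite subrr normr0 ltW.
by have [_ z] := IntP (lexx 0) c0; rewrite /duh z (lin0 (@S_lin 0)).
Qed.

(** Uniqueness for the inhomogeneous linear equation. *)
Lemma duh_unique T f u : 0 <= T -> cont T f -> cont T u ->
  antider T (fun t => A (u t) + f t) u -> forall t, 0 <= t <= T -> u t = S t (u 0) + duh f t.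
Proof.
move=> T0 cf cu du t tT.
have dv := duh_ode (u 0) T0 cf; set v := (fun t => S t (u 0) + duh f t) in dv.
have cv : cont T (fun t => S t (u 0)).
  have cc : cont T (fun=> u 0) by move=> e e0; exists 1 => // a b _ _ _; rewrite subrr normr0 ltW.
  apply: (cont_S (p := id)) => //; exists T => s /andP[s0 sT]; by rewrite ger0_norm.
have [Mu Mu0 uM] := cont_bounded cu T0; have [Ms Ms0 sM] := cont_bounded cv T0.
have [Mf Mf0 fM] := cont_bounded cf T0.
have lin : forall c (x y : Q), -%R (c *: x + y) = c *: - x + - y by move=> c z y; rewrite opprD scalerN.
have bd : forall x : Q, `|- x| <= 1 * `|x| by move=> z; rewrite normrN mul1r.
have dn : antider T (fun t => - (A (v t) + f t)) (fun t => - v t) := antider_linear lin bd ltr01 dv.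
apply/eqP; rewrite -subr_eq0; apply/eqP.
apply: (ode_zero (L := 1) (M0 := Mu + (Ms + 2 * T * Mf)) ltr01 (antiderD du dn)) => //.
- move=> s sT; rewrite mul1r.
  have -> : A (u s) + f s - (A (v s) + f s) = A (u s - v s) by rewrite (linB Al); lmod_eq R.
  exact: Ale.
- move=> s sT; apply: le_trans (ler_normB _ _) _; apply: lerD; first exact: uM.
  apply: le_trans (ler_normD _ _) _; apply: lerD; [exact: sM|exact: duh_le].
- by rewrite /v S0 duh0 addr0 subrr.
Qed.

Lemma cont_orbit T x : 0 <= T -> cont T (fun t => S t x).
Proof.
move=> T0; have cc : cont T (fun=> x) by move=> e e0; exists 1 => // a b _ _ _; rewrite subrr normr0 ltW.
apply: (cont_S (p := id)) => //; exists T => s /andP[s0 sT]; by rewrite ger0_norm.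
Qed.

Lemma cont_duh T f : 0 <= T -> cont T f -> cont T (duh f).
Proof.
move=> T0 cf; have cs := cont_Sneg T0 cf; have [hz z0] := IntP T0 cs.
have [Ms Ms0 sM] := cont_bounded cs T0; have cz := antider_cont sM Ms0 hz.
apply: (cont_S (p := id)) => //; exists T => s /andP[s0 sT]; by rewrite ger0_norm.
Qed.

End exponential.

(** * Power series of curves *)

Section sums.
Context {R : realType}.

Lemma triangle_sum (V : nmodType) (F : nat -> nat -> V) n :
  \sum_(m < n) \sum_(i < m.+1) F i (m - i)%N = \sum_(i < n) \sum_(j < n - i) F i j.
Proof.
elim: n => [|n IH]; first by rewrite !big_ord0.
rewrite big_ord_recr /= IH.
have -> : \sum_(i < n.+1) \sum_(j < n.+1 - i) F i j =
    \sum_(i < n.+1) (\sum_(j < n - i) F i j + F i (n - i)%N).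
  by apply: eq_bigr => i _; rewrite subSn ?big_ord_recr // -ltnS.
by rewrite big_split /=; congr (_ + _); rewrite big_ord_recr /= subnn big_ord0 addr0.
Qed.

Lemma strong_rec (T : Type) (g : T) (Phi : nat -> (nat -> T) -> T) :
  (forall n f f', (forall i, (i <= n)%N -> f i = f' i) -> Phi n f = Phi n f') ->
  exists a, a 0%N = g /\ forall n, a n.+1 = Phi n a.
Proof.
move=> ext.
pose fix l n : seq T := if n is m.+1 then rcons (l m) (Phi m (nth g (l m))) else [:: g].
have sl n : size (l n) = n.+1 by elim: n => [//|n IH] /=; rewrite size_rcons IH.
pose a n := nth g (l n) n.
have E n i : (i <= n)%N -> nth g (l n) i = a i.
  elim: n => [|n IH]; first by rewrite leqn0 => /eqP ->.
  rewrite leq_eqVlt => /orP[/eqP -> //|]; rewrite ltnS => i_n.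
  by rewrite /= nth_rcons sl ltnS i_n IH.
exists a; split=> // n; rewrite /a /= nth_rcons sl ltnn eqxx.
by apply: ext => i i_n; exact: E.
Qed.

(** The Catalan numbers are the coefficients of the solution of [x = z + x ^ 2], so
    that their growth is seen on the partial sums at [z = 1 / 4]. *)
Lemma catalan_bound : exists c : nat -> R, [/\ c 0%N = 1,
  forall n, c n.+1 = \sum_(i < n.+1) c i * c (n - i)%N, forall n, 0 <= c n &
  forall n, c n <= 2 * 4 ^+ n].
Proof.
have [|c [c0 cS]] := @strong_rec R 1 (fun n c => \sum_(i < n.+1) c i * c (n - i)%N).
  by move=> n f f' H; apply: eq_bigr => i _; rewrite !H // ?leq_subr // -ltnS.
have cp n : 0 <= c n.
  have [m] := ubnP n; elim: m n => // m IH [|n]; rewrite ltnS => nm; first by rewrite c0.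
  rewrite cS; apply: sumr_ge0 => i _; apply: mulr_ge0; apply: IH.
    exact: leq_trans (ltn_ord i) nm.
  exact: leq_ltn_trans (leq_subr _ _) nm.
pose w n := c n * 4^-1 ^+ n.
have w0 n : 0 <= w n by rewrite mulr_ge0 // exprn_ge0.
have P n : \sum_(i < n) w i <= 2.
  elim: n => [|n IH]; first by rewrite big_ord0.
  have E : \sum_(i < n.+1) w i = 1 + 4^-1 * \sum_(i < n) \sum_(j < n - i) w i * w j.
    rewrite -(triangle_sum (fun i j => w i * w j)) big_ord_recl {1}/w c0 expr0 mulr1; congr (1 + _).
    rewrite mulr_sumr; apply: eq_bigr => m _.
    have -> : w (lift ord0 m) = c m.+1 * 4^-1 ^+ m.+1 by [].
    rewrite cS mulr_suml mulr_sumr; apply: eq_bigr => i _; rewrite /w.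
    have -> : 4^-1 ^+ m.+1 = 4^-1 * (4^-1 ^+ i * 4^-1 ^+ (m - i)) :> R.
      by rewrite -exprD subnKC -?exprS // -ltnS.
    by ring.
  rewrite E.
  have K : \sum_(i < n) \sum_(j < n - i) w i * w j <= (\sum_(i < n) w i) * \sum_(j < n) w j.
    rewrite mulr_suml; apply: ler_sum => i _; rewrite -mulr_sumr ler_wpM2l //.
    have -> : \sum_(j < n) w j = \sum_(0 <= j < n) w j by rewrite big_mkord.
    have ni : (n - i <= n)%N by exact: leq_subr.
    rewrite (big_cat_nat (leq0n _) ni) /= big_mkord lerDl.
    by apply: sumr_ge0.
  have s0 : 0 <= \sum_(i < n) w i by exact: sumr_ge0.
  have : (\sum_(i < n) w i) * \sum_(j < n) w j <= 2 * 2 by apply: ler_pM.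
  lra.
exists c; split=> // n.
have := P n.+1; rewrite big_ord_recr /= => H.
have wn : w n <= 2 by apply: le_trans H; rewrite lerDr; exact: sumr_ge0.
have p4 : (0 : R) < 4 ^+ n by rewrite exprn_gt0.
by move: wn; rewrite /w exprVn ler_pdivrMr.
Qed.

Lemma geom_tail (k q : R) n : 0 <= q -> q < 1 ->
  limn (series (geometric k q)) - series (geometric k q) n = k * q ^+ n / (1 - q).
Proof.
move=> q0 q1; have qq : `|q| < 1 by rewrite ger0_norm.
have q' : 1 - q != 0 by rewrite subr_eq0 gt_eqF.
rewrite (cvg_lim _ (cvg_geometric_series qq)) // geometric_seriesE ?lt_eqF //=.
by field.
Qed.

Lemma small_power (C q e : R) : 0 <= C -> 0 <= q -> q < 1 -> 0 < e ->
  exists n0, forall n, (n0 <= n)%N -> C * q ^+ n <= e.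
Proof.
move=> C0 q0 q1 e0; have qq : `|q| < 1 by rewrite ger0_norm.
have c1 : 0 < C + 1 by rewrite ltr_wpDl.
have /cvgrPdist_le/(_ _ (divr_gt0 e0 c1))[n0 _ H] := cvg_expr qq; exists n0 => n /H.
rewrite sub0r normrN ger0_norm ?exprn_ge0 // ler_pdivlMr // mulrC; apply: le_trans.
by rewrite ler_wpM2r ?exprn_ge0 // lerDl.
Qed.

Lemma small_npower (C q e : R) : 0 <= C -> 0 <= q -> q < 1 -> 0 < e ->
  exists n0, forall n, (n0 <= n)%N -> C * (n%:R * q ^+ n) <= e.
Proof.
move=> C0 q0 q1 e0; pose s := Num.sqrt q; have s0 : 0 <= s := sqrtr_ge0 q.
have s1 : s < 1 by rewrite /s -sqrtr1 ltr_sqrt.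
have sq_ : q = s * s by rewrite -expr2 sqr_sqrtr.
have d1 : 0 < 1 - s by lra.
have K n : n%:R * s ^+ n <= (1 - s)^-1.
  have : n%:R * s ^+ n <= \sum_(i < n) s ^+ i.
    rewrite -[n in n%:R]card_ord -sum1_card natr_sum mulr_suml; apply: ler_sum => i _.
    by rewrite mul1r; apply: ler_wiXn2l => //; [exact: ltW|exact: ltnW].
  move/le_trans; apply; rewrite -[leRHS]mul1r ler_pdivlMr //.
  have := subrX1 s n; rewrite -(opprB 1 s) mulNr => E.
  have : (\sum_(i < n) s ^+ i) * (1 - s) = 1 - s ^+ n by rewrite mulrC -[RHS]opprB E opprK.
  by move=> ->; rewrite gerBl exprn_ge0.
have [|n0 H] := @small_power (C / (1 - s)) s e _ s0 s1 e0; first by rewrite divr_ge0 // ltW.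
exists n0 => n /H h; apply: le_trans h; rewrite sq_ exprMn.
have -> : C * (n%:R * (s ^+ n * s ^+ n)) = C * (n%:R * s ^+ n) * s ^+ n by ring.
by apply: ler_wpM2r; [exact: exprn_ge0|apply: ler_wpM2l].
Qed.

End sums.

Section function_series.
Context {R : realType} (Q : normedModType R).
Hypothesis Qc : seq_complete Q.
Variable T : R.
Hypothesis T0 : 0 <= T.
Notation It t := (0 <= t <= T).

Lemma ulim (u : nat -> R -> Q) (k q : R) : 0 <= q -> q < 1 -> (forall n, cont T (u n)) ->
  (forall n t, It t -> `|u n.+1 t - u n t| <= k * q ^+ n) ->
  exists w, cont T w /\ forall n t, It t -> `|u n t - w t| <= k * q ^+ n / (1 - q).
Proof.
move=> q0 q1 cu H; have qq : `|q| < 1 by rewrite ger0_norm.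
have /choice[w Hw] (t : R) : exists l, It t -> forall n, `|u n t - l| <= k * q ^+ n / (1 - q).
  case: (boolP (It t)) => tT; last by exists 0.
  have [|l Hl] := absconv Qc (a := geometric k q) (u := fun n => u n t) _ (is_cvg_geometric_series qq).
    by move=> n; exact: H.
  by exists l => _ n; rewrite -geom_tail.
have z0 : 0 <= (0 : R) <= T by rewrite lexx T0.
have k0 : 0 <= k by have := H 0%N 0 z0; rewrite expr0 mulr1; exact: le_trans.
exists w; split=> [e e0|n t tT]; last exact: Hw.
have e3 : 0 < e / 3 by rewrite divr_gt0.
have kp : 0 <= k / (1 - q) by rewrite divr_ge0 // subr_ge0 ltW.
have [n0 Hn] := small_power kp q0 q1 e3.
have [d d0 Hd] := cu n0 _ e3; exists d => // a b aT bT h.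
have -> : w b - w a = (u n0 b - u n0 a) - (u n0 b - w b) + (u n0 a - w a) by lmod_eq R.
have h1 := Hd a b aT bT h; have h2 := Hw a aT n0; have h3 := Hw b bT n0.
have h4 := Hn n0 (leqnn _); rewrite mulrAC in h4.
apply: le_trans (ler_normD _ _) _; have := ler_normB (u n0 b - u n0 a) (u n0 b - w b).
by lra.
Qed.

Lemma cont0 : cont T (fun=> 0 : Q).
Proof. by move=> e e0; exists 1 => // a b _ _ _; rewrite subrr normr0 ltW. Qed.

Lemma cont_sum n (u : nat -> R -> Q) : (forall i, (i < n)%N -> cont T (u i)) ->
  cont T (fun t => \sum_(i < n) u i t).
Proof.
elim: n => [|n IH] H; first by apply: eq_cont cont0 => t _; rewrite big_ord0.
have h1 := IH (fun i i_n => H i (ltnW i_n)); have h2 := H n (ltnSn n).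
by apply: eq_cont (contD h1 h2) => t _; rewrite big_ord_recr.
Qed.

Lemma contB (u v : R -> Q) : cont T u -> cont T v -> cont T (fun t => u t - v t).
Proof.
move=> cu cv; apply: eq_cont (contD (contZ (-1) cv) cu) => t _.
by rewrite scaleN1r addrC.
Qed.

(** ** Quadratic equations *)

Section quadratic.
Variables (M : (R -> Q) -> (R -> Q) -> (R -> Q)) (D : R).
Hypotheses (D0 : 0 <= D)
  (Mcont : forall u v, cont T u -> cont T v -> cont T (M u v))
  (Mle : forall u v a b, cont T u -> cont T v -> bounded_on T u a -> bounded_on T v b ->
     bounded_on T (M u v) (D * a * b))
  (Mlin : forall c u u' v t, cont T u -> cont T u' -> cont T v -> It t ->
     M (fun s => c *: u s + u' s) v t = c *: M u v t + M u' v t)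
  (Msym : forall u v, M u v = M v u)
  (Mext : forall u u' v t, cont T u -> cont T u' -> cont T v -> (forall s, It s -> u s = u' s) ->
     It t -> M u v t = M u' v t).

Variables (g : R -> Q) (b0 : R) (al : nat -> R -> Q).
Hypotheses (cg : cont T g) (b00 : 0 <= b0) (gb : bounded_on T g b0)
  (al0 : forall t, It t -> al 0%N t = g t)
  (alS : forall n t, It t -> al n.+1 t = \sum_(i < n.+1) M (al i) (al (n - i)%N) t).

Lemma cont_al n : cont T (al n).
Proof.
have [m] := ubnP n; elim: m n => // m IH [|n]; rewrite ltnS => nm; first by apply: eq_cont cg => t /al0.
apply: (@eq_cont _ _ T (fun t => \sum_(i < n.+1) M (al i) (al (n - i)%N) t)).
  by move=> t tT; rewrite alS.
apply: (@cont_sum n.+1 (fun i => M (al i) (al (n - i)%N))) => i i_n.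
apply: Mcont; apply: IH; first exact: leq_trans i_n nm.
exact: leq_ltn_trans (leq_subr _ _) nm.
Qed.

Lemma al_bound n t : It t -> `|al n t| <= 2 * b0 * (4 * D * b0) ^+ n.
Proof.
have [c [c0 cS cp cb]] := @catalan_bound R.
suff K m s : It s -> `|al m s| <= c m * D ^+ m * b0 ^+ m.+1.
  move=> tT; apply: le_trans (K n t tT) _.
  have p0 : 0 <= D ^+ n * b0 ^+ n.+1 by rewrite mulr_ge0 // exprn_ge0.
  rewrite -mulrA; apply: le_trans (ler_wpM2r p0 (cb n)) _.
  by rewrite le_eqVlt; apply/orP; left; apply/eqP; rewrite !exprMn exprS; ring.
have [k] := ubnP m; elim: k m s => // k IH [|m] s; rewrite ltnS => mk sT.
  by rewrite al0 // c0 expr0 !mul1r expr1; exact: gb.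
rewrite alS // cS; apply: le_trans (ler_norm_sum _ _ _) _.
rewrite !mulr_suml; apply: ler_sum => i _.
have i_m : (i <= m)%N by rewrite -ltnS.
have h1 : bounded_on T (al i) (c i * D ^+ i * b0 ^+ i.+1).
  by move=> r rT; apply: IH => //; exact: leq_trans (ltn_ord i) mk.
have h2 : bounded_on T (al (m - i)%N) (c (m - i)%N * D ^+ (m - i) * b0 ^+ (m - i).+1).
  by move=> r rT; apply: IH => //; exact: leq_ltn_trans (leq_subr _ _) mk.
apply: le_trans (Mle (cont_al i) (cont_al _) h1 h2 sT) _.
have -> : D ^+ m.+1 = D * (D ^+ i * D ^+ (m - i)) by rewrite -exprD subnKC // exprS.
have -> : b0 ^+ m.+2 = b0 ^+ i.+1 * b0 ^+ (m - i).+1 by rewrite -exprD addSn addnS subnKC.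
by rewrite le_eqVlt; apply/orP; left; apply/eqP; ring.
Qed.

Lemma M0 v t : cont T v -> It t -> M (fun=> 0) v t = 0.
Proof.
move=> cv tT; have := Mlin 1 cont0 cont0 cv tT.
have -> : (fun s : R => 1 *: (0 : Q) + 0) = fun=> 0 by apply/funext => s; rewrite scaler0 addr0.
by rewrite scale1r => /esym/eqP; rewrite -subr_eq0 addrK => /eqP.
Qed.

Lemma Msum n (u : nat -> R -> Q) v t : (forall i, cont T (u i)) -> cont T v -> It t ->
  M (fun s => \sum_(i < n) u i s) v t = \sum_(i < n) M (u i) v t.
Proof.
move=> cu cv tT; elim: n => [|n IH].
  rewrite big_ord0; have -> : (fun s : R => \sum_(i < 0) u i s) = fun=> 0 by apply/funext => s; rewrite big_ord0.
  exact: M0.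
have cs : cont T (fun s => \sum_(i < n) u i s) by exact: cont_sum.
have -> : (fun s => \sum_(i < n.+1) u i s) = fun s => 1 *: (\sum_(i < n) u i s) + u n s.
  by apply/funext => s; rewrite big_ord_recr scale1r.
by rewrite Mlin // IH scale1r big_ord_recr.
Qed.

Lemma MB u u' v t : cont T u -> cont T u' -> cont T v -> It t ->
  M (fun s => u s - u' s) v t = M u v t - M u' v t.
Proof.
move=> cu cu' cv tT; have -> : (fun s => u s - u' s) = fun s => -1 *: u' s + u s.
  by apply/funext => s; rewrite scaleN1r addrC.
by rewrite Mlin // scaleN1r addrC.
Qed.

Hypothesis q1 : 4 * D * b0 < 1.

Lemma quadratic_solution : exists u, [/\ cont T u,
  (forall n t, It t -> `|\sum_(i < n) al i t - u t| <= 2 * b0 * (4 * D * b0) ^+ n / (1 - 4 * D * b0)) &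
  forall t, It t -> u t = g t + M u u t].
Proof.
have q1' := q1; set q := 4 * D * b0 in q1' *; pose k := 2 * b0.
have q0 : 0 <= q by rewrite !mulr_ge0.
have k0 : 0 <= k by rewrite mulr_ge0.
have d1 : 0 < 1 - q by lra.
pose P n t := \sum_(i < n) al i t.
have cP n : cont T (P n) by apply: cont_sum => i _; exact: cont_al.
have [|u [cu Hu]] := @ulim P k q q0 q1' cP.
  by move=> n t tT; rewrite /P big_ord_recr /= addrAC subrr add0r; exact: al_bound.
exists u; split=> // t tT.
pose U := k / (1 - q); have U0 : 0 <= U by rewrite divr_ge0 // ltW.
have uU : bounded_on T u U.
  by move=> s sT; have := Hu 0%N s sT; rewrite /P big_ord0 sub0r normrN expr0 mulr1.
apply/eqP; rewrite -subr_eq0 -normr_le0; apply/ler_addgt0Pr => e e0; rewrite add0r.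
have C0 : 0 <= D * k * U by apply: mulr_ge0 => //; apply: mulr_ge0.
have CU : 0 <= D * U * U by apply: mulr_ge0 => //; apply: mulr_ge0.
have e3 : 0 < e / 3 by rewrite divr_gt0.
have [n1 H1] := small_npower C0 q0 q1' e3; have [n2 H2] := small_power CU q0 q1' e3.
have [n3 H3] := small_power U0 q0 q1' e3.
pose n := maxn n1 (maxn n2 n3).
have h1 := H1 n (leq_maxl _ _); have h2 := H2 n (leq_trans (leq_maxl _ _) (leq_maxr _ _)).
have h3 := H3 n.+1 (leqW (leq_trans (leq_maxr _ _) (leq_maxr _ _))).
have E : P n.+1 t = g t + \sum_(i < n) M (al i) (P (n - i)%N) t.
  rewrite /P big_ord_recl al0 //; congr (_ + _).
  rewrite (eq_bigr (fun m : 'I_n => \sum_(i < m.+1) M (al i) (al (m - i)%N) t)); last first.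
    by move=> m _; exact: alS.
  rewrite (triangle_sum (fun i j => M (al i) (al j) t)); apply: eq_bigr => i _.
  rewrite Msym Msum //; [|by move=> j; exact: cont_al|exact: cont_al].
  by apply: eq_bigr => j _; rewrite Msym.
have cD m : cont T (fun s => u s - P m s) by exact: contB.
have bD m : bounded_on T (fun s => u s - P m s) (U * q ^+ m).
  by move=> s sT; rewrite distrC /U mulrAC; exact: Hu.
have E2 : M u u t - \sum_(i < n) M (al i) (P (n - i)%N) t =
   M (fun s => u s - P n s) u t + \sum_(i < n) M (fun s => u s - P (n - i)%N s) (al i) t.
  have ca i := cont_al i.
  have e1 : M (fun s => u s - P n s) u t = M u u t - \sum_(i < n) M (al i) u t.
    by rewrite MB // /P Msum.
  have e2 : \sum_(i < n) M (fun s => u s - P (n - i)%N s) (al i) t =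
      \sum_(i < n) M (al i) u t - \sum_(i < n) M (al i) (P (n - i)%N) t.
    by rewrite -sumrB; apply: eq_bigr => i _; rewrite MB // (Msym u) (Msym (P _)).
  by rewrite e1 e2; lmod_eq R.
have F1 : `|M (fun s => u s - P n s) u t| <= D * U * U * q ^+ n.
  apply: le_trans (Mle (cD n) cu (bD n) uU tT) _.
  by rewrite le_eqVlt; apply/orP; left; apply/eqP; ring.
have F2 : `|\sum_(i < n) M (fun s => u s - P (n - i)%N s) (al i) t| <= D * k * U * (n%:R * q ^+ n).
  apply: le_trans (ler_norm_sum _ _ _) _.
  rewrite -[n in n%:R]card_ord -sum1_card natr_sum mulr_suml mulr_sumr; apply: ler_sum => i _.
  have ba : bounded_on T (al i) (k * q ^+ i) by move=> s sT; exact: al_bound.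
  apply: le_trans (Mle (cD _) (cont_al i) (bD _) ba tT) _; rewrite mul1r.
  have -> : q ^+ n = q ^+ (n - i) * q ^+ i by rewrite -exprD subnK // ltnW.
  by rewrite le_eqVlt; apply/orP; left; apply/eqP; ring.
have F3 : `|u t - P n.+1 t| <= U * q ^+ n.+1 by exact: bD.
have -> : u t - (g t + M u u t) = (u t - P n.+1 t) - (M u u t - \sum_(i < n) M (al i) (P (n - i)%N) t).
  by rewrite E; lmod_eq R.
rewrite E2; apply: le_trans (ler_normB _ _) _.
have := ler_normD (M (fun s => u s - P n s) u t) (\sum_(i < n) M (fun s => u s - P (n - i)%N s) (al i) t).
by lra.
Qed.

End quadratic.

(** ** Linear equations *)

Section neumann.
Variable L : (R -> Q) -> R -> Q.
Hypotheses (Lcont : forall u, cont T u -> cont T (L u))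
  (Lle : forall u a, cont T u -> bounded_on T u a -> bounded_on T (L u) (2^-1 * a))
  (Llin : forall c u v t, cont T u -> cont T v -> It t ->
     L (fun s => c *: u s + v s) t = c *: L u t + L v t).

Lemma neumann_unique u v g : cont T u -> cont T v -> (forall t, It t -> u t = g t + L u t) ->
  (forall t, It t -> v t = g t + L v t) -> forall t, It t -> u t = v t.
Proof.
move=> cu cv eu ev.
pose w := fun s => -1 *: v s + u s.
have cw : cont T w by exact: contD (contZ _ cv) cu.
have ew t : It t -> w t = L w t.
  by move=> tT; rewrite /w Llin // -/w {1}eu // {1}ev //; lmod_eq R.
have [m m0 wm] := cont_bounded cw T0.
have K n : bounded_on T w (2^-1 ^+ n * m).
  elim: n => [|n IH]; first by rewrite expr0 mul1r.
  by move=> t tT; rewrite ew // exprS -mulrA; exact: Lle.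
move=> t tT; apply/eqP; rewrite -subr_eq0 -normr_le0; apply/ler_addgt0Pr => e e0; rewrite add0r.
have [||n0 H] := @small_power R m 2^-1 e (ltW m0) _ _ e0; try lra.
have := K n0 t tT; rewrite /w scaleN1r addrC mulrC => /le_trans; apply; exact: H.
Qed.

Lemma neumann g (b : R) : cont T g -> bounded_on T g b ->
  exists w, [/\ cont T w, bounded_on T w (2 * b) & forall t, It t -> w t = g t + L w t].
Proof.
move=> cg gb; have b0 : 0 <= b by apply: le_trans (normr_ge0 _) (gb 0 _); rewrite lexx.
pose a n := iter n L g; pose P n t := \sum_(i < n) a i t.
have ca n : cont T (a n) by elim: n => [//|n IH]; exact: Lcont.
have ba n : bounded_on T (a n) (b * 2^-1 ^+ n).
  elim: n => [|n IH]; first by rewrite expr0 mulr1.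
  by rewrite exprS mulrCA; exact: Lle.
have cP n : cont T (P n) by apply: cont_sum.
have h1 : (2^-1 : R) < 1 by lra.
have [//||w [cw Hw]] := @ulim P b 2^-1 _ h1 cP.
  by move=> n t tT; rewrite /P big_ord_recr /= addrAC subrr add0r; exact: ba.
have PS n t : It t -> P n.+1 t = g t + L (P n) t.
  elim: n t => [|n IH] t tT.
    have -> : P 0%N = fun s => -1 *: (0 : Q) + 0 by apply/funext => s; rewrite /P big_ord0 scaler0 addr0.
    by rewrite (Llin (-1) cont0 cont0 tT) scaleN1r addNr addr0 /P big_ord_recr big_ord0 /= add0r.
  have E : P n.+1 = fun s => 1 *: a n s + P n s.
    by apply/funext => s; rewrite /P big_ord_recr scale1r addrC.
  rewrite {1}/P big_ord_recr /= -/(P n.+1 t) IH // E Llin // scale1r.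
  by rewrite addrAC -addrA [X in _ + X]addrC.
exists w; split=> //.
  move=> t tT; have := Hw 0%N t tT; rewrite /P big_ord0 sub0r normrN expr0 mulr1 => /le_trans; apply.
  have -> : 1 - 2^-1 = 2^-1 :> R by lra.
  by rewrite invrK mulrC.
move=> t tT; apply/eqP; rewrite -subr_eq0 -normr_le0; apply/ler_addgt0Pr => e e0; rewrite add0r.
have b4 : 0 <= 4 * b by rewrite mulr_ge0.
have h0 : (0 : R) <= 2^-1 by lra.
have [n H] := small_power b4 h0 h1 e0.
have F1 := Hw n.+1 t tT.
have cd : cont T (fun s => -1 *: P n s + w s) by exact: contD (contZ _ (cP n)) cw.
have bd : bounded_on T (fun s => -1 *: P n s + w s) (b * 2^-1 ^+ n / (1 - 2^-1)).
  by move=> s sT; rewrite scaleN1r addrC distrC; exact: Hw.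
have F2 := Lle cd bd tT; rewrite Llin // in F2.
have -> : w t - (g t + L w t) = - (P n.+1 t - w t) - (-1 *: L (P n) t + L w t).
  by rewrite PS //; lmod_eq R.
apply: le_trans (ler_normB _ _) _; rewrite normrN; apply: le_trans (lerD F1 F2) _.
apply: le_trans (H n (leqnn _)); rewrite exprS.
have -> : 1 - 2^-1 = 2^-1 :> R by lra.
by rewrite invrK; move: (2^-1 ^+ n) (exprn_ge0 n h0) => p p0; have := mulr_ge0 b0 p0; nra.
Qed.

End neumann.

End function_series.

(** * Quadratic evolution equations *)

(** The data of the equation [u' = A u + B (u, u)] in a Banach space: a bounded skew
    operator, its skewness being expressed by an equivalent energy, and a bounded
    symmetric bilinear map. *)
Record evo (R : realType) := Evo {
  eQ : normedModType R;
  eQc : seq_complete eQ;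
  eA : eQ -> eQ;
  eAl : lin eA;
  eAle : forall x, `|eA x| <= `|x|;
  eEn : eQ -> R;
  eEn_le : forall x, eEn x <= `|x|;
  eEn_ge : forall x, `|x| <= 2 * eEn x;
  eEnD : forall x y, eEn (x + y) <= eEn x + eEn y;
  eEnA : forall (c : R) x, eEn (x + c *: eA x) ^+ 2 <= (1 + c ^+ 2) * eEn x ^+ 2;
  eB : eQ -> eQ -> eQ;
  eBl : forall z, lin (fun x => eB x z);
  eBs : forall x y, eB x y = eB y x;
  ebeta : R;
  ebeta_gt0 : 0 < ebeta;
  eBle : forall x y, `|eB x y| <= ebeta * `|x| * `|y| }.

Section evolution.
Context {R : realType} (X : evo R).
Notation Q := (eQ X).
Notation A := (@eA R X).
Notation B := (@eB R X).
Notation beta := (ebeta X).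
Implicit Types (T : R) (u v f : R -> Q) (x : Q).

Let Qc := @eQc R X. Let Al := @eAl R X. Let Ale := @eAle R X.
Let Ele := @eEn_le R X. Let Ege := @eEn_ge R X. Let ED := @eEnD R X. Let EA := @eEnA R X.

Definition flow (t : R) x : Q := S A t x.
Definition Duh f (t : R) : Q := duh A f t.

Ltac evo := first [exact: Qc|exact: Al|exact: Ele|exact: Ale|exact: Ege|exact: ED|exact: EA|eassumption].

Lemma flow_lin t : lin (flow t). Proof. apply: S_lin; evo. Qed.
Lemma flow0 x : flow 0 x = x. Proof. apply: S0; evo. Qed.
Lemma flow_le t x : 0 <= t -> `|flow t x| <= 2 * `|x|.
Proof. by move=> t0; apply: S_le2; evo. Qed.
Lemma cont_flow T x : 0 <= T -> cont T (fun t => flow t x).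
Proof. by move=> T0; apply: cont_orbit; evo. Qed.
Lemma Duh_cont T f : 0 <= T -> cont T f -> cont T (Duh f).
Proof. by move=> T0 cf; apply: cont_duh; evo. Qed.
Lemma Duh_lin T c f (g : R -> Q) t : cont T f -> cont T g -> 0 <= t <= T ->
  Duh (fun s => c *: f s + g s) t = c *: Duh f t + Duh g t.
Proof. by move=> cf cg tT; apply: duh_lin; evo. Qed.
Lemma Duh_int T f t : cont T f -> 0 <= t <= T ->
  exists W, [/\ antider t (fun s => flow (t - s) (f s)) W, W 0 = 0 & W t = Duh f t].
Proof. by move=> cf tT; apply: duh_int; evo. Qed.
Lemma Duh_le T f t (M : R) : cont T f -> bounded_on T f M -> 0 <= t <= T -> `|Duh f t| <= 2 * T * M.
Proof. by move=> cf fM tT; apply: duh_le; evo. Qed.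
Lemma Duh_ode T f x : 0 <= T -> cont T f ->
  antider T (fun t => A (flow t x + Duh f t) + f t) (fun t => flow t x + Duh f t).
Proof. by move=> T0 cf; apply: duh_ode; evo. Qed.
Lemma Duh0 f : Duh f 0 = 0. Proof. apply: duh0; evo. Qed.
Lemma Duh_unique T f u : 0 <= T -> cont T f -> cont T u ->
  antider T (fun t => A (u t) + f t) u -> forall t, 0 <= t <= T -> u t = flow t (u 0) + Duh f t.
Proof. by move=> T0 cf cu du t tT; apply: duh_unique; evo. Qed.

Lemma Duh_ext T f (g : R -> Q) t : cont T f -> cont T g -> (forall s, 0 <= s <= T -> f s = g s) ->
  0 <= t <= T -> Duh f t = Duh g t.
Proof.
move=> cf cg fg tT; have /andP[t0 tT'] := tT.
have [W [h W0 <-]] := Duh_int cf tT; have [W' [h' W0' <-]] := Duh_int cg tT.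
apply: (antider_unique (T := t) (F := fun s => flow (t - s) (g s))) => //.
- by apply: eq_antider h => // s /andP[s0 st]; rewrite fg // s0 (le_trans st).
- by rewrite W0.
- by rewrite t0 lexx.
Qed.

(** ** The bilinear term *)

Lemma eBr z : lin (B z).
Proof. by move=> c x y; rewrite !(eBs z) eBl. Qed.

Lemma cont_B T u v : 0 <= T -> cont T u -> cont T v -> cont T (fun t => B (u t) (v t)).
Proof.
move=> T0 cu cv e e0; have [mu mu0 um] := cont_bounded cu T0; have [mv mv0 vm] := cont_bounded cv T0.
have b0 := ebeta_gt0 X; have c1 : 0 < 2 * (beta * mv) by rewrite !mulr_gt0.
have c2 : 0 < 2 * (beta * mu) by rewrite !mulr_gt0.
have [d d0 Hd] := cu _ (divr_gt0 e0 c1); have [d' d0' Hd'] := cv _ (divr_gt0 e0 c2).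
exists (Num.min d d'); first by rewrite lt_min d0.
move=> a b aT bT; rewrite lt_min => /andP[h h'].
have -> : B (u b) (v b) - B (u a) (v a) = B (u b - u a) (v b) + B (u a) (v b - v a).
  by rewrite (linB (eBl _)) (linB (eBr _)); lmod_eq R.
have h1 : `|B (u b - u a) (v b)| <= e / 2.
  apply: le_trans (eBle _ _) _; have -> : e / 2 = beta * (e / (2 * (beta * mv))) * mv by field; lra.
  by apply: ler_pM => //; [rewrite mulr_ge0 // ltW|rewrite ler_wpM2l ?(ltW b0) // Hd|exact: vm].
have h2 : `|B (u a) (v b - v a)| <= e / 2.
  apply: le_trans (eBle _ _) _; have -> : e / 2 = beta * mu * (e / (2 * (beta * mu))) by field; lra.
  by apply: ler_pM => //; [rewrite mulr_ge0 // ltW|rewrite ler_wpM2l ?(ltW b0) // um|exact: Hd'].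
by apply: le_trans (ler_normD _ _) _; lra.
Qed.

Definition Nn u v : R -> Q := Duh (fun t => B (u t) (v t)).

Lemma Nn_cont T u v : 0 <= T -> cont T u -> cont T v -> cont T (Nn u v).
Proof. by move=> T0 cu cv; apply: Duh_cont => //; exact: cont_B. Qed.

Lemma Nn_le T u v (a b : R) : 0 <= T -> cont T u -> cont T v -> bounded_on T u a ->
  bounded_on T v b -> bounded_on T (Nn u v) (2 * T * beta * a * b).
Proof.
move=> T0 cu cv ua vb t tT; have b0 := ebeta_gt0 X.
have := @Duh_le T (fun t => B (u t) (v t)) t (beta * a * b) (cont_B T0 cu cv) _ tT.
rewrite (_ : 2 * T * (beta * a * b) = 2 * T * beta * a * b); last by ring.
apply=> s sT; apply: le_trans (eBle _ _) _.
by apply: ler_pM => //; [rewrite mulr_ge0 // ltW|rewrite ler_wpM2l ?(ltW b0) // ua|exact: vb].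
Qed.

Lemma Nn_lin T c u u' v t : cont T u -> cont T u' -> cont T v -> 0 <= t <= T ->
  Nn (fun s => c *: u s + u' s) v t = c *: Nn u v t + Nn u' v t.
Proof.
move=> cu cu' cv tT; have T0 : 0 <= T by case/andP: tT; exact: le_trans.
rewrite -(Duh_lin c (cont_B T0 cu cv) (cont_B T0 cu' cv) tT) /Nn.
by congr (Duh _ t); apply/funext => s; rewrite eBl.
Qed.

Lemma Nn_sym u v : Nn u v = Nn v u.
Proof. by rewrite /Nn; congr Duh; apply/funext => s; exact: eBs. Qed.

Lemma Nn_ext T u u' v t : cont T u -> cont T u' -> cont T v -> (forall s, 0 <= s <= T -> u s = u' s) ->
  0 <= t <= T -> Nn u v t = Nn u' v t.
Proof.
move=> cu cu' cv E tT; have T0 : 0 <= T by case/andP: tT; exact: le_trans.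
by apply: (Duh_ext (cont_B T0 cu cv) (cont_B T0 cu' cv)) => // s /E ->.
Qed.

(** ** Mild solutions *)

Definition mild T x u : Prop := cont T u /\ forall t, 0 <= t <= T -> u t = flow t x + Nn u u t.

Lemma mild_ode T x u : 0 <= T ->
  mild T x u <-> [/\ cont T u, u 0 = x & antider T (fun t => A (u t) + B (u t) (u t)) u].
Proof.
move=> T0; split=> [[cu eu]|[cu u0 du]].
  split=> //; first by rewrite eu ?lexx ?T0 // flow0 /Nn Duh0 addr0.
  have H := Duh_ode x T0 (cont_B T0 cu cu).
  have eu' t : 0 <= t <= T -> flow t x + Duh (fun s => B (u s) (u s)) t = u t by move=> tT; rewrite [RHS]eu.
  by apply: eq_antider H => t tT; rewrite eu'.
by split=> // t tT; have := Duh_unique T0 (cont_B T0 cu cu) cu du tT; rewrite u0.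
Qed.

Lemma mild_sub T T' x u : T' <= T -> mild T x u -> mild T' x u.
Proof.
move=> TT [cu eu]; split; first exact: cont_sub TT cu.
by move=> t /andP[t0 tT]; apply: eu; rewrite t0 (le_trans tT).
Qed.

Lemma mild_unique T x u v : 0 <= T -> mild T x u -> mild T x v -> forall t, 0 <= t <= T -> u t = v t.
Proof.
move=> T0 /(mild_ode _ _ T0)[cu u0 du] /(mild_ode _ _ T0)[cv v0 dv] t tT.
have [mu mu0 um] := cont_bounded cu T0; have [mv mv0 vm] := cont_bounded cv T0.
have lin1 : forall c (x y : Q), -%R (c *: x + y) = c *: - x + - y by move=> c y z; rewrite opprD scalerN.
have bd : forall x : Q, `|- x| <= 1 * `|x| by move=> z; rewrite normrN mul1r.
have dn : antider T (fun t => - (A (v t) + B (v t) (v t))) (fun t => - v t) := antider_linear lin1 bd ltr01 dv.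
have b0 := ebeta_gt0 X; apply/eqP; rewrite -subr_eq0; apply/eqP.
have L0 : 0 < 1 + beta * (mu + mv) by rewrite ltr_wpDr // mulr_ge0 ?addr_ge0 // ltW.
apply: (ode_zero (L := 1 + beta * (mu + mv)) (M0 := mu + mv) L0 (antiderD du dn)) => //.
- move=> s sT.
  have -> : A (u s) + B (u s) (u s) - (A (v s) + B (v s) (v s)) =
    A (u s - v s) + (B (u s - v s) (u s) + B (u s - v s) (v s)).
    by rewrite (linB Al) !(linB (eBl _)) (eBs (v s) (u s)); lmod_eq R.
  apply: le_trans (ler_normD _ _) _; rewrite mulrDl mul1r; apply: lerD; first exact: Ale.
  apply: le_trans (ler_normD _ _) _; rewrite mulrDr mulrDl.
  have W : 0 <= beta * `|u s - v s| by rewrite mulr_ge0 // ltW.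
  apply: lerD; (apply: le_trans (eBle _ _) _; rewrite mulrAC; apply: ler_wpM2r => //; rewrite ler_wpM2l ?(ltW b0) //).
    exact: um.
  exact: vm.
- by move=> s sT; apply: le_trans (ler_normB _ _) _; apply: lerD; [exact: um|exact: vm].
- by rewrite u0 v0 subrr.
Qed.

(** A solution may be continued by a solution starting from its final value. *)
Lemma mild_glue T T' x u v : 0 <= T -> 0 <= T' -> mild T x u -> mild T' (u T) v ->
  exists w, mild (T + T') x w.
Proof.
move=> T0 T0' /(mild_ode _ _ T0)[cu u0 du] /(mild_ode _ _ T0')[cv v0 dv].
pose w t := if t <= T then u t else v (t - T).
have wu t : t <= T -> w t = u t by rewrite /w => ->.
have wv t : T <= t -> w t = v (t - T).
  rewrite /w le_eqVlt => /orP[/eqP <-|Tt]; first by rewrite lexx subrr v0.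
  by rewrite leNgt Tt.
have TT : 0 <= T + T' by rewrite addr_ge0.
have cw : cont (T + T') w.
  move=> e e0; have e2 : 0 < e / 2 by rewrite divr_gt0.
  have [d d0 Hd] := cu _ e2; have [d' d0' Hd'] := cv _ e2.
  exists (Num.min d d'); first by rewrite lt_min d0.
  have K a b : 0 <= a -> a <= b -> b <= T + T' -> b - a < d -> b - a < d' -> `|w b - w a| <= e.
    move=> a0 ab bT h h'.
    have P1 p q : 0 <= p -> p <= q -> q <= T -> q - p < d -> `|w q - w p| <= e / 2.
      move=> p0 pq qT pqd; rewrite !wu //; last exact: le_trans pq qT.
      by apply: Hd; rewrite ?ger0_norm ?subr_ge0 //; apply/andP; split; lra.
    have P2 p q : T <= p -> p <= q -> q <= T + T' -> q - p < d' -> `|w q - w p| <= e / 2.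
      move=> p0 pq qT pqd; rewrite !wv //; last exact: le_trans p0 pq.
      have E : q - T - (p - T) = q - p by ring.
      by apply: Hd'; rewrite ?E ?ger0_norm ?subr_ge0 //; apply/andP; split; lra.
    have [bT'|Tb] := leP b T; first by have := P1 a b a0 ab bT' h; lra.
    have [Ta|aT] := leP T a; first by have := P2 a b Ta ab bT h'; lra.
    have -> : w b - w a = (w b - w T) + (w T - w a) by lmod_eq R.
    apply: le_trans (ler_normD _ _) _.
    have q1 : `|w b - w T| <= e / 2 by apply: P2 => //; lra.
    have q2 : `|w T - w a| <= e / 2 by apply: P1 => //; lra.
    by lra.
  move=> a b /andP[a0 aT] /andP[b0 bT]; rewrite lt_min => /andP[h h'].
  case: (leP a b) => [ab|/ltW ba].
    by rewrite ger0_norm ?subr_ge0 // in h h'; exact: K.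
  have E : `|b - a| = a - b by rewrite distrC ger0_norm // subr_ge0.
  by rewrite E in h h'; rewrite distrC; exact: K.
exists w; apply/(mild_ode _ _ TT); split=> //; first by rewrite wu.
pose F t := A (w t) + B (w t) (w t).
have lA : forall c (x y : Q), A (c *: x + y) = c *: A x + A y := Al.
have cA : cont (T + T') (fun t => A (w t)).
  move=> e /cw[d d0 Hd]; exists d => // a b aT bT h; rewrite -(linB Al).
  exact: le_trans (Ale _) (Hd a b aT bT h).
have cF : cont (T + T') F by exact: contD cA (cont_B TT cw cw).
move=> e e0; have e2 : 0 < e / 2 by rewrite divr_gt0.
have [d1 p1 H1] := du _ e2; have [d2 p2 H2] := dv _ e2; have [d3 p3 H3] := cF _ e2.
exists (Num.min d1 (Num.min d2 d3)); first by rewrite !lt_min p1 p2.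
move=> a b a0 ab bT; rewrite !lt_min => /and3P[h1 h2 h3]; rewrite -/(F a).
have G1 p q : 0 <= p -> p <= q -> q <= T -> q - p < d1 -> `|w q - w p - (q - p) *: F p| <= (q - p) * (e / 2).
  move=> p0 pq qT pqd; have pT := le_trans pq qT; rewrite /F (wu p pT) (wu q qT); exact: H1.
have G2 p q : T <= p -> p <= q -> q <= T + T' -> q - p < d2 -> `|w q - w p - (q - p) *: F p| <= (q - p) * (e / 2).
  move=> p0 pq qT pqd; rewrite /F (wv p p0) (wv q (le_trans p0 pq)).
  have E : q - T - (p - T) = q - p by ring.
  by have := H2 (p - T) (q - T); rewrite E; apply; lra.
have ba : 0 <= b - a by rewrite subr_ge0.
have half : (b - a) * (e / 2) <= (b - a) * e by rewrite ler_wpM2l //; lra.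
have [bT'|Tb] := leP b T; first exact: le_trans (G1 a b a0 ab bT' h1) half.
have [Ta|aT] := leP T a; first exact: le_trans (G2 a b Ta ab bT h2) half.
have bT0 : 0 <= b - T by lra.
have -> : w b - w a - (b - a) *: F a = (w b - w T - (b - T) *: F T) + ((w T - w a - (T - a) *: F a) +
   (b - T) *: (F T - F a)) by lmod_eq R.
have g1 : `|w b - w T - (b - T) *: F T| <= (b - T) * (e / 2) by apply: G2 => //; lra.
have g2 : `|w T - w a - (T - a) *: F a| <= (T - a) * (e / 2) by apply: G1 => //; lra.
have g3 : `|(b - T) *: (F T - F a)| <= (b - T) * (e / 2).
  rewrite normrZ (ger0_norm bT0) ler_wpM2l //; apply: H3; rewrite ?ger0_norm ?subr_ge0 ?(ltW aT) //; try (apply/andP; split); lra.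
apply: le_trans (ler_normD _ _) _; apply: le_trans (lerD g1 (ler_normD _ _)) _.
have i1 : (b - T) * (e / 2) <= (b - a) * (e / 2) by rewrite ler_wpM2r ?(ltW e2) //; lra.
have i2 : (b - T) * (e / 2) + (T - a) * (e / 2) = (b - a) * (e / 2) by ring.
have i3 : (b - a) * (e / 2) + (b - a) * (e / 2) = (b - a) * e by field.
by lra.
Qed.

(** ** The power series *)

Lemma power_series T x (al : nat -> R -> Q) : 0 <= T ->
  (forall t, 0 <= t <= T -> al 0%N t = flow t x) ->
  (forall n t, 0 <= t <= T -> al n.+1 t = \sum_(i < n.+1) Nn (al i) (al (n - i)%N) t) ->
  [/\ forall n, cont T (al n),
    forall n, bounded_on T (al n) (4 * `|x| * (16 * T * beta * `|x|) ^+ n) &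
    16 * T * beta * `|x| < 1 -> exists u, mild T x u /\
      forall n t, 0 <= t <= T -> `|\sum_(i < n) al i t - u t| <=
        4 * `|x| * (16 * T * beta * `|x|) ^+ n / (1 - 16 * T * beta * `|x|)].
Proof.
move=> T0 a0 aS; have b0 := ebeta_gt0 X.
have D0 : 0 <= 2 * T * beta by rewrite mulr_ge0 ?mulr_ge0 // ltW.
have x0 : 0 <= 2 * `|x| by rewrite mulr_ge0.
have cg := cont_flow x T0.
have gb : bounded_on T (fun t => flow t x) (2 * `|x|) by move=> t /andP[t0 _]; exact: flow_le.
have Mc u v : cont T u -> cont T v -> cont T (Nn u v) by exact: Nn_cont.
have Ml u v a b : cont T u -> cont T v -> bounded_on T u a -> bounded_on T v b ->
  bounded_on T (Nn u v) (2 * T * beta * a * b) by exact: Nn_le.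
have Mn c u u' v t : cont T u -> cont T u' -> cont T v -> 0 <= t <= T ->
  Nn (fun s => c *: u s + u' s) v t = c *: Nn u v t + Nn u' v t by exact: Nn_lin.
have E1 : 2 * (2 * `|x|) = 4 * `|x| by ring.
have E2 : 4 * (2 * T * beta) * (2 * `|x|) = 16 * T * beta * `|x| by ring.
split.
- by move=> n; exact: (cont_al Mc cg a0 aS).
- by move=> n t tT; have := al_bound D0 Mc Ml cg x0 gb a0 aS n tT; rewrite E1 E2.
- rewrite -{1}E2 => q1; have [u [cu Hu eu]] := quadratic_solution Qc T0 D0 Mc Ml Mn Nn_sym cg x0 gb a0 aS q1.
  by exists u; split=> // n t tT; have := Hu n t tT; rewrite E1 E2.
Qed.

Lemma series_exists x : exists al : nat -> R -> Q, al 0%N = (fun t => flow t x) /\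
  forall n, al n.+1 = fun t => \sum_(i < n.+1) Nn (al i) (al (n - i)%N) t.
Proof.
have [|al H] := @strong_rec (R -> Q) (fun t => flow t x)
  (fun n al t => \sum_(i < n.+1) Nn (al i) (al (n - i)%N) t); last by exists al.
by move=> n f f' H; apply/funext => t; apply: eq_bigr => i _; rewrite !H // ?leq_subr // -ltnS.
Qed.

Lemma local_mild T x : 0 <= T -> 16 * T * beta * `|x| < 1 -> exists u, mild T x u.
Proof.
move=> T0 q1; have [al [a0 aS]] := series_exists x.
have [||_ _ /(_ q1)[u [mu _]]] := @power_series T x al T0.
- by move=> t _; rewrite a0.
- by move=> n t _; rewrite aS.
by exists u.
Qed.

End evolution.

(** ** Change of space *)

Section persistence.
Context {R : realType} (X Y : evo R) (j : eQ X -> eQ Y).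
Hypotheses (jl : lin j) (jle : forall x, `|j x| <= `|x|) (jinj : injective j)
  (jA : forall x, j (eA x) = eA (j x)) (jB : forall x y, j (eB x y) = eB (j x) (j y)).

Lemma cont_j T u : cont T u -> cont T (fun t => j (u t)).
Proof.
move=> cu e /cu[d d0 Hd]; exists d => // a b aT bT h; rewrite -linB //.
exact: le_trans (jle _) (Hd a b aT bT h).
Qed.

Let jle1 x : `|j x| <= 1 * `|x|. Proof. by rewrite mul1r. Qed.

Lemma mild_down T x u : 0 <= T -> mild T x u -> mild T (j x) (fun t => j (u t)).
Proof.
move=> T0 /(mild_ode _ _ T0)[cu u0 du]; apply/(mild_ode _ _ T0); split.
- exact: cont_j.
- by rewrite u0.
have H : antider T (fun t => j (eA (u t) + eB (u t) (u t))) (fun t => j (u t)) :=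
  antider_linear jl jle1 ltr01 du.
by apply: eq_antider H => // t _; rewrite (linD jl) jA jB.
Qed.

(** If the bilinear term maps the larger space to the smaller one, then the integral
    equation shows that a solution stays in the smaller space. *)
Variable (Bt : eQ Y -> eQ Y -> eQ X) (bt : R).
Hypotheses (Btl : forall z, lin (fun y => Bt y z)) (Bts : forall y z, Bt y z = Bt z y)
  (Btle : forall y z, `|Bt y z| <= bt * `|y| * `|z|) (bt0 : 0 < bt)
  (jBt : forall y z, j (Bt y z) = eB y z).

Lemma cont_Bt T u : 0 <= T -> cont T u -> cont T (fun t => Bt (u t) (u t)).
Proof.
move=> T0 cu e e0; have [mu mu0 um] := cont_bounded cu T0.
have c1 : 0 < 2 * (bt * mu) by rewrite !mulr_gt0.
have [d d0 Hd] := cu _ (divr_gt0 e0 c1); exists d => // a b aT bT h.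
have -> : Bt (u b) (u b) - Bt (u a) (u a) = Bt (u b - u a) (u b) + Bt (u b - u a) (u a).
  by rewrite !(linB (Btl _)) (Bts (u a) (u b)); lmod_eq R.
have K c : 0 <= c <= T -> `|Bt (u b - u a) (u c)| <= e / 2.
  move=> cT; apply: le_trans (Btle _ _) _.
  have -> : e / 2 = bt * (e / (2 * (bt * mu))) * mu.
    by field; rewrite ?(lt0r_neq0 bt0) ?(lt0r_neq0 mu0).
  by apply: ler_pM => //; [rewrite mulr_ge0 // ltW|rewrite ler_wpM2l ?(ltW bt0) // Hd|exact: um].
by apply: le_trans (ler_normD _ _) _; have := K a aT; have := K b bT; lra.
Qed.

Lemma mild_up T x u : 0 <= T -> mild T (j x) u -> exists w, mild T x w.
Proof.
move=> T0 /(mild_ode _ _ T0)[cu u0 du]; have cf := cont_Bt T0 cu.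
pose W t := flow t x + Duh (fun t => Bt (u t) (u t)) t.
have dW := Duh_ode x T0 cf; rewrite -/W in dW.
have cW : cont T W by apply: contD; [exact: cont_flow|exact: Duh_cont].
have W0 : W 0 = x by rewrite /W flow0 Duh0 addr0.
have dj : antider T (fun t => j (eA (W t) + Bt (u t) (u t))) (fun t => j (W t)) :=
  antider_linear jl jle1 ltr01 dW.
have dj' : antider T (fun t => eA (j (W t)) + eB (u t) (u t)) (fun t => j (W t)).
  by apply: eq_antider dj => // t _; rewrite (linD jl) jA jBt.
have cB := cont_B T0 cu cu.
have E t : 0 <= t <= T -> j (W t) = u t.
  move=> tT; rewrite (Duh_unique T0 cB cu du tT) u0.
  by rewrite (Duh_unique T0 cB (cont_j cW) dj' tT) W0.
exists W; apply/(mild_ode _ _ T0); split=> //.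
apply: eq_antider dW => // t tT; congr (_ + _); apply: jinj.
by rewrite jBt jB E.
Qed.

End persistence.

(** * Analytic dependence on the data *)

Section analyticity.
Context {R : realType} (X : evo R).
Notation Q := (eQ X).
Notation beta := (ebeta X).
Variables (T rho : R) (x0 : Q) (u : R -> Q).
Hypotheses (T0 : 0 <= T) (rho0 : 0 <= rho) (small : 64 * T * beta * rho <= 1)
  (x0rho : `|x0| <= rho) (mu : mild T x0 u).
Notation It t := (0 <= t <= T).

Let b0 : 0 < beta := ebeta_gt0 X.
Let cu : cont T u := mu.1.

Lemma mild_small : bounded_on T u (8 * rho).
Proof.
have tb : 0 <= T * beta by rewrite mulr_ge0 // ltW.
have q0 : 16 * T * beta * `|x0| <= 4^-1.
  have := ler_wpM2l tb x0rho; move: small; rewrite -!mulrA; move: (T * (beta * _)) (T * (beta * _)).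
  by move=> *; lra.
have q1 : 16 * T * beta * `|x0| < 1 by lra.
have [al [a0 aS]] := series_exists x0.
have [||_ _ /(_ q1)[v [mv Hv]]] := @power_series R X T x0 al T0.
- by move=> t _; rewrite a0.
- by move=> n t _; rewrite aS.
move=> t tT; rewrite (mild_unique T0 mu mv tT).
have := Hv 0%N t tT; rewrite big_ord0 sub0r normrN expr0 mulr1 => /le_trans; apply.
rewrite ler_pdivrMr; last by lra.
have := normr_ge0 x0; move: q0 (x0rho); move: (16 * T * beta * `|x0|) (`|x0|) => q x q0 xr x0'.
by apply: (@le_trans _ _ (8 * rho * (3 / 4))); [lra|rewrite ler_wpM2l ?mulr_ge0 //; lra].
Qed.

(** The linear part of the equation for the difference of two solutions. *)
Definition Lam (w : R -> Q) (t : R) : Q := 2 *: Nn w u t.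

Lemma Lam_cont w : cont T w -> cont T (Lam w).
Proof. by move=> cw; apply: contZ; exact: Nn_cont. Qed.

Lemma Lam_le w a : cont T w -> bounded_on T w a -> bounded_on T (Lam w) (2^-1 * a).
Proof.
move=> cw wa t tT; rewrite /Lam normrZ ger0_norm //.
have a0 : 0 <= a by apply: le_trans (normr_ge0 _) (wa t tT).
have := Nn_le T0 cw cu wa mild_small tT; have := ler_wpM2r a0 small.
by move: (`|_|) => y h1 h2; lra.
Qed.

Lemma Lam_lin c v w t : cont T v -> cont T w -> It t ->
  Lam (fun s => c *: v s + w s) t = c *: Lam v t + Lam w t.
Proof. by move=> cv cw tT; rewrite /Lam (Nn_lin c cv cw cu tT); lmod_eq R. Qed.

Definition Res (g : R -> Q) : R -> Q :=
  xget (fun=> 0) [set w | cont T w /\ forall t, It t -> w t = g t + Lam w t].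

Lemma Res_spec g (b : R) : cont T g -> bounded_on T g b ->
  [/\ cont T (Res g), bounded_on T (Res g) (2 * b) & forall t, It t -> Res g t = g t + Lam (Res g) t].
Proof.
move=> cg gb; have [w [cw wb ew]] := neumann (@eQc R X) T0 Lam_cont Lam_le Lam_lin cg gb.
have [c e] : [set w | cont T w /\ forall t, It t -> w t = g t + Lam w t] (Res g).
  by apply: xgetPex; exists w.
split=> // t tT; rewrite (neumann_unique T0 Lam_le Lam_lin c cw e ew tT); exact: wb.
Qed.

Lemma Res_cont g : cont T g -> cont T (Res g).
Proof. by move=> cg; have [m _ gm] := cont_bounded cg T0; have [] := Res_spec cg gm. Qed.

Lemma Res_eq g t : cont T g -> It t -> Res g t = g t + Lam (Res g) t.
Proof. by move=> cg tT; have [m _ gm] := cont_bounded cg T0; have [_ _] := Res_spec cg gm; apply. Qed.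

Lemma Res_unique g w : cont T g -> cont T w -> (forall t, It t -> w t = g t + Lam w t) ->
  forall t, It t -> w t = Res g t.
Proof.
move=> cg cw ew; apply: (neumann_unique T0 Lam_le Lam_lin cw (Res_cont cg) ew).
by move=> t; exact: Res_eq.
Qed.

Lemma Res_lin c f g h t : cont T f -> cont T g -> cont T h ->
  (forall s, It s -> h s = c *: f s + g s) -> It t -> Res h t = c *: Res f t + Res g t.
Proof.
move=> cf cg ch E tT; have rf := Res_cont cf; have rg := Res_cont cg.
apply/esym; apply: (Res_unique (w := fun s => c *: Res f s + Res g s) ch _ _ tT).
  by apply: contD rg; exact: contZ.
move=> s sT; rewrite (Lam_lin c rf rg sT) E // {1}(Res_eq cf sT) {1}(Res_eq cg sT).
by lmod_eq R.
Qed.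

Definition M (v w : R -> Q) : R -> Q := Res (Nn v w).

Lemma M_cont v w : cont T v -> cont T w -> cont T (M v w).
Proof. by move=> cv cw; apply: Res_cont; exact: Nn_cont. Qed.

Lemma M_le v w a b : cont T v -> cont T w -> bounded_on T v a -> bounded_on T w b ->
  bounded_on T (M v w) (4 * T * beta * a * b).
Proof.
move=> cv cw va wb; have [_ + _] := Res_spec (Nn_cont T0 cv cw) (Nn_le T0 cv cw va wb).
by rewrite (_ : 2 * (2 * T * beta * a * b) = 4 * T * beta * a * b) //; ring.
Qed.

Lemma M_linE c v v' w z t : cont T v -> cont T v' -> cont T w -> cont T z ->
  (forall s, It s -> z s = c *: v s + v' s) -> It t -> M z w t = c *: M v w t + M v' w t.
Proof.
move=> cv cv' cw cz E tT; apply: Res_lin => //; try exact: Nn_cont.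
move=> s sT; rewrite -(Nn_lin c cv cv' cw sT); apply: (Nn_ext (T := T)) => //.
by apply: contD cv'; exact: contZ.
Qed.

Lemma M_lin c v v' w t : cont T v -> cont T v' -> cont T w -> It t ->
  M (fun s => c *: v s + v' s) w t = c *: M v w t + M v' w t.
Proof.
by move=> cv cv' cw tT; apply: M_linE => //; apply: contD cv'; exact: contZ.
Qed.

Lemma M_sym v w : M v w = M w v. Proof. by rewrite /M Nn_sym. Qed.

(** ** The terms of the expansion *)

Definition shiftn (k : nat) (h : nat -> Q) (i : nat) : Q := h (i + k)%N.
Definition upd (h : nat -> Q) (i : nat) (x : Q) (k : nat) : Q := if k == i then x else h k.

Definition start (x : Q) : R -> Q := Res (fun t => flow t x).

Lemma start_le x : bounded_on T (start x) (4 * `|x|).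
Proof.
have gb : bounded_on T (fun t => flow t x) (2 * `|x|) by move=> t /andP[t0 _]; exact: flow_le.
have [_ + _] := Res_spec (cont_flow x T0) gb.
by rewrite (_ : 2 * (2 * `|x|) = 4 * `|x|) //; ring.
Qed.

Lemma expansion_exists : exists l : nat -> (nat -> Q) -> R -> Q,
  (forall h, l 0%N h = start (h 0%N)) /\
  forall n h, l n.+1 h = fun t => \sum_(i < n.+1) M (l i h) (l (n - i)%N (shiftn i.+1 h)) t.
Proof.
have [|l [l0 lS]] := @strong_rec ((nat -> Q) -> R -> Q) (fun h => start (h 0%N))
  (fun n l h t => \sum_(i < n.+1) M (l i h) (l (n - i)%N (shiftn i.+1 h)) t).
  move=> n f f' H; apply/funext => h; apply/funext => t; apply: eq_bigr => i _.
  by rewrite !H // ?leq_subr // -ltnS.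
by exists l; split=> [h|n h]; [rewrite l0|rewrite lS].
Qed.

Variable l : nat -> (nat -> Q) -> R -> Q.
Hypotheses (l0 : forall h, l 0%N h = start (h 0%N))
  (lS : forall n h, l n.+1 h = fun t => \sum_(i < n.+1) M (l i h) (l (n - i)%N (shiftn i.+1 h)) t).

Lemma l_cont n h : cont T (l n h).
Proof.
have [m] := ubnP n; elim: m n h => // m IH [|n] h; rewrite ltnS => nm.
  by rewrite l0; apply: Res_cont; exact: cont_flow.
rewrite lS; apply: (@cont_sum _ _ T n.+1 (fun i => M (l i h) (l (n - i)%N (shiftn i.+1 h)))) => i i_n.
apply: M_cont; apply: IH; first exact: leq_trans i_n nm.
exact: leq_ltn_trans (leq_subr _ _) nm.
Qed.

Lemma l_local n h h' : (forall i, (i <= n)%N -> h i = h' i) -> l n h = l n h'.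
Proof.
have [m] := ubnP n; elim: m n h h' => // m IH [|n] h h'; rewrite ltnS => nm H; first by rewrite !l0 H.
rewrite !lS; apply/funext => t; apply: eq_bigr => i _; have i_n : (i <= n)%N by rewrite -ltnS.
rewrite (IH i h h') ?(IH (n - i)%N (shiftn i.+1 h) (shiftn i.+1 h')) //.
- exact: leq_ltn_trans (leq_subr _ _) nm.
- by move=> k kn; apply: H; rewrite addnS ltnS addnC -leq_subRL.
- exact: leq_ltn_trans i_n nm.
- by move=> k ki; apply: H; exact: leq_trans ki (leqW i_n).
Qed.

Lemma l_bound n h : bounded_on T (l n h) (8 * (64 * T * beta) ^+ n * \prod_(i < n.+1) `|h i|).
Proof.
have [c [c0 cS cp cb]] := @catalan_bound R.
have D0 : 0 <= 4 * T * beta by rewrite !mulr_ge0 // ltW.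
suff K m h' : bounded_on T (l m h') (c m * (4 * T * beta) ^+ m * 4 ^+ m.+1 * \prod_(i < m.+1) `|h' i|).
  move=> t tT; apply: le_trans (K n h t tT) _; apply: ler_wpM2r; first exact: prodr_ge0.
  have -> : 8 * (64 * T * beta) ^+ n = 2 * 4 ^+ n * (4 * T * beta) ^+ n * 4 ^+ n.+1.
    rewrite exprS (_ : 64 * T * beta = 4 * (4 * T * beta) * 4); last by ring.
    by rewrite !exprMn; ring.
  apply: ler_wpM2r; first exact: exprn_ge0.
  by apply: ler_wpM2r (cb n); exact: exprn_ge0.
have [k] := ubnP m; elim: k m h' => // k IH [|m] h'; rewrite ltnS => mk t tT.
  rewrite l0 c0 expr0 !mul1r expr1 big_ord_recl big_ord0 mulr1; exact: start_le.
rewrite lS cS; apply: le_trans (ler_norm_sum _ _ _) _.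
rewrite !mulr_suml; apply: ler_sum => i _.
have i_m : (i <= m)%N by rewrite -ltnS.
have h1 := IH i h' (leq_ltn_trans i_m mk).
have h2 := IH (m - i)%N (shiftn i.+1 h') (leq_ltn_trans (leq_subr _ _) mk).
apply: le_trans (M_le (l_cont _ _) (l_cont _ _) h1 h2 tT) _.
have -> : (4 * T * beta) ^+ m.+1 = (4 * T * beta) * ((4 * T * beta) ^+ i * (4 * T * beta) ^+ (m - i)).
  by rewrite -exprD subnKC // exprS.
have -> : 4 ^+ m.+2 = 4 ^+ i.+1 * 4 ^+ (m - i).+1 :> R by rewrite -exprD addSn addnS subnKC.
have -> : \prod_(j < m.+2) `|h' j| = (\prod_(j < i.+1) `|h' j|) * \prod_(j < (m - i).+1) `|shiftn i.+1 h' j|.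
  have E (F : nat -> R) p : \prod_(j < p) F j = \prod_(0 <= j < p) F j by rewrite big_mkord.
  rewrite (E (fun j => `|h' j|)) (E (fun j => `|h' j|) i.+1) (E (fun j => `|shiftn i.+1 h' j|)).
  rewrite (@big_cat_nat _ _ _ i.+1) //=; last by rewrite ltnS leqW.
  congr (_ * _); rewrite -{1}(add0n i.+1) big_addn; congr bigop.
  by rewrite -subSS subSn ?ltnS // subSS.
by rewrite le_eqVlt; apply/orP; left; apply/eqP; ring.
Qed.

Lemma l_linear n i h c f g t : (i <= n)%N -> It t ->
  l n (upd h i (c *: f + g)) t = c *: l n (upd h i f) t + l n (upd h i g) t.
Proof.
have [m] := ubnP n; elim: m n i h t => // m IH [|n] i h t; rewrite ltnS => nm i_n tT.
  move: i_n; rewrite leqn0 => /eqP ->; rewrite !l0 /upd eqxx.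
  apply: Res_lin => //; try exact: cont_flow.
  by move=> s _; exact: flow_lin.
rewrite !lS scaler_sumr -big_split /=; apply: eq_bigr => k _.
have k_n : (k <= n)%N by rewrite -ltnS.
have [ik|ki] := leqP i k.
  have E x : shiftn k.+1 (upd h i x) = shiftn k.+1 h.
    by apply/funext => p; rewrite /shiftn /upd; case: eqP => // pe; move: ik; rewrite -pe addnS ltnNge leq_addl.
  rewrite !E; apply: M_linE; try exact: l_cont; last exact: tT.
  by move=> s sT; apply: IH => //; exact: leq_ltn_trans k_n nm.
have E1 x : l k (upd h i x) = l k h.
  by apply: l_local => p pk; rewrite /upd; case: eqP => // pe; move: ki; rewrite -pe ltnNge pk.
have E2 x : shiftn k.+1 (upd h i x) = upd (shiftn k.+1 h) (i - k.+1) x.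
  apply/funext => p; rewrite /shiftn /upd; congr (if _ then _ else _).
  by apply/eqP/eqP => [<-|->]; rewrite ?addnK ?subnK.
rewrite !E1 !E2 !(M_sym (l k h)); apply: M_linE; try exact: l_cont; last exact: tT.
move=> s sT; apply: IH => //; first exact: leq_ltn_trans (leq_subr _ _) nm.
by rewrite leq_subLR addSn subnKC.
Qed.

Lemma expansion_sum (x : Q) v n t : 64 * T * beta * `|x| < 1 -> mild T (x0 + x) v -> It t ->
  `|u t + \sum_(i < n) l i (fun=> x) t - v t| <=
    8 * `|x| * (64 * T * beta * `|x|) ^+ n / (1 - 64 * T * beta * `|x|).
Proof.
move=> q1 mv tT.
have D0 : 0 <= 4 * T * beta by rewrite !mulr_ge0 // ltW.
have x4 : 0 <= 4 * `|x| by rewrite mulr_ge0.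
have E1 : 2 * (4 * `|x|) = 8 * `|x| by ring.
have E2 : 4 * (4 * T * beta) * (4 * `|x|) = 64 * T * beta * `|x| by ring.
have q1' : 4 * (4 * T * beta) * (4 * `|x|) < 1 by rewrite E2.
have cg : cont T (start x) by apply: Res_cont; exact: cont_flow.
have a0 s : It s -> l 0%N (fun=> x) s = start x s by move=> _; rewrite l0.
have aS k s : It s -> l k.+1 (fun=> x) s = \sum_(i < k.+1) M (l i (fun=> x)) (l (k - i)%N (fun=> x)) s.
  by move=> _; rewrite lS.
have [w [cw Hw ew]] := quadratic_solution (al := fun i => l i (fun=> x)) (@eQc R X) T0 D0 M_cont M_le M_lin M_sym cg x4 (@start_le x) a0 aS q1'.
have mw : mild T (x0 + x) (fun s => 1 *: u s + w s).
  split; first by apply: contD cw; exact: contZ.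
  move=> s sT; have cz : cont T (fun s => 1 *: u s + w s) by apply: contD cw; exact: contZ.
  have cNw := Nn_cont T0 cw cw; have cg2 : cont T (M w w) by exact: M_cont.
  have e1 := Res_eq (cont_flow x T0) sT; have e2 := Res_eq cNw sT.
  rewrite -/(start x) in e1; rewrite -/(M w w) in e2.
  have e3 : Nn w u s = Nn (start x) u s + Nn (M w w) u s.
    rewrite -[Nn (start x) u s]scale1r -(Nn_lin 1 cg cg2 cu sT); apply: (Nn_ext (T := T)) => //.
      by apply: contD cg2; exact: contZ.
    by move=> r rT; rewrite scale1r; exact: ew.
  have e4 : w s = flow s x + Nn w w s + 2 *: Nn w u s.
    by rewrite ew // e1 e2 /Lam e3; lmod_eq R.
  pose z r := 1 *: u r + w r.
  have h1 : Nn u z s = 1 *: Nn u u s + Nn w u s by rewrite (Nn_sym u z); exact: (Nn_lin 1 cu cw cu sT).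
  have h2 : Nn w z s = 1 *: Nn u w s + Nn w w s by rewrite (Nn_sym w z); exact: (Nn_lin 1 cu cw cw sT).
  have e5 : Nn z z s = Nn u u s + 2 *: Nn w u s + Nn w w s.
    have h3 : Nn z z s = 1 *: Nn u z s + Nn w z s := Nn_lin 1 cu cw cz sT.
    by rewrite h3 h1 h2 (Nn_sym u w); lmod_eq R.
  rewrite -/(z s) -/z e5 /z.
  rewrite (linD (flow_lin s)) {1}e4; have e6 := mu.2 s sT.
  by rewrite {1}e6; lmod_eq R.
rewrite (mild_unique T0 mv mw tT) scale1r.
have -> : u t + \sum_(i < n) l i (fun=> x) t - (u t + w t) = \sum_(i < n) l i (fun=> x) t - w t by lmod_eq R.
by have := Hw n t tT; rewrite E1 E2.
Qed.

End analyticity.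

(** * The Boussinesq system as a quadratic evolution equation *)

Opaque Hs_norm sq inv_dx hn Xnorm energy.

Section lift.
Context {R : realType} {V : lmodType R} (N1 N2 : esn V) (F : V -> V) (M : R).
Hypotheses (M0 : 0 <= M)
  (Flin : forall (c : R) f g, fin N1 f -> fin N1 g -> N2 (F (c *: f + g) - (c *: F f + F g)) = 0%E)
  (Fle : forall f, fin N1 f -> (N2 (F f) <= (M * fine (N1 f))%:E)%E).

Definition qlift (x : quo N1) : quo N2 := cls N2 (F (rep x)).

Lemma fin_F f : fin N1 f -> fin N2 (F f).
Proof. by move=> ff; apply: le_lt_trans (Fle ff) _; rewrite ltry. Qed.

Lemma qlift_cls f : fin N1 f -> qlift (cls N1 f) = cls N2 (F f).
Proof.
move=> ff; have fr := fin_rep (cls N1 f); have h := rep_cls ff; set r := rep _ in fr h.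
apply/(cls_eq (fin_F fr) (fin_F ff)).
have e : N2 (F (-1 *: f + r)) = 0%E.
  apply: N_le0; have := Fle (finD (finZ (-1) ff) fr).
  by rewrite (_ : -1 *: f + r = r - f) ?h ?mulr0 // scaleN1r addrC.
have e2 := Flin (-1) ff fr.
have := esn0_trans (u := F r) (v := F f + F (-1 *: f + r)) (w := F f) (N := N2).
apply.
  have fa : fin N2 (F (-1 *: f + r)) by apply: fin_F; apply: finD => //; exact: finZ.
  have fb : fin N2 (-1 *: F f + F r) by apply: finD; [apply: finZ|]; exact: fin_F.
  have -> : F r - (F f + F (-1 *: f + r)) = - (F (-1 *: f + r) - (-1 *: F f + F r)) by lmod_eq R.
  by rewrite esnN //; exact: finB.
by rewrite addrAC subrr add0r.
Qed.

Lemma qlift_lin : lin qlift.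
Proof.
move=> c; elim/(@quoP R V N1) => f ff; elim/(@quoP R V N1) => g fg.
have fc := finZ c ff; have f1 := fin_F ff; have f2 := fin_F fg.
rewrite -clsZ // -clsD // !qlift_cls //; last exact: finD.
rewrite -clsZ // -clsD //; last exact: finZ.
apply/cls_eq; [by apply: fin_F; exact: finD|by apply: finD => //; exact: finZ|exact: Flin].
Qed.

Lemma qlift_le x : `|qlift x| <= M * `|x|.
Proof.
elim/(@quoP R V N1): x => f ff; rewrite qlift_cls // -lee_fin -norm_cls; last exact: fin_F.
by apply: le_trans (Fle ff) _; rewrite (norm_cls ff).
Qed.

End lift.

Section bona_evolution.
Context {R : realType}.
Notation V := (Xfun R).

Definition Xesn (s : R) : esn V :=
  @ESN R V (Xnorm s) (@Xnorm_ge0 R s) (@Xnorm0 R s) (@XnormD R s) (@XnormZ R s).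

Variables (s : R) (hs : 0 <= s).
Notation N := (Xesn s).
Notation Q := (quo N).

Lemma quo_complete : seq_complete Q.
Proof.
move=> u uc.
have E x y : Xnorm s (rep x - rep y) = (`|x - y : Q|)%:E.
  have := @norm_cls R V N (rep x - rep y) (finB (fin_rep x) (fin_rep y)).
  by rewrite (clsB (fin_rep x) (fin_rep y)) !repK.
have [n|e e0|f ff cf] := @Xs_complete R s (fun n => rep (u n)) hs.
- exact: (@fin_rep R V N (u n)).
- have [n0 H] := uc e e0; exists n0 => m n mn nn; rewrite E lee_fin; exact: H.
exists (cls N f) => e e0.
have K n : Xnorm s (rep (u n) - f) = (`|u n - cls N f|)%:E.
  have := @norm_cls R V N (rep (u n) - f) (finB (fin_rep (u n)) ff).
  by rewrite (clsB (fin_rep (u n)) ff) repK.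
have /ecvg0P := cf => /(_ (fun n => Xnorm_ge0 s (rep (u n) - f)) e e0)[n0 _ H].
by exists n0 => n /H; rewrite K lee_fin.
Qed.

Definition qA : Q -> Q := qlift N (@opA R).

Let A1 (c : R) f g : fin N f -> fin N g -> N (opA (c *: f + g) - (c *: opA f + opA g)) = 0%E.
Proof. exact: opA_lin. Qed.
Let A2 f : fin N f -> (N (opA f) <= (1 * fine (N f))%:E)%E.
Proof. move=> ff; have fn : N f \is a fin_num by rewrite (ge0_fin_numE (esn_ge0 N f)).
by rewrite mul1r (fineK fn); exact: opA_bound. Qed.

Lemma qA_lin : lin qA. Proof. exact: qlift_lin A1 A2. Qed.
Lemma qA_le x : `|qA x| <= `|x|. Proof. by rewrite -[leRHS]mul1r; exact: qlift_le A2 x. Qed.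
Lemma qA_cls f : fin N f -> qA (cls N f) = cls N (opA f).
Proof. by move=> ff; exact: (qlift_cls A1 A2 ff). Qed.
Lemma opA_fin f : fin N f -> fin N (opA f). Proof. by move=> ff; exact: (fin_F A2 ff). Qed.

Definition qE (x : Q) : R := energy s (rep x).

Lemma fine_norm f : fin N f -> fine (Xnorm s f) = `|cls N f|.
Proof. by move=> ff; rewrite (norm_cls ff : Xnorm s f = _). Qed.

Lemma energy_null f g : fin N f -> fin N g -> Xnorm s (f - g) = 0%E -> energy s f <= energy s g.
Proof.
move=> ff fg h; have fd : fin N (f - g) := finB ff fg.
have -> : f = g + (f - g) by rewrite addrC subrK.
apply: le_trans (energyD fg fd) _; rewrite gerDl.
by apply: le_trans (energy_le fd) _; rewrite h.
Qed.

Lemma qE_cls f : fin N f -> qE (cls N f) = energy s f.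
Proof.
move=> ff; have fr : fin N (rep (cls N f)) := fin_rep (cls N f); have h := rep_cls ff.
have h' : Xnorm s (f - rep (cls N f)) = 0%E := etrans (esnBC ff fr) h.
by apply: le_anti; rewrite (energy_null fr ff h) (energy_null ff fr h').
Qed.

Lemma qE_le x : qE x <= `|x|.
Proof. by elim/(@quoP R V N): x => f ff; rewrite (qE_cls ff) -(fine_norm ff); exact: energy_le. Qed.
Lemma qE_ge x : `|x| <= 2 * qE x.
Proof. by elim/(@quoP R V N): x => f ff; rewrite (qE_cls ff) -(fine_norm ff); exact: energy_ge. Qed.
Lemma qED x y : qE (x + y) <= qE x + qE y.
Proof.
elim/(@quoP R V N): x => f ff; elim/(@quoP R V N): y => g fg.
rewrite -(clsD ff fg) (qE_cls ff) (qE_cls fg) (qE_cls (finD ff fg)); exact: (energyD ff fg).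
Qed.
Lemma qEA (c : R) x : qE (x + c *: qA x) ^+ 2 <= (1 + c ^+ 2) * qE x ^+ 2.
Proof.
elim/(@quoP R V N): x => f ff; have fa := opA_fin ff; have fc : fin N (c *: opA f) := finZ c fa.
rewrite (qA_cls ff) -(clsZ c fa) -(clsD ff fc) (qE_cls ff) (qE_cls (finD ff fc)).
exact: (energy_step c ff).
Qed.

(** The bilinear map, with values in the better space. *)
Section bilinear.
Variables (r : R) (rs : r <= s + 4^-1).

Definition Bh (f g : V) : V := - 2^-1 *: Bq f g.

Definition qBt (x y : Q) : quo (Xesn r) := qlift (Xesn r) (Bh^~ (rep y)) x.

Lemma Bq_fin f g : fin N f -> fin N g -> (Xnorm r (Bq f g) <=
   (smoothC s * fine (Xnorm s f) * fine (Xnorm s g))%:E)%E.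
Proof. by move=> ff fg; apply: le_trans (Xs_mono _ rs) (Bq_bound hs ff fg). Qed.

Lemma Bh_le f g : fin N f -> fin N g -> (Xnorm r (Bh f g) <=
   ((smoothC s + 1) * `|cls N g| * fine (Xnorm s f))%:E)%E.
Proof.
move=> ff fg; have fB : Xs r (Bq f g) by apply: le_lt_trans (Bq_fin ff fg) _; rewrite ltry.
rewrite /Bh (XnormZ _ fB); apply: (@le_trans _ _ (1%:E * Xnorm r (Bq f g))%E).
  by apply: lee_wpmul2r; [exact: Xnorm_ge0|rewrite lee_fin normrN ger0_norm //; lra].
rewrite mul1e; apply: le_trans (Bq_fin ff fg) _; rewrite lee_fin -(fine_norm fg).
have a0 : 0 <= fine (Xnorm s f) by apply: fine_ge0; exact: Xnorm_ge0.
have b0 : 0 <= fine (Xnorm s g) by apply: fine_ge0; exact: Xnorm_ge0.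
by have := mulr_ge0 a0 b0; move: (fine _) (fine _) => a b; lra.
Qed.

Lemma Bh_lin g (c : R) p q : fin N g -> fin N p -> fin N q ->
  Xesn r (Bh (c *: p + q) g - (c *: Bh p g + Bh q g)) = 0%E.
Proof.
move=> fg fp fq.
have -> : Bh (c *: p + q) g - (c *: Bh p g + Bh q g) =
  - 2^-1 *: (Bq (c *: p + q) g - (c *: Bq p g + Bq q g)) by rewrite /Bh; lmod_eq R.
have K v : Xnorm r v = 0%E -> Xesn r (- 2^-1 *: v) = 0%E.
  move=> v0; have vf : fin (Xesn r) v by rewrite /fin (v0 : Xesn r v = 0%E) ltry.
  by rewrite (esnZ _ vf) (v0 : Xesn r v = 0%E) mule0.
by apply: K; exact: (Bq_lin r c hs fp fq fg).
Qed.

Let F1 g (fg : fin N g) (c : R) p q (fp : fin N p) (fq : fin N q) := Bh_lin c fg fp fq.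
Let F2 g (fg : fin N g) p (fp : fin N p) := Bh_le fp fg.

Lemma Bh_rep g f : fin N g -> fin N f -> cls (Xesn r) (Bh (rep (cls N f)) g) = cls (Xesn r) (Bh f g).
Proof. move=> fg ff; exact: (qlift_cls (F1 fg) (F2 fg) ff). Qed.

Lemma qBt_lin y : lin (fun x => qBt x y).
Proof. exact: (qlift_lin (F1 (fin_rep y)) (F2 (fin_rep y))). Qed.

Lemma qBt_le x y : `|qBt x y| <= (smoothC s + 1) * `|x| * `|y|.
Proof.
have := qlift_le (F1 (fin_rep y)) (F2 (fin_rep y)) x; rewrite repK => H.
by rewrite -mulrA (mulrC `|x|) mulrA.
Qed.

Lemma qBt_sym x y : qBt x y = qBt y x.
Proof. exact: (congr1 (fun v => cls (Xesn r) (- 2^-1 *: v)) (Bq_sym (rep x) (rep y))). Qed.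

Lemma qBt_cls f g : fin N f -> fin N g -> qBt (cls N f) (cls N g) = cls (Xesn r) (Bh f g).
Proof.
move=> ff fg; have fr := fin_rep (cls N g).
have sym p q : cls (Xesn r) (Bh p q) = cls (Xesn r) (Bh q p).
  exact: (congr1 (fun v => cls (Xesn r) (- 2^-1 *: v)) (Bq_sym p q)).
exact: etrans (Bh_rep fr ff) (etrans (sym _ _) (etrans (Bh_rep ff fg) (sym _ _))).
Qed.

End bilinear.

Let s4 : s <= s + 4^-1. Proof. by rewrite lerDl. Qed.

Lemma smooth1_gt0 : 0 < smoothC s + 1.
Proof. by have := smoothC_ge0 s; lra. Qed.

Definition Xevo : evo R := @Evo R Q quo_complete qA qA_lin qA_le qE qE_le qE_ge qED qEA
  (@qBt s) (qBt_lin s4) (@qBt_sym s) (smoothC s + 1) smooth1_gt0 (qBt_le s4).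

End bona_evolution.

(** * From classes to functions *)

Section time_derivatives.
Context {R : realType} (Q : normedModType R).

Lemma pointwise_growth (T e : R) (g : R -> R) : 0 <= T -> 0 < e -> 
  (forall t, 0 <= t <= T -> exists2 d : R, 0 < d & forall t', 0 <= t' <= T -> `|t' - t| < d ->
     `|g t' - g t| <= e * `|t' - t|) -> forall t, 0 <= t <= T -> g t - g 0 <= e * t.
Proof.
move=> T0 e0 H.
pose A := [set t : R | 0 <= t <= T /\ forall s, 0 <= s <= t -> g s - g 0 <= e * s].
have A0 : A 0.
  split=> [|s /andP[s0 s0']]; first by rewrite lexx T0.
  have -> : s = 0 by lra.
  by rewrite subrr mulr0.
have sA : has_sup A by split; [exists 0|exists T => t [/andP[]]].
pose c := sup A; have c0 : 0 <= c by apply: sup_upper_bound.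
have cT : c <= T by apply: ge_sup => [|t [/andP[]] //]; exists 0.
have cI : 0 <= c <= T by rewrite c0.
have [d d0 Hd] := H c cI.
have below s : 0 <= s -> s < c -> g s - g 0 <= e * s.
  move=> s0 sc; have cs : 0 < c - s by lra.
  have [s1 [s1T s1A] h] := sup_adherent cs sA; rewrite -/c in h.
  by apply: s1A; rewrite s0; lra.
have gc : g c - g 0 <= e * c.
  have [->|cp] := eqVneq c 0; first by rewrite subrr mulr0.
  have cp' : 0 < c by rewrite lt_def cp.
  pose s := Num.max 0 (c - d / 2).
  have sc : s < c by rewrite /s gt_max cp' /=; lra.
  have s0 : 0 <= s by rewrite le_max lexx.
  have sd : c - d / 2 <= s by rewrite le_max lexx orbT.
  have sI : 0 <= s <= T by rewrite s0 (le_trans (ltW sc)).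
  have := Hd s sI; rewrite distrC gtr0_norm ?subr_gt0 // => /(_ _) h.
  have {}h : `|g s - g c| <= e * (c - s) by apply: h; lra.
  by have := below s s0 sc; have := ler_norm (g c - g s); rewrite distrC; lra.
have cA : c = T.
  apply/eqP; rewrite eq_le cT /= leNgt; apply/negP => cT'.
  pose s1 := Num.min T (c + d / 2).
  have c1 : c < s1 by rewrite lt_min cT' /=; lra.
  suff : A s1 by move=> /(sup_upper_bound sA); rewrite -/c leNgt c1.
  have s1T : s1 <= T by rewrite ge_min lexx.
  have s1d : s1 <= c + d / 2 by rewrite ge_min lexx orbT.
  split=> [|s /andP[s0 ss1]]; first by rewrite s1T; lra.
  have [sc|cs] := ltP s c; first exact: below.
  have sI : 0 <= s <= T by rewrite s0 (le_trans ss1).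
  have := Hd s sI; rewrite ger0_norm ?subr_ge0 // => h.
  have {}h : `|g s - g c| <= e * (s - c) by apply: h; lra.
  by have := ler_norm (g s - g c); lra.
move=> t /andP[t0 tT]; have [tc|ct] := ltP t c; first exact: below.
by have -> : t = c by lra.
Qed.

Lemma pointwise_antider (T : R) (G U : R -> Q) : seq_complete Q -> 0 <= T -> cont T G ->
  (forall t, 0 <= t <= T -> forall e : R, 0 < e -> exists2 d : R, 0 < d & forall t', 0 <= t' <= T ->
     `|t' - t| < d -> `|U t' - U t - (t' - t) *: G t| <= e * `|t' - t|) -> antider T G U.
Proof.
move=> Qc T0 cG H; have [W [GW W0]] := antider_exists Qc T0 cG.
suff E t : 0 <= t <= T -> W t + U 0 = U t.
  apply: (eq_antider (F := G) (U := fun t => W t + U 0)) => // e /GW[d d0 Hd].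
  exists d => // a b a0 ab bT h.
  have -> : W b + U 0 - (W a + U 0) - (b - a) *: G a = W b - W a - (b - a) *: G a by lmod_eq R.
  exact: Hd.
move=> tT; apply/eqP; rewrite -subr_eq0 -normr_le0.
have t1 : 0 < t + 1 by case/andP: tT; lra.
apply/ler_addgt0Pr => e e0; rewrite add0r.
have e1 : 0 < e / (t + 1) by rewrite divr_gt0.
have e2 : 0 < e / (t + 1) / 2 by rewrite divr_gt0.
pose g s := `|W s + U 0 - U s|.
have : g t - g 0 <= e / (t + 1) * t.
  apply: (@pointwise_growth T) => // s sT.
  have [d d0 Hd] := H s sT _ e2; have [d' d0' Hd'] := antider_any cG GW e2.
  exists (Num.min d d'); first by rewrite lt_min d0.
  move=> r rT; rewrite lt_min => /andP[h h'].
  apply: le_trans (ler_dist_dist _ _) _.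
  have -> : W r + U 0 - U r - (W s + U 0 - U s) = (W r - W s - (r - s) *: G s) - (U r - U s - (r - s) *: G s).
    by lmod_eq R.
  have h1 := Hd r rT h.
  have h2 : `|W r - W s - (r - s) *: G s| <= e / (t + 1) / 2 * `|r - s|.
    move: sT rT h' => /andP[s0 sT] /andP[r0 rT].
    case: (leP s r) => [sr|/ltW rs] h'.
      by have := Hd' s s r s0 (lexx s) sr rT; rewrite (ger0_norm (_ : 0 <= r - s)) ?subr_ge0 // in h' *; rewrite mulrC; apply.
    have := Hd' r s s r0 rs (lexx s) sT; rewrite distrC (ger0_norm (_ : 0 <= s - r)) ?subr_ge0 // in h' *.
    rewrite mulrC; have -> : W r - W s - (r - s) *: G s = - (W s - W r - (s - r) *: G s) by lmod_eq R.
    by rewrite normrN; apply.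
  apply: le_trans (ler_normB _ _) _.
  have -> : e / (t + 1) * `|r - s| = e / (t + 1) / 2 * `|r - s| + e / (t + 1) / 2 * `|r - s|.
    by rewrite -mulrDl -splitr.
  exact: lerD.
rewrite /g W0 add0r subrr normr0 subr0 => /le_trans; apply.
have -> : e / (t + 1) * t = e * (t / (t + 1)) by rewrite mulrAC mulrA.
by rewrite ger_pMr // ler_pdivrMr // mul1r; lra.
Qed.

Lemma near_within_ball (A : set R) (t : R) (P : R -> Prop) :
  (\forall x \near within A (nbhs t), P x) <-> exists2 d : R, 0 < d & forall x, A x -> `|x - t| < d -> P x.
Proof.
split=> [|[d d0 H]]; rewrite near_withinE.
  move=> /nbhs_ballP[d /= d0 H]; exists d => // x Ax h; apply: H => //.
  by rewrite /ball /= distrC.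
by apply/nbhs_ballP; exists d => //= x; rewrite /ball /= distrC => h Ax; exact: H.
Qed.

Lemma dist_via (x y z : Q) : `|y - x| <= `|x - z| + `|z - y|.
Proof. by rewrite (distrC y); exact: ler_distD. Qed.

Lemma norm_fwd (a b : R) : a <= b -> `|b - a| = b - a.
Proof. by move=> ab; rewrite ger0_norm // subr_ge0. Qed.

Lemma norm_bwd (a b : R) : a <= b -> `|a - b| = b - a.
Proof. by rewrite distrC; exact: norm_fwd. Qed.

Lemma dist_shift (t a b : R) : `|t - b - (t - a)| <= `|b - a|.
Proof.
have -> : t - b - (t - a) = - (b - a) by ring.
by rewrite normrN.
Qed.

Lemma quot_to_diff (x y z : Q) (t' t e : R) : (t' != t -> `|(t' - t)^-1 *: (x - y) - z| <= e) ->
  (t' = t -> x = y) -> `|x - y - (t' - t) *: z| <= e * `|t' - t|.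
Proof.
have [->|tt] := eqVneq t' t.
  by move=> _ /(_ erefl) ->; rewrite !subrr scale0r subr0 !normr0 mulr0.
move=> /(_ isT) h _; have tn : t' - t != 0 by rewrite subr_eq0.
have -> : x - y - (t' - t) *: z = (t' - t) *: ((t' - t)^-1 *: (x - y) - z).
  by rewrite scalerBr scalerA divff // scale1r.
by rewrite normrZ mulrC ler_wpM2r.
Qed.

Lemma diff_to_quot (x y z : Q) (t' t e : R) : t' != t ->
  `|x - y - (t' - t) *: z| <= e * `|t' - t| -> `|(t' - t)^-1 *: (x - y) - z| <= e.
Proof.
move=> tt h; have tn : t' - t != 0 by rewrite subr_eq0.
have np : 0 < `|t' - t| by rewrite normr_gt0.
by rewrite -(ler_pM2l np) -normrZ scalerBr scalerA divff // scale1r mulrC.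
Qed.

Lemma diff_sym (x y z : Q) (t' t : R) : `|x - y - (t' - t) *: z| = `|y - x - (t - t') *: z|.
Proof.
have -> : x - y - (t' - t) *: z = - (y - x - (t - t') *: z) by lmod_eq R.
by rewrite normrN.
Qed.

Lemma cont_lin (A : Q -> Q) T (U : R -> Q) : lin A -> (forall x, `|A x| <= `|x|) ->
  cont T U -> cont T (fun t => A (U t)).
Proof.
move=> Al Ale cU e /cU[d d0 Hd]; exists d => // a b aT bT h; rewrite -(linB Al).
exact: le_trans (Ale _) (Hd a b aT bT h).
Qed.

End time_derivatives.

Section bridge.
Context {R : realType} (s : R) (hs : 0 <= s).
Notation V := (Xfun R).
Notation N := (Xesn s).
Notation X := (Xevo hs).
Notation c := (cls N).
Implicit Types (f g : V) (u v F : R -> V) (t T : R).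

Lemma Xdist f g : fin N f -> fin N g -> Xnorm s (f - g) = (`|c f - c g|)%:E.
Proof. by move=> ff fg; rewrite -(clsB ff fg); exact: (norm_cls (finB ff fg)). Qed.

Lemma Xeq_cls f g : fin N f -> fin N g -> Xeq f g <-> c f = c g.
Proof.
move=> ff fg; have [f1 f2] := Xs_L2 (ff : Xs s f); have [g1 g2] := Xs_L2 (fg : Xs s g).
by rewrite (Xeq_Xnorm s f1 f2 g1 g2) (cls_eq ff fg).
Qed.

Lemma Xnorm_eq0 f g : f = g -> Xnorm s (f - g) = 0%E.
Proof. by move=> ->; rewrite subrr Xnorm0. Qed.

Lemma mem_It T t : (t \in `[0, T]) = (0 <= t <= T).
Proof. by rewrite in_itv. Qed.

(** Heine's theorem, by compactness of [[0, T]]. *)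
Lemma XsT_cont T u : XsT s T u <-> (forall t, 0 <= t <= T -> fin N (u t)) /\ cont T (fun t => c (u t)).
Proof.
split=> [H|[fu cu] t tT].
  have fu t : 0 <= t <= T -> fin N (u t) by move=> tT; apply: (H t _).1; rewrite mem_It.
  split=> // e e0; have e2 : 0 < e / 2 by rewrite divr_gt0.
  have loc t : 0 <= t <= T -> exists2 d : R, 0 < d & forall t', 0 <= t' <= T -> `|t' - t| < d ->
      `|c (u t') - c (u t)| <= e / 2.
    move=> tT; have [_ ct] := H t (etrans (mem_It T t) tT).
    have /ecvg0P := ct => /(_ (fun t' => Xnorm_ge0 s _) _ e2).
    rewrite near_withinE => /nbhs_ballP[d /= d0 Hd]; exists d => // t' tT' h.
    have := Hd t'; rewrite /ball /= distrC => /(_ h); rewrite mem_It => /(_ tT').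
    by rewrite (Xdist (fu _ tT') (fu _ tT)) lee_fin.
  have K : near_covering (`[0, T]%classic : set R) by apply/compact_near_coveringP; exact: segment_compact.
  have := K R (0^'+) (fun d x => forall t', 0 <= t' <= T -> 0 <= x <= T -> `|t' - x| < d -> `|c (u t') - c (u x)| <= e) _.
  move=> /(_ _)[].
    move=> x; rewrite /= in_itv /= => xT; have [d d0 Hd] := loc x xT.
    have d2 : 0 < d / 2 by rewrite divr_gt0.
    exists (ball x (d / 2), [set i | i < d / 2]).
      by split; [exact: nbhsx_ballx|exact: nbhs_right_lt].
    move=> [y i] /= [xy id] t' tT' yT h; rewrite /ball /= in xy.
    have h1 := Hd y yT; have h2 := Hd t' tT'.
    have -> : c (u t') - c (u y) = (c (u t') - c (u x)) - (c (u y) - c (u x)) by lmod_eq R.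
    apply: le_trans (ler_normB _ _) _.
    have g1 : `|c (u y) - c (u x)| <= e / 2 by apply: h1; rewrite distrC; lra.
    have g2 : `|c (u t') - c (u x)| <= e / 2.
      apply: h2; have := ler_normD (t' - y) (y - x); rewrite addrA subrK (distrC y x); lra.
    by rewrite (splitr e); exact: lerD g2 g1.
  move=> d /= d0 Hd; exists (d / 2); first by rewrite divr_gt0.
  move=> a b aT bT h; have d3 : 0 < d / 2 by rewrite divr_gt0.
  have d2 : `|0 - d / 2| < d by rewrite sub0r normrN (gtr0_norm d3) ltr_pdivrMr // ltr_pMr // ltr1n.
  have Hd2 := Hd (d / 2) d2 d3.
  have ma : (`[0, T]%classic : set R) a by rewrite /= in_itv.
  exact: (Hd2 a ma b bT aT h).
rewrite mem_It in tT; split; first exact: fu.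
apply/ecvg0P => [t'|e e0]; first exact: Xnorm_ge0.
have [d d0 Hd] := cu e e0; rewrite near_withinE; apply/nbhs_ballP; exists d => //= t' h.
rewrite /= mem_It => tT'; rewrite (Xdist (fu _ tT') (fu _ tT)) lee_fin; apply: Hd => //.
by move: h; rewrite /ball /= distrC.
Qed.

Lemma iter_opA k f : fin N f -> fin N (iter k (@opA R) f) /\ c (iter k (@opA R) f) = iter k (@eA R X) (c f).
Proof.
move=> ff; elim: k => [//|k [IH1 IH2]] /=; split; first exact: (opA_fin IH1).
by rewrite -IH2; exact: esym (qA_cls IH1).
Qed.

Lemma opS_cls t f : fin N f -> fin N (opS s t f) /\ c (opS s t f) = flow (X := X) t (c f).
Proof.
move=> ff; pose w n : V := \sum_(k < n) (t ^+ k / k`!%:R) *: iter k (@opA R) f.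
have ft k : fin N ((t ^+ k / k`!%:R) *: iter k (@opA R) f) by apply: finZ; exact: (iter_opA k ff).1.
have wE n : c (w n) = expsum (@eA R X) n t (c f) /\ fin N (w n).
  have [E fs] := @cls_sum R V N 'I_n (index_enum 'I_n) xpredT (fun k => (t ^+ k / k`!%:R) *: iter k (@opA R) f) (fun k => ft k).
  split; last exact: fs.
  rewrite [LHS]E; apply: eq_bigr => k _.
  by rewrite (clsZ _ (iter_opA k ff).1) (iter_opA k ff).2.
have sl := S_slim (@eQc R X) (@eAle R X) t (c f); rewrite -/(flow (X := X) t (c f)) in sl.
have Lim l : fin N l -> (Xnorm s (w n - l) @[n --> \oo] --> 0%E <-> slim (fun n => expsum (@eA R X) n t (c f)) (c l)).
  move=> fl; have D n : Xnorm s (w n - l) = (`|expsum (@eA R X) n t (c f) - c l|)%:E.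
    by rewrite (Xdist (wE n).2 fl) (wE n).1.
  split=> [/ecvg0P H e e0|H].
    have [n0 _ Hn] := H (fun n => Xnorm_ge0 s _) e e0; exists n0 => n /Hn.
    by rewrite D lee_fin.
  apply/ecvg0P => [n|e /H[n0 Hn]]; first exact: Xnorm_ge0.
  by exists n0 => // n /= /Hn h; rewrite D lee_fin.
have [f1 f2] : [set l | Xs s l /\ Xnorm s (w n - l) @[n --> \oo] --> 0%E] (opS s t f).
  apply: xgetPex; exists (rep (flow (X := X) t (c f))).
  have fr : fin N (rep (flow (X := X) t (c f))) by exact: fin_rep.
  by split; [exact: fr|apply/(Lim _ fr); rewrite repK].
split; first exact: f1.
exact: slim_unique ((Lim _ (f1 : fin N _)).1 f2) sl.
Qed.

Lemma Xintegral_cls t F (W : R -> eQ X) : 0 <= t -> (forall r, 0 <= r <= t -> fin N (F r)) ->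
  cont t (fun r => c (F r) : eQ X) -> antider t (fun r => c (F r) : eQ X) W -> W 0 = 0 ->
  fin N (Xintegral s 0 t F) /\ c (Xintegral s 0 t F) = W t.
Proof.
move=> t0 fF cF FW W0.
have sums n (p cc : nat -> R) (e d : R) w : fin N w ->
    (forall a x b : R, 0 <= a -> a <= x -> x <= b -> b <= t -> b - a < d ->
      `|W b - W a - (b - a) *: c (F x)| <= (b - a) * e) ->
    p 0%N = 0 -> p n = t -> (forall i, (i < n)%N -> p i <= cc i <= p i.+1 /\ p i.+1 - p i < d) ->
    exists z : eQ X, `|W t - z| <= t * e /\ Xnorm s (\sum_(i < n) (p i.+1 - p i) *: F (cc i) - w) = (`|z - c w|)%:E.
  move=> fw Hd p0 pn pc.
  have mono i j : (i <= j)%N -> (j <= n)%N -> p i <= p j.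
    elim: j => [|j IH]; first by rewrite leqn0 => /eqP ->.
    rewrite leq_eqVlt => /orP[/eqP -> //|ij] jn; apply: le_trans (IH ij (ltnW jn)) _.
    by have [/andP[h1 h2] _] := pc j jn; exact: le_trans h1 h2.
  have pge i : (i <= n)%N -> 0 <= p i by move=> i_n; rewrite -p0; exact: mono.
  have ple i : (i <= n)%N -> p i <= t by move=> i_n; rewrite -pn; exact: mono.
  have cin i : (i < n)%N -> 0 <= cc i <= t.
    move=> i_n; have [/andP[h1 h2] _] := pc i i_n.
    by rewrite (le_trans (pge i (ltnW i_n)) h1) (le_trans h2 (ple _ i_n)).
  have fi (i : 'I_n) : fin N ((p i.+1 - p i) *: F (cc i)) by apply: finZ; apply: fF; exact: cin.
  have [E fs] := @cls_sum R V N 'I_n (index_enum 'I_n) xpredT (fun i : 'I_n => (p i.+1 - p i) *: F (cc i)) fi.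
  have E' : c (\sum_(i < n) (p i.+1 - p i) *: F (cc i)) = \sum_(i < n) (p i.+1 - p i) *: (c (F (cc i)) : eQ X).
    rewrite [LHS]E; apply: eq_bigr => i _; exact: (clsZ _ (fF _ (cin i (ltn_ord i)))).
  exists (c (\sum_(i < n) (p i.+1 - p i) *: F (cc i))); split; last exact: (Xdist fs fw).
  rewrite E'.
  have K m : (m <= n)%N -> `|W (p m) - \sum_(i < m) (p i.+1 - p i) *: (c (F (cc i)) : eQ X)| <= p m * e.
    elim: m => [|m IH] mn; first by rewrite big_ord0 p0 W0 subrr normr0 mul0r.
    have [/andP[h1 h2] h3] := pc m mn.
    have h4 := Hd (p m) (cc m) (p m.+1) (pge m (ltnW mn)) h1 h2 (ple _ mn) h3.
    rewrite big_ord_recr /=.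
    have -> : W (p m.+1) - (\sum_(i < m) (p i.+1 - p i) *: (c (F (cc i)) : eQ X) + (p m.+1 - p m) *: c (F (cc m))) =
      (W (p m) - \sum_(i < m) (p i.+1 - p i) *: (c (F (cc i)) : eQ X)) + (W (p m.+1) - W (p m) - (p m.+1 - p m) *: c (F (cc m))).
      by lmod_eq R.
    apply: le_trans (ler_normD _ _) _; have := IH (ltnW mn).
    have -> : p m.+1 * e = p m * e + (p m.+1 - p m) * e by ring.
    by move=> h5; exact: lerD h5 h4.
  by have := K n (leqnn n); rewrite pn.
have any (e : R) : 0 < e -> 0 < e / (2 * (t + 1)) by move=> e0; rewrite divr_gt0 // mulr_gt0 // ltr_wpDl.
have te (e : R) : 0 < e -> t * (e / (2 * (t + 1))) < e.
  move=> e0; have -> : t * (e / (2 * (t + 1))) = e * (t / (2 * (t + 1))) by field; lra.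
  by rewrite gtr_pMr // ltr_pdivrMr ?mul1r; lra.
have ex : is_Xintegral s 0 t F (rep (W t)).
  split; first exact: (fin_rep (W t)).
  move=> e e0; have [d d0 Hd] := antider_any cF FW (any e e0); exists d => // n p cc p0 pn pc.
  have [z [z1 ->]] := sums n p cc _ d (rep (W t)) (fin_rep (W t)) Hd p0 pn pc.
  by rewrite repK lte_fin distrC; exact: le_lt_trans z1 (te e e0).
have [fi ii] : is_Xintegral s 0 t F (Xintegral s 0 t F) := xgetPex 0 (ex_intro _ _ ex).
split; first exact: fi.
apply/eqP; rewrite -subr_eq0 -normr_le0; apply/ler_addgt0Pr => e e0; rewrite add0r.
have e2 : 0 < e / 2 by rewrite divr_gt0.
have [d d0 Hd] := antider_any cF FW (any _ e2); have [d' d0' Hd'] := ii _ e2.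
have dd : 0 < Num.min d d' by rewrite lt_min d0.
have [n0 Hn] := mesh_small t dd; have mh := Hn n0 (leqnn _).
pose p (i : nat) : R := i%:R * mesh t n0.
have m0 : 0 <= mesh t n0 by rewrite /mesh divr_ge0.
have p0 : p 0%N = 0 by rewrite /p mul0r.
have pn : p n0.+1 = t by rewrite /p mesh_total.
have pS i : p i.+1 - p i = mesh t n0 by rewrite /p -addn1 natrD; ring.
have pc b : mesh t n0 < b -> forall i, (i < n0.+1)%N -> p i <= p i <= p i.+1 /\ p i.+1 - p i < b.
  by move=> mb i _; rewrite lexx -subr_ge0 pS.
move: mh; rewrite lt_min => /andP[md md'].
have [z [z1 zE]] := sums n0.+1 p p _ d _ fi Hd p0 pn (pc _ md).
have := Hd' n0.+1 p p p0 pn (pc _ md'); rewrite zE lte_fin => z2.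
have b1 : `|W t - z| <= e / 2 := le_trans z1 (ltW (te _ e2)).
have b2 : `|z - c (Xintegral s 0 t F)| <= e / 2 := ltW z2.
have b3 := dist_via (W t) (c (Xintegral s 0 t F) : eQ X) z.
apply: le_trans b3 (le_trans (lerD b1 b2) _).
by rewrite -splitr.
Qed.

Lemma opN2_cls T u v t : (forall r, 0 <= r <= T -> fin N (u r)) -> (forall r, 0 <= r <= T -> fin N (v r)) ->
  cont T (fun r => c (u r) : eQ X) -> cont T (fun r => c (v r) : eQ X) -> 0 <= t <= T ->
  fin N (opN2 s u v t) /\ c (opN2 s u v t) = Nn (X := X) (fun r => c (u r)) (fun r => c (v r)) t.
Proof.
move=> fu fv cu cv tT; have /andP[t0 tT'] := tT; have T0 := le_trans t0 tT'.
pose f r : eQ X := eB (c (u r) : eQ X) (c (v r) : eQ X).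
have cf : cont T f by exact: cont_B.
have [W [dW W0 Wt]] := Duh_int cf tT.
have fB r : 0 <= r <= T -> fin N (Bq (u r) (v r)).
  move=> rT; have s4 : s <= s + 4^-1 by rewrite lerDl.
  by apply: le_lt_trans (Bq_fin hs s4 (fu r rT) (fv r rT)) _; rewrite ltry.
have fE r : 0 <= r <= T -> c (Bq (u r) (v r)) = -2 *: f r.
  move=> rT; have s4 : s <= s + 4^-1 by rewrite lerDl.
  have -> : f r = c (Bh (u r) (v r)) := qBt_cls hs s4 (fu r rT) (fv r rT).
  rewrite /Bh (clsZ _ (fB r rT)) scalerA; have -> : -2 * - 2^-1 = 1 :> R by field.
  by rewrite scale1r.
pose F r := opS s (t - r) (Bq (u r) (v r)).
have rT r : 0 <= r <= t -> 0 <= r <= T by move=> /andP[r0 rt]; rewrite r0 (le_trans rt).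
have FE r : 0 <= r <= t -> fin N (F r) /\ c (F r) = -2 *: flow (X := X) (t - r) (f r).
  move=> rt; have [h1 h2] := opS_cls (t - r) (fB r (rT r rt)).
  split; first exact: h1.
  by rewrite h2 (fE r (rT r rt)); exact: (linZ (flow_lin (X := X) (t - r))).
have cS : cont t (fun r => flow (X := X) (t - r) (f r)).
  apply: (cont_S (@eQc R X) (@eAl R X) (@eAle R X) (p := fun r => t - r) t0); last exact: cont_sub tT' cf.
    by exists t => r /andP[r0 rt]; rewrite ger0_norm; lra.
  by move=> a b; exact: dist_shift.
have cF : cont t (fun r => c (F r) : eQ X).
  by apply: eq_cont (contZ (-2) cS) => r rt; rewrite (FE r rt).2.
have l2 (a : R) (x y : eQ X) : -2 *: (a *: x + y) = a *: (-2 *: x) + -2 *: y by lmod_eq R.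
have b2 (x : eQ X) : `|-2 *: x| <= 2 * `|x| by rewrite normrZ normrN ger0_norm.
have dF : antider t (fun r => c (F r) : eQ X) (fun r => -2 *: W r).
  have H : antider t (fun r => -2 *: flow (X := X) (t - r) (f r)) (fun r => -2 *: W r) := antider_linear l2 b2 (ltr0n _ 2) dW.
  by apply: eq_antider H => // r rt; rewrite (FE r rt).2.
have z0 : -2 *: W 0 = 0 by rewrite W0 scaler0.
have [i1 i2] := Xintegral_cls t0 (fun r rt => (FE r rt).1) cF dF z0.
split; first exact: (finZ (- 2^-1) i1).
have -> : c (opN2 s u v t) = - 2^-1 *: c (Xintegral s 0 t F) := clsZ (- 2^-1) i1.
rewrite i2 Wt scalerA; have -> : - 2^-1 * -2 = 1 :> R by field.
by rewrite scale1r.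
Qed.

Lemma mild_solution_cls T f u : 0 <= T -> fin N f -> mild_solution s T f u <->
  (forall t, 0 <= t <= T -> fin N (u t)) /\ mild (X := X) T (c f) (fun t => c (u t)).
Proof.
move=> T0 ff; rewrite /mild_solution XsT_cont; split=> [[[fu cu] eu]|[fu [cu eu]]].
  split=> //; split=> // t tT.
  have [n1 n2] := opN2_cls fu fu cu cu tT; have [s1 s2] := opS_cls t ff.
  rewrite -n2 -s2 -(clsD s1 n1); apply/(Xeq_cls (fu t tT) (finD s1 n1)).
  by apply: eu; rewrite mem_It.
split=> // t; rewrite mem_It => tT.
have [n1 n2] := opN2_cls fu fu cu cu tT; have [s1 s2] := opS_cls t ff.
apply/(Xeq_cls (fu t tT) (finD s1 n1)); rewrite (clsD s1 n1) n2 s2; exact: eu.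
Qed.

Lemma rhs_cls f : fin N f -> fin N (opA f + - 2^-1 *: Bq f f) /\
  c (opA f + - 2^-1 *: Bq f f) = eA (c f : eQ X) + eB (c f : eQ X) (c f).
Proof.
move=> ff; have s4 : s <= s + 4^-1 by rewrite lerDl.
have fB : fin N (Bq f f) by apply: le_lt_trans (Bq_fin hs s4 ff ff) _; rewrite ltry.
have fZ := finZ (- 2^-1) fB; have fA := opA_fin ff.
split; first exact: (finD fA fZ).
have e1 : eA (c f : eQ X) = c (opA f) := qA_cls ff.
have e2 : eB (c f : eQ X) (c f) = c (Bh f f) := qBt_cls hs s4 ff ff.
by rewrite (clsD fA fZ) e1 e2.
Qed.

Lemma boussinesq_cls T f u : 0 <= T -> fin N f -> boussinesq_solution s T f u <->
  (forall t, 0 <= t <= T -> fin N (u t)) /\ mild (X := X) T (c f) (fun t => c (u t)).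
Proof.
move=> T0 ff; have z0 : 0 <= (0 : R) <= T by rewrite lexx T0.
split=> [[/XsT_cont[fu cu] u0 [ut [/XsT_cont[ft ct] dt et]]]|[fu mu]].
  split; first exact: fu.
  have c0 : c (u 0) = c f by exact/(Xeq_cls (fu 0 z0) ff).
  apply/(mild_ode _ _ T0); split; [exact: cu|exact: c0|].
  have E t : 0 <= t <= T -> c (ut t) = eA (c (u t) : eQ X) + eB (c (u t) : eQ X) (c (u t)).
    move=> tT; have [r1 r2] := rhs_cls (fu t tT); rewrite -r2; apply/(cls_eq (ft t tT) r1).
    apply/(equations_inv_dx hs (fu t tT) (ft t tT)) => phi tp; apply: et tp.
    by rewrite mem_It.
  have cG : cont T (fun t => c (ut t) : eQ X) by exact: ct.
  suff : antider T (fun t => c (ut t) : eQ X) (fun t => c (u t)) by apply: eq_antider.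
  apply: (pointwise_antider (@eQc R X) T0 cG) => t tT e e0.
  have /ecvg0P := dt t (etrans (mem_It T t) tT) => /(_ (fun t' => Xnorm_ge0 s _) e e0).
  move=> /near_within_ball[d d0 Hd]; exists d; first exact: d0.
  move=> t' tT' h.
  apply: quot_to_diff => [tt|->]; last exact: erefl.
  have mt : (`[0, T] `\ t)%classic t' by split; [rewrite /= in_itv /= tT'|move=> /= E'; rewrite E' eqxx in tt].
  have := Hd t' mt h.
  have fd := finB (fu _ tT') (fu _ tT); have fz := finZ (t' - t)^-1 fd.
  rewrite (Xdist fz (ft t tT)) (clsZ _ fd) (clsB (fu _ tT') (fu _ tT)) lee_fin; exact: id.
move: mu => /(mild_ode _ _ T0)[cu u0 du].
pose ut t := opA (u t) + - 2^-1 *: Bq (u t) (u t).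
have ft t : 0 <= t <= T -> fin N (ut t) by move=> tT; exact: (rhs_cls (fu t tT)).1.
have E t : 0 <= t <= T -> eA (c (u t) : eQ X) + eB (c (u t) : eQ X) (c (u t)) = c (ut t).
  by move=> tT; rewrite -(rhs_cls (fu t tT)).2.
have cA : cont T (fun t => eA (c (u t) : eQ X)).
  exact: (cont_lin (@eAl R X) (@eAle R X) cu).
have cG : cont T (fun t => c (ut t) : eQ X) by exact: (eq_cont E (contD cA (cont_B T0 cu cu))).
have dG : antider T (fun t => c (ut t) : eQ X) (fun t => c (u t)) by exact: (eq_antider E (fun t _ => erefl) du).
split; first by apply/XsT_cont; split; [exact: fu|exact: cu].
  by apply/(Xeq_cls (fu 0 z0) ff); exact: u0.
exists ut; split; first by apply/XsT_cont; split; [exact: ft|exact: cG].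
  move=> t; rewrite mem_It => tT; apply/ecvg0P => [t'|e e0]; first exact: Xnorm_ge0.
  have [d d0 Hd] := antider_any cG dG e0.
  apply/near_within_ball; exists d; first exact: d0.
  move=> t' [/= tT' tt] h; rewrite in_itv /= in tT'.
  have tn : t' != t by apply/eqP.
  have fd := finB (fu _ tT') (fu _ tT); have fz := finZ (t' - t)^-1 fd.
  rewrite (Xdist fz (ft t tT)) (clsZ _ fd) (clsB (fu _ tT') (fu _ tT)) lee_fin.
  apply: (diff_to_quot tn); have /andP[t0 t1] := tT; have /andP[t0' t1'] := tT'.
  case: (leP t t') => [le|/ltW le].
    have n1 : `|t' - t| = t' - t := norm_fwd le.
    rewrite n1 in h; rewrite n1 (mulrC e); exact: (Hd t t t' t0 (lexx t) le t1' h).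
  have n1 : `|t' - t| = t - t' := norm_bwd le.
  rewrite n1 in h; rewrite n1 (mulrC e) diff_sym; exact: (Hd t' t t t0' le (lexx t) t1 h).
move=> t phi; rewrite mem_It => tT tp; move: phi tp.
apply/(equations_inv_dx hs (fu t tT) (ft t tT)).
exact: Xnorm_eq0.
Qed.

End bridge.

(** * Existence, blow-up, persistence and analyticity *)

Section boussinesq.
Context {R : realType}.
Notation V := (Xfun R).

Lemma geometric_const (p y : R) n : 0 <= p -> 0 <= y -> 4 * y * (p * y) ^+ n <= (4 + p) ^+ n.+1 * y ^+ n.+1.
Proof.
move=> p0 y0; have -> : 4 * y * (p * y) ^+ n = 4 * p ^+ n * y ^+ n.+1 by rewrite exprMn exprS; ring.
apply: ler_wpM2r; first exact: exprn_ge0.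
rewrite exprS; apply: ler_pM; rewrite ?exprn_ge0 ?lerDl //.
by apply: lerXn2r; rewrite ?nnegrE ?addr_ge0 // lerDr.
Qed.

Lemma expansion_term_le (rho r0 : R) m : 0 < rho -> 0 < r0 -> r0 <= rho / 2 ->
  8 * rho^-1 ^+ m * r0 ^+ m.+1 <= 8 * rho * 2^-1 ^+ m.+1.
Proof.
move=> rho0 r00 rr; have -> : 8 * rho^-1 ^+ m * r0 ^+ m.+1 = 8 * rho * (r0 / rho) ^+ m.+1.
  have -> : 8 * rho * (r0 / rho) ^+ m.+1 = (rho / rho) * (8 * rho^-1 ^+ m * r0 ^+ m.+1).
    by rewrite exprMn (exprS rho^-1); move: (rho^-1) => q; ring.
  by rewrite divff ?mul1r // lt0r_neq0.
have r8 : 0 <= 8 * rho by rewrite mulr_ge0 // ltW.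
apply: (ler_wpM2l r8); apply: lerXn2r; rewrite ?nnegrE ?divr_ge0 ?(ltW r00) ?(ltW rho0) //.
by rewrite ler_pdivrMr // mulrC.
Qed.

Lemma sum_split_first (Q : nmodType) (F G : nat -> Q) (x : Q) n : F 0%N = x ->
  (forall i, F i.+1 = G i) -> \sum_(i < n.+1) F i = x + \sum_(i < n) G i.
Proof. by move=> F0 FS; rewrite big_ord_recl -F0; congr (_ + _); apply: eq_bigr => i _; exact: FS. Qed.

Lemma steps_le (h : R) (i n : nat) : 0 <= h -> (i <= n)%N -> i%:R * h <= n%:R * h.
Proof. by move=> h0 i_n; rewrite ler_wpM2r // ler_nat. Qed.

Lemma half_room (x z rho : R) : x < rho -> z < (rho - x) / 2 -> x + z < rho.
Proof. by move=> *; lra. Qed.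

Lemma tail_const_ge0 (x q : R) : 0 <= x -> q < 1 -> 0 <= 8 * x / (1 - q).
Proof. by move=> x0 q1; rewrite divr_ge0 ?mulr_ge0 // subr_ge0 ltW. Qed.

Lemma max_time_mono (s s' : R) (f : V) :
  (forall T : R, 0 < T -> (exists u, mild_solution s T f u) -> exists u, mild_solution s' T f u) ->
  (max_time s f <= max_time s' f)%E.
Proof.
move=> H; apply: ge_ereal_sup => _ [T [T0 h] <-]; apply: ereal_sup_ubound.
by exists T; [split; [exact: T0|exact: H T0 h]|exact: erefl].
Qed.

Section fixed_s.
Variables (s : R) (hs : 0 <= s).
Notation N := (Xesn s).
Notation X := (Xevo hs).
Notation c := (cls N).
Notation beta := (ebeta X).
Let b0 : 0 < beta := ebeta_gt0 X.

Lemma mild_lift T f (W : R -> eQ X) : 0 <= T -> fin N f -> mild (X := X) T (c f) W ->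
  mild_solution s T f (fun t => rep (W t)).
Proof.
move=> T0 ff mW; apply/(mild_solution_cls hs _ T0 ff); split=> [t _|]; first exact: fin_rep.
by have -> : (fun t => c (rep (W t))) = W by apply/funext => t; exact: repK.
Qed.

Lemma mild_unique_on T f u : 0 <= T -> fin N f -> mild_solution s T f u ->
  unique_on T (mild_solution s T f) u /\ unique_on T (boussinesq_solution s T f) u.
Proof.
move=> T0 ff mu; have [fu m] := (mild_solution_cls hs u T0 ff).1 mu.
have K w : (forall t, 0 <= t <= T -> fin N (w t)) /\ mild (X := X) T (c f) (fun t => c (w t)) ->
    forall t, t \in `[0, T] -> Xeq (w t) (u t).
  move=> [fw mw] t; rewrite mem_It => tT; apply/(Xeq_cls (fw t tT) (fu t tT)).
  exact: (mild_unique T0 mw m tT).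
split; split.
- exact: mu.
- by move=> w /(mild_solution_cls hs w T0 ff)/K.
- by apply/(boussinesq_cls hs u T0 ff).
- by move=> w /(boussinesq_cls hs w T0 ff)/K.
Qed.

Lemma XsT_norm_le T u (M : R) : (forall t, 0 <= t <= T -> fin N (u t) /\ `|c (u t)| <= M) ->
  (XsT_norm s T u <= M%:E)%E.
Proof.
move=> H; apply: ge_ereal_sup => _ [t tT <-]; rewrite /= in_itv /= in tT.
by have [ft le] := H t tT; rewrite (norm_cls ft : Xnorm s (u t) = _) lee_fin.
Qed.

(** ** The series *)

Lemma series_functions : exists a : nat -> V -> R -> V, (forall f t, a 0%N f t = opS s t f) /\
  forall n f t, a n.+1 f t = \sum_(i < n.+1) opN2 s (a i f) (a (n - i)%N f) t.
Proof.
have [|a [a0 aS]] := @strong_rec (V -> R -> V) (fun f t => opS s t f)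
  (fun n a f t => \sum_(i < n.+1) opN2 s (a i f) (a (n - i)%N f) t).
  move=> n f f' H; apply/funext => g; apply/funext => t; apply: eq_bigr => i _.
  by rewrite !H // ?leq_subr // -ltnS.
by exists a; split=> [f t|n f t]; rewrite ?a0 ?aS.
Qed.

Variable a : nat -> V -> R -> V.
Hypotheses (a0 : forall f t, a 0%N f t = opS s t f)
  (aS : forall n f t, a n.+1 f t = \sum_(i < n.+1) opN2 s (a i f) (a (n - i)%N f) t).

Lemma series_termsP : series_terms s (fun n => a n.-1).
Proof.
split=> [f t|[//|[//|n]] f t _]; first exact: a0.
rewrite aS big_add1 /= big_mkord; apply: eq_bigr => i _.
have -> : (n.+2 - i.+1).-1 = (n - i)%N by rewrite subSS (subSn (ltn_ord i : (i <= n)%N)).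
exact: erefl.
Qed.

Lemma a_cls T f n : 0 <= T -> fin N f -> [/\ forall t, 0 <= t <= T -> fin N (a n f t),
  cont T (fun t => c (a n f t) : eQ X) &
  forall t, 0 <= t <= T -> if n is m.+1 then
    c (a n f t) = \sum_(i < m.+1) Nn (X := X) (fun r => c (a i f r)) (fun r => c (a (m - i)%N f r)) t
    else c (a n f t) = flow (X := X) t (c f)].
Proof.
move=> T0 ff; have [k] := ubnP n; elim: k n => // k IH [|m]; rewrite ltnS => mk.
  have S t : fin N (a 0%N f t) /\ c (a 0%N f t) = flow (X := X) t (c f) by rewrite a0; exact: opS_cls.
  split=> [t _||t _]; [exact: (S t).1| |exact: (S t).2].
  by apply: (eq_cont (F := fun t => flow (X := X) t (c f))) (cont_flow (X := X) _ T0) => t _; rewrite (S t).2.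
have P i : (i <= m)%N -> (forall t, 0 <= t <= T -> fin N (a i f t)) /\ cont T (fun t => c (a i f t) : eQ X).
  by move=> im; have [h1 h2 _] := IH i (leq_ltn_trans im mk).
have Pi (i : 'I_m.+1) := P i (ltn_ord i : (i <= m)%N).
have Pj (i : 'I_m.+1) := P (m - i)%N (leq_subr i m).
have E t : 0 <= t <= T -> fin N (a m.+1 f t) /\ c (a m.+1 f t) =
    \sum_(i < m.+1) Nn (X := X) (fun r => c (a i f r)) (fun r => c (a (m - i)%N f r)) t.
  move=> tT; rewrite aS.
  have O i := opN2_cls (Pi i).1 (Pj i).1 (Pi i).2 (Pj i).2 tT.
  have [E fs] := @cls_sum R V N 'I_m.+1 (index_enum 'I_m.+1) xpredT (fun i : 'I_m.+1 => opN2 s (a i f) (a (m - i)%N f) t) (fun i => (O i).1).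
  split; first exact: fs.
  by rewrite [LHS]E; apply: eq_bigr => i _; rewrite (O i).2.
split=> [t tT||t tT]; [exact: (E t tT).1| |exact: (E t tT).2].
apply: (eq_cont (F := fun t => \sum_(i < m.+1) Nn (X := X) (fun r => c (a i f r)) (fun r => c (a (m - i)%N f r)) t)).
  by move=> t tT; rewrite (E t tT).2.
apply: (@cont_sum _ _ T m.+1 (fun i => Nn (X := X) (fun r => c (a i f r)) (fun r => c (a (m - i)%N f r)))) => i im.
by apply: Nn_cont => //; [exact: (P i im).2|exact: (P _ (leq_subr i m)).2].
Qed.

Lemma a_series T f : 0 <= T -> fin N f ->
  [/\ forall n, cont T (fun t => c (a n f t) : eQ X),
    forall n, bounded_on T (fun t => c (a n f t) : eQ X) (4 * `|c f| * (16 * T * beta * `|c f|) ^+ n) &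
    16 * T * beta * `|c f| < 1 -> exists u, mild (X := X) T (c f) u /\
      forall n t, 0 <= t <= T -> `|\sum_(i < n) (c (a i f t) : eQ X) - u t| <=
        4 * `|c f| * (16 * T * beta * `|c f|) ^+ n / (1 - 16 * T * beta * `|c f|)].
Proof.
move=> T0 ff; apply: (@power_series R X T (c f) (fun n t => c (a n f t)) T0).
  by move=> t tT; have [_ _ /(_ t tT)] := a_cls 0 T0 ff.
by move=> n t tT; have [_ _ /(_ t tT)] := a_cls n.+1 T0 ff.
Qed.

(** The time is chosen so that the ratio [16 T beta |f|] of the dominating geometric
    series is less than 1. *)
Lemma local_well_posedness f : fin N f -> exists2 T : R, 0 < T & exists u : R -> V,
  [/\ unique_on T (mild_solution s T f) u, unique_on T (boussinesq_solution s T f) u,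
   (exists2 K : R, 0 < K & forall (n : nat) (g : V), (0 < n)%N -> Xs s g ->
      XsT s T (a n.-1 g) /\ (XsT_norm s T (a n.-1 g) <= (K ^+ n)%R%:E * Xnorm s g ^+ n)%E),
   (\sum_(1 <= n <oo) XsT_norm s T (a n.-1 f) < +oo)%E &
   XsT_norm s T (fun t => \sum_(1 <= n < M) a n.-1 f t - u t) @[M --> \oo] --> 0%E].
Proof.
move=> ff; pose x := `|c f|; have x0 : 0 <= x := normr_ge0 _.
have d0 : 0 < 16 * beta * x + 1 by rewrite ltr_wpDl // !mulr_ge0 // ltW.
pose T := (16 * beta * x + 1)^-1; have T0 : 0 < T by rewrite invr_gt0.
have T0' := ltW T0.
pose q := 16 * T * beta * x; have q0 : 0 <= q by rewrite !mulr_ge0 // ltW.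
have q1 : q < 1.
  have -> : q = 16 * beta * x / (16 * beta * x + 1) by rewrite /q /T; ring.
  by rewrite ltr_pdivrMr // mul1r ltrDl.
have [cc bb /(_ q1)[W [mW HW]]] := a_series T0' ff.
have mu := mild_lift T0' ff mW.
have [U1 U2] := mild_unique_on T0' ff mu.
exists T => //; exists (fun t => rep (W t)); split=> //.
- exists (4 + 16 * T * beta); first by rewrite ltr_wpDr // !mulr_ge0 // ltW.
  move=> [//|n] g _ gs; have gf : fin N g := gs; have [cg bg _] := a_series T0' gf.
  have fg := fun t (tT : 0 <= t <= T) => let: And3 h _ _ := a_cls n T0' gf in h t tT.
  split; first by apply/XsT_cont; split; [exact: fg|exact: cg].
  rewrite (norm_cls gf : Xnorm s g = _) -EFin_expe -EFinM; apply: XsT_norm_le => t tT.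
  split; first exact: fg.
  have p0 : 0 <= 16 * T * beta by rewrite !mulr_ge0 // ltW.
  exact: le_trans (bg n t tT) (geometric_const n p0 (normr_ge0 _)).
- have T_ge0 n : (0 <= XsT_norm s T (a n.-1 f))%E.
    apply: le_trans (Xnorm_ge0 s (a n.-1 f 0)) _; apply: ereal_sup_ubound; exists 0 => //=.
    by rewrite in_itv /= lexx.
  have Tb n : (XsT_norm s T (a n f) <= (4 * x * q ^+ n)%:E)%E.
    by apply: XsT_norm_le => t tT; split; [have [h _ _] := a_cls n T0' ff; exact: h|exact: bb].
  have cv : cvgn (fun n => \sum_(1 <= i < n) XsT_norm s T (a i.-1 f))%E.
    by apply: is_cvg_nneseries => n _ _; exact: T_ge0.
  apply: (@le_lt_trans _ _ ((4 * x / (1 - q))%:E)); last by rewrite ltry.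
  apply: lime_le cv _; apply: nearW => n.
  apply: (@le_trans _ _ (\sum_(1 <= i < n) (4 * x * q ^+ i.-1)%:E)%E); first by apply: lee_sum => i _; exact: Tb.
  rewrite sumEFin lee_fin big_add1 /=.
  have e1 : series (geometric (4 * x) q) n.-1 = \sum_(0 <= i < n.-1) 4 * x * q ^+ i by [].
  rewrite -e1; have g1 := geom_tail (4 * x) n.-1 q0 q1; have g0 := geom_tail (4 * x) 0 q0 q1.
  rewrite expr0 mulr1 in g0; have z : series (geometric (4 * x) q) 0 = 0 by rewrite /series /= big_nil.
  rewrite z subr0 in g0; rewrite -g0 -subr_ge0 g1.
  by rewrite divr_ge0 ?mulr_ge0 ?exprn_ge0 // subr_ge0 ltW.
- apply/ecvg0P => [M|e e0].
    apply: le_trans (Xnorm_ge0 s ((fun t => \sum_(1 <= n < M) a n.-1 f t - rep (W t)) 0)) _.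
    by apply: ereal_sup_ubound; exists 0 => //=; rewrite in_itv /= lexx.
  have C0 : 0 <= 4 * x / (1 - q) by rewrite divr_ge0 ?mulr_ge0 // subr_ge0 ltW.
  have [n0 Hn] := small_power C0 q0 q1 e0.
  exists n0.+1 => // -[//|M] /= Mn; apply: XsT_norm_le => t tT.
  have fa (i : 'I_M) : fin N (a i f t) by have [h _ _] := a_cls i T0' ff; exact: h.
  have [E fs] := @cls_sum R V N 'I_M (index_enum 'I_M) xpredT (fun i : 'I_M => a i f t) fa.
  rewrite big_add1 /= big_mkord; split; first exact: (finB fs (fin_rep (W t))).
  rewrite (clsB fs (fin_rep (W t))) E repK; apply: le_trans (HW M t tT) _.
  by apply: le_trans (Hn M Mn); rewrite mulrAC.
Qed.

(** ** Existence times *)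

Lemma max_time_ge T f u : 0 < T -> mild_solution s T f u -> (T%:E <= max_time s f)%E.
Proof. by move=> T0 mu; apply: ereal_sup_ubound; exists T => //; split=> //; exists u. Qed.

Lemma lifespan_local f T : fin N f -> 0 < T -> 16 * T * beta * `|c f| < 1 -> (T%:E <= max_time s f)%E.
Proof.
move=> ff T0 q1; have [W mW] := local_mild (ltW T0) q1.
exact: max_time_ge T0 (mild_lift (ltW T0) ff mW).
Qed.

Lemma ge_from_below (b m : \bar R) : (0 < b)%E ->
  (forall T : R, 0 < T -> (T%:E < b)%E -> (T%:E <= m)%E) -> (b <= m)%E.
Proof.
move=> b_gt0 H; rewrite leNgt; apply/negP => mb.
case: b b_gt0 mb H => [b b_gt0|_|//]; case: m => [m|//|] mb H.
- rewrite lte_fin in b_gt0; rewrite lte_fin in mb.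
  pose T := (Num.max 0 m + b) / 2.
  have M1 : Num.max 0 m < b by rewrite gt_max b_gt0.
  have M0 : 0 <= Num.max 0 m by rewrite le_max lexx.
  have M2 : m <= Num.max 0 m by rewrite le_max lexx orbT.
  have t1 : 0 < T by rewrite /T; lra.
  have t2 : T < b by rewrite /T; lra.
  by have := H T t1; rewrite lte_fin => /(_ t2); rewrite lee_fin /T; lra.
- have t1 : 0 < b / 2 by rewrite divr_gt0.
  have t2 : b / 2 < b by rewrite lte_fin in b_gt0; lra.
  by have := H _ t1; rewrite lte_fin => /(_ t2).
- have t1 : 0 < Num.max 0 m + 1 by rewrite ltr_wpDl // le_max lexx.
  have := H _ t1 (ltry _); rewrite lee_fin.
  have M2 : m <= Num.max 0 m by rewrite le_max lexx orbT.
  lra.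
- by have := H 1 ltr01 (ltry _).
Qed.

Lemma max_time_lower_bound f : fin N f -> (((4 * (4 * beta))%R%:E * Xnorm s f)^-1 <= max_time s f)%E.
Proof.
move=> ff; rewrite (norm_cls ff : Xnorm s f = _) -EFinM.
set x := `|c f|; have x0 : 0 <= x := normr_ge0 _.
have B0 : 0 < 4 * (4 * beta) by rewrite !mulr_gt0.
have [xz|xn] := eqVneq x 0.
  rewrite xz mulr0 inve0; apply: ge_from_below => // T T0 _; apply: lifespan_local => //.
  by rewrite -/x xz mulr0.
have xp : 0 < x by rewrite lt_def xn.
have p0 : 0 < 4 * (4 * beta) * x by rewrite mulr_gt0.
rewrite inver gt_eqF //; apply: ge_from_below; first by rewrite lte_fin invr_gt0.
move=> T T0; rewrite lte_fin => Tb; apply: lifespan_local => //; rewrite -/x.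
have := Tb; rewrite -(ltr_pM2r p0) mulVf ?gt_eqF //.
by have -> : T * (4 * (4 * beta) * x) = 16 * T * beta * x by ring.
Qed.

Lemma max_time_gt0 f : fin N f -> (0 < max_time s f)%E.
Proof.
move=> ff; have [T T0 [u [[mu _] _ _ _ _]]] := local_well_posedness ff.
by apply: lt_le_trans (max_time_ge T0 mu); rewrite lte_fin.
Qed.

Lemma mild_longer f T : fin N f -> 0 < T -> (T%:E < max_time s f)%E ->
  exists W, mild (X := X) T (c f) W.
Proof.
move=> ff T0 /ereal_sup_gt[_ [T' [T0' [u mu]] <-]]; rewrite lte_fin => TT.
have [_ m] := (mild_solution_cls hs u (ltW T0') ff).1 mu.
by exists (fun t => c (u t)); exact: mild_sub (ltW TT) m.
Qed.

(** By uniqueness, the solutions on the various intervals agree where both are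
    defined. *)
Lemma maximal_exists f : fin N f -> exists u, maximal_solution s f u.
Proof.
move=> ff.
have /choice[Y HY] (t : R) : exists y : eQ X, forall T W, 0 <= t <= T -> mild (X := X) T (c f) W -> W t = y.
  have [[T [W [tT mW]]]|nW] := pselect (exists T W, 0 <= t <= T /\ mild (X := X) T (c f) W); last first.
    by exists 0 => T W tT mW; case: nW; exists T; exists W.
  exists (W t) => T' W' tT' mW'; have /andP[t0 t1] := tT; have /andP[_ t2] := tT'.
  by apply: (mild_unique t0 (mild_sub t2 mW') (mild_sub t1 mW)); rewrite t0 lexx.
exists (fun t => rep (Y t)) => T T0 TT; have [W mW] := mild_longer ff T0 TT.
apply: (mild_lift (ltW T0) ff).
have E t : 0 <= t <= T -> W t = Y t by move=> tT; exact: HY tT mW.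
move: mW => /(mild_ode _ _ (ltW T0))[cW W0 dW]; apply/(mild_ode _ _ (ltW T0)); split.
- exact: eq_cont E cW.
- by rewrite -E ?W0 // lexx ltW.
- have EF t : 0 <= t <= T -> eA (W t) + eB (W t) (W t) = eA (Y t) + eB (Y t) (Y t) by move=> tT; rewrite (E t tT).
  exact: (eq_antider EF E dW).
Qed.

(** If the norm stayed bounded, the solution could be restarted close to the maximal
    time and would live longer. *)
Lemma blow_up f u (Ts : R) : fin N f -> maximal_solution s f u -> max_time s f = Ts%:E ->
  limf_esup (fun t => Xnorm s (u t)) (Ts^'-) = +oo%E.
Proof.
move=> ff mu mT; have Ts0 : 0 < Ts by rewrite -lte_fin -mT max_time_gt0.
apply/eqP; rewrite eq_le leey /= leNgt; apply/negP => /ereal_inf_lt[_ [A /= FA <-] supA].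
pose S := ereal_sup [set Xnorm s (u t) | t in A].
have [d d0 Hd] : exists2 d : R, 0 < d & forall t, Ts - d < t -> t < Ts -> A t.
  have /near_within_ball[d d0 Hd] : \forall x \near within (fun x => x < Ts) (nbhs Ts), A x by exact: FA.
  exists d => // t t1 t2; apply: Hd => //; rewrite ltr_norml; apply/andP; split; lra.
pose M := fine S + 1.
have ub t : Ts - d < t -> t < Ts -> (Xnorm s (u t) <= S)%E.
  by move=> t1 t2; apply: ereal_sup_ubound; exists t => //; exact: Hd.
have S0 : (0 <= S)%E.
  apply: le_trans (Xnorm_ge0 s (u (Ts - d / 2))) _; apply: ub; lra.
have SE : S = (fine S)%:E by rewrite fineK // ge0_fin_numE.
have fS : 0 <= fine S by exact: fine_ge0.
have M0 : 0 < M by rewrite /M; lra.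
pose tau := (16 * beta * M + 1)^-1.
have dd : 0 < 16 * beta * M + 1 by rewrite ltr_wpDl // !mulr_ge0 // ltW.
have tau0 : 0 < tau by rewrite invr_gt0.
pose t := Ts - Num.min (Num.min d tau) Ts / 2.
set m := Num.min _ _ in t.
have m0 : 0 < m by rewrite /m !lt_min d0 tau0 Ts0.
have m1 : m <= d by rewrite /m !ge_min lexx.
have m2 : m <= tau by rewrite /m !ge_min lexx orbT.
have m3 : m <= Ts by rewrite /m !ge_min lexx orbT.
have t0 : 0 < t by rewrite /t; lra.
have tT : t < Ts by rewrite /t; lra.
have td : Ts - d < t by rewrite /t; lra.
have tmax : (t%:E < max_time s f)%E by rewrite mT lte_fin.
have [fu mt] := (mild_solution_cls hs u (ltW t0) ff).1 (mu t t0 tmax).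
have tt : 0 <= t <= t by rewrite lexx ltW.
have le : `|c (u t)| <= M.
  have := ub t td tT; rewrite (norm_cls (fu t tt) : Xnorm s (u t) = _) SE lee_fin => /le_trans; apply.
  by rewrite /M lerDl.
have q1 : 16 * tau * beta * `|c (u t)| < 1.
  apply: (@le_lt_trans _ _ (16 * beta * M / (16 * beta * M + 1))); last by rewrite ltr_pdivrMr // mul1r ltrDl.
  have -> : 16 * beta * M / (16 * beta * M + 1) = 16 * tau * beta * M by rewrite /tau; ring.
  by rewrite ler_wpM2l // !mulr_ge0 // ltW.
have [v mv] := local_mild (ltW tau0) q1.
have [w mw] := mild_glue (ltW t0) (ltW tau0) mt mv.
have p0 : 0 < t + tau by rewrite addr_gt0.
have := max_time_ge p0 (mild_lift (ltW p0) ff mw); rewrite mT lee_fin /t; lra.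
Qed.

(** ** Analyticity *)

(** The open set is a ball containing the bounded set; [T] is inversely proportional
    to its radius. *)
Lemma solution_analytic (B : set V) : Xs_bounded s B -> exists2 T : R, 0 < T &
  exists (U : set V) (Phi : V -> R -> V), [/\ Xs_open s U, B `<=` U,
    forall f, U f -> unique_on T (mild_solution s T f) (Phi f) &
    forall g, U g -> analytic_at s T Phi g].
Proof.
move=> [r Br]; pose rho := `|r| + 1; have rho0 : 0 < rho by rewrite ltr_wpDl.
have rho0' := ltW rho0.
pose T := (64 * beta * rho)^-1; have p0 : 0 < 64 * beta * rho by rewrite !mulr_gt0.
have T0 : 0 < T by rewrite invr_gt0. have T0' := ltW T0.
have Tr : 64 * T * beta = rho^-1 by rewrite /T; field; rewrite ?(lt0r_neq0 rho0) ?(lt0r_neq0 b0).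
have small : 64 * T * beta * rho <= 1 by rewrite Tr mulVf // lt0r_neq0.
pose U : set V := [set f | (Xnorm s f < rho%:E)%E].
have Uf f : U f -> fin N f by move=> Uf; apply: lt_trans Uf _; rewrite ltry.
have Un f : U f -> `|c f| < rho by move=> Uf'; have := Uf'; rewrite /U /= (norm_cls (Uf f Uf') : Xnorm s f = _) lte_fin.
have /choice[W HW] (f : V) : exists W, U f -> mild (X := X) T (c f) W.
  have [Uf'|nU] := pselect (U f); last by exists (fun=> 0).
  have [|W mW] := @local_mild R X T (c f) T0'; last by exists W.
  have := Un f Uf'; have tb : 0 < 16 * T * beta by rewrite !mulr_gt0.
  rewrite -(ltr_pM2l tb) => h; apply: lt_le_trans h _.
  by move: small; rewrite -!mulrA; move: (T * (beta * rho)) => z; have := mulr_ge0 T0' (mulr_ge0 (ltW b0) rho0'); lra.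
pose Phi f t := rep (W f t).
have ms f : U f -> mild_solution s T f (Phi f) by move=> Uf'; exact: (mild_lift T0' (Uf f Uf') (HW f Uf')).
exists T => //; exists U; exists Phi; split.
- split=> [f|g Ug]; first exact: Uf.
  have ng := Un g Ug; exists (rho - `|c g|); first by rewrite subr_gt0.
  move=> h hh; have fh : fin N h by apply: lt_trans hh _; rewrite ltry.
  move: hh; rewrite (norm_cls fh : Xnorm s h = _) lte_fin => hh.
  rewrite /U /= (norm_cls (finD (Uf g Ug) fh) : Xnorm s (g + h) = _) lte_fin (clsD (Uf g Ug) fh).
  by apply: le_lt_trans (ler_normD _ _) _; rewrite addrC -ltrBrDr.
- move=> f /Br fr; apply: le_lt_trans fr _; rewrite lte_fin /rho.
  by have := ler_norm r; lra.
- by move=> f Uf'; exact: (mild_unique_on T0' (Uf f Uf') (ms f Uf')).1.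
move=> g Ug; have ng := Un g Ug; have mg := HW g Ug; have fg := Uf g Ug.
have [l [l0 lS]] := @expansion_exists R X T (W g).
pose ext k (h : 'I_k.+1 -> V) (i : nat) : eQ X := c (h (inord i)).
pose L k : ('I_k -> V) -> R -> V := match k with
  | 0%N => fun _ => Phi g | m.+1 => fun h t => rep (l m (ext m h) t) end.
pose Mk k : R := if k is m.+1 then 8 * (64 * T * beta) ^+ m else 8 * rho.
pose r0 := (rho - `|c g|) / 2.
have g0 : 0 <= `|c g| := normr_ge0 _.
have r00 : 0 < r0 by rewrite /r0; lra.
have rr : r0 <= rho / 2 by rewrite /r0; lra.
have rr1 : r0 <= rho by rewrite /r0; lra.
have Ti : 0 <= 64 * T * beta by rewrite !mulr_ge0 // ltW.
have Mk0 k : 0 <= Mk k by case: k => [|k] /=; rewrite mulr_ge0 // exprn_ge0.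
have lc m h := l_cont T0' rho0' small (ltW ng) mg l0 lS m h.
have lb m h := l_bound T0' rho0' small (ltW ng) mg l0 lS m h.
exists r0; exists Mk; exists L; split=> //.
- move=> [|m]; split=> //; split.
  + move=> h _; have mg' := ms g Ug; split; first exact: mg'.1.
    rewrite big_ord0 mulr1; apply: XsT_norm_le => t tT; split; first exact: fin_rep.
    by rewrite repK; exact: (mild_small T0' rho0' small (ltW ng) mg tT).
  + by move=> h [].
  + move=> h fh; split.
      apply/XsT_cont; split=> [t _|]; first exact: fin_rep.
      exact: (eq_cont (fun t _ => esym (repK _)) (lc m (ext m h))).
    apply: XsT_norm_le => t tT; split; first exact: fin_rep.
    rewrite repK; apply: le_trans (lb m (ext m h) t tT) _.
    rewrite le_eqVlt; apply/orP; left; apply/eqP; congr (_ * _); apply: eq_bigr => i _.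
    by rewrite /ext inord_val (norm_cls (fh i : fin N (h i)) : Xnorm s (h i) = _).
  + move=> h i d f k fh ff fk put t; rewrite mem_It => tT.
    have E z : l m (ext m (put z)) = l m (upd (ext m h) i (c z)).
      apply: (l_local l0 lS) => p pm; rewrite /ext /upd /put.
      have -> : (inord p == i) = (p == i :> nat) by rewrite -val_eqE /= inordK.
      by case: (p == i).
    have f1 z : fin N (L m.+1 (put z) t) by exact: fin_rep.
    have f2 := finZ d (f1 f); have f3 := finD f2 (f1 k).
    apply/(Xeq_cls (f1 (d *: f + k)) f3); rewrite (clsD f2 (f1 k)) (clsZ d (f1 f)) /= !repK !E.
    have gf : fin N f := ff; have gk : fin N k := fk.
    rewrite (clsD (finZ d gf) gk) (clsZ d gf).
    exact: (l_linear T0' rho0' small (ltW ng) mg l0 lS (ext m h) d (c f) (c k) (ltn_ord i : (i <= m)%N) tT).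
- have h2 : (0 : R) <= 2^-1 by lra.
  apply: (@series_le_cvg R _ (geometric (8 * rho) 2^-1)).
  + by move=> k; rewrite mulr_ge0 // exprn_ge0 // ltW.
  + by move=> k; rewrite /geometric /= mulr_ge0 ?mulr_ge0 ?exprn_ge0.
  + move=> [|m]; rewrite /geometric /=; first by rewrite !expr0.
    by rewrite Tr; exact: (expansion_term_le m rho0 r00 rr).
  + by apply: is_cvg_geometric_series; rewrite ger0_norm //; lra.
- move=> h hh; have fh : fin N h by apply: lt_trans hh _; rewrite ltry.
  move: hh; rewrite (norm_cls fh : Xnorm s h = _) lte_fin => hh.
  have fgh := finD fg fh.
  have Ugh : U (g + h).
    rewrite /U /= (norm_cls fgh : Xnorm s (g + h) = _) lte_fin (clsD fg fh).
    exact: le_lt_trans (ler_normD _ _) (half_room ng hh).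
  have mgh := HW _ Ugh; rewrite (clsD fg fh) in mgh.
  pose q := 64 * T * beta * `|c h|; have q0 : 0 <= q := mulr_ge0 Ti (normr_ge0 _).
  have q1 : q < 1.
    have -> : q = `|c h| / rho by rewrite /q Tr mulrC.
    rewrite (ltr_pdivrMr _ _ rho0) mul1r; exact: lt_le_trans hh rr1.
  apply/ecvg0P => [n|e e0].
    apply: le_trans (Xnorm_ge0 s ((fun t => \sum_(k < n) L k (fun=> h) t - Phi (g + h) t) 0)) _.
    by apply: ereal_sup_ubound; exists 0 => //=; rewrite in_itv /= lexx.
  have C0 := tail_const_ge0 (normr_ge0 (c h)) q1.
  have [n0 Hn] := small_power C0 q0 q1 e0; exists n0.+1 => // -[//|n] /= nn.
  apply: XsT_norm_le => t tT.
  have fa (i : 'I_n.+1) : fin N (L i (fun=> h) t) by case: i => -[|m] im; exact: fin_rep.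
  have [E fs] := @cls_sum R V N 'I_n.+1 (index_enum 'I_n.+1) xpredT (fun i : 'I_n.+1 => L i (fun=> h) t) fa.
  split; first exact: (finB fs (fin_rep (W (g + h) t))).
  have E1 : c (\sum_(i < n.+1) L i (fun=> h) t) = W g t + \sum_(i < n) l i (fun=> c h) t.
    have F0 : L 0%N (fun=> h) t = rep (W g t) := erefl.
    have FS (i : nat) : L i.+1 (fun=> h) t = rep (l i (fun=> c h) t) := erefl.
    have G0 : c (L 0%N (fun=> h) t) = W g t by rewrite F0; exact: (repK (W g t)).
    have GS (i : nat) : c (L i.+1 (fun=> h) t) = l i (fun=> c h) t by rewrite FS; exact: (repK (l i (fun=> c h) t)).
    exact (etrans E (sum_split_first (F := fun k => c (L k (fun=> h) t) : eQ X) n G0 GS)).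
  have -> : c (\sum_(i < n.+1) L i (fun=> h) t - Phi (g + h) t) = W g t + \sum_(i < n) l i (fun=> c h) t - W (g + h) t.
    have -> : c (\sum_(i < n.+1) L i (fun=> h) t - Phi (g + h) t) = c (\sum_(i < n.+1) L i (fun=> h) t) - c (rep (W (g + h) t)).
      exact: (clsB fs (fin_rep (W (g + h) t))).
    by rewrite E1 repK.
  apply: le_trans (expansion_sum T0' rho0' small (ltW ng) mg l0 lS n q1 mgh tT) _.
  rewrite mulrAC; exact: (Hn n nn).
Qed.

End fixed_s.

(** ** Independence of s *)

Section two_exponents.
Variables (r r' : R) (hr : 0 <= r) (hr' : 0 <= r') (rr : r <= r') (r4 : r' <= r + 4^-1).
Notation Q' := (eQ (Xevo hr')).
Notation Q := (eQ (Xevo hr)).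

Let I1 (c : R) f g : fin (Xesn r') f -> fin (Xesn r') g -> Xesn r (id (c *: f + g) - (c *: id f + id g)) = 0%E.
Proof. by move=> _ _; rewrite subrr esn0. Qed.
Let I2 f : fin (Xesn r') f -> (Xesn r (id f) <= (1 * fine (Xesn r' f))%:E)%E.
Proof.
move=> ff; have fn : Xesn r' f \is a fin_num by rewrite (ge0_fin_numE (esn_ge0 (Xesn r') f)).
by rewrite mul1r (fineK fn); exact: (Xs_mono f rr).
Qed.

Definition incl : Q' -> Q := qlift (Xesn r) id.

Lemma incl_cls f : fin (Xesn r') f -> incl (cls (Xesn r') f) = cls (Xesn r) f.
Proof. by move=> ff; exact: (qlift_cls I1 I2 ff). Qed.

Lemma fin_down f : fin (Xesn r') f -> fin (Xesn r) f.
Proof. by move=> ff; exact: (fin_F I2 ff). Qed.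

(** One inequality is the inclusion of the smaller space in the larger one; the other
    one is the persistence of regularity, as the bilinear form gains a quarter of a
    derivative. *)
Lemma max_time_step f : fin (Xesn r') f -> max_time r f = max_time r' f.
Proof.
move=> ff; have fd := fin_down ff.
have jl : lin incl := qlift_lin I1 I2.
have jle x : `|incl x| <= `|x| by rewrite -[leRHS]mul1r; exact: (qlift_le I1 I2 x).
have jinj : injective incl.
  elim/(@quoP R V (Xesn r')) => g fg; elim/(@quoP R V (Xesn r')) => h fh.
  rewrite (incl_cls fg) (incl_cls fh) => E; apply/(Xeq_cls fg fh).
  exact/(Xeq_cls (fin_down fg) (fin_down fh)).
have jA x : incl (eA x) = eA (incl x).
  elim/(@quoP R V (Xesn r')): x => g fg; rewrite (incl_cls fg).
  have e1 : eA (cls (Xesn r') g : Q') = cls (Xesn r') (opA g) := qA_cls fg.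
  have e2 : eA (cls (Xesn r) g : Q) = cls (Xesn r) (opA g) := qA_cls (fin_down fg).
  by rewrite e1 e2; exact: (incl_cls (opA_fin fg)).
have fB z (hz : z <= r' + 4^-1) g h : fin (Xesn r') g -> fin (Xesn r') h -> fin (Xesn z) (Bh g h).
  move=> fg fh; apply: finZ; apply: le_lt_trans (Bq_fin hr' hz fg fh) _; exact: ltry.
have r'4 : r' <= r' + 4^-1 by rewrite lerDl.
have r4' : r <= r + 4^-1 by rewrite lerDl.
have jB x y : incl (eB x y) = eB (incl x) (incl y).
  elim/(@quoP R V (Xesn r')): x => g fg; elim/(@quoP R V (Xesn r')): y => h fh.
  rewrite (incl_cls fg) (incl_cls fh).
  have e1 : eB (cls (Xesn r') g : Q') (cls (Xesn r') h) = cls (Xesn r') (Bh g h) := qBt_cls hr' r'4 fg fh.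
  have e2 : eB (cls (Xesn r) g : Q) (cls (Xesn r) h) = cls (Xesn r) (Bh g h) := qBt_cls hr r4' (fin_down fg) (fin_down fh).
  by rewrite e1 e2; exact: (incl_cls (fB _ r'4 _ _ fg fh)).
pose Bt (x y : Q) : Q' := qBt r' x y.
have jBt x y : incl (Bt x y) = eB x y.
  elim/(@quoP R V (Xesn r)): x => g fg; elim/(@quoP R V (Xesn r)): y => h fh.
  have e1 : Bt (cls (Xesn r) g) (cls (Xesn r) h) = cls (Xesn r') (Bh g h) := qBt_cls hr r4 fg fh.
  have e2 : eB (cls (Xesn r) g : Q) (cls (Xesn r) h) = cls (Xesn r) (Bh g h) := qBt_cls hr r4' fg fh.
  rewrite e1 e2; apply: incl_cls; apply: finZ; apply: le_lt_trans (Bq_fin hr r4 fg fh) _; exact: ltry.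
have Btl z : lin (fun y => Bt y z) by exact: (qBt_lin hr r4).
have Bts y z : Bt y z = Bt z y by exact: qBt_sym.
have Btle y z : `|Bt y z| <= (smoothC r + 1) * `|y| * `|z| by exact: (qBt_le hr r4).
have bt0 := smooth1_gt0 r.
have up (T : R) : 0 < T -> (exists u, mild_solution r T f u) -> exists u, mild_solution r' T f u.
  move=> T0 [u mu]; have [_ m] := (mild_solution_cls hr u (ltW T0) fd).1 mu; rewrite -(incl_cls ff) in m.
  have [w mw] := mild_up jl jle jinj jA jB Btl Bts Btle bt0 jBt (ltW T0) m.
  by exists (fun t => rep (w t)); exact: (mild_lift (ltW T0) ff mw).
have down (T : R) : 0 < T -> (exists u, mild_solution r' T f u) -> exists u, mild_solution r T f u.
  move=> T0 [u mu]; have [_ m] := (mild_solution_cls hr' u (ltW T0) ff).1 mu.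
  have := mild_down jl jle jA jB (ltW T0) m; rewrite (incl_cls ff) => m'.
  by exists (fun t => rep (incl (cls (Xesn r') (u t)))); exact: (mild_lift (ltW T0) fd m').
by apply: le_anti; apply/andP; split; [exact: (max_time_mono up)|exact: (max_time_mono down)].
Qed.

End two_exponents.

Lemma max_time_indep (r r' : R) f : 0 <= r -> r <= r' -> fin (Xesn r') f -> max_time r f = max_time r' f.
Proof.
move=> r0 rr ff; have [n n1] : exists n : nat, (r' - r) * 4 < n.+1%:R.
  by exists (Num.truncn ((r' - r) * 4)); rewrite truncnS_gt.
have n0 : (0 : R) < n.+1%:R by rewrite ltr0n.
pose h := (r' - r) / n.+1%:R; have h0 : 0 <= h by rewrite divr_ge0 ?subr_ge0 // ltW.
have h4 : h <= 4^-1 by rewrite /h ler_pdivrMr //; lra.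
have nh : n.+1%:R * h = r' - r by rewrite /h mulrCA divff ?mulr1 // lt0r_neq0.
have K i : (i <= n.+1)%N -> max_time r f = max_time (r + i%:R * h) f.
  elim: i => [|i IH] i_n; first by rewrite mul0r addr0.
  have N1 : i.+1%:R = i%:R + 1 :> R by rewrite -addn1 natrD.
  have ih : 0 <= i%:R * h by rewrite mulr_ge0.
  have a1 : 0 <= r + i%:R * h by rewrite addr_ge0.
  have a2 : r + i%:R * h <= r + i.+1%:R * h by rewrite N1; lra.
  have a3 : r + i.+1%:R * h <= r + i%:R * h + 4^-1 by rewrite N1; lra.
  have a4 : r + i.+1%:R * h <= r'.
    have := steps_le h0 i_n.
    by rewrite nh; lra.
  rewrite (IH (ltnW i_n)); apply: (max_time_step a1 (le_trans a1 a2) a2 a3).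
  exact: le_lt_trans (Xs_mono f a4) ff.
by rewrite (K n.+1 (leqnn _)) nh addrC subrK.
Qed.

End boussinesq.

Theorem theorem3p1 (R : realType) (s : R) (hs : 0 <= s) :
  (exists A : nat -> Xfun R -> R -> Xfun R, series_terms s A /\
     forall u0 : Xfun R, Xs s u0 ->
     exists2 T : R, 0 < T & exists u : R -> Xfun R,
     [/\ unique_on T (mild_solution s T u0) u,
         unique_on T (boussinesq_solution s T u0) u,
         (exists2 K : R, 0 < K &
            forall (n : nat) (f : Xfun R), (0 < n)%N -> Xs s f ->
              XsT s T (A n f) /\
              (XsT_norm s T (A n f) <= (K ^+ n)%R%:E * Xnorm s f ^+ n)%E),
         (\sum_(1 <= n <oo) XsT_norm s T (A n u0) < +oo)%E
       & XsT_norm s T (fun t => \sum_(1 <= n < N) A n u0 t - u t)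
           @[N --> \oo] --> 0%E]) /\
  (exists2 C : R, 0 < C & forall u0 : Xfun R, Xs s u0 ->
     (((4 * C)%R%:E * Xnorm s u0)^-1 <= max_time s u0)%E) /\
  (forall u0 : Xfun R, Xs s u0 ->
     (exists u, maximal_solution s u0 u) /\
     forall (u : R -> Xfun R) (Ts : R), maximal_solution s u0 u ->
       max_time s u0 = Ts%:E ->
       limf_esup (fun t => Xnorm s (u t)) (Ts^'-) = +oo%E) /\
  (2^-1 < s -> forall (s' : R) (u0 : Xfun R), 2^-1 < s' ->
     Xs s u0 -> Xs s' u0 -> max_time s u0 = max_time s' u0) /\
  (forall B : set (Xfun R), Xs_bounded s B ->
     exists2 T : R, 0 < T &
     exists (U : set (Xfun R)) (Phi : Xfun R -> R -> Xfun R),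
     [/\ Xs_open s U, B `<=` U,
         forall f, U f -> unique_on T (mild_solution s T f) (Phi f)
       & forall a, U a -> analytic_at s T Phi a]).
Proof.
have [a [a0 aS]] := series_functions s.
split; [|split; [|split; [|split]]].
- exists (fun n => a n.-1); split; first exact: (series_termsP a0 aS).
  by move=> u0 u0s; exact: (local_well_posedness hs a0 aS u0s).
- exists (4 * ebeta (Xevo hs)); first by rewrite mulr_gt0 // ebeta_gt0.
  by move=> u0 u0s; exact: (max_time_lower_bound hs u0s).
- move=> u0 u0s; split; first exact: (maximal_exists hs u0s).
  by move=> u Ts mu mT; exact (blow_up hs a0 aS u0s mu mT).
- move=> s2 s' u0 s2' us us'.
  have p2 : (0 : R) <= 2^-1 by rewrite invr_ge0.
  have hs' : 0 <= s' := le_trans p2 (ltW s2').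
  have [ss|/ltW ss] := leP s s'; first exact: (max_time_indep hs ss us').
  by rewrite (max_time_indep hs' ss us).
- by move=> B Bb; exact: (solution_analytic hs Bb).
Qed.
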